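(* Let $k \geq 2$ be a fixed integer and let $\operatorname{SG}^{(k)}_n$ denote the number of $k$-regular graphs on $n$ vertices. Define the following objects. Let $\psi(t)$ be the formal power series \[ \psi(t) = \Bigg( 1 + \frac{\log\big(\frac{1}{1+t}\big) + t - \frac{t^2}{2}}{t^2} \Bigg)^{-1/2}, \] and let $T(x)$ be the unique formal power series with $T(0)=0$ satisfying $T(x) = x\,\psi(T(x))$. For integers $p,q \geq 0$ set \[ u_{p,q} = [s^p] \frac{1}{(1+T(s))^q}, \qquad v_{p,q}(\mathbf{t}) = [z^p] \frac{\left(\sum_{j\geq 2} t_j z^{j-1}\right)^q}{\sqrt{1-z^2}}, \] where $\mathbf{t} = (t_1, t_2, \ldots)$ are variables. For $j \geq 1$ set \[ B_{0,j}(u,\mathbf{t}) = \sum_{\substack{1 \leq \ell,\ 0 \leq a \leq \ell,\ 0 \leq b \\ a+b+\ell \leq j}} \bigg( \prod_{m=0}^{a+b+\ell-1} (k-m) \bigg) \frac{u^{a+b+\ell}\, t_1^{j-a-b-\ell}}{a!\, b!} \left(\frac{k-1}{2}\right)^a u_{j-a-b-\ell,\, 3a+b+\ell}\, v_{\ell-a,\, b}(\mathbf{t}), \] $B_0(s,u,\mathbf{t}) = \sum_{j\geq 1} B_{0,j}(u,\mathbf{t}) s^j$, \[ C_1(u,s,\mathbf{t}) = \exp\left( \frac{ k(k-1)\frac{u^2 s^2 t_2}{(1+T(st_1))^2} - \log\left(1 + B_0(s,u,\mathbf{t})\right)}{s^2} + \frac{(k-1)^2}{4(1+T(st_1))^4}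 + (2k^2u^2 - k + 1)\frac{k-1}{4} \right), \] \[ C_2(s,\mathbf{t}) = \left( C_1\left(-\tfrac{1}{\sqrt{k}}, s, \mathbf{t}\right) + C_1\left(\tfrac{1}{\sqrt{k}}, s, \mathbf{t}\right) \right) T'(st_1), \] and define the formal power series $\tilde{\operatorname{SG}}^{(k)}(z)$ by \[ [z^r]\tilde{\operatorname{SG}}^{(k)}(z) = (-1)^r\, e^{-t_1^2/(4k) - \sum_{j=2}^{2r+2} t_j^2/(2j)} \odot_{\mathbf{t} = \mathbf{1}} [s^{2r}] C_2(s,\mathbf{t}) \qquad (r \geq 0). \] Then, as $n \to \infty$ with $nk$ even, \[ \operatorname{SG}^{(k)}_n \approx \frac{(nk/e)^{nk/2}}{k!^n} \frac{e^{-(k^2-1)/4}}{\sqrt{2}} \tilde{\operatorname{SG}}^{(k)}(n^{-1}), \] and for every $r$ the coefficient $[z^r]\tilde{\operatorname{SG}}^{(k)}(z)$ is a polynomial in $k$ with rational coefficients divided by $k^r$.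
   Context: Graphs are simple (no loops, no multiple edges) with labeled vertex set $\{1,\ldots,n\}$; a graph is $k$-regular if every vertex has degree $k$. For a formal power series $\tilde F(z)$ and sequences $f_n, a_n$, the notation $f_n \approx a_n \tilde F(n^{-1})$ means that for every fixed $r \geq 0$, $f_n = a_n\big(\sum_{\ell=0}^{r-1} [z^\ell]\tilde F(z)\, n^{-\ell} + O(n^{-r})\big)$ as $n\to\infty$ (here along $n$ with $nk$ even). $[z^p]F$ denotes the coefficient of $z^p$ in $F$. Exponential Hadamard product: for $F(z)=\sum_n a_n z^n/n!$ and $G(z)=\sum_n b_n z^n/n!$, $F(z)\odot_z G(z) = \sum_n a_n b_n z^n/n!$, and $F(z)\odot_{z=x}G(z)$ is this series evaluated at $z=x$. In particular, for a constant $c$ and polynomial $G$, $e^{c z^2}\odot_{z=1} G(z) = \sum_{m} c^m \frac{(2m)!}{m!}[z^{2m}]G(z)$. For several variables, $e^{\sum_{j} F_j(t_j)} \odot_{\mathbf{t}=\mathbf{1}} G(\mathbf{t})$ means the iterated product $e^{F_1(t_1)}\odot_{t_1=1}\big(e^{F_2(t_2)}\odot_{t_2=1}(\cdots G(\mathbf{t})\cdots)\big)$. *)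

(* Defs.v *)
From HB Require Import structures.
From mathcomp Require Import all_boot all_order all_algebra.
From mathcomp Require Import mpoly.
From mathcomp Require Import reals sequences.
Set Implicit Arguments.
Unset Strict Implicit.
Unset Printing Implicit Defensive.
Import Order.TTheory GRing.Theory Num.Theory.
Local Open Scope ring_scope.

Definition SG (k n : nat) : nat :=
  #|[set E : {set {set 'I_n}} |
      [forall e in E, #|e| == 2%N] &&
      [forall v : 'I_n, #|[set e in E | v \in e]| == k]]|.

Section FPS.
Variables (R : realType) (A : lalgType R).

Definition fps := nat -> A.

Definition fps_const (a : A) : fps := fun n => if n == 0%N then a else 0.
Definition fps1 : fps := fps_const 1.
Definition fps_X : fps := fun n => if n == 1%N then 1 else 0.
Definition fps_add (f g : fps) : fps := fun n => f n + g n.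
Definition fps_opp (f : fps) : fps := fun n => - f n.
Definition fps_scale (c : R) (f : fps) : fps := fun n => c *: f n.
Definition fps_mul (f g : fps) : fps :=
  fun n => \sum_(i < n.+1) f i * g (n - i)%N.
Definition fps_pow (f : fps) (m : nat) : fps := iter m (fps_mul f) fps1.
Definition fps_mulX (f : fps) : fps := fun n => if n is n'.+1 then f n' else 0.
Definition fps_divX2 (f : fps) : fps := fun n => f n.+2.
Definition fps_deriv (f : fps) : fps := fun n => n.+1%:R *: f n.+1.

(* substitution  sum_m c_m w^m  of a series w with w 0 = 0 into the
   scalar series sum_m c_m x^m *)
Definition fps_subst (c : nat -> R) (w : fps) : fps :=
  fun n => \sum_(m < n.+1) c m *: fps_pow w m n.

Definition gbinom (al : R) (m : nat) : R :=
  (\prod_(i < m) (al - i%:R)) / m`!%:R.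

(* (1 + w)^al, log (1 + w), exp w   for w with zero constant term *)
Definition fps_binom (al : R) (w : fps) : fps := fps_subst (gbinom al) w.
Definition fps_log1p (w : fps) : fps :=
  fps_subst (fun m => if m == 0%N then 0 else (-1) ^+ m.+1 / m%:R) w.
Definition fps_exp (w : fps) : fps := fps_subst (fun m => (m`!%:R)^-1) w.

End FPS.

Section Construction.
Variable R : realType.

Notation sfps := (fps (R^o)).

Definition psi_inner : sfps :=
  fps_divX2 (fps_add (fps_add (fps_opp (fps_log1p (fps_X (R^o)))) (fps_X (R^o)))
                     (fps_scale (- (1/2)) (fps_pow (fps_X (R^o)) 2))).
Definition psi : sfps := fps_binom (- (1/2)) psi_inner.

(* T(x): the unique series with T(0) = 0 and T = x psi(T).  The map
   f |-> x psi(f) is contracting for the x-adic order: after n+1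
   iterations starting from 0 the coefficient of x^n is final. *)
Definition Tstep (f : sfps) : sfps := fps_mulX (fps_subst psi f).
Definition Tser : sfps := fun n => iter n.+1 Tstep (fun _ => 0) n.

Definition ucoef (p q : nat) : R := fps_binom (- q%:R) Tser p.

Variables (k : nat) (n : nat).
(* polynomials in the N := n+1 variables t_1, ..., t_N; variable
   'X_i (i : 'I_N) stands for t_(i+1). *)
Notation P := {mpoly R[n.+1]}.
Notation pfps := (fps P).

Definition tv (j : nat) : P :=
  if (1 <= j <= n.+1)%N then 'X_(inord j.-1) else 0.

Definition Wser : pfps := fun m => if m == 0%N then 0 else tv m.+1.
Definition isqrt1mz2 : pfps :=
  fps_binom (- (1/2)) (fun m => if m == 2%N then -1 else 0).

Definition vcoef (p q : nat) : P := fps_mul (fps_pow Wser q) isqrt1mz2 p.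

Definition kR : R := k%:R.

Definition B0j (u : R) (j : nat) : P :=
  \sum_(1 <= l < j.+1) \sum_(a < l.+1) \sum_(b < j.+1 | (a + b + l <= j)%N)
    (((\prod_(m < a + b + l) (kR - m%:R)) * u ^+ (a + b + l)
        / (a`!%:R * b`!%:R) * ((kR - 1) / 2) ^+ a
        * ucoef (j - a - b - l) (3 * a + b + l)) *:
     (tv 1 ^+ (j - a - b - l) * vcoef (l - a) b)).

Definition B0 (u : R) : pfps := fun j => if j == 0%N then 0 else B0j u j.

Definition Tst1 : pfps := fun m => Tser m *: tv 1 ^+ m.
Definition dTst1 : pfps := fun m => fps_deriv Tser m *: tv 1 ^+ m.

Definition s2t2 : pfps := fun m => if m == 2%N then tv 2 else 0.

Definition C1exponent (u : R) : pfps :=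
  fps_add
    (fps_add
       (fps_divX2
          (fps_add
             (fps_scale (kR * (kR - 1) * u ^+ 2)
                (fps_mul s2t2 (fps_binom (-2) Tst1)))
             (fps_opp (fps_log1p (B0 u)))))
       (fps_scale ((kR - 1) ^+ 2 / 4) (fps_binom (-4) Tst1)))
    (fps_const ((2 * kR ^+ 2 * u ^+ 2 - kR + 1) * (kR - 1) / 4 : R)%:MP).

Definition C1 (u : R) : pfps := fps_exp (C1exponent u).

Definition C2 : pfps :=
  fps_mul (fps_add (C1 (- (Num.sqrt kR)^-1)) (C1 ((Num.sqrt kR)^-1))) dTst1.

(* The iterated exponential Hadamard product
     e^{ c_1 t_1^2 + ... + c_N t_N^2 } (.)_{t = 1} G(t)
   for a polynomial G, with c_1 = -1/(4k), c_j = -1/(2j) (j >= 2):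
   e^{c z^2} (.)_{z=1} z^e = c^(e/2) e!/(e/2)! if e is even, 0 otherwise. *)
Definition hcoef (i : 'I_n.+1) : R :=
  if i == 0%N :> nat then - (4 * kR)^-1 else - (2 * (i.+1)%:R)^-1.
Definition hw (c : R) (e : nat) : R :=
  if odd e then 0 else c ^+ e./2 * e`!%:R / (e./2)`!%:R.
Definition hadamard1 (G : P) : R :=
  \sum_(m <- msupp G) G@_m * \prod_(i < n.+1) hw (hcoef i) (m i).

End Construction.

(* [z^r] SG~^{(k)}(z): computed with the 2r+2 variables t_1..t_{2r+2} *)
Definition SGt (R : realType) (k r : nat) : R :=
  (-1) ^+ r * @hadamard1 R k r.*2.+1 (@C2 R k r.*2.+1 r.*2).

Definition an (R : realType) (k n : nat) : R :=
  (((n * k)%:R / expR 1) ^+ (n * k)./2 / (k`!%:R ^+ n))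
  * expR (- ((k%:R ^+ 2 - 1) / 4)) / Num.sqrt 2.

(* Main.v *)
Require Import Defs.
From HB Require Import structures.
From mathcomp Require Import all_boot all_order all_algebra.
From mathcomp Require Import mpoly.
From mathcomp Require Import boolp reals topology normedtype sequences exp.
From mathcomp Require Import ring lra zify.
Set Implicit Arguments.
Unset Strict Implicit.
Unset Printing Implicit Defensive.
Import Order.TTheory GRing.Theory Num.Theory.
Local Open Scope ring_scope.

(* A graph is encoded by its edge indicators x_u x_v.  Taking logarithms in
   [\prod_(u < v) (1 - x_u x_v)] produces squares of the power sums of the x_v, which are
   linearized by Gaussian variables t_1, ..., t_M; extracting x_1^k ... x_n^k then gives
   the number of graphs, up to sign, as a Gaussian functional of the n-th power of one
   polynomial in the t_j.  Expanding in t_1 gives a sum of quotients of double factorials,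
   which have a Stirling series expressed through T (Laplace's method, done formally).
   The sum over the order q is dominated term by term by a Gaussian majorant, so that
   expansion and summation may be exchanged (Tannery).  The resulting coefficients are
   identified with those of the statement by reading the sum over q as the evaluation at
   u = 1/sqrt k and u = - 1/sqrt k of a power series in u, after completing the square
   in t_2.
   Rescaling t_1 and s by sqrt k makes the coefficients polynomial in k. *)

(** * Formal power series *)

(** The letter [s] stands for a square root of [- 1/n]: the binomial sums over [j] then become the
    formal power [(1 + B) ^ (-1/s^2)], and the weight [- 1/(4k)] of [t_1] reproduces the Laplace
    integral of the double factorials. The obstacle is that the exponent contains, at order [s^0],
    the term [- k (k-1) u^2 t_2], so that the coefficients in [s] are power series in [u] that
    cannot simply be evaluated. Translating [t_2] leaves at order [s^0] only the scalar [- lam(u)],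
    where [lam(u) = k (k-1) u^2 / 2 + (k (k-1))^2 u^4 / 4]; all other coefficients are polynomials
    in [u], and [lam] at [u^2 = 1/k] is the exponent [(k^2-1)/4] of the statement. For the majorant,
    setting [t_1] apart is essential: the remaining exponent has size [n] in degree 2 and size [n^2]
    only from degree 4 on, so it stays bounded at radius of order [1/sqrt n]. No value of
    [sqrt (2 pi)] is needed, as only quotients of factorials occur. Exactness requires at least [k]
    variables, the statement has [2r+2]; the coefficients must be shown independent of that
    number. *)

Section FpsRing.
Variables (R : realType) (A : comAlgType R).
Implicit Types f g h : fps A.

Lemma fpsP f g : (forall n, f n = g n) <-> f = g.
Proof. by split=> [fg | -> //]; apply: funext. Qed.

Definition fps_zero : fps A := fun=> 0.

HB.instance Definition _ := gen_eqMixin (fps A).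
HB.instance Definition _ := gen_choiceMixin (fps A).

Fact fps_addA : associative (@fps_add R A).
Proof. by move=> f g h; apply/fpsP => n; rewrite /fps_add addrA. Qed.
Fact fps_addC : commutative (@fps_add R A).
Proof. by move=> f g; apply/fpsP => n; rewrite /fps_add addrC. Qed.
Fact fps_add0 : left_id fps_zero (@fps_add R A).
Proof. by move=> f; apply/fpsP => n; rewrite /fps_add add0r. Qed.
Fact fps_addN : left_inverse fps_zero (@fps_opp R A) (@fps_add R A).
Proof. by move=> f; apply/fpsP => n; rewrite /fps_add addNr. Qed.

HB.instance Definition _ := GRing.isZmodule.Build (fps A)
  fps_addA fps_addC fps_add0 fps_addN.

Definition fps_trunc n f : {poly A} := \poly_(i < n.+1) f i.

(** A coefficient of a product sees only finitely many coefficients of the factors, so the ring laws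
    are inherited from [{poly A}] instead of being reproved on convolution sums. *)
Lemma fps_mul_trunc n m f g : (m <= n)%N ->
  fps_mul f g m = (fps_trunc n f * fps_trunc n g)`_m.
Proof.
move=> mn; rewrite coefM; apply: eq_bigr => i _; rewrite !coef_poly.
have im : (i <= m)%N by rewrite -ltnS.
by rewrite !ltnS (leq_trans im mn) (leq_trans (leq_subr _ _) mn).
Qed.

Lemma fps_trunc_mul n m f g : (m <= n)%N ->
  (fps_trunc n (fps_mul f g))`_m = (fps_trunc n f * fps_trunc n g)`_m.
Proof. by move=> mn; rewrite coef_poly ltnS mn -fps_mul_trunc. Qed.

Fact fps_mulA : associative (@fps_mul R A).
Proof.
move=> f g h; apply/fpsP => n; rewrite !(@fps_mul_trunc n) //.
transitivity ((fps_trunc n f * (fps_trunc n g * fps_trunc n h))`_n).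
  rewrite !coefM; apply: eq_bigr => i _.
  by rewrite fps_trunc_mul ?leq_subr.
rewrite mulrA !coefM; apply: eq_bigr => i _.
by rewrite fps_trunc_mul // -ltnS.
Qed.

Fact fps_mulC : commutative (@fps_mul R A).
Proof. by move=> f g; apply/fpsP => n; rewrite !(@fps_mul_trunc n) // mulrC. Qed.

Fact fps_mul1 : left_id (fps1 A) (@fps_mul R A).
Proof.
move=> f; apply/fpsP => n; rewrite /fps_mul big_ord_recl /= subn0 /fps1 /fps_const.
by rewrite mul1r big1 ?addr0 // => i _; rewrite mul0r.
Qed.

Fact fps_mulD : left_distributive (@fps_mul R A) (@fps_add R A).
Proof.
move=> f g h; apply/fpsP => n; rewrite /fps_mul /fps_add -big_split /=.
by apply: eq_bigr => i _; rewrite mulrDl.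
Qed.

Fact fps_1neq0 : (fps1 A : fps A) != 0.
Proof.
apply/eqP => /fpsP /(_ 0%N) /eqP; rewrite /fps1 /fps_const /=.
by rewrite (negbTE (oner_neq0 _)).
Qed.

HB.instance Definition _ := GRing.Zmodule_isComNzRing.Build (fps A)
  fps_mulA fps_mulC fps_mul1 fps_mulD fps_1neq0.

Fact fps_scaleA a b f : fps_scale a (fps_scale b f) = fps_scale (a * b) f.
Proof. by apply/fpsP => n; rewrite /fps_scale scalerA. Qed.
Fact fps_scale1 : left_id 1 (@fps_scale R A).
Proof. by move=> f; apply/fpsP => n; rewrite /fps_scale scale1r. Qed.
Fact fps_scaleDr : right_distributive (@fps_scale R A) +%R.
Proof. by move=> a f g; apply/fpsP => n; rewrite /fps_scale scalerDr. Qed.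
Fact fps_scaleDl f : {morph (fun a => fps_scale a f) : a b / a + b >-> a + b}.
Proof. by move=> a b; apply/fpsP => n; rewrite /fps_scale scalerDl. Qed.

HB.instance Definition _ := GRing.Zmodule_isLmodule.Build R (fps A)
  fps_scaleA fps_scale1 fps_scaleDr fps_scaleDl.

Fact fps_scaleAl a f g : a *: (f * g) = a *: f * g.
Proof.
apply/fpsP => n; rewrite /GRing.scale /= /fps_scale /GRing.mul /= /fps_mul.
by rewrite scaler_sumr; apply: eq_bigr => i _; rewrite scalerAl.
Qed.

HB.instance Definition _ := GRing.Lmodule_isLalgebra.Build R (fps A) fps_scaleAl.
Fact fps_scaleAr a f g : a *: (f * g) = f * (a *: g).
Proof. by rewrite mulrC fps_scaleAl mulrC. Qed.

HB.instance Definition _ := GRing.Lalgebra_isAlgebra.Build R (fps A) fps_scaleAr.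

End FpsRing.

Section FpsTheory.
Variables (R : realType) (A : comAlgType R).
Implicit Types f g h w : fps A.

Lemma fps0E n : (0 : fps A) n = 0. Proof. by []. Qed.
Lemma fpsDE f g n : (f + g) n = f n + g n. Proof. by []. Qed.
Lemma fpsNE f n : (- f) n = - f n. Proof. by []. Qed.
Lemma fpsBE f g n : (f - g) n = f n - g n. Proof. by []. Qed.
Lemma fpsZE (a : R) f n : (a *: f) n = a *: f n. Proof. by []. Qed.
Lemma fpsME f g n : (f * g) n = \sum_(i < n.+1) f i * g (n - i)%N. Proof. by []. Qed.
Lemma fpsE1 n : (1 : fps A) n = (n == 0%N)%:R.
Proof. by rewrite /GRing.one /= /fps1 /fps_const; case: ifP. Qed.
Lemma fps_sumE (I : Type) (r : seq I) (P : pred I) (F : I -> fps A) n :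
  (\sum_(i <- r | P i) F i) n = \sum_(i <- r | P i) F i n.
Proof. by elim/big_rec2: _ => // i y x _ <-. Qed.
Lemma fps_powE f n : fps_pow f n = f ^+ n.
Proof. by elim: n => // n IHn; rewrite exprS /fps_pow iterS -IHn. Qed.
Lemma fpsM0 f g : (f * g) 0%N = f 0%N * g 0%N.
Proof. by rewrite fpsME big_ord1. Qed.

Fact fps_const_is_zmod : zmod_morphism (@fps_const R A).
Proof. by move=> a b; apply/fpsP=> n; rewrite fpsBE /fps_const; case: ifP; rewrite ?subr0. Qed.
HB.instance Definition _ := GRing.isZmodMorphism.Build A (fps A) (@fps_const R A)
  fps_const_is_zmod.
Lemma fps_constM a f n : (fps_const a * f) n = a * f n.
Proof.
rewrite fpsME big_ord_recl subn0 /fps_const /= big1 ?addr0 // => i _.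
by rewrite mul0r.
Qed.
Fact fps_const_is_mul : monoid_morphism (@fps_const R A).
Proof.
split=> // a b; apply/fpsP=> n; rewrite fps_constM /fps_const.
by case: ifP; rewrite ?mulr0.
Qed.
HB.instance Definition _ := GRing.isMonoidMorphism.Build A (fps A) (@fps_const R A)
  fps_const_is_mul.
Fact fps_const_scalable : scalable (@fps_const R A).
Proof.
move=> a b; apply/fpsP=> n; rewrite fpsZE /fps_const.
by case: ifP; rewrite ?scaler0.
Qed.
HB.instance Definition _ := GRing.isScalable.Build R A (fps A) *:%R (@fps_const R A)
  fps_const_scalable.

Lemma fps_alg (a : R) : a%:A = fps_const (a%:A : A).
Proof. by rewrite linearZ /=. Qed.

Notation "'fX'" := (fps_X A).
Lemma fps_XM f n : (fX * f) n = if n is m.+1 then f m else 0.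
Proof.
rewrite fpsME; case: n => [|n]; first by rewrite big_ord1 /fps_X mul0r.
rewrite big_ord_recl big_ord_recl big1 ?addr0 => [|i _]; last by rewrite /fps_X mul0r.
by rewrite /fps_X /= mul0r add0r mul1r /bump /= subSS subn0.
Qed.
Lemma fps_XnM f k n : (fX ^+ k * f) n = if (k <= n)%N then f (n - k)%N else 0.
Proof.
elim: k n => [|k IHk] n; first by rewrite mul1r subn0.
by rewrite exprS -mulrA fps_XM; case: n => // n; rewrite IHk ltnS subSS.
Qed.
Lemma fps_XnE k n : (fX ^+ k) n = (n == k)%:R.
Proof.
rewrite -[_ ^+ _]mulr1 fps_XnM fpsE1 subn_eq0 eqn_leq andbC.
by case: ifP.
Qed.
Lemma fps_XE n : fX n = (n == 1%N)%:R.
Proof. by rewrite /fps_X; case: eqP. Qed.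
Lemma fps_Xreg k f g : fX ^+ k * f = fX ^+ k * g -> f = g.
Proof.
move=> fg; apply/fpsP => n; move/fpsP/(_ (n + k)%N): fg.
by rewrite !fps_XnM leq_addl addnK.
Qed.
Lemma fps_X2_div f : f 0%N = 0 -> f 1%N = 0 -> fX ^+ 2 * fps_divX2 f = f.
Proof.
move=> f0 f1; apply/fpsP; case=> [|[|n]]; rewrite fps_XnM //=.
by rewrite /fps_divX2 subSS subSS subn0.
Qed.

(** Order of vanishing at least [k]. It replaces the [X]-adic topology: two series are equal when
    their difference lies in every [vge k] ([vge_eq]). *)
Definition vge k f := forall i, (i < k)%N -> f i = 0.

Lemma vge_le k l f : (k <= l)%N -> vge l f -> vge k f.
Proof. by move=> kl fl i ik; apply: fl; apply: leq_trans kl. Qed.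
Lemma vge0 k : vge k 0. Proof. by []. Qed.
Lemma vgeD k f g : vge k f -> vge k g -> vge k (f + g).
Proof. by move=> fk gk i ik; rewrite fpsDE fk ?gk ?addr0. Qed.
Lemma vgeN k f : vge k f -> vge k (- f).
Proof. by move=> fk i ik; rewrite fpsNE fk ?oppr0. Qed.
Lemma vgeZ k (a : R) f : vge k f -> vge k (a *: f).
Proof. by move=> fk i ik; rewrite fpsZE fk ?scaler0. Qed.
Lemma vgeM k l f g : vge k f -> vge l g -> vge (k + l) (f * g).
Proof.
move=> fk gl i ikl; rewrite fpsME big1 // => j _.
have [jk|kj] := ltnP j k; first by rewrite fk ?mul0r.
by rewrite gl ?mulr0 //; have := ltn_ord j; lia.
Qed.
Lemma vgeMl k f g : vge k f -> vge k (g * f).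
Proof. by move=> fk; rewrite -[k]add0n; apply: vgeM. Qed.
Lemma vgeMr k f g : vge k f -> vge k (f * g).
Proof. by move=> fk; rewrite mulrC; apply: vgeMl. Qed.
Lemma vgeX k w : vge 1 w -> vge k (w ^+ k).
Proof.
by move=> w1; elim: k => // k IHk; rewrite exprS -add1n; apply: vgeM.
Qed.
Lemma vge_sum k (I : Type) (r : seq I) (P : pred I) (F : I -> fps A) :
  (forall i, P i -> vge k (F i)) -> vge k (\sum_(i <- r | P i) F i).
Proof. by move=> Fk; elim/big_rec: _ => // i x Pi xk; apply: vgeD => //; apply: Fk. Qed.
Lemma vge_eq f g : (forall k, vge k (f - g)) -> f = g.
Proof.
by move=> fg; apply/fpsP=> n; apply: subr0_eq; rewrite -fpsBE; apply: (fg n.+1).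
Qed.
Lemma vge_trans k g f h : vge k (f - g) -> vge k (g - h) -> vge k (f - h).
Proof. by move=> fg gh; have := vgeD fg gh; rewrite addrA subrK. Qed.
Lemma vge_sym k f g : vge k (f - g) -> vge k (g - f).
Proof. by move=> fg; rewrite -opprB; apply: vgeN. Qed.
Lemma vge1P f : f 0%N = 0 -> vge 1 f. Proof. by move=> f0 [|i]. Qed.

(** Unlike in [fps_subst], the coefficients may lie in [A]. This serves for composing two series
    over [A] and for expansions whose coefficients are themselves series ([Phi_exp]). *)
Definition bsubst (c : nat -> A) w : fps A := fun n => \sum_(m < n.+1) c m * (w ^+ m) n.

Lemma fps_substE (c : nat -> R) w : fps_subst c w = bsubst (fun m => (c m)%:A) w.
Proof.
apply/fpsP => n; apply: eq_bigr => m _.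
by rewrite fps_powE -scalerAl mul1r.
Qed.

Lemma fps_expE w : fps_exp w = bsubst (fun m => (m`!%:R^-1)%:A) w.
Proof. exact: fps_substE. Qed.
Lemma fps_logE w : fps_log1p w =
  bsubst (fun m => (if m == 0%N then 0 else (-1) ^+ m.+1 / m%:R)%:A) w.
Proof. exact: fps_substE. Qed.
Lemma fps_binE al w : fps_binom al w = bsubst (fun m => (gbinom al m)%:A) w.
Proof. exact: fps_substE. Qed.

Definition psubst K (c : nat -> A) w : fps A := \sum_(m < K) fps_const (c m) * w ^+ m.

Lemma psubst_vge K c w : vge 1 w -> vge K (bsubst c w - psubst K c w).
Proof.
move=> w1 i iK; apply/eqP; rewrite fpsBE subr_eq0; apply/eqP.
rewrite /psubst fps_sumE /bsubst.
under [RHS]eq_bigr => j _ do rewrite fps_constM.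
rewrite (big_ord_widen K (fun m => c m * (w ^+ m) i)) // big_mkcond /=.
apply: eq_bigr => j _; case: ltnP => // ij.
by rewrite (vgeX w1) // mulr0.
Qed.

Lemma bsubst_wide K c w n : vge 1 w -> (n < K)%N ->
  bsubst c w n = \sum_(m < K) c m * (w ^+ m) n.
Proof.
move=> w1 nK; apply/eqP; rewrite -subr_eq0.
have := psubst_vge c w1 nK; rewrite fpsBE /psubst fps_sumE.
by under eq_bigr => j _ do rewrite fps_constM; move=> ->.
Qed.

Lemma eq_bsubst c c' w : c =1 c' -> bsubst c w = bsubst c' w.
Proof. by move=> cc'; apply/fpsP=> n; apply: eq_bigr => m _; rewrite cc'. Qed.

Lemma bsubstE0 c w : bsubst c w 0%N = c 0%N.
Proof. by rewrite /bsubst big_ord1 expr0 fpsE1 mulr1. Qed.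

Lemma bsubstD c c' w : bsubst (fun m => c m + c' m) w = bsubst c w + bsubst c' w.
Proof.
apply/fpsP=> n; rewrite fpsDE /bsubst -big_split; apply: eq_bigr => m _.
by rewrite mulrDl.
Qed.

Lemma bsubstZ a c w : bsubst (fun m => a * c m) w = fps_const a * bsubst c w.
Proof.
apply/fpsP=> n; rewrite fps_constM /bsubst mulr_sumr; apply: eq_bigr => m _.
by rewrite mulrA.
Qed.

Lemma bsubst_const (a : A) w : bsubst (fun m => if m == 0%N then a else 0) w = fps_const a.
Proof.
apply/fpsP=> n; rewrite /bsubst big_ord_recl big1 => [|i _]; last by rewrite mul0r.
by rewrite addr0 /= expr0 fpsE1 /fps_const; case: eqP; rewrite ?mulr1 ?mulr0.
Qed.

Lemma bsubst_shift c w : vge 1 w ->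
  bsubst (fun m => if m is m'.+1 then c m' else 0) w = w * bsubst c w.
Proof.
move=> w1; apply: vge_eq => k.
apply: (@vge_trans _ (w * psubst k c w)); last first.
  by rewrite -mulrBr; apply: vgeMl; apply: vge_sym; apply: psubst_vge.
have -> : w * psubst k c w = psubst k.+1 (fun m => if m is m'.+1 then c m' else 0) w.
  rewrite /psubst big_ord_recl raddf0 mul0r add0r mulr_sumr.
  by apply: eq_bigr => i _; rewrite lift0 exprS mulrCA.
by apply: vge_le (psubst_vge _ w1).
Qed.

(** Up to order [n] both factors are values at [w] of truncated polynomials; the surplus terms of
    the product polynomial have degree above [n] and disappear because [w] has positive order. *)
Lemma bsubst_mul (f g : fps A) w : vge 1 w ->
  bsubst (f * g) w = bsubst f w * bsubst g w.
Proof.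
move=> w1.
have pE n (h : fps A) : psubst n.+1 h w = (map_poly (@fps_const R A) (fps_trunc n h)).[w].
  rewrite (@horner_coef_wide _ n.+1); last first.
    by rewrite (leq_trans (size_poly _ _)) // size_poly.
  by apply: eq_bigr => i _; rewrite coef_map coef_poly ltn_ord.
apply/fpsP => n.
have -> : (bsubst f w * bsubst g w) n = (psubst n.+1 f w * psubst n.+1 g w) n.
  apply: subr0_eq; rewrite -fpsBE; have : vge n.+1 (bsubst f w * bsubst g w - psubst n.+1 f w * psubst n.+1 g w).
    apply: (@vge_trans _ (psubst n.+1 f w * bsubst g w)).
      by rewrite -mulrBl; apply: vgeMr; apply: psubst_vge.
    by rewrite -mulrBr; apply: vgeMl; apply: psubst_vge.
  exact.
rewrite !pE -hornerM -rmorphM /= (@horner_coef_wide _ (n.+1 + n.+1)); last first.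
  rewrite (leq_trans (size_poly _ _)) // (leq_trans (size_polyMleq _ _)) //.
  by rewrite (leq_trans (leq_pred _)) // leq_add // size_poly.
rewrite (bsubst_wide _ w1 (leq_addr n.+1 n.+1 : n < n.+1 + n.+1)%N) fps_sumE.
apply: eq_bigr => i _; rewrite coef_map /= fps_constM.
have [ni|ni] := ltnP n i; first by rewrite (vgeX w1) ?mulr0.
by rewrite -[(f * g) i]/(fps_mul f g i) (fps_mul_trunc f g ni).
Qed.

(** A continuous derivation over [R], which may lower the order of vanishing by one. One chain rule
    then serves [fps_deriv], derivations acting on the coefficients, and the combination [flow] of
    both. *)
Record fder (D : fps A -> fps A) : Prop := Fder {
  fderD : {morph D : f g / f + g};
  fderM : forall f g, D (f * g) = D f * g + f * D g;
  fder_cont : forall k f, vge k.+1 f -> vge k (D f);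
  fder_alg : forall a : R, D a%:A = 0 }.

Section Derivation.
Variable (D : fps A -> fps A).
Hypothesis HD : fder D.

Lemma fder0 : D 0 = 0.
Proof. by apply: (addrI (D 0)); rewrite -(fderD HD) !addr0. Qed.
Lemma fderN f : D (- f) = - D f.
Proof. by apply/eqP; rewrite -addr_eq0 -(fderD HD) addNr fder0. Qed.
Lemma fderB f g : D (f - g) = D f - D g.
Proof. by rewrite (fderD HD) fderN. Qed.
Lemma fderZ a f : D (a *: f) = a *: D f.
Proof. by rewrite -mulr_algl (fderM HD) (fder_alg HD) mul0r add0r mulr_algl. Qed.
Lemma fder1 : D 1 = 0.
Proof. by rewrite -(scale1r 1) (fder_alg HD). Qed.
Lemma fder_sum (I : Type) (r : seq I) (P : pred I) (F : I -> fps A) :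
  D (\sum_(i <- r | P i) F i) = \sum_(i <- r | P i) D (F i).
Proof. by apply: (big_morph D (fderD HD) fder0). Qed.
Lemma fderX f n : D (f ^+ n) = n%:R *: (f ^+ n.-1 * D f).
Proof.
elim: n => [|n IHn]; first by rewrite scale0r fder1.
rewrite exprS (fderM HD) IHn /= -scalerAr mulrA; case: n IHn => [|n] IHn /=.
  by rewrite scale0r addr0 expr0 mul1r mulr1 scale1r.
by rewrite -exprS [D f * _]mulrC -[X in X + _ = _]scale1r -scalerDl nat1r.
Qed.

Lemma fder_bsubst c w : (forall m, D (fps_const (c m)) = 0) -> vge 1 w ->
  D (bsubst c w) = bsubst (fun m => m.+1%:R *: c m.+1) w * D w.
Proof.
move=> Dc w1; apply: vge_eq => k.
set c' := fun m => _.
have -> : D (bsubst c w) - bsubst c' w * D w =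
   D (bsubst c w - psubst k.+1 c w) + (D (psubst k.+1 c w) - bsubst c' w * D w).
  by rewrite fderB addrA subrK.
apply: vgeD; first by apply: (fder_cont HD); apply: psubst_vge.
have -> : D (psubst k.+1 c w) = psubst k c' w * D w.
  rewrite /psubst fder_sum big_ord_recl expr0 mulr1 Dc add0r mulr_suml.
  apply: eq_bigr => i _; rewrite lift0 (fderM HD) Dc mul0r add0r fderX /=.
  by rewrite -scalerAr mulrA /c' linearZ /= !scalerAl.
by rewrite -mulrBl; apply: vgeMr; rewrite -opprB; apply: vgeN; apply: psubst_vge.
Qed.

Lemma fder_subst (c : nat -> R) w : vge 1 w ->
  D (fps_subst c w) = fps_subst (fun m => m.+1%:R * c m.+1) w * D w.
Proof.
move=> w1; rewrite !fps_substE fder_bsubst => [|m|//].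
  by congr (_ * _); apply: eq_bsubst => m; rewrite scalerA.
by rewrite -fps_alg (fder_alg HD).
Qed.

Lemma fder_exp w : vge 1 w -> D (fps_exp w) = fps_exp w * D w.
Proof.
move=> w1; rewrite fder_subst // fps_substE fps_expE; congr (_ * _).
apply: eq_bsubst => m; rewrite factS natrM invfM mulrA divff ?mul1r // pnatr_eq0 //.
Qed.

End Derivation.

Fact fps_deriv_fder : fder (@fps_deriv R A).
Proof.
split.
- by move=> f g; apply/fpsP=> n; rewrite fpsDE /fps_deriv fpsDE scalerDr.
- move=> f g; apply/fpsP=> n.
  have tr h m : (m <= n)%N -> (fps_trunc n.+1 h)^`()`_m = fps_deriv h m.
    move=> mn; rewrite coef_deriv coef_poly !ltnS mn /fps_deriv.
    by rewrite scaler_nat.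
  rewrite /fps_deriv -[(f * g) n.+1]/(fps_mul f g n.+1) (fps_mul_trunc f g (leqnn _)).
  rewrite scaler_nat -coef_deriv derivM coefD fpsDE; congr (_ + _).
    rewrite coefM; apply: eq_bigr => i _; rewrite tr ?coef_poly; last by rewrite -ltnS.
    by rewrite ltnS (leq_trans (leq_subr _ _)).
  rewrite coefM; apply: eq_bigr => i _; rewrite tr ?leq_subr // coef_poly.
  by rewrite (leqW (ltn_ord i)).
- by move=> k f fk i ik; rewrite /fps_deriv fk ?scaler0.
- by move=> a; apply/fpsP=> n; rewrite /fps_deriv fps_alg /fps_const /= scaler0.
Qed.

Lemma natr_scale_inj n (a : A) : n.+1%:R *: a = 0 -> a = 0.
Proof.
move=> na; rewrite -[a]scale1r -(@mulVf _ (n.+1%:R : R)) ?pnatr_eq0 //.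
by rewrite -scalerA na scaler0.
Qed.

(** Since [P] has constant term 1, comparing coefficients of [X^n] gives [y (n+1)] from the earlier
    ones. The identities between exponential, logarithm and powers below all exhibit a first-order
    equation solved by both sides. *)
Lemma ode0 (P Q y : fps A) : P 0%N = 1 -> P * fps_deriv y = Q * y -> y 0%N = 0 -> y = 0.
Proof.
move=> P0 E y0.
suff H n : forall i, (i <= n)%N -> y i = 0 by apply/fpsP => n; exact: (H n).
elim: n => [|n IHn] i; first by rewrite leqn0 => /eqP->.
rewrite leq_eqVlt => /orP[/eqP->|]; last exact: IHn.
have := congr1 (fun f : fps A => f n) E; rewrite /= !fpsME big_ord_recl.
rewrite [X in _ + X]big1 => [|j _]; last first.
  by rewrite /fps_deriv /= /bump IHn ?scaler0 ?mulr0 //; have := ltn_ord j; lia.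
rewrite [X in _ = X]big1 => [|j _]; last by rewrite IHn ?mulr0 // leq_subr.
by rewrite /= P0 mul1r addr0 subn0 => /natr_scale_inj.
Qed.

Lemma ode_uniq (P Q y z : fps A) : P 0%N = 1 ->
  P * fps_deriv y = Q * y -> P * fps_deriv z = Q * z -> y 0%N = z 0%N -> y = z.
Proof.
move=> P0 Ey Ez yz; apply/eqP; rewrite -subr_eq0; apply/eqP.
apply: (@ode0 P Q) => //; last by rewrite fpsBE yz subrr.
by rewrite (fderB fps_deriv_fder) mulrBr Ey Ez mulrBr.
Qed.

Lemma fps_exp0 w : fps_exp w 0%N = 1.
Proof. by rewrite fps_expE bsubstE0 fact0 invr1 scale1r. Qed.

Lemma fps_expD v w : vge 1 v -> vge 1 w -> fps_exp (v + w) = fps_exp v * fps_exp w.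
Proof.
move=> v1 w1; have D := fps_deriv_fder.
apply: (@ode_uniq 1 (fps_deriv v + fps_deriv w)) => //.
- have vw : vge 1 (v + w) by apply: vgeD.
  by rewrite mul1r (fder_exp D) // (fderD D) mulrC.
- by rewrite mul1r (fderM D) (fder_exp D) // (fder_exp D) //; ring.
- by rewrite fpsM0 !fps_exp0 mulr1.
Qed.

Lemma fps_exp_zero : fps_exp (0 : fps A) = 1.
Proof.
apply/fpsP=> n; rewrite fps_expE /bsubst big_ord_recl expr0 fpsE1 fact0 invr1.
rewrite scale1r mul1r big1 ?addr0 // => i _.
by rewrite lift0 expr0n /= mulr0.
Qed.

Lemma fps_expMn w n : vge 1 w -> fps_exp (w *+ n) = fps_exp w ^+ n.
Proof.
move=> w1; elim: n => [|n IHn]; first by rewrite mulr0n fps_exp_zero.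
by rewrite mulrS fps_expD ?IHn ?exprS //; elim: n {IHn} => // n IHn;
   rewrite mulrS; apply: vgeD.
Qed.

Lemma fps_exp_sum (I : Type) (r : seq I) (P : pred I) (F : I -> fps A) :
  (forall i, P i -> vge 1 (F i)) ->
  fps_exp (\sum_(i <- r | P i) F i) = \prod_(i <- r | P i) fps_exp (F i).
Proof.
move=> F1; elim: r => [|i r IHr]; first by rewrite !big_nil fps_exp_zero.
rewrite !big_cons; case: ifP => // Pi; rewrite fps_expD ?IHr //; first exact: F1.
by apply: vge_sum.
Qed.

Lemma fps_log0 w : fps_log1p w 0%N = 0.
Proof. by rewrite fps_logE bsubstE0 /= scale0r. Qed.
Lemma vge_log w : vge 1 (fps_log1p w).
Proof. by apply: vge1P; rewrite fps_log0. Qed.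

Lemma fder_log D w : fder D -> vge 1 w -> (1 + w) * D (fps_log1p w) = D w.
Proof.
move=> HD w1; rewrite (fder_subst HD) // mulrA.
suff -> : (1 + w) * fps_subst (fun m => m.+1%:R * (if m.+1 == 0%N then 0 else (-1) ^+ m.+2 / m.+1%:R)) w = 1.
  by rewrite mul1r.
rewrite fps_substE mulrDl mul1r -bsubst_shift // -bsubstD -[RHS](bsubst_const 1 w).
apply: eq_bsubst => -[|m] /=.
  by rewrite addr0 mul1r divr1 exprS expr1 mulrNN mulr1 scale1r.
have E (i : nat) (x : R) : i.+1%:R * (x / i.+1%:R) = x.
  by rewrite mulrC divfK // pnatr_eq0.
by rewrite -scalerDl !E [X in X + _]exprS mulN1r addNr scale0r.
Qed.

Lemma fps_log1pK w : vge 1 w -> fps_exp (fps_log1p w) = 1 + w.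
Proof.
move=> w1; have D := fps_deriv_fder.
apply: (@ode_uniq (1 + w) (fps_deriv w)).
- by rewrite fpsDE fpsE1 w1 // addr0.
- have lw := vge_log w.
  by rewrite (fder_exp D) // mulrCA (fder_log D) // mulrC.
- by rewrite (fderD D) (fder1 D) add0r mulrC.
- by rewrite fps_exp0 fpsDE fpsE1 w1 // addr0.
Qed.

Lemma fps_binom0 al w : fps_binom al w 0%N = 1.
Proof. by rewrite fps_binE bsubstE0 /gbinom big_ord0 fact0 divr1 scale1r. Qed.

Lemma fps_binomE al w : vge 1 w -> fps_binom al w = fps_exp (al *: fps_log1p w).
Proof.
move=> w1; have D := fps_deriv_fder.
apply: (@ode_uniq (1 + w) (al *: fps_deriv w)).
- by rewrite fpsDE fpsE1 w1 // addr0.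
- rewrite (fder_subst D) // mulrA mulrC [RHS]mulrC -scalerAr scalerAl [RHS]mulrC.
  congr (_ * _); rewrite fps_binE fps_substE mulrDl mul1r -bsubst_shift // -bsubstD.
  rewrite -(mulr_algl al) fps_alg -bsubstZ; apply: eq_bsubst => m.
  have E i : i.+1%:R * gbinom al i.+1 = (al - i%:R) * gbinom al i.
    rewrite /gbinom big_ord_recr /= factS natrM invfM mulrACA mulrCA.
    have nz : i.+1%:R != 0 :> R by rewrite pnatr_eq0.
    rewrite [LHS]mulrCA; congr (_ * _); set p := (X in i.+1%:R * (X / _ / _)).
    by rewrite mulrA [i.+1%:R * _]mulrC divfK.
  rewrite mulr_algl scalerA E; case: m => [|m]; first by rewrite subr0 addr0.
  by rewrite -scalerDl -mulrDl subrK.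
- have lw := vgeZ al (vge_log w).
  by rewrite (fder_exp D) // (fderZ D) mulrCA -scalerAr (fder_log D) // mulrC.
- by rewrite fps_binom0 fps_exp0.
Qed.

Lemma fps_binomD al be w : vge 1 w ->
  fps_binom (al + be) w = fps_binom al w * fps_binom be w.
Proof.
by move=> w1; rewrite !fps_binomE // scalerDl fps_expD //; apply: vgeZ; apply: vge_log.
Qed.
Lemma fps_binom_nat n w : vge 1 w -> fps_binom n%:R w = (1 + w) ^+ n.
Proof.
move=> w1; rewrite fps_binomE // scaler_nat fps_expMn ?fps_log1pK //.
exact: vge_log.
Qed.
Lemma fps_binom_zero w : vge 1 w -> fps_binom 0 w = 1.
Proof. by move=> w1; rewrite (fps_binom_nat 0). Qed.
Lemma fps_binomN al w : vge 1 w -> fps_binom (- al) w * fps_binom al w = 1.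
Proof. by move=> w1; rewrite -fps_binomD // addNr fps_binom_zero. Qed.
Lemma fps_binomMn al n w : vge 1 w -> fps_binom (n%:R * al) w = fps_binom al w ^+ n.
Proof.
move=> w1; rewrite !fps_binomE // -scalerA scaler_nat fps_expMn //.
by apply: vgeZ; apply: vge_log.
Qed.

End FpsTheory.
Notation "'fX'" := (fps_X _).

(* A graded relation covers at once congruences, rescalings of the variables and
   evaluations that are only defined on part of the coefficients. *)
Section Transfer.
Variables (R : realType) (A A' : comAlgType R) (rho : nat -> A -> A' -> Prop).
Hypothesis rho0 : forall j, rho j 0 0.
Hypothesis rho1 : rho 0%N 1 1.
Hypothesis rhoD : forall j a b a' b', rho j a a' -> rho j b b' -> rho j (a + b) (a' + b').
Hypothesis rhoZ : forall j (x : R) a a', rho j a a' -> rho j (x *: a) (x *: a').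
Hypothesis rhoM : forall i j a b a' b',
  rho i a a' -> rho j b b' -> rho (i + j)%N (a * b) (a' * b').

Definition frel K (f : fps A) (g : fps A') := forall j, (j < K)%N -> rho j (f j) (g j).

Lemma rho_sum j (I : Type) (r : seq I) (P : pred I) (F : I -> A) (F' : I -> A') :
  (forall i, P i -> rho j (F i) (F' i)) ->
  rho j (\sum_(i <- r | P i) F i) (\sum_(i <- r | P i) F' i).
Proof. by move=> H; elim/big_ind2: _ => // *; apply: rhoD. Qed.

Lemma frel1 K : frel K 1 1.
Proof. by move=> j _; rewrite !fpsE1; case: j. Qed.
Lemma frelD K f g f' g' : frel K f f' -> frel K g g' -> frel K (f + g) (f' + g').
Proof. by move=> Hf Hg j jK; apply: rhoD; [apply: Hf | apply: Hg]. Qed.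
Lemma frelZ K (x : R) f f' : frel K f f' -> frel K (x *: f) (x *: f').
Proof. by move=> Hf j jK; apply: rhoZ; apply: Hf. Qed.
Lemma frelN K f f' : frel K f f' -> frel K (- f) (- f').
Proof. by rewrite -(scaleN1r f) -(scaleN1r f'); apply: frelZ. Qed.
Lemma frelM K f g f' g' : frel K f f' -> frel K g g' -> frel K (f * g) (f' * g').
Proof.
move=> Hf Hg j jK; rewrite !fpsME; apply: rho_sum => i _.
have ij : (i <= j)%N by rewrite -ltnS.
rewrite -{1}(subnKC ij); apply: rhoM; [apply: Hf | apply: Hg].
  exact: leq_ltn_trans jK.
by apply: leq_ltn_trans jK; apply: leq_subr.
Qed.
Lemma frelX K f f' n : frel K f f' -> frel K (f ^+ n) (f' ^+ n).
Proof.
move=> Hf; elim: n => [|n IHn]; first exact: frel1.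
by rewrite !exprS; apply: frelM.
Qed.
Lemma frel_subst K (c : nat -> R) f f' : frel K f f' ->
  frel K (fps_subst c f) (fps_subst c f').
Proof.
move=> Hf j jK; rewrite /fps_subst; apply: rho_sum => m _.
by rewrite !fps_powE; apply: rhoZ; apply: (frelX m Hf jK).
Qed.
End Transfer.

Section ContinuousMorphism.
Variables (R : realType) (A A' : comAlgType R) (phi : fps A -> fps A').
Hypothesis phiD : {morph phi : f g / f + g}.
Hypothesis phiM : {morph phi : f g / f * g}.
Hypothesis phi_alg : forall a : R, phi a%:A = a%:A.
Hypothesis phi_vge : forall k f, vge k f -> vge k (phi f).

Lemma cmorph_sum (I : Type) (r : seq I) (P : pred I) (F : I -> fps A) :
  phi (\sum_(i <- r | P i) F i) = \sum_(i <- r | P i) phi (F i).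
Proof.
by apply: (big_morph phi phiD); rewrite -[0 in LHS](scale0r 1) phi_alg scale0r.
Qed.
Lemma cmorphX f n : phi (f ^+ n) = phi f ^+ n.
Proof.
elim: n => [|n IHn]; first by rewrite !expr0 -(scale1r 1) phi_alg scale1r.
by rewrite !exprS phiM IHn.
Qed.
Lemma cmorphB f g : phi (f - g) = phi f - phi g.
Proof.
rewrite phiD -[- g]scaleN1r -(mulr_algl (-1) g) phiM phi_alg mulr_algl scaleN1r //.
Qed.

(** The morphism commutes with the finite truncations of the substitution, and the remainders have
    arbitrarily high order. Composition, Taylor shifts, twisting and rescaling are all instances. *)
Lemma cmorph_subst (c : nat -> R) w : vge 1 w ->
  phi (fps_subst c w) = fps_subst c (phi w).
Proof.
move=> w1; have pw1 : vge 1 (phi w) by apply: phi_vge.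
rewrite !fps_substE; apply: vge_eq => k.
apply: (vge_trans (g := psubst k (fun m => (c m)%:A) (phi w))); last first.
  by apply: vge_sym; apply: psubst_vge.
have -> : psubst k (fun m => (c m)%:A) (phi w) = phi (psubst k (fun m => (c m)%:A) w).
  rewrite /psubst cmorph_sum; apply: eq_bigr => i _.
  by rewrite phiM cmorphX -!fps_alg phi_alg.
by rewrite -cmorphB; apply: phi_vge; apply: psubst_vge.
Qed.
End ContinuousMorphism.

(** * Formal Gaussian integrals *)

Section Gaussian.
Variables (R : realType) (B : comAlgType R) (d : B -> B) (t : B) (h : B -> R) (c : R).
Hypothesis dD : {morph d : a b / a + b}.
Hypothesis dM : forall a b, d (a * b) = d a * b + a * d b.
Hypothesis d_alg : forall x : R, d x%:A = 0.
Hypothesis dt : d t = 1.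
Hypothesis hD : {morph h : a b / a + b}.
Hypothesis hZ : forall x a, h (x *: a) = x * h a.
(** Besides linearity, integration by parts is the only property of the Gaussian functional that is
    used; no integral is involved. *)
Hypothesis ibp : forall f, h (t * f) = 2 * c * h (d f).

Lemma dX n : d (t ^+ n) = n%:R *: t ^+ n.-1.
Proof.
elim: n => [|n IHn]; first by rewrite scale0r expr0 -(scale1r 1) d_alg.
rewrite exprS dM dt mul1r IHn; case: n IHn => [|n] IHn.
  by rewrite scale0r mulr0 addr0 scale1r.
by rewrite -scalerAr -exprS -[X in X + _]scale1r -scalerDl nat1r.
Qed.

Lemma h0 : h 0 = 0. Proof. by rewrite -[0 in LHS](scale0r (0 : B)) hZ mul0r. Qed.
Lemma h_sum (I : Type) (r : seq I) (P : pred I) (F : I -> B) :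
  h (\sum_(i <- r | P i) F i) = \sum_(i <- r | P i) h (F i).
Proof. exact: (big_morph h hD h0). Qed.

Let ka i : R := c ^+ i / i`!%:R.
Let mu a : R := (2 * c) ^+ a / a`!%:R.
Let S K b f := \sum_(i < K) \sum_(a < K)
  if (i.*2 + a == b)%N then ka i * mu a * h (iter a d f) else 0.

(** [S K b f] is the coefficient of [z^b] in [exp (c z^2) h (exp (2 c z d) f)], and the recursion
    comes from differentiating in [z]. The bound [K] merely makes the double sum finite. *)
Lemma hermite_rec K b f : (b.+1 < K)%N ->
  b.+1%:R * S K b.+1 f = 2 * c * S K b (d f) +
    (if b is b'.+1 then 2 * c * S K b' f else 0).
Proof.
case: K => // K; rewrite ltnS => bK.
have muS a : a.+1%:R * mu a.+1 = 2 * c * mu a.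
  rewrite /mu factS natrM invfM exprS -!mulrA mulrCA; congr (_ * _).
  rewrite mulrCA; congr (_ * _).
  by rewrite mulrCA; congr (_ * _); rewrite mulrA divff ?mul1r ?pnatr_eq0.
have kaS a : a.+1%:R * ka a.+1 = c * ka a.
  rewrite /ka factS natrM invfM exprS -!mulrA mulrCA; congr (_ * _).
  by rewrite mulrCA; congr (_ * _); rewrite mulrA divff ?mul1r ?pnatr_eq0.
have -> : b.+1%:R * S K.+1 b.+1 f =
  (\sum_(i < K.+1) \sum_(a < K.+1)
    if (i.*2 + a == b.+1)%N then ka i * (a%:R * mu a) * h (iter a d f) else 0) +
  (\sum_(i < K.+1) \sum_(a < K.+1)
    if (i.*2 + a == b.+1)%N then 2 * (i%:R * ka i) * mu a * h (iter a d f) else 0).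
  rewrite -big_split mulr_sumr; apply: eq_bigr => i _ /=.
  rewrite -big_split mulr_sumr; apply: eq_bigr => a _ /=.
  case: eqP => [<-|]; last by rewrite mulr0 addr0.
  by rewrite natrD -muln2 natrM; ring.
congr (_ + _).
  rewrite /S mulr_sumr; apply: eq_bigr => i _.
  rewrite big_ord_recl /= mul0r mulr0 mul0r if_same add0r mulr_sumr big_ord_recr /=.
  have -> : (i.*2 + K == b)%N = false by lia.
  rewrite mulr0 addr0; apply: eq_bigr => a _ /=.
  rewrite /bump /= add1n addnS eqSS; case: ifP; rewrite ?mulr0 // => _.
  by rewrite muS -iterSr; ring.
rewrite big_ord_recl big1 ?add0r => [|a _]; last first.
  by rewrite mul0r mulr0 !mul0r if_same.
case: b bK => [|b] bK.
  by rewrite big1 // => i _; rewrite big1 // => a _; rewrite /= /bump doubleS !addSn.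
rewrite /S mulr_sumr [RHS]big_ord_recr /= [X in _ + 2 * c * X]big1 => [|a _]; last first.
  by have -> : (K.*2 + a == b)%N = false by lia.
rewrite mulr0 addr0; apply: eq_bigr => i _; rewrite mulr_sumr; apply: eq_bigr => a _.
rewrite /= /bump /= add1n doubleS !addSn !eqSS; case: ifP; rewrite ?mulr0 // => _.
by rewrite kaS; ring.
Qed.

(** Coefficient form of [h (exp (z t) f) = exp (c z^2) h (f (t + 2 c z))]; the induction removes one
    factor [t] by parts. *)
Lemma hermite K b f : (b < K)%N -> h (t ^+ b * f) = b`!%:R * S K b f.
Proof.
elim/ltn_ind: b f => -[|b] IHb f bK.
  rewrite mul1r fact0 mul1r /S; case: K IHb bK => // K _ _.
  rewrite big_ord_recl [X in _ + X]big1 => [|i _]; last by rewrite big1.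
  rewrite addr0 big_ord_recl [X in _ + X]big1 => [|i _]; last by [].
  by rewrite /= /ka /mu !expr0 fact0 divr1 !mul1r !addr0.
rewrite exprS -mulrA ibp dM hD dX -scalerAl hZ.
rewrite factS natrM [b.+1%:R * _]mulrC -[_ * _ * S _ _ _]mulrA hermite_rec // mulrDr.
have IH1 := IHb b (ltnSn b) (d f) (ltnW bK).
rewrite mulrDr addrC IH1; congr (_ + _); first ring.
case: b IHb bK {IH1} => [|b] IHb bK; first by rewrite mul0r !mulr0.
by rewrite (IHb b _ f) //= ?factS ?natrM; [ring | lia].
Qed.

Definition cmap (f : fps B) : fps B := fun n => d (f n).

Lemma d0 : d 0 = 0. Proof. by rewrite -[0 in LHS](scale0r (1 : B)) d_alg. Qed.
Lemma d_sum (I : Type) (r : seq I) (P : pred I) (F : I -> B) :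
  d (\sum_(i <- r | P i) F i) = \sum_(i <- r | P i) d (F i).
Proof. exact: (big_morph d dD d0). Qed.

Lemma cmapM f g : cmap (f * g) = cmap f * g + f * cmap g.
Proof.
apply/fpsP=> n; rewrite fpsDE /cmap !fpsME d_sum -big_split.
by apply: eq_bigr => i _; rewrite dM.
Qed.

Lemma cmap_fder : fder cmap.
Proof.
split.
- by move=> f g; apply/fpsP=> n; rewrite /cmap !fpsDE dD.
- exact: cmapM.
- by move=> k f fk i ik; rewrite /cmap fk ?d0 // ltnS ltnW.
- by move=> a; apply/fpsP=> n; rewrite /cmap fps_alg /fps_const; case: ifP; rewrite ?d_alg ?d0.
Qed.

Lemma cmap_vge k f : vge k f -> vge k (cmap f).
Proof. by move=> fk i ik; rewrite /cmap fk ?d0. Qed.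
Lemma iter_cmap_vge k a f : vge k f -> vge k (iter a cmap f).
Proof. by move=> fk; elim: a => //= a; apply: cmap_vge. Qed.
Lemma iter_cmapE a f n : iter a cmap f n = iter a d (f n).
Proof. by elim: a => //= a IHa; rewrite /cmap IHa. Qed.
Lemma cmapX0 al n : cmap al = 0 -> cmap (al ^+ n) = 0.
Proof. by move=> al0; rewrite (fderX cmap_fder) al0 mulr0 scaler0. Qed.
Lemma iter_cmapM0 al a f : cmap al = 0 -> iter a cmap (al * f) = al * iter a cmap f.
Proof. by move=> al0; elim: a => //= a ->; rewrite cmapM al0 mul0r add0r. Qed.

(** Taylor's formula for [exp (be d) f]: the substitution of [t + be] for [t]. In each degree the
    sum may be cut off because [be] is used with positive order. *)
Definition shiftop (be f : fps B) : fps B :=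
  fun n => \sum_(a < n.+1) a`!%:R^-1 *: (be ^+ a * iter a cmap f) n.

Definition pshift K (be f : fps B) : fps B :=
  \sum_(a < K) a`!%:R^-1 *: (be ^+ a * iter a cmap f).

Lemma pshift_vge K be f : vge 1 be -> vge K (shiftop be f - pshift K be f).
Proof.
move=> b1 i iK; rewrite fpsBE; apply/eqP; rewrite subr_eq0; apply/eqP.
rewrite /pshift fps_sumE /shiftop.
rewrite (big_ord_widen K (fun a => a`!%:R^-1 *: (be ^+ a * iter a cmap f) i)) //.
rewrite big_mkcond /=; apply: eq_bigr => j _; case: ltnP => // ij.
by rewrite fpsZE (vgeMr _ (vgeX b1)) ?scaler0.
Qed.

Lemma exp_mul_coef K (w f : fps B) n : vge 1 w -> (n < K)%N ->
  (fps_exp w * f) n = \sum_(b < K) b`!%:R^-1 *: (w ^+ b * f) n.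
Proof.
move=> w1 nK.
have E : vge K (fps_exp w * f - psubst K (fun m => (m`!%:R^-1)%:A) w * f).
  by rewrite -mulrBl fps_expE; apply: vgeMr; apply: psubst_vge.
apply/eqP; rewrite -subr_eq0; apply/eqP; rewrite -[RHS](E n nK) fpsBE; congr (_ - _).
rewrite /psubst mulr_suml fps_sumE; apply: eq_bigr => b _.
by rewrite -mulrA fps_constM -scalerAl mul1r.
Qed.

(** The identity behind [hermite], summed over all powers with [- al] in place of [z]; [al] has to
    be free of [t]. *)
Lemma gauss_shift al f n : vge 1 al -> cmap al = 0 ->
  h ((fps_exp (- (al * fps_const t)) * f) n) =
  h ((fps_exp (c *: al ^+ 2) * shiftop (- (2 * c) *: al) f) n).
Proof.
move=> al1 al0; set K := n.+1.
have nal1 : vge 1 (- al) by apply: vgeN.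
have nal0 : cmap (- al) = 0 by rewrite (fderN cmap_fder) al0 oppr0.
transitivity (\sum_(i < K) \sum_(a < K) ka i * mu a *
    h (((- al) ^+ (i.*2 + a) * iter a cmap f) n)).
  rewrite (@exp_mul_coef K) //; last by apply: vgeN; apply: vgeMr.
  rewrite h_sum.
  have E (b : 'I_K) : h (b`!%:R^-1 *: ((- (al * fps_const t)) ^+ b * f) n) =
     \sum_(i < K) \sum_(a < K) if (i.*2 + a == b)%N then
       ka i * mu a * h (((- al) ^+ b * iter a cmap f) n) else 0.
    rewrite hZ -mulNr exprMn mulrAC -rmorphXn [_ * fps_const _]mulrC fps_constM (@hermite K) //.
    rewrite mulrA mulVf ?mul1r; last by rewrite pnatr_eq0 -lt0n fact_gt0.
    apply: eq_bigr => i _; apply: eq_bigr => a _; case: ifP => // _.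
    by rewrite -iter_cmapE iter_cmapM0 // cmapX0.
  rewrite (eq_bigr _ (fun b _ => E b)) exchange_big; apply: eq_bigr => i _.
  rewrite exchange_big; apply: eq_bigr => a _.
  (* Pairs with [2 i + a > n] do not occur on the left; on the right they contribute nothing, as
     [al ^ (2 i + a)] then has order above [n]. *)
  have [lt|ge] := ltnP (i.*2 + a) K.
    rewrite (bigD1 (Ordinal lt)) //= eqxx big1 ?addr0 // => b.
    rewrite -val_eqE /= eq_sym => /negbTE-> //.
  rewrite big1 => [|b _].
    by rewrite (vgeMr _ (vgeX nal1)) ?h0 ?mulr0.
  by case: eqP => // E'; move: ge; rewrite E' leqNgt ltn_ord.
rewrite (@exp_mul_coef K) ?h_sum //; last by apply: vgeZ; apply: vgeMr.
apply: eq_bigr => i _; rewrite hZ.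
set be := - (2 * c) *: al; have be1 : vge 1 be by apply: vgeZ.
have -> : ((c *: al ^+ 2) ^+ i * shiftop be f) n = ((c *: al ^+ 2) ^+ i * pshift K be f) n.
  apply: subr0_eq; rewrite -fpsBE -mulrBr.
  exact: (vgeMl _ (pshift_vge f be1) (leqnn _)).
rewrite /pshift mulr_sumr fps_sumE h_sum mulr_sumr; apply: eq_bigr => a _.
have -> : be = (2 * c) *: - al by rewrite /be scaleNr scalerN.
rewrite !exprZn.
have G (x y z : R) (P Q g : fps B) :
    (x *: P) * (y *: (z *: Q * g)) = (x * (y * z)) *: (P * Q * g).
  by rewrite -[z *: Q * g]scalerAl scalerA -scalerAr -scalerAl scalerA mulrC -mulrA.
rewrite G fpsZE hZ -[al ^+ 2]sqrrN -exprM mul2n -exprD /ka /mu; ring.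
Qed.

Lemma shiftop_const be f : cmap f = 0 -> shiftop be f = f.
Proof.
move=> f0; apply/fpsP=> n; rewrite /shiftop big_ord_recl fact0 invr1 scale1r mul1r.
rewrite big1 ?addr0 // => a _; rewrite lift0.
have -> : iter a.+1 cmap f = 0.
  by elim: (nat_of_ord a) => //= m ->; apply: (fder0 cmap_fder).
by rewrite mulr0 scaler0.
Qed.

Lemma gauss_elim w f n : vge 1 w -> cmap w = 0 -> cmap f = 0 ->
  h ((fps_exp (w * fps_const t) * f) n) = h ((fps_exp (c *: w ^+ 2) * f) n).
Proof.
move=> w1 w0 f0; have := @gauss_shift (- w) f n; rewrite mulNr opprK => ->.
- by rewrite sqrrN shiftop_const.
- exact: vgeN.
- by rewrite (fderN cmap_fder) w0 oppr0.
Qed.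

Section Shift.
Variable be : fps B.
Hypothesis be1 : vge 1 be.

Lemma shiftopD : {morph shiftop be : f g / f + g}.
Proof.
have iD a f g : iter a cmap (f + g) = iter a cmap f + iter a cmap g.
  by elim: a => //= a ->; apply: (fderD cmap_fder).
move=> f g; apply/fpsP=> n; rewrite fpsDE /shiftop -big_split /=.
by apply: eq_bigr => a _; rewrite iD mulrDr fpsDE scalerDr.
Qed.
Lemma shiftop_alg (x : R) : shiftop be x%:A = x%:A.
Proof. by apply: shiftop_const; apply: (fder_alg cmap_fder). Qed.
Lemma shiftop_vge k f : vge k f -> vge k (shiftop be f).
Proof.
move=> fk i ik; rewrite /shiftop big1 // => a _.
by rewrite (vgeMl _ (iter_cmap_vge _ fk)) ?scaler0.
Qed.

Let dv a f : fps B := a`!%:R^-1 *: iter a cmap f.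
Lemma dvM a f g : dv a (f * g) = \sum_(i < a.+1) dv i f * dv (a - i)%N g.
Proof.
have dvS b u : b.+1%:R *: dv b.+1 u = cmap (dv b u).
  rewrite /dv /= (fderZ cmap_fder) scalerA factS natrM invfM mulrA divff ?mul1r //.
  by rewrite pnatr_eq0.
elim: a f g => [|a IHa] f g.
  by rewrite big_ord1 /dv fact0 invr1 !scale1r.
apply: (@scalerI _ _ (a.+1%:R : R)); first by rewrite pnatr_eq0.
rewrite dvS IHa (fder_sum cmap_fder) scaler_sumr.
have -> : \sum_(i < a.+2) a.+1%:R *: (dv i f * dv (a.+1 - i) g) =
   \sum_(i < a.+2) (i%:R *: dv i f) * dv (a.+1 - i)%N g +
   \sum_(i < a.+2) dv i f * ((a.+1 - i)%:R *: dv (a.+1 - i)%N g).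
  rewrite -big_split; apply: eq_bigr => i _ /=.
  have G (x y : fps B) (p q : R) : (p + q) *: (x * y) = p *: x * y + x * (q *: y).
    by rewrite -scalerAl -scalerAr -scalerDl.
  by rewrite -G -natrD subnKC // -ltnS.
rewrite (eq_bigr _ (fun i _ => fderM cmap_fder _ _)) big_split /=; congr (_ + _).
  rewrite [RHS]big_ord_recl scale0r mul0r add0r; apply: eq_bigr => i _.
  by rewrite lift0 dvS subSS.
rewrite [RHS]big_ord_recr /= subnn scale0r mulr0 addr0; apply: eq_bigr => i _.
by rewrite subSn ?dvS // -ltnS.
Qed.

(** By Leibniz' rule for the divided derivatives [dv], truncated Taylor polynomials in [be] multiply
    up to terms of order [n+1]. *)
Lemma shiftopM : {morph shiftop be : f g / f * g}.
Proof.
have pE n u : pshift n.+1 be u = (\poly_(a < n.+1) dv a u).[be].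
  rewrite horner_poly; apply: eq_bigr => a _.
  by rewrite /dv -scalerAl mulrC.
move=> f g; apply/fpsP => n; apply: subr0_eq; rewrite -fpsBE.
suff : vge n.+1 (shiftop be (f * g) - shiftop be f * shiftop be g) by apply.
apply: vge_trans (pshift_vge _ be1) _.
apply: vge_sym; apply: (vge_trans (g := pshift n.+1 be f * shiftop be g)).
  by rewrite -mulrBl; apply: vgeMr; apply: pshift_vge.
apply: (vge_trans (g := pshift n.+1 be f * pshift n.+1 be g)).
  by rewrite -mulrBr; apply: vgeMl; apply: pshift_vge.
rewrite !pE -hornerM (@horner_coef_wide _ (n.+1 + n.+1)); last first.
  rewrite (leq_trans (size_polyMleq _ _)) //.
  by rewrite (leq_trans (leq_pred _)) // leq_add // size_poly.
rewrite horner_poly big_split_ord /= -addrA addrC -addrA [X in _ + X]addrC.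
apply: vgeD.
  by apply: vge_sum => i _; apply: vgeMl; apply: vge_le (vgeX be1); apply: leq_addr.
rewrite (_ : _ - _ = 0) //; apply/eqP; rewrite subr_eq0; apply/eqP.
apply: eq_bigr => i _; congr (_ * _); rewrite dvM coefM; apply: eq_bigr => j _.
rewrite !coef_poly.
have := ltn_ord i; have := ltn_ord j => ji iN.
by rewrite !ifT //; lia.
Qed.

Lemma shiftop_subst (e : nat -> R) w : vge 1 w ->
  shiftop be (fps_subst e w) = fps_subst e (shiftop be w).
Proof.
move=> w1; apply: cmorph_subst => //.
- exact: shiftopD.
- exact: shiftopM.
- exact: shiftop_alg.
- exact: shiftop_vge.
Qed.
End Shift.
End Gaussian.

Section Composition.
Variables (R : realType) (A : comAlgType R) (T : fps A).
Hypothesis T1 : vge 1 T.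
Implicit Types f g : fps A.

Lemma bsubst_vge k f : vge k f -> vge k (bsubst f T).
Proof.
move=> fk i ik; rewrite /bsubst big1 // => m _.
have [mk|km] := ltnP m k; first by rewrite fk ?mul0r.
by rewrite (vgeX T1) ?mulr0 //; have := ltn_ord m; lia.
Qed.
Lemma bsubst_X : bsubst (fX : fps A) T = T.
Proof.
apply/fpsP=> n; rewrite /bsubst; case: n => [|n].
  by rewrite big_ord1 mul0r T1.
rewrite big_ord_recl mul0r add0r big_ord_recl big1 ?addr0 => [|i _].
  by rewrite /= mul1r.
by rewrite /fps_X /= mul0r.
Qed.
Lemma bsubst_alg (a : R) : bsubst (a%:A : fps A) T = a%:A.
Proof.
by rewrite !fps_alg -[RHS](bsubst_const _ T); apply: eq_bsubst.
Qed.
Lemma bsubst_comp (c : nat -> R) w : vge 1 w ->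
  bsubst (fps_subst c w) T = fps_subst c (bsubst w T).
Proof.
move=> w1; apply: (@cmorph_subst _ _ _ (fun f => bsubst f T)) => //.
- by move=> f g; rewrite -bsubstD.
- by move=> f g; apply: bsubst_mul.
- exact: bsubst_alg.
- exact: bsubst_vge.
Qed.
End Composition.

(** * The series T and the formal Stirling series *)

Section TreeSeries.
Variable R : realType.
Notation S := (fps R^o).
Notation T := (Tser R : S).

Lemma alg_regular (a : R) : (a%:A : R^o) = a.
Proof. by rewrite /GRing.scale /= mulr1. Qed.
Lemma subst_bsubst (c w : S) : fps_subst c w = bsubst c w.
Proof. by rewrite fps_substE; apply: eq_bsubst => m; rewrite alg_regular. Qed.

Lemma fps_mulXE (A : comAlgType R) (f : fps A) : fps_mulX f = fX * f.
Proof. by apply/fpsP=> n; rewrite fps_XM. Qed.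

Lemma Tser_vge : vge 1 T. Proof. exact: vge1P. Qed.

Lemma Tstep_cont k (f g : S) : (forall i, (i < k)%N -> f i = g i) ->
  forall i, (i < k.+1)%N -> Tstep f i = Tstep g i.
Proof.
move=> fg [//|i] ik; rewrite /Tstep /fps_mulX.
by apply: (@frel_subst R R^o R^o (fun _ a b => a = b) _ _ _ _ _ k) => //;
  [move=> j a b ? ? -> -> | move=> j x a ? -> | move=> i' j a b ? ? -> ->].
Qed.

(** [Tstep] gains one correct coefficient per application ([Tstep_cont]), so the diagonal choice
    made in [Tser] agrees with all later iterates. *)
Lemma Tser_fix : T = fX * fps_subst (psi R) T.
Proof.
rewrite -fps_mulXE -[fps_mulX _]/(Tstep T).
pose F m : S := iter m (@Tstep R) (fun=> 0).
have FS m i : (i < m)%N -> F m.+1 i = F m i.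
  elim: m i => // m IHm i im; rewrite /F iterS [in RHS]iterS.
  exact: (@Tstep_cont m).
have TF m i : (i < m)%N -> T i = F m i.
  elim: m => // m IHm; rewrite ltnS leq_eqVlt => /orP[/eqP->|im].
    by rewrite /Tser -/(F m.+1).
  by rewrite FS // IHm.
apply/fpsP=> n; rewrite (TF n.+1) // /F iterS; symmetry.
apply: (@Tstep_cont n) => // i; exact: TF.
Qed.

(** Squaring [T = X psi(T)] removes the exponent [-1/2] of [psi]. With [y = 1 + T] the result is
    [x^2 = (y^2 - 1)/2 - log y]: [T] is the change of variables that makes the phase of the integral
    of [y^N exp (- N y^2 / 2)] quadratic. *)
Lemma Tser_sqr : fX ^+ 2 = (1/2) *: T ^+ 2 + T - fps_log1p T.
Proof.
have T1 := Tser_vge.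
set W := (1/2 : R); have W2 : (- W) *+ 2 = -1 by rewrite /W; lra.
pose Y : S := - fps_log1p fX + fX - W *: fX ^+ 2.
have X1 : vge 1 (fX : S) by apply: vge1P.
have logX1 : fps_log1p (fX : S) 1%N = 1.
  have := congr1 (fun f : S => f 0%N) (fder_log (fps_deriv_fder _) X1).
  by rewrite fpsM0 fpsDE fpsE1 X1 // addr0 mul1r /fps_deriv !scale1r.
have innerE : fX ^+ 2 * psi_inner R = Y.
  rewrite -(@fps_X2_div _ _ Y).
  - by congr (_ * fps_divX2 _); rewrite /Y /psi_inner fps_powE -scaleNr.
  - by rewrite /Y !fpsDE !fpsNE fps_log0 oppr0 add0r fpsZE fps_XnE scaler0 subr0.
  - by rewrite /Y !fpsDE !fpsNE logX1 fpsZE fps_XnE scaler0 subr0 addNr.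
have inner1 : vge 1 (psi_inner R).
  apply: vge1P; have /fpsP/(_ 2) := innerE; rewrite fps_XnM /= => ->.
  have := congr1 (fun f : S => f 1%N) (fder_log (fps_deriv_fder _) X1).
  rewrite fpsME !big_ord_recl big_ord0 addr0 /= /bump /= !fpsDE !fpsE1 /=.
  rewrite !fps_XE /= /fps_deriv logX1 /= addr0 add0r !mul1r !fps_XE /=.
  rewrite /GRing.scale /= !mulr1 mulr0 /Y !fpsDE !fpsNE fpsZE fps_XnE /GRing.scale /=.
  rewrite fps_XE /= mulr1 subn0 addn0 subnn => E; rewrite /W; lra.
set P := fps_subst (psi R) T; have TP : T = fX * P := Tser_fix.
have PE : P = fps_binom (- W) (bsubst (psi_inner R) T).
  by rewrite /P subst_bsubst /psi /fps_binom bsubst_comp.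
have bi1 : vge 1 (bsubst (psi_inner R) T) by apply: bsubst_vge.
have PP : P ^+ 2 * (1 + bsubst (psi_inner R) T) = 1.
  rewrite PE -fps_binomMn // mulr_natl W2 -[1 + _]expr1 -fps_binom_nat //.
  exact: fps_binomN.
have TY : T ^+ 2 * bsubst (psi_inner R) T = - fps_log1p T + T - W *: T ^+ 2.
  have := congr1 (fun f : S => bsubst f T) innerE.
  rewrite bsubst_mul // -!subst_bsubst.
  rewrite expr2 subst_bsubst bsubst_mul // !bsubst_X // -expr2 => ->.
  rewrite /Y subst_bsubst.
  have BD (f g : S) : bsubst (f + g) T = bsubst f T + bsubst g T by rewrite -bsubstD.
  have BZ (a : R) (f : S) : bsubst (a *: f) T = a *: bsubst f T.
    by rewrite -mulr_algl bsubst_mul // bsubst_alg mulr_algl.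
  rewrite -!scaleN1r !BD !BZ bsubst_X // /fps_log1p bsubst_comp // bsubst_X //.
  by rewrite expr2 bsubst_mul // bsubst_X.
have -> : fX ^+ 2 = T ^+ 2 * (1 + bsubst (psi_inner R) T) :> S.
  by rewrite {1}TP exprMn -mulrA PP mulr1.
rewrite mulrDr mulr1 TY -[X in X + _]scale1r.
have -> : (1 : R) = W + W by rewrite /W; lra.
rewrite scalerDl; ring.
Qed.

Section Lift.
Variable A : comAlgType R.
Definition liftA (f : S) : fps A := fun n => (f n)%:A.
Notation TA := (liftA T).

Let rho (j : nat) (a : R^o) (b : A) := b = a%:A.
Let r0 : forall j, rho j 0 0. Proof. by move=> j; rewrite /rho scale0r. Qed.
Let r1 : rho 0%N 1 1. Proof. by rewrite /rho scale1r. Qed.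
Let rD : forall j (a b : R^o) (a' b' : A), rho j a a' -> rho j b b' -> rho j (a + b) (a' + b').
Proof. by move=> j a b _ _ -> ->; rewrite /rho scalerDl. Qed.
Let rZ : forall j (x : R) (a : R^o) (a' : A), rho j a a' -> rho j (x *: a) (x *: a').
Proof. by move=> j x a _ ->; rewrite /rho scalerA. Qed.
Let rM : forall i j (a b : R^o) (a' b' : A),
  rho i a a' -> rho j b b' -> rho (i + j)%N (a * b) (a' * b').
Proof. by move=> i j a b _ _ -> ->; rewrite /rho -scalerAl mul1r scalerA. Qed.
Let frelP f g : (forall K, frel rho K f g) -> g = liftA f.
Proof. by move=> H; apply/fpsP=> n; apply: (H n.+1). Qed.
Lemma liftAD f g : liftA (f + g) = liftA f + liftA g.
Proof. by symmetry; apply: frelP => K; apply: frelD. Qed.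
Lemma liftAM f g : liftA (f * g) = liftA f * liftA g.
Proof. by symmetry; apply: frelP => K; apply: frelM. Qed.
Lemma liftAZ (a : R) f : liftA (a *: f) = a *: liftA f.
Proof. by symmetry; apply: frelP => K; apply: frelZ. Qed.
Lemma liftA1 : liftA 1 = 1.
Proof. by symmetry; apply: frelP => K; apply: frel1. Qed.
Lemma liftAN f : liftA (- f) = - liftA f.
Proof. by rewrite -scaleN1r liftAZ scaleN1r. Qed.
Lemma liftAX f n : liftA (f ^+ n) = liftA f ^+ n.
Proof. by symmetry; apply: frelP => K; apply: frelX. Qed.
Lemma liftA_subst c f : liftA (fps_subst c f) = fps_subst c (liftA f).
Proof. by symmetry; apply: frelP => K; apply: frel_subst. Qed.
Lemma liftA_X : liftA fX = fX.
Proof.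
by apply/fpsP=> n; rewrite /liftA /fps_X; case: eqP; rewrite ?scale1r ?scale0r.
Qed.
Lemma liftA_deriv f : liftA (fps_deriv f) = fps_deriv (liftA f).
Proof. by apply/fpsP=> n; rewrite /liftA /fps_deriv scalerA. Qed.

Lemma TA_vge : vge 1 TA. Proof. by apply: vge1P; rewrite /liftA scale0r. Qed.
Lemma TA_log : fps_log1p TA = (1/2) *: TA ^+ 2 + TA - fX ^+ 2.
Proof.
have := congr1 liftA Tser_sqr.
rewrite !liftAD liftAN liftAZ !liftAX liftA_X /fps_log1p liftA_subst => ->; ring.
Qed.
Lemma TA_deriv : 2 *: (fX * (1 + TA)) = fps_deriv TA * ((1 + TA) ^+ 2 - 1).
Proof.
have D := @fps_deriv_fder R A; have := fder_log D TA_vge.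
rewrite TA_log (fderB D) (fderD D) (fderZ D) !(fderX D) /= !expr1 scalerA.
have -> : fps_deriv (fX : fps A) = 1.
  apply/fpsP=> n; rewrite fpsE1 /fps_deriv /fps_X eqSS; case: eqP => [->|_].
    by rewrite scale1r.
  by rewrite scaler0.
have -> : 1 / 2 * 2 = 1 :> R by lra.
rewrite scale1r mulr1 => E.
rewrite scalerAl; move: E; set Q := 2 *: fX; set T' := fps_deriv TA => E.
have -> : T' * ((1 + TA) ^+ 2 - 1) = (1 + TA) * (TA * T' + T') - T' by ring.
by rewrite -[X in _ = _ - X]E; ring.
Qed.
End Lift.

(** The moment of order [2j] of [exp (- x^2)], normalized to total mass 1. *)
Definition mom j : R := (j.*2)`!%:R / (j`!%:R * 4 ^+ j).
Lemma momS j : 2 * mom j.+1 = j.*2.+1%:R * mom j.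
Proof.
rewrite /mom doubleS !factS !natrM exprS.
have -> : j.*2.+2%:R = 2 * j.+1%:R :> R by rewrite -natrM; congr _%:R; lia.
have a0 : j.+1%:R != 0 :> R by rewrite pnatr_eq0.
have b0 : j`!%:R != 0 :> R by rewrite pnatr_eq0 -lt0n fact_gt0.
have c0 : (4 : R) ^+ j != 0 by rewrite expf_neq0 // pnatr_eq0.
set x := j.+1%:R in a0 *; set y := j`!%:R in b0 *; set z := 4 ^+ j in c0 *.
set g := (j.*2)`!%:R; set e := j.*2.+1%:R; field.
by rewrite nat1r c0 a0 b0.
Qed.

Section Bracket.
Variable A : comAlgType R.
(** Formal integral of [f(x)] against the normalized weight [exp (- N x^2)], as a series in [1/N].
    Thus [fX] is [x] under the bracket and [1/N] outside. *)
Definition bracket (f : fps A) : fps A := fun j => mom j *: f j.*2.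
Lemma bracketD f g : bracket (f + g) = bracket f + bracket g.
Proof. by apply/fpsP=> n; rewrite fpsDE /bracket scalerDr. Qed.
Lemma bracketZ (a : R) f : bracket (a *: f) = a *: bracket f.
Proof. by apply/fpsP=> n; rewrite fpsZE /bracket fpsZE !scalerA mulrC. Qed.
Lemma bracketB f g : bracket (f - g) = bracket f - bracket g.
Proof. by rewrite bracketD -[- g]scaleN1r bracketZ scaleN1r. Qed.
Lemma bracket_constM (a : A) f : bracket (fps_const a * f) = fps_const a * bracket f.
Proof. by apply/fpsP=> n; rewrite /bracket !fps_constM scalerAr. Qed.
Lemma bracket_ibp f : 2 *: bracket (fX * f) = fX * bracket (fps_deriv f).
Proof.
apply/fpsP=> -[|j]; rewrite fpsZE fps_XM /bracket fps_XM ?scaler0 //.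
by rewrite doubleS scalerA momS /fps_deriv scalerA mulrC.
Qed.
(** Multiplication by [x^2] is [- d/dN], which is [e^2 d/de] for [e = 1/N]; the normalizing factor
    [sqrt N] is responsible for the additional [e/2]. *)
Lemma bracket_sqr f :
  2 *: bracket (fX ^+ 2 * f) = 2 *: (fX ^+ 2 * fps_deriv (bracket f)) + fX * bracket f.
Proof.
apply/fpsP=> -[|j]; rewrite fpsDE !fpsZE fps_XM fps_XnM /bracket fps_XnM ?scaler0 ?addr0 //.
rewrite doubleS /= subSS subSS subn0 scalerA momS; case: j => [|j] /=.
  by rewrite scaler0 add0r -scalerA scale1r.
have -> : j.+1.*2.+1%:R = 2 * j.+1%:R + 1 :> R by rewrite -mul2n -natr1 natrM.
rewrite !subSS subn0 /fps_deriv scalerA scalerA -scalerDl.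
by congr (_ *: _); ring.
Qed.
End Bracket.

(* [nu q j] is the coefficient of [N^-j] in the formal Gaussian integral
   of [(1+T)^-q dT] against [exp (- N x^2)]. *)
Definition nu q : S := bracket (fps_binom (- q%:R) T * fps_deriv T).

(** Integration by parts of [(1 + T) ^ -(q+1)]. In terms of [y = 1 + T] it is the moment recursion
    for [exp (- N y^2 / 2)], whence the factor [1 - (q+1)/N]. *)
Lemma nu_rec q : nu q = (1 - q.+1%:R *: fX) * nu q.+2.
Proof.
have T1 := Tser_vge; have D := @fps_deriv_fder R R^o.
set U := fps_binom (- 1) T.
have UT : U * (1 + T) = 1.
  by rewrite -[1 + T]expr1 -fps_binom_nat //; apply: fps_binomN.
have UE m : fps_binom (- m%:R) T = U ^+ m by rewrite -fps_binomMn // mulrN1.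
have dT : 2 *: (fX * (1 + T)) = fps_deriv T * ((1 + T) ^+ 2 - 1).
  have := TA_deriv R^o; have -> // : liftA R^o T = T.
  by apply/fpsP=> n; rewrite /liftA alg_regular.
have dU : fps_deriv U = - (U ^+ 2 * fps_deriv T).
  have := congr1 (@fps_deriv R R^o) UT; rewrite (fderM D) (fderD D) (fder1 D) add0r.
  move/(congr1 (fun f => U * f)); rewrite mulrDr mulr0 mulrCA UT mulr1.
  by rewrite mulrA -expr2 => /eqP; rewrite addr_eq0 => /eqP.
rewrite /nu !UE mulrBl mul1r -scalerAl.
have := bracket_ibp (U ^+ q.+1); rewrite -bracketZ.
rewrite (fderX D) /= dU mulrN scalerN mulrA -exprD addn2.
have -> : 2 *: (fX * U ^+ q.+1) = U ^+ q * fps_deriv T - U ^+ q.+2 * fps_deriv T.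
  have -> : U ^+ q * fps_deriv T = U ^+ q.+2 * (fps_deriv T * (1 + T) ^+ 2).
    rewrite mulrCA -[in RHS]addn2 exprD -mulrA -exprMn UT expr1n mulr1 mulrC //.
  have -> : U ^+ q.+1 = U ^+ q.+2 * (1 + T).
    by rewrite [in RHS]exprSr -mulrA UT mulr1.
  rewrite mulrCA scalerAr dT; ring.
rewrite bracketB => E; rewrite -[LHS](subrK (bracket (U ^+ q.+2 * fps_deriv T))) E.
by rewrite -scaleNr bracketZ scaleNr mulrN scalerAr addrC.
Qed.
End TreeSeries.

(** * The shift identity of the formal Stirling series *)

Section StirlingShift.
Variable R : realType.
Notation S := (fps R^o).
Notation P := {poly R}.
Notation lam := (fps_const ('X : P)).
Notation T := (liftA P (Tser R)).

Local Notation dl := (cmap (@deriv R)).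

Fact deriv_alg (x : R) : deriv (x%:A : P) = 0.
Proof. by rewrite alg_polyC derivC. Qed.
Lemma dl_fder : @fder R P dl.
Proof.
apply: cmap_fder; [exact: derivD | exact: derivM | exact: deriv_alg].
Qed.

(** With [N = 1/X] this is [d/dlam - d/dN], the derivative along the lines [N + lam] constant. *)
Definition flow (f : fps P) : fps P := dl f + fX ^+ 2 * fps_deriv f.

Lemma flow_fder : fder flow.
Proof.
have D1 := dl_fder; have D2 := @fps_deriv_fder R P; split.
- by move=> f g; rewrite /flow (fderD D1) (fderD D2); ring.
- by move=> f g; rewrite /flow (fderM D1) (fderM D2); ring.
- move=> k f fk; apply: vgeD; first exact: (fder_cont D1).
  by apply: vgeMl; apply: (fder_cont D2).
- by move=> a; rewrite /flow (fder_alg D1) (fder_alg D2) mulr0 addr0.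
Qed.

(** The coefficient of [X^j] of the equation expresses the [lam]-derivative of the [j]-th
    coefficient by lower ones, so only the value at [lam = 0] remains free. *)
Lemma flow_uniq (f g : fps P) : flow f = (1/2) *: (lam * fX * f) ->
  flow g = (1/2) *: (lam * fX * g) -> (forall j, (f j).[0] = (g j).[0]) -> f = g.
Proof.
move=> Ef Eg E0; apply/eqP; rewrite -subr_eq0; apply/eqP.
set u := f - g; have Eu : flow u = (1/2) *: (lam * fX * u).
  by rewrite (fderB flow_fder) Ef Eg -scalerBr mulrBr.
have u0 j : (u j).[0] = 0 by rewrite /u fpsBE hornerD hornerN E0 subrr.
have Z (p : P) : p^`() = 0 -> p.[0] = 0 -> p = 0.
  move=> p' p0; apply/polyP => -[|i]; first by rewrite -horner_coef0 p0 coef0.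
  have := congr1 (fun q : P => q`_i) p'; rewrite coef_deriv !coef0 => /eqP.
  by rewrite mulrn_eq0 => /eqP.
apply/fpsP=> j; elim: j => [|j IHj].
  apply: Z => //; have /fpsP/(_ 0%N) := Eu.
  by rewrite /flow fpsDE fps_XnM addr0 fpsZE -mulrA fps_constM fps_XM mulr0 scaler0.
apply: Z => //; have /fpsP/(_ j.+1) := Eu.
rewrite /flow fpsDE fps_XnM fpsZE -mulrA fps_constM fps_XM IHj mulr0 scaler0.
case: j IHj => [|j] IHj; first by rewrite addr0.
by rewrite !subSS subn0 /fps_deriv IHj scaler0 addr0.
Qed.

Definition Gam : S := nu R 0.
Definition Tpow : fps P := fps_exp (lam * fps_log1p T).
Definition GamR : fps P := bracket (Tpow * fps_deriv T).

Lemma lamlog_vge : vge 1 (lam * fps_log1p T).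
Proof. by apply: vgeMl; apply: vge_log. Qed.

Lemma dl_lift (f : S) : dl (liftA P f) = 0.
Proof. by apply/fpsP=> n; rewrite /cmap /liftA deriv_alg. Qed.
Lemma dl_lam : dl lam = 1.
Proof.
apply/fpsP=> n; rewrite /cmap /fps_const fpsE1; case: eqP => _; last exact: deriv0.
by rewrite derivX.
Qed.

(** The [lam]-derivative inserts [log (1 + T)], which [TA_log] turns into [T^2/2 + T - x^2]. The
    [x^2] becomes a derivative in [N] by [bracket_sqr]; the rest is integrated by parts. *)
Lemma flow_GamR : flow GamR = (1/2) *: (lam * fX * GamR).
Proof.
have D := @fps_deriv_fder R P; have D1 := dl_fder.
have T1 := TA_vge P; have ll1 := lamlog_vge.
set T' := fps_deriv T.
have dT : 2 *: (fX * (1 + T)) = T' * ((1 + T) ^+ 2 - 1) := TA_deriv P.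
have dlT : dl T' = 0 by rewrite /T' -liftA_deriv dl_lift.
have dllog : dl (fps_log1p T) = 0 by rewrite /fps_log1p -liftA_subst dl_lift.
have E1 : dl GamR = bracket (Tpow * (fps_log1p T * T')).
  have -> : dl GamR = bracket (dl (Tpow * T')).
    by apply/fpsP=> n; rewrite /cmap /bracket derivZ.
  rewrite (fderM D1) dlT mulr0 addr0 (fder_exp D1) // (fderM D1) dllog dl_lam.
  by rewrite mulr0 addr0 mul1r mulrA.
have E2 : fps_deriv (Tpow * (1 + T)) = (lam + 1) * (Tpow * T').
  rewrite (fderM D) (fder_exp D) // (fderM D) (fderD D) (fder1 D) add0r.
  have -> : fps_deriv lam = 0.
    by apply/fpsP=> n; rewrite /fps_deriv /fps_const /= scaler0.
  rewrite mul0r add0r -/T'; have := fder_log D T1; rewrite -/T' => E.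
  by rewrite -/Tpow [RHS]mulrDl mul1r; congr (_ + _); rewrite -E; ring.
have := bracket_ibp (Tpow * (1 + T)); rewrite E2 mulrDl mul1r bracketD.
rewrite bracket_constM -/GamR -bracketZ.
have -> : 2 *: (fX * (Tpow * (1 + T))) = Tpow * (T' * ((1 + T) ^+ 2 - 1)).
  by rewrite -dT mulrCA scalerAr.
move=> E3; have := bracket_sqr (Tpow * T'); rewrite -/GamR => E4.
apply: (@scalerI _ _ (2 : R)); first by rewrite pnatr_eq0.
rewrite scalerDr E1 (TA_log P) -bracketZ.
have -> : 2 *: (Tpow * (((1 / 2) *: T ^+ 2 + T - fX ^+ 2) * T')) =
   Tpow * (T' * ((1 + T) ^+ 2 - 1)) - 2 *: (fX ^+ 2 * (Tpow * T')).
  have -> : T' * ((1 + T) ^+ 2 - 1) = 2 *: (((1/2) *: T ^+ 2 + T) * T').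
    rewrite scalerAl scalerDr scalerA; have -> : 2 * (1/2) = 1 :> R by lra.
    rewrite scale1r -[2 *: T]mulr_algl.
    have -> : (2%:A : fps P) = 2 by rewrite scaler_nat.
    ring.
  rewrite -scalerAr -scalerBr; congr (_ *: _); ring.
rewrite bracketB [bracket (2 *: _)]bracketZ E4 E3 scalerA.
have -> : 2 * (1/2) = 1 :> R by lra.
rewrite scale1r; set w := 2 *: _; ring.
Qed.

(** This is [1/(N + lam)], and [shX] is [((N + lam)/2) log (1 + lam/N) - lam/2], the logarithm of
    the factor that appears when [y] is rescaled by [sqrt (1 + lam/N)]. *)
Definition shE : fps P := fX * fps_binom (- 1) (lam * fX).
Definition shZ : fps P := (1 + lam * fX) * fps_log1p (lam * fX) - lam * fX.
Definition shX : fps P := (1/2) *: ((fun n => shZ n.+1) : fps P).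
Definition GamL : fps P := fps_subst Gam shE * fps_exp shX.

Lemma lamX_vge : vge 1 (lam * fX).
Proof. by apply: vgeMl; apply: vge1P. Qed.
Lemma shE_vge : vge 1 shE. Proof. by apply: vgeMr; apply: vge1P. Qed.
Lemma shE_eq : shE * (1 + lam * fX) = fX.
Proof.
rewrite /shE -mulrA -[1 + _]expr1 -(fps_binom_nat 1) ?fps_binomN ?mulr1 //;
  exact: lamX_vge.
Qed.
Lemma shX_eq : 2 *: (fX * shX) = shZ.
Proof.
rewrite /shX -scalerAr scalerA; have -> : 2 * (1/2) = 1 :> R by lra.
rewrite scale1r; apply/fpsP=> -[|n]; rewrite fps_XM //.
rewrite /shZ fpsBE fpsM0 fps_log0 mulr0 lamX_vge // subr0 //.
Qed.

Lemma flow_X : flow fX = fX ^+ 2.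
Proof.
rewrite /flow; have -> : fps_deriv (fX : fps P) = 1.
  apply/fpsP=> n; rewrite fpsE1 /fps_deriv fps_XE eqSS; case: eqP => [->|_].
    by rewrite scale1r.
  by rewrite scaler0.
have -> : dl fX = 0.
  by apply/fpsP=> n; rewrite /cmap fps_XE; case: (_ == _); rewrite ?derivC ?deriv0.
by rewrite mulr1 add0r.
Qed.
Lemma flow_lamX : flow (lam * fX) = fX * (1 + lam * fX).
Proof.
rewrite (fderM flow_fder) flow_X {1}/flow dl_lam.
have -> : fps_deriv lam = 0.
  by apply/fpsP=> n; rewrite /fps_deriv /fps_const /= scaler0.
rewrite mulr0 addr0; ring.
Qed.
Lemma flow_shE : flow shE = 0.
Proof.
have := congr1 flow shE_eq.
rewrite (fderM flow_fder) (fderD flow_fder) (fder1 flow_fder) add0r flow_lamX flow_X.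
have -> : shE * (fX * (1 + lam * fX)) = fX ^+ 2.
  by rewrite mulrCA shE_eq expr2.
move/(congr1 (fun y => y - fX ^+ 2)); rewrite addrK subrr => E0.
have B1 := fps_binomN 1 lamX_vge; rewrite (fps_binom_nat 1) ?expr1 in B1; last exact: lamX_vge.
by rewrite -[LHS]mulr1 -B1 mulrCA E0 mulr0.
Qed.
Lemma flow_shX : flow shX = (1/2) *: (lam * fX).
Proof.
have F := flow_fder.
have := congr1 flow shX_eq; rewrite (fderZ F) (fderM F) flow_X {1}/shZ.
rewrite (fderB F) (fderM F) (fderD F) (fder1 F) add0r (fder_log F) ?flow_lamX; last exact: lamX_vge.
rewrite addrK => E.
apply: (@fps_Xreg _ _ 1); apply: (@scalerI _ _ (2 : R)); first by rewrite pnatr_eq0.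
rewrite expr1 -[LHS](addKr (2 *: (fX ^+ 2 * shX))) -scalerDr E.
have -> : 2 *: (fX ^+ 2 * shX) = fX * shZ by rewrite expr2 -mulrA -shX_eq scalerAr.
rewrite -[in RHS]scalerAr scalerA; have -> : 2 * (1/2) = 1 :> R by lra.
rewrite scale1r /shZ; ring.
Qed.

Lemma shX_vge : vge 1 shX.
Proof.
apply: vge1P; rewrite /shX fpsZE.
have l1 := lamX_vge.
have -> : shZ 1%N = 0; last by rewrite scaler0.
rewrite /shZ fpsBE mulrDl mul1r fpsDE.
have -> : (lam * fX * fps_log1p (lam * fX)) 1%N = 0.
  by apply: (vgeM l1 (vge_log _)).
rewrite addr0; have := congr1 (fun f : fps P => f 0%N) (fder_log (@fps_deriv_fder R P) l1).
by rewrite fpsM0 fpsDE fpsE1 l1 // addr0 mul1r /fps_deriv !scale1r => ->; rewrite subrr.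
Qed.

Lemma flow_GamL : flow GamL = (1/2) *: (lam * fX * GamL).
Proof.
have F := flow_fder.
rewrite (fderM F) (fder_subst F); last exact: shE_vge.
rewrite flow_shE mulr0 mul0r add0r (fder_exp F); last exact: shX_vge.
by rewrite flow_shX /GamL -!scalerAr; congr (_ *: _); ring.
Qed.

Section Eval.
Variable x : R.
Definition ev (f : fps P) : S := fun n => (f n).[x].
Let rho (j : nat) (a : P) (b : R^o) := b = a.[x].
Let r0 : forall j, rho j 0 0. Proof. by move=> j; rewrite /rho horner0. Qed.
Let r1 : rho 0%N 1 1. Proof. by rewrite /rho hornerC. Qed.
Let rD : forall j (a b : P) (a' b' : R^o), rho j a a' -> rho j b b' -> rho j (a + b) (a' + b').
Proof. by move=> j a b ? ? -> ->; rewrite /rho hornerD. Qed.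
Let rZ : forall j (y : R) (a : P) (a' : R^o), rho j a a' -> rho j (y *: a) (y *: a').
Proof. by move=> j y a ? ->; rewrite /rho hornerZ. Qed.
Let rM : forall i j (a b : P) (a' b' : R^o),
  rho i a a' -> rho j b b' -> rho (i + j)%N (a * b) (a' * b').
Proof. by move=> i j a b ? ? -> ->; rewrite /rho hornerM. Qed.
Let frelP f g : (forall K, frel rho K f g) -> g = ev f.
Proof. by move=> H; apply/fpsP=> n; apply: (H n.+1). Qed.
Lemma evD f g : ev (f + g) = ev f + ev g.
Proof. by symmetry; apply: frelP => K; apply: frelD. Qed.
Lemma evM f g : ev (f * g) = ev f * ev g.
Proof. by symmetry; apply: frelP => K; apply: frelM. Qed.
Lemma evZ (a : R) f : ev (a *: f) = a *: ev f.
Proof. by symmetry; apply: frelP => K; apply: frelZ. Qed.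
Lemma ev_subst c f : ev (fps_subst c f) = fps_subst c (ev f).
Proof. by symmetry; apply: frelP => K; apply: frel_subst. Qed.
Lemma ev1 : ev 1 = 1.
Proof. by symmetry; apply: frelP => K; apply: frel1. Qed.
Lemma ev_lift (f : S) : ev (liftA P f) = f.
Proof. by apply/fpsP=> n; rewrite /ev /liftA alg_polyC hornerC. Qed.
Lemma ev_X : ev fX = fX.
Proof.
by apply/fpsP=> n; rewrite /ev !fps_XE; case: (_ == _); rewrite ?hornerC ?horner0.
Qed.
Lemma ev_lam : ev lam = x%:A.
Proof.
apply/fpsP=> n; rewrite /ev fps_alg /fps_const alg_regular.
by case: eqP => _; rewrite ?hornerX ?horner0.
Qed.
Lemma ev_bracket f : ev (bracket f) = bracket (ev f).
Proof. by apply/fpsP=> n; rewrite /ev /bracket hornerZ. Qed.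
Lemma ev_GamR : ev GamR = bracket (fps_binom x (Tser R : S) * fps_deriv (Tser R : S)).
Proof.
rewrite /GamR ev_bracket evM -liftA_deriv ev_lift; congr (bracket (_ * _)).
rewrite fps_binomE; last exact: Tser_vge.
by rewrite /Tpow /fps_exp ev_subst evM ev_lam /fps_log1p ev_subst ev_lift mulr_algl.
Qed.
End Eval.

(** Analytically both sides are the integral of [y^(N + lam) exp (- N (y^2 - 1)/2)], before and
    after rescaling [y]. Formally they solve the same equation for [flow] and agree at [lam = 0]. *)
Lemma GamLR : GamL = GamR.
Proof.
apply: flow_uniq; [exact: flow_GamL | exact: flow_GamR|] => j.
suff : ev 0 GamL = ev 0 GamR by move/fpsP/(_ j).
rewrite ev_GamR evM ev_subst [ev 0 shE]evM ev_X.
have lX0 : ev 0 (lam * fX) = 0 by rewrite evM ev_lam scale0r mul0r.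
have Z1 (c : nat -> R) : c 0%N = 1 -> fps_subst c (0 : S) = 1.
  move=> c0; apply/fpsP=> n; rewrite fps_substE /bsubst big_ord_recl expr0 c0 scale1r mul1r.
  rewrite big1 ?addr0 // => i _; rewrite /= /bump /= exprS mul0r fps0E mulr0 //.
have Z0 (c : nat -> R) : c 0%N = 0 -> fps_subst c (0 : S) = 0.
  move=> c0; apply/fpsP=> n; rewrite fps_substE /bsubst big_ord_recl expr0 c0 scale0r mul0r.
  rewrite add0r big1 // => i _; rewrite /= /bump /= exprS mul0r fps0E mulr0 //.
rewrite [ev 0 (fps_binom _ _)]ev_subst lX0 Z1; last by rewrite /gbinom big_ord0 fact0 divr1.
rewrite mulr1.
have -> : ev 0 (fps_exp shX) = 1.
  rewrite ev_subst [ev 0 shX]evZ.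
  have -> : ev 0 (fun n => shZ n.+1) = 0.
    have E : ev 0 shZ = 0.
      rewrite /shZ -scaleN1r evD evZ evM lX0 [ev 0 (fps_log1p _)]ev_subst lX0 Z0 //.
      by rewrite mulr0 scaler0 addr0.
    by apply/fpsP=> n; have /fpsP/(_ n.+1) := E.
  by rewrite scaler0 Z1 // fact0 invr1.
rewrite mulr1 subst_bsubst.
have -> : bsubst Gam (fX : S) = Gam.
  apply/fpsP=> n; rewrite /bsubst big_ord_recr /= fps_XnE eqxx mulr1.
  rewrite big1 ?add0r // => i _; rewrite fps_XnE.
  by rewrite gtn_eqF ?ltn_ord // mulr0.
by rewrite /Gam /nu oppr0.
Qed.

Definition Sh : S := fX * fps_binom (- 1) (2 *: fX).
Definition ShZ : S := (1 + 2 *: fX) * fps_log1p (2 *: fX) - 2 *: fX.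
Definition ShX : S := (1/2) *: ((fun n => ShZ n.+1) : S).

(** The case [lam = 2], where the factor [(1 + T)^2] is removed by one integration by parts. It is
    the formal counterpart of [zst_rec]. *)
Lemma Gam_shift : fps_subst Gam Sh * fps_exp ShX = (1 + fX) * Gam.
Proof.
have := congr1 (ev 2) GamLR; rewrite ev_GamR evM ev_subst [ev 2 shE]evM ev_X.
have lX : ev 2 (lam * fX) = 2 *: fX by rewrite evM ev_lam ev_X mulr_algl.
rewrite [ev 2 (fps_binom _ _)]ev_subst lX -/(fps_binom _ _) -/Sh.
have -> : ev 2 (fps_exp shX) = fps_exp ShX.
  rewrite [LHS]ev_subst [ev 2 shX]evZ; congr (fps_exp (_ *: _)).
  have E : ev 2 shZ = ShZ.
    rewrite /shZ -scaleN1r evD evZ evM evD ev1 lX [ev 2 (fps_log1p _)]ev_subst lX.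
    by rewrite scaleN1r.
  by apply/fpsP=> n; have /fpsP/(_ n.+1) := E.
move=> ->; have T1 := Tser_vge R.
rewrite (fps_binom_nat 2) //.
have := bracket_ibp (1 + Tser R : S); rewrite -bracketZ.
have D := @fps_deriv_fder R R^o; rewrite (fderD D) (fder1 D) add0r.
have -> : 2 *: (fX * (1 + Tser R : S)) = fps_deriv (Tser R : S) * ((1 + Tser R) ^+ 2 - 1).
  have := TA_deriv R^o; have -> // : liftA R^o (Tser R) = Tser R.
  by apply/fpsP=> n; rewrite /liftA alg_regular.
rewrite mulrBr mulr1 bracketB mulrC => /eqP; rewrite subr_eq => /eqP->.
by rewrite /Gam /nu oppr0 fps_binom_zero // mul1r mulrDl mul1r addrC.
Qed.
End StirlingShift.

(** * Asymptotic expansions and Stirling's formula *)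

Section Asymptotics.
Variable R : realType.
Notation S := (fps R^o).
Implicit Types (f g : nat -> R) (F G : S).

Definition eps (N : nat) : R := N%:R^-1.

(** The strict inequality forces [0 < N], so that [eps N] is a true inverse. *)
Definition bigO (r : nat) f := exists C : R, exists N0 : nat,
  forall N, (N0 < N)%N -> `|f N| <= C * eps N ^+ r.

Lemma epsE N : eps N = N%:R^-1. Proof. by []. Qed.
Lemma eps_ge0 N : 0 <= eps N. Proof. by rewrite invr_ge0. Qed.
Lemma eps_gt0 N : (0 < N)%N -> 0 < eps N. Proof. by move=> N0; rewrite invr_gt0 ltr0n. Qed.
Lemma eps_le1 N : eps N <= 1.
Proof.
case: N => [|N]; first by rewrite /eps invr0.
by rewrite invf_le1 ?ltr0n // ler1n.
Qed.
Lemma eps_le N M : (0 < N)%N -> (N <= M)%N -> eps M <= eps N.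
Proof. by move=> N0 NM; rewrite lef_pV2 ?ler_nat // posrE ltr0n // (leq_trans N0). Qed.

Lemma bigO_ge0 r f : bigO r f -> exists2 C : R, 0 <= C & exists N0 : nat,
  forall N, (N0 < N)%N -> `|f N| <= C * eps N ^+ r.
Proof.
move=> [C [N0 H]]; exists `|C| => //; exists N0 => N /H /le_trans; apply.
by rewrite ler_wpM2r ?exprn_ge0 ?eps_ge0 // ler_norm.
Qed.

Lemma bigO_le r f g : bigO r g -> (exists N0, forall N, (N0 < N)%N -> `|f N| <= `|g N|) ->
  bigO r f.
Proof.
move=> [C [N0 H]] [N1 H1]; exists C, (maxn N0 N1) => N; rewrite gtn_max => /andP[a b].
exact: le_trans (H1 _ b) (H _ a).
Qed.
Lemma bigO_ext r f g : bigO r g -> f =1 g -> bigO r f.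
Proof. by move=> Hg fg; apply: bigO_le Hg _; exists 0%N => N _; rewrite fg. Qed.
Lemma bigOD r f g : bigO r f -> bigO r g -> bigO r (fun N => f N + g N).
Proof.
move=> [C [N0 H]] [C' [N1 H1]]; exists (C + C'), (maxn N0 N1) => N.
rewrite gtn_max => /andP[a b]; rewrite mulrDl.
by apply: le_trans (ler_normD _ _) _; apply: lerD; auto.
Qed.
Lemma bigOM r s f g : bigO r f -> bigO s g -> bigO (r + s) (fun N => f N * g N).
Proof.
move=> /bigO_ge0[C C0 [N0 H]] /bigO_ge0[C' C'0 [N1 H1]].
exists (C * C'), (maxn N0 N1) => N; rewrite gtn_max => /andP[a b].
by rewrite normrM exprD mulrACA ler_pM //; auto.
Qed.
Lemma bigOW r s f : (r <= s)%N -> bigO s f -> bigO r f.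
Proof.
move=> rs /bigO_ge0[C C0 [N0 H]]; exists C, N0 => N a; apply: le_trans (H _ a) _.
rewrite ler_wpM2l // -(subnK rs) exprD ler_piMl ?exprn_ge0 ?eps_ge0 //.
by rewrite exprn_ile1 ?eps_ge0 ?eps_le1.
Qed.
Lemma bigO_const a : bigO 0 (fun=> a).
Proof. by exists `|a|, 0%N => N _; rewrite expr0 mulr1. Qed.
Lemma bigO0 r : bigO r (fun=> 0).
Proof. by exists 0, 0%N => N _; rewrite normr0 mul0r. Qed.
Lemma bigOZ r a f : bigO r f -> bigO r (fun N => a * f N).
Proof. by move=> Hf; have := bigOM (bigO_const a) Hf. Qed.
Lemma bigON r f : bigO r f -> bigO r (fun N => - f N).
Proof. by move=> /(bigOZ (-1)) /bigO_ext; apply => N; rewrite mulN1r. Qed.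
Lemma bigOB r f g : bigO r f -> bigO r g -> bigO r (fun N => f N - g N).
Proof. by move=> Hf /bigON; apply: bigOD. Qed.
Lemma bigO_eps k : bigO k (fun N => eps N ^+ k).
Proof. by exists 1, 0%N => N _; rewrite mul1r ger0_norm // exprn_ge0 ?eps_ge0. Qed.
Lemma bigO_sum r n (h : nat -> nat -> R) : (forall i, (i < n)%N -> bigO r (h i)) ->
  bigO r (fun N => \sum_(i < n) h i N).
Proof.
elim: n => [|n IHn] H.
  by apply: bigO_ext (bigO0 r) _ => N; rewrite big_ord0.
have /bigOD/(_ (H n (ltnSn n))) : bigO r (fun N => \sum_(i < n) h i N).
  by apply: IHn => i ni; apply: H; rewrite ltnS ltnW.
by move/bigO_ext; apply => N; rewrite big_ord_recr.
Qed.
Lemma bigO_poly r (Q : {poly R}) : (forall j, (j < r)%N -> Q`_j = 0) ->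
  bigO r (fun N => Q.[eps N]).
Proof.
move=> Q0; have : bigO r (fun N => \sum_(i < size Q) Q`_i * eps N ^+ i).
  apply: (@bigO_sum _ _ (fun i N => Q`_i * eps N ^+ i)) => i _; have [ir|ri] := ltnP i r.
    by apply: bigO_ext (bigO0 r) _ => N; rewrite Q0 // mul0r.
  by apply: bigOZ; apply: bigOW (bigO_eps i).
by move/bigO_ext; apply => N; rewrite horner_coef.
Qed.

Definition pol r F : {poly R} := \poly_(j < r) F j.
Definition asy r f F := bigO r (fun N => f N - (pol r F).[eps N]).

Lemma pol_sum r F x : (pol r F).[x] = \sum_(j < r) F j * x ^+ j.
Proof. by rewrite horner_poly. Qed.

Lemma asyP r f F (Q : {poly R}) : (forall j, (j < r)%N -> Q`_j = F j) ->
  bigO r (fun N => f N - Q.[eps N]) -> asy r f F.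
Proof.
move=> QF H; have /(bigOD H) : bigO r (fun N => (Q - pol r F).[eps N]).
  by apply: bigO_poly => j jr; rewrite coefB coef_poly jr QF // subrr.
by move/bigO_ext; apply => N; rewrite hornerD hornerN; ring.
Qed.
Lemma asy_eq r f F G : (forall j, (j < r)%N -> F j = G j) -> asy r f F -> asy r f G.
Proof.
move=> FG; apply: asyP => j jr; rewrite coef_poly jr; exact: FG.
Qed.
Lemma asyW r s f F : (r <= s)%N -> asy s f F -> asy r f F.
Proof.
move=> rs H; apply: (@asyP _ _ _ (pol s F)); last exact: bigOW H.
by move=> j jr; rewrite coef_poly (leq_trans jr).
Qed.
Lemma asy_ext r f g F : asy r g F -> f =1 g -> asy r f F.
Proof. by move=> Hg fg; apply: bigO_ext Hg _ => N; rewrite fg. Qed.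
Lemma asy_near r f g F : asy r g F -> (exists N0, forall N, (N0 < N)%N -> f N = g N) ->
  asy r f F.
Proof. by move=> Hg [N0 fg]; apply: bigO_le Hg _; exists N0 => N /fg ->. Qed.
Lemma asyD r f g F G : asy r f F -> asy r g G -> asy r (fun N => f N + g N) (F + G).
Proof.
move=> Hf Hg; apply: (@asyP _ _ _ (pol r F + pol r G)).
  by move=> j jr; rewrite coefD !coef_poly jr.
by apply: bigO_ext (bigOD Hf Hg) _ => N; rewrite hornerD; ring.
Qed.
Lemma asy_bnd r f F : asy r f F -> bigO 0 f.
Proof.
move=> /(bigOW (leq0n r)) H; have P : bigO 0 (fun N => (pol r F).[eps N]) by apply: bigO_poly.
by apply: bigO_ext (bigOD H P) _ => N; ring.
Qed.
Lemma asyM r f g F G : asy r f F -> asy r g G -> asy r (fun N => f N * g N) (F * G).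
Proof.
move=> Hf Hg; apply: (@asyP _ _ _ (pol r F * pol r G)).
  move=> j jr; rewrite coefM fpsME; apply: eq_bigr => i _; rewrite !coef_poly.
  by rewrite !ifT //; have := ltn_ord i; lia.
have P : bigO 0 (fun N => (pol r F).[eps N]) by apply: bigO_poly.
have H1 := bigOM Hf (asy_bnd Hg); have H2 := bigOM P Hg; rewrite addn0 in H1.
by apply: bigO_ext (bigOD H1 H2) _ => N; rewrite hornerM; ring.
Qed.
Lemma asy_const r a : asy r (fun=> a) (a%:A : S).
Proof.
apply: (@asyP _ _ _ a%:P).
  by move=> j jr; rewrite coefC fps_alg /fps_const alg_regular.
by apply: bigO_ext (bigO0 r) _ => N; rewrite hornerC subrr.
Qed.
Lemma asy_eps r : asy r eps fX.
Proof.
apply: (@asyP _ _ _ 'X); first by move=> j jr; rewrite coefX fps_XE.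
by apply: bigO_ext (bigO0 r) _ => N; rewrite hornerX subrr.
Qed.
Lemma asyZ r a f F : asy r f F -> asy r (fun N => a * f N) (a *: F).
Proof. by move=> Hf; rewrite -mulr_algl; apply: asyM Hf; apply: asy_const. Qed.
Lemma asyN r f F : asy r f F -> asy r (fun N => - f N) (- F).
Proof.
by move=> Hf; rewrite -scaleN1r; apply: asy_ext (asyZ (-1) Hf) _ => N; rewrite mulN1r.
Qed.
Lemma asyB r f g F G : asy r f F -> asy r g G -> asy r (fun N => f N - g N) (F - G).
Proof. by move=> Hf /asyN; apply: asyD. Qed.
Lemma asyX r f F n : asy r f F -> asy r (fun N => f N ^+ n) (F ^+ n).
Proof.
move=> Hf; elim: n => [|n IHn].
  by rewrite expr0 -(scale1r (1 : S)); apply: asy_ext (asy_const r 1) _ => N.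
by rewrite exprS; apply: asy_ext (asyM Hf IHn) _ => N; rewrite exprS.
Qed.
Lemma asy_sum r n (h : nat -> nat -> R) (H : nat -> S) :
  (forall i, (i < n)%N -> asy r (h i) (H i)) ->
  asy r (fun N => \sum_(i < n) h i N) (\sum_(i < n) H i).
Proof.
elim: n => [|n IHn] HH.
  rewrite big_ord0 -(scale0r 1); apply: asy_ext (asy_const r 0) _ => N.
  by rewrite big_ord0.
rewrite big_ord_recr; apply: asy_ext (asyD (IHn _) (HH n (ltnSn n))) _.
  by move=> i ni; apply: HH; rewrite ltnS ltnW.
by move=> N; rewrite big_ord_recr.
Qed.
Lemma asy_bigO k r f F : (k <= r)%N -> vge k F -> asy r f F -> bigO k f.
Proof.
move=> kr Fk /(bigOW kr) H.
have P : bigO k (fun N => (pol r F).[eps N]).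
  by apply: bigO_poly => j jk; rewrite coef_poly (leq_trans jk kr) Fk.
by apply: bigO_ext (bigOD H P) _ => N; ring.
Qed.
Lemma asy_shift r f F : asy r.+1 (fun N => eps N * f N) (fX * F) -> asy r f F.
Proof.
move=> [C [N0 H]]; exists C, N0 => N lN; have := H N lN.
have e0 : 0 < eps N by apply: eps_gt0; apply: leq_ltn_trans lN.
have -> : (pol r.+1 (fX * F)).[eps N] = eps N * (pol r F).[eps N].
  rewrite !pol_sum big_ord_recl fps_XM mul0r add0r mulr_sumr.
  by apply: eq_bigr => i _; rewrite fps_XM /= exprS mulrCA.
by rewrite -mulrBr normrM gtr0_norm // exprS mulrCA ler_pM2l.
Qed.
Lemma asy_psubst r (c : nat -> R) f F n : vge 1 F -> (r <= n)%N -> asy r f F ->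
  asy r (fun N => \sum_(m < n) c m * f N ^+ m) (fps_subst c F).
Proof.
move=> F1 rn Hf; apply: (@asy_eq _ _ (\sum_(m < n) c m *: F ^+ m)).
  move=> j jr; have jn := leq_trans jr rn.
  rewrite fps_substE (bsubst_wide _ F1 jn) fps_sumE; apply: eq_bigr => m _.
  by rewrite fpsZE -scalerAl mul1r.
apply: (@asy_sum _ _ (fun m N => c m * f N ^+ m) (fun m => c m *: F ^+ m)) => m _.
by apply: (asyZ _ (asyX _ _)).
Qed.

Lemma expR_partial (x : R) n : 0 <= x -> \sum_(m < n) x ^+ m / m`!%:R <= expR x.
Proof.
move=> x0; have := @nondecreasing_cvgn_le R (series (exp_coeff x)) _ (is_cvg_series_exp_coeff x) n.
rewrite /series /= big_mkord; apply.
apply/nondecreasing_seqP => m; rewrite !big_mkord big_ord_recr /= lerDl.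
exact: exp_coeff_ge0.
Qed.

Lemma expR_taylor (x : R) r :
  `|expR x - \sum_(m < r) x ^+ m / m`!%:R| <= `|x| ^+ r * expR `|x|.
Proof.
set P := \sum_(m < r) _; set B := `|x| ^+ r * _.
have key n : (r <= n)%N -> `|series (exp_coeff x) n - P| <= B.
  move=> rn; rewrite /series /= big_mkord -(subnKC rn) big_split_ord /= addrAC subrr add0r.
  apply: le_trans (ler_norm_sum _ _ _) _.
  apply: le_trans (_ : `|x| ^+ r * \sum_(i < n - r) `|x| ^+ i / i`!%:R <= _).
    rewrite mulr_sumr; apply: ler_sum => i _; rewrite normrM normrX exprD -mulrA.
    rewrite ler_wpM2l ?exprn_ge0 // ler_wpM2l ?exprn_ge0 //.
    rewrite ger0_norm ?invr_ge0 // lef_pV2 ?posrE ?ltr0n ?fact_gt0 // ler_nat.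
    by rewrite leq_fact ?leq_addl.
  by rewrite ler_wpM2l ?exprn_ge0 // expR_partial.
rewrite ler_distl; apply/andP; split.
  apply: limr_ge; first exact: is_cvg_series_exp_coeff.
  near=> n; have rn : (r <= n)%N by near: n; exact: nbhs_infty_ge.
  by have := key n rn; rewrite ler_distl => /andP[].
apply: limr_le; first exact: is_cvg_series_exp_coeff.
near=> n; have rn : (r <= n)%N by near: n; exact: nbhs_infty_ge.
by have := key n rn; rewrite ler_distl => /andP[].
Unshelve. all: by end_near.
Qed.

Lemma bigO1_bnd f : bigO 1 f -> exists2 C : R, 0 <= C & exists N0 : nat,
  forall N, (N0 < N)%N -> `|f N| <= C.
Proof.
move=> /(bigOW (leq0n 1)) /bigO_ge0[C C0 [N0 H]]; exists C => //; exists N0 => N.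
by move/H; rewrite expr0 mulr1.
Qed.

Lemma asy_exp r f F : vge 1 F -> bigO 1 f -> asy r f F ->
  asy r (fun N => expR (f N)) (fps_exp F).
Proof.
move=> F1 f1 Hf; have Hs := asy_psubst (fun m => (m`!%:R)^-1) F1 (leqnn r) Hf.
have HO : bigO r (fun N => expR (f N) - \sum_(m < r) (m`!%:R)^-1 * f N ^+ m).
  have [C C0 [N0 H]] := bigO1_bnd f1.
  have fr : bigO r (fun N => f N ^+ r).
    elim: (r) => [|n IHn]; first by apply: bigO_ext (bigO_const 1) _.
    by rewrite -add1n; apply: bigO_ext (bigOM f1 IHn) _ => N; rewrite exprS.
  have := bigOM fr (bigO_const (expR C)); rewrite addn0 => HB.
  apply: bigO_le HB _; exists N0 => N lN.
  rewrite [X in _ <= X]normrM normrX (ger0_norm (ltW (expR_gt0 _))).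
  have := expR_taylor (f N) r.
  under eq_bigr => i _ do rewrite mulrC.
  move=> /le_trans; apply; rewrite ler_wpM2l ?exprn_ge0 // ler_expR; exact: H.
by apply: bigO_ext (bigOD Hs HO) _ => N /=; ring.
Qed.

Lemma expR_lip (a b C : R) : - C <= a -> - C <= b ->
  `|a - b| <= expR C * `|expR a - expR b|.
Proof.
wlog ba : a b / b <= a => [W|] aC bC.
  have [ba|ab] := leP b a; first exact: W.
  by rewrite distrC [X in _ * X]distrC; apply: W => //; apply: ltW.
rewrite !ger0_norm ?subr_ge0 ?ler_expR //.
have -> : expR a = expR b * expR (a - b) by rewrite -expRD addrCA subrr addr0.
have h := expR_ge1Dx (a - b).
rewrite -[X in expR b * _ - X]mulr1 -mulrBr mulrA -expRD.
have h1 : 1 <= expR (C + b) by rewrite -expR0 ler_expR addrC -lerBlDr sub0r.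
have h2 : 0 <= a - b by rewrite subr_ge0.
apply: le_trans (_ : 1 * (expR (a - b) - 1) <= _); first by rewrite mul1r lerBrDl.
by rewrite ler_wpM2r // subr_ge0 (le_trans _ h) // lerDl.
Qed.

(** On a bounded set the slope of [exp] is bounded below ([expR_lip]), so an error on [exp f] is an
    error of the same order on [f]. This gives access to real logarithms through the formal identity
    [fps_log1pK]. *)
Lemma asy_expK r f F : vge 1 F -> bigO 1 f -> asy r (fun N => expR (f N)) (fps_exp F) ->
  asy r f F.
Proof.
move=> F1 f1 Hf; set p := fun N => (pol r F).[eps N].
have p1 : bigO 1 p.
  by apply: bigO_poly => -[|//] _; rewrite coef_poly F1 ?if_same.
have Hp : asy r p F by apply: bigO_ext (bigO0 r) _ => N; rewrite subrr.
have HB := bigOB Hf (asy_exp F1 p1 Hp).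
have [C C0 [N0 H]] := bigO1_bnd f1; have [C' C'0 [N1 H1]] := bigO1_bnd p1.
apply: bigO_le (bigOZ (expR (C + C')) HB) _; exists (maxn N0 N1) => N.
rewrite gtn_max => /andP[/H a /H1 b].
rewrite [X in _ <= X]normrM (ger0_norm (ltW (expR_gt0 _))).
rewrite [X in _ * `|X|](_ : _ = expR (f N) - expR (p N)); last by ring.
have := ler_norm (- f N); have := ler_norm (- p N); rewrite !normrN => h1 h2.
by apply: (@expR_lip (f N) (p N)); lra.
Qed.

Lemma asy_div r f g F G : (exists N0, forall N, (N0 < N)%N -> 1/2 <= g N) ->
  asy r g G -> asy r (fun N => f N * g N) (F * G) -> asy r f F.
Proof.
move=> [N0 Hg] gG fg; set p := fun N => (pol r F).[eps N].
have Hp : asy r p F by apply: bigO_ext (bigO0 r) _ => N; rewrite subrr.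
have HB := bigOZ 2 (bigOB fg (asyM Hp gG)).
apply: bigO_le HB _; exists N0 => N /Hg g2.
rewrite [X in _ <= `|2 * X|](_ : _ = (f N - p N) * g N); last by ring.
rewrite normrM (normrM (_ - _)) (ger0_norm (ler0n _ 2)) mulrCA ler_peMr //.
by rewrite (le_trans _ (ler_wpM2l _ (ler_norm _))) //; lra.
Qed.
End Asymptotics.

(** * Stirling's formula for odd double factorials *)

Section Stirling.
Variable R : realType.
Notation S := (fps R^o).
Notation eps := (eps R).

Definition lnq (a : R) (N : nat) : R := ln (1 + a * eps N).

Lemma lnq_bigO a : 0 <= a -> bigO 1 (lnq a).
Proof.
move=> a0; exists a, 0%N => N N0; rewrite expr1.
have h : 0 <= a * eps N by rewrite mulr_ge0 ?eps_ge0.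
rewrite ger0_norm; last by rewrite ln_ge0 // lerDl.
by apply: le_ln1Dx; apply: lt_le_trans h; rewrite ltrN10.
Qed.

Lemma asy_lnq r a : 0 <= a -> asy r (lnq a) (fps_log1p (a *: fX : S)).
Proof.
move=> a0; have X1 : vge 1 (a *: fX : S) by apply: vgeZ; apply: vge1P.
apply: asy_expK; [exact: vge_log | exact: lnq_bigO |].
rewrite fps_log1pK //.
have H := asyD (asy_const r 1) (asyZ a (@asy_eps R r)); rewrite scale1r in H.
apply: asy_ext H _ => N; rewrite /lnq lnK // posrE ltr_wpDr // mulr_ge0 ?eps_ge0 //.
Qed.

(* [expR (shx N)] is (1 + 2/N) ^ (N/2 + 1) / e, which is, up to the factor [N], the ratio
   of the values of (N/e) ^ (N/2) at [N + 2] and [N]. *)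
Definition shx (N : nat) : R := (N%:R / 2 + 1) * lnq 2 N - 1.

Lemma asy_shx r : asy r shx (ShX R).
Proof.
apply: asy_shift; apply: (@asy_eq _ _ _ ((1/2) *: ShZ R)).
  move=> j _; rewrite /ShX -scalerAr !fpsZE fps_XM; case: j => //.
  by rewrite /ShZ fpsBE fpsM0 fps_log0 mulr0 fpsZE fps_XE scaler0 subr0.
have H1 := asyM (asyD (asy_const r.+1 1) (asyZ 2 (@asy_eps R r.+1))) (asy_lnq r.+1 (ler0n _ 2)).
have := asyZ (1/2) (asyB H1 (asyZ 2 (@asy_eps R r.+1))).
rewrite scale1r => /asy_near; apply; exists 0%N => N N0.
have e1 : eps N * N%:R = 1 by rewrite mulVf // pnatr_eq0 -lt0n.
rewrite /shx; have -> : eps N * ((N%:R / 2 + 1) * lnq 2 N - 1) =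
  ((eps N * N%:R) / 2 + eps N) * lnq 2 N - eps N by ring.
by rewrite e1; field.
Qed.

Definition shw N : R := expR (shx N).

Lemma ShX_vge : vge 1 (ShX R).
Proof.
apply: vge1P; rewrite /ShX fpsZE.
have l1 : vge 1 (2 *: fX : S) by apply: vgeZ; apply: vge1P.
have -> : ShZ R 1%N = 0; last by rewrite scaler0.
rewrite /ShZ fpsBE mulrDl mul1r fpsDE.
have -> : ((2 *: fX) * fps_log1p (2 *: fX)) 1%N = 0 :> R^o.
  by apply: (vgeM l1 (vge_log _)).
rewrite addr0; have := congr1 (fun f : S => f 0%N) (fder_log (@fps_deriv_fder R R^o) l1).
by rewrite fpsM0 fpsDE fpsE1 l1 // addr0 mul1r /fps_deriv !scale1r => ->; rewrite subrr.
Qed.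

Lemma asy_shw r : asy r shw (fps_exp (ShX R)).
Proof.
apply: asy_exp; [exact: ShX_vge | | exact: asy_shx].
exact: asy_bigO (leqnn 1) ShX_vge (asy_shx 1).
Qed.

Lemma asy_eps2 r : asy r (fun N => eps N.+2) (Sh R).
Proof.
have l1 : vge 1 (2 *: fX : S) by apply: vgeZ; apply: vge1P.
have H1 := asyD (asy_const r 1) (asyZ 2 (@asy_eps R r)); rewrite scale1r in H1.
apply: (asy_div _ H1).
  exists 0%N => N _; have := eps_ge0 R N; lra.
have -> : Sh R * (1 + 2 *: fX) = fX.
  by rewrite /Sh -mulrA -[1 + _]expr1 -fps_binom_nat // fps_binomN // mulr1.
apply: asy_near (@asy_eps R r) _; exists 0%N => N N0.
rewrite !epsE -[N.+2]addn2 natrD; have N1 : N%:R != 0 :> R by rewrite pnatr_eq0 -lt0n.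
have N2 : N%:R + 2 != 0 :> R by rewrite -natrD pnatr_eq0 addn2.
by field; rewrite N1 N2.
Qed.

Lemma log1pX_coef n : fps_log1p (fX : S) n = if n == 0%N then 0 else (-1) ^+ n.+1 / n%:R.
Proof.
rewrite fps_logE /bsubst big_ord_recr /= fps_XnE eqxx mulr1 big1 ?add0r ?alg_regular //.
by move=> i _; rewrite fps_XnE (gtn_eqF (ltn_ord i)) mulr0.
Qed.

Definition hst (M : nat) : R := (2 * M%:R + 1) * lnq 1 M - 2.

(** The factor [2 M + 1] makes the terms in [1/M] cancel. Multiplying by [eps] to clear the factor
    [M] costs one order, so the expansion is carried to order 3. *)
Lemma hst_bigO : bigO 2 hst.
Proof.
have H1 := asyM (asyD (asy_const 3 2) (@asy_eps R 3)) (asy_lnq 3 ler01).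
have H2 := asyB H1 (asyZ 2 (@asy_eps R 3)); rewrite scale1r in H2.
set G : S := _ - _ in H2.
have G3 : vge 3 G.
  have E n : G n = 2 * fps_log1p (fX : S) n + (fX * fps_log1p (fX : S)) n - 2 * (n == 1%N)%:R.
    by rewrite /G fpsBE mulrDl fpsDE mulr_algl !fpsZE fps_XE.
  case=> [|[|[|//]]] _; rewrite E fps_XM !log1pX_coef /=.
  - by rewrite !mulr0 addr0 subrr.
  - by rewrite !exprS expr0 divr1; ring.
  - by rewrite !exprS expr0 divr1; lra.
have [C [N0 H]] := asy_bigO (leqnn 3) G3 H2.
exists C, N0 => N lN; have := H N lN.
have e0 : 0 < eps N by apply: eps_gt0; apply: leq_ltn_trans lN.
have e1 : eps N * N%:R = 1 by rewrite mulVf // pnatr_eq0 -lt0n (leq_ltn_trans _ lN).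
have -> : (2 + eps N) * lnq 1 N - 2 * eps N = eps N * hst N.
  rewrite /hst; have -> : eps N * ((2 * N%:R + 1) * lnq 1 N - 2) =
    (2 * (eps N * N%:R) + eps N) * lnq 1 N - 2 * eps N by ring.
  by rewrite e1 mulr1.
by rewrite normrM gtr0_norm // exprS mulrCA ler_pM2l.
Qed.

Definition lnfac (M : nat) : R := 2 * ln M`!%:R + 2 * M%:R - (2 * M%:R + 1) * ln M%:R.

Lemma lnfac_diff M : (0 < M)%N -> lnfac M.+1 - lnfac M = - hst M.
Proof.
move=> M0; rewrite /lnfac /hst factS natrM lnM ?posrE ?ltr0n ?fact_gt0 //.
have -> : ln M.+1%:R = ln M%:R + lnq 1 M :> R.
  rewrite /lnq -lnM ?posrE ?ltr0n //; last by rewrite ltr_wpDr // mul1r eps_ge0.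
  by rewrite mul1r mulrDr mulr1 divff ?natr1 // pnatr_eq0 -lt0n.
by rewrite -natr1; ring.
Qed.

(** The double factorial [(2 M - 1)!!]. *)
Definition oddf (M : nat) : R := (M.*2)`!%:R / (2 ^+ M * M`!%:R).

Lemma oddfS M : oddf M.+1 = (M.*2.+1)%:R * oddf M.
Proof.
rewrite /oddf doubleS !factS !natrM exprS.
have -> : M.*2.+2%:R = 2 * M.+1%:R :> R by rewrite -natrM; congr _%:R; lia.
have a0 : M.+1%:R != 0 :> R by rewrite pnatr_eq0.
have b0 : M`!%:R != 0 :> R by rewrite pnatr_eq0 -lt0n fact_gt0.
have c0 : (2 : R) ^+ M != 0 by rewrite expf_neq0 // pnatr_eq0.
rewrite [2 * _ * _]mulrC !invfM; set g := (M.*2)`!%:R; set e := M.*2.+1%:R.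
set x := M.+1%:R in a0 *; set y := M`!%:R in b0 *; set z := 2 ^+ M in c0 *.
by field; rewrite nat1r c0 a0 b0.
Qed.
Lemma oddf_gt0 M : 0 < oddf M.
Proof. by rewrite divr_gt0 ?mulr_gt0 ?exprn_gt0 ?ltr0n ?fact_gt0. Qed.

(** [(2 M - 1)!!] divided by its leading term [sqrt 2 (2 M / e)^M]. *)
Definition zst (M : nat) : R := oddf M * expR M%:R * eps M.*2 ^+ M / Num.sqrt 2.

Lemma sqrt2_gt0 : 0 < Num.sqrt 2 :> R. Proof. by rewrite sqrtr_gt0. Qed.

Lemma zst_gt0 M : (0 < M)%N -> 0 < zst M.
Proof.
move=> M0; have e0 : 0 < eps M.*2 by rewrite eps_gt0 // double_gt0.
apply: divr_gt0; last exact: sqrt2_gt0.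
by apply: mulr_gt0; [apply: mulr_gt0; [exact: oddf_gt0 | exact: expR_gt0] | exact: exprn_gt0].
Qed.

Lemma ln_zst M : (0 < M)%N -> 2 * ln (zst M) = lnfac M.*2 - lnfac M.
Proof.
move=> M0; have e0 : 0 < eps M.*2 by rewrite eps_gt0 // double_gt0.
have s2 := sqrt2_gt0; have M1 : 0 < M%:R :> R by rewrite ltr0n.
have f0 n : 0 < n`!%:R :> R by rewrite ltr0n fact_gt0.
have lnX n (x : R) : 0 < x -> ln (x ^+ n) = n%:R * ln x.
  by move=> x0; rewrite lnXn // mulr_natl.
have L2 : 2 * ln (Num.sqrt 2) = ln 2 :> R.
  by rewrite -[X in _ = ln X](@sqr_sqrtr R 2) // lnX.
have L2M : ln M.*2%:R = ln 2 + ln M%:R :> R.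
  by rewrite -muln2 natrM mulrC lnM ?posrE.
rewrite /zst ln_div ?posrE ?mulr_gt0 ?oddf_gt0 ?expR_gt0 ?exprn_gt0 //.
rewrite lnM ?posrE ?mulr_gt0 ?oddf_gt0 ?expR_gt0 ?exprn_gt0 //.
rewrite lnM ?posrE ?oddf_gt0 ?expR_gt0 // expRK lnX // epsE lnV ?posrE ?ltr0n ?double_gt0 //.
rewrite /oddf ln_div ?posrE ?mulr_gt0 ?exprn_gt0 // lnM ?posrE ?exprn_gt0 // lnX //.
rewrite /lnfac !mulrBr L2 L2M.
have -> : M.*2%:R = 2 * M%:R :> R by rewrite -mul2n natrM.
set a := ln (M.*2)`!%:R; set b := ln M`!%:R; first ring.
all: by rewrite invr_gt0 mulr_gt0 ?exprn_gt0.
Qed.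

(** By [ln_zst] the logarithm is half the increment of [lnfac] from [M] to [2 M], that is [M] steps
    of size [O(1/M^2)]. The constant of Stirling's formula cancels in the difference. *)
Lemma ln_zst_bigO : bigO 1 (fun M => ln (zst M)).
Proof.
have [C C0 [N0 H]] := bigO_ge0 hst_bigO.
exists C, N0 => M lM; have M0 : (0 < M)%N by apply: leq_ltn_trans lM.
have e0 := eps_gt0 R M0.
have T n : `|lnfac (M + n)%N - lnfac M| <= n%:R * (C * eps M ^+ 2).
  elim: n => [|n IHn]; first by rewrite addn0 subrr normr0 mul0r.
  have -> : lnfac (M + n.+1)%N - lnfac M =
     (lnfac (M + n)%N.+1 - lnfac (M + n)%N) + (lnfac (M + n)%N - lnfac M).
    by rewrite addnS; ring.
  apply: le_trans (ler_normD _ _) _; rewrite -nat1r mulrDl mul1r; apply: lerD => //.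
  have Mn : (M <= M + n)%N := leq_addr _ _.
  rewrite lnfac_diff ?(leq_trans M0) // normrN.
  apply: le_trans (H _ (leq_trans lM Mn)) _; rewrite ler_wpM2l //.
  by rewrite lerXn2r ?nnegrE ?eps_ge0 // eps_le.
have := T M; rewrite addnn -ln_zst // normrM (ger0_norm (ler0n _ 2)) => h.
have E : M%:R * (C * eps M ^+ 2) = C * eps M.
  have e1 : eps M * M%:R = 1 by rewrite mulVf // pnatr_eq0 -lt0n.
  by transitivity (C * eps M * (eps M * M%:R)); [ring | rewrite e1 mulr1].
rewrite E in h; rewrite expr1; have := normr_ge0 (ln (zst M)); lra.
Qed.

Lemma zst_bigO : bigO 1 (fun M => zst M - 1).
Proof.
have H : asy 1 (fun M => ln (zst M)) 0.
  apply: bigO_ext ln_zst_bigO _ => M.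
  by rewrite pol_sum big_ord1 mul0r subr0.
have := asy_exp (@vge0 R R^o 1) ln_zst_bigO H; rewrite fps_exp_zero => -[C [N0 HC]].
exists C, N0 => M lM; have := HC M lM; rewrite pol_sum big_ord1 fpsE1 mulr1 lnK //.
by rewrite posrE zst_gt0 // (leq_ltn_trans _ lM).
Qed.

Lemma zst_rec M : (0 < M)%N -> zst M.+1 * shw M.*2 = (1 + eps M.*2) * zst M.
Proof.
move=> M0; have M2 : (0 < M.*2)%N by rewrite double_gt0.
have N0 : M.*2%:R != 0 :> R by rewrite pnatr_eq0 -lt0n.
have N2 : M.+1.*2%:R != 0 :> R by rewrite pnatr_eq0.
have -> : shw M.*2 = (M.+1.*2%:R * eps M.*2) ^+ M.+1 * expR (- 1).
  rewrite /shw /shx expRD.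
  have -> : M.*2%:R / 2 + 1 = M.+1%:R :> R.
    by rewrite -muln2 natrM mulfK ?natr1 // pnatr_eq0.
  rewrite expRM_natl /lnq lnK ?posrE.
    congr (_ ^+ _ * _); have -> : M.+1.*2%:R = M.*2%:R + 2 :> R by rewrite -natrD addn2.
    have e2 : M.*2%:R * eps M.*2 = 1 by rewrite mulfV.
    by rewrite [RHS]mulrDl e2.
  by rewrite ltr_wpDr // mulr_ge0 ?eps_ge0.
have -> : (1 + eps M.*2) = M.*2.+1%:R * eps M.*2 by rewrite -nat1r mulrDl mul1r divff // addrC.
have e1 : eps M.+1.*2 * M.+1.*2%:R = 1 by rewrite epsE mulVf.
rewrite /zst oddfS exprMn -[M.+1%:R]natr1 expRD expRN.
have -> : (oddf M * expR M%:R * eps M.*2 ^+ M / Num.sqrt 2) = oddf M * expR M%:R * (eps M.*2 ^+ M / Num.sqrt 2) by rewrite !mulrA.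
have x0 : expR 1 != 0 :> R by rewrite gt_eqF ?expR_gt0.
have -> : M.*2.+1%:R * oddf M * (expR M%:R * expR 1) * eps M.+1.*2 ^+ M.+1 / Num.sqrt 2 *
    (M.+1.*2%:R ^+ M.+1 * eps M.*2 ^+ M.+1 / expR 1) =
    M.*2.+1%:R * oddf M * expR M%:R * (expR 1 / expR 1) * (eps M.+1.*2 ^+ M.+1 * M.+1.*2%:R ^+ M.+1)
      * (eps M.*2 ^+ M.+1 / Num.sqrt 2) by ring.
by rewrite -exprMn e1 expr1n divff // exprS; ring.
Qed.

Lemma Gam0 : Gam R 0%N = 1.
Proof.
rewrite /Gam /nu oppr0 fps_binom_zero ?mul1r; last exact: Tser_vge.
rewrite /bracket /mom double0 fact0 expr0 mulr1 divr1 scale1r /fps_deriv scale1r.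
rewrite Tser_fix fps_XM fps_substE bsubstE0 /psi fps_binom0 alg_regular //.
Qed.

Lemma le_limit (x y C : R) (L0 : nat) : (forall L, (L0 < L)%N -> x <= y + C * eps L) -> x <= y.
Proof.
move=> H; rewrite leNgt; apply/negP => yx.
pose d := x - y; have d0 : 0 < d by rewrite subr_gt0.
pose L1 := Num.bound (`|C| / d); pose L := (maxn L1 L0).+1.
have L0' : 0 < L%:R :> R by rewrite ltr0n.
have := H L; rewrite ltnS leq_maxr => /(_ isT) hx.
have : `|C| < d * L%:R.
  rewrite mulrC -ltr_pdivrMr //; apply: lt_le_trans (archi_boundP _) _.
    by rewrite divr_ge0 // ltW.
  by rewrite ler_nat /L (leq_trans (leq_maxl _ L0)).
apply/negP; rewrite -leNgt.
apply: le_trans (ler_norm C).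
have : d <= C * eps L by rewrite /d; lra.
by move=> /(ler_wpM2r (ltW L0')); rewrite -mulrA mulVf ?mulr1 // gt_eqF.
Qed.

(** The truncated series satisfies the recursion [zst_rec] up to [O(1/N^(r+1))], so the ratio [rho]
    of [zst] to it has increments of that size. Since [rho] tends to 1 by [zst_bigO], summing the
    increments gives [rho = 1 + O(1/M^r)]. *)
Lemma zst_asy r : bigO r (fun M => zst M - (pol r (Gam R)).[eps M.*2]).
Proof.
have eps2 M : eps M.*2 = eps M / 2 by rewrite !epsE -muln2 natrM invfM.
have eps2le M : 0 <= eps M.*2 <= eps M.
  by rewrite eps2; have := eps_ge0 R M; lra.
have even_bigO k (f : nat -> R) : bigO k f -> bigO k (fun M => f M.*2).
  move=> /bigO_ge0[C C0 [N0 H]]; exists C, N0 => M lM.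
  apply: le_trans (H _ _) _; first by apply: leq_trans lM _; rewrite -addnn leq_addr.
  by have /andP[h0 h1] := eps2le M; rewrite ler_wpM2l // lerXn2r ?nnegrE // (le_trans h0).
wlog r0 : r / (0 < r)%N => [W|].
  case: r => [|r]; last exact: W.
  have := bigOW (leq0n 1) (W 1%N isT).
  have P : bigO 0 (fun M => (pol 1 (Gam R) - pol 0 (Gam R)).[eps M.*2]).
    by apply: (even_bigO 0%N (fun N => (pol 1 (Gam R) - pol 0 (Gam R)).[eps N])); apply: bigO_poly.
  move/bigOD/(_ P)/bigO_ext; apply => M; rewrite hornerD hornerN; ring.
(* One term more than claimed is kept so that the recursion holds to order [r+1]; it is discarded at
   the end. *)
pose g N : R := (pol r.+1 (Gam R)).[eps N].
have g_asy k : (k <= r.+1)%N -> asy k g (Gam R).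
  by move=> kr; apply: asyW kr _; apply: bigO_ext (bigO0 R _) _ => N; rewrite subrr.
have rec : bigO r.+1 (fun N => g N.+2 * shw N - (1 + eps N) * g N).
  have H1 : asy r.+1 (fun N => g N.+2) (fps_subst (Gam R) (Sh R)).
    apply: asy_ext (asy_psubst (Gam R) _ (leqnn _) (asy_eps2 r.+1)) _.
      by apply: vgeMr; apply: vge1P.
    by move=> N; rewrite /g pol_sum.
  have H2 := asyM H1 (asy_shw r.+1); rewrite Gam_shift in H2.
  have H3 := asyD (asy_const r.+1 1) (@asy_eps R r.+1); rewrite scale1r in H3.
  have := bigOB H2 (asyM H3 (g_asy _ (leqnn _))).
  by move/bigO_ext; apply => N; ring.
have g1 : bigO 1 (fun N => g N - 1).
  apply: bigO_ext (g_asy 1%N _) _ => // N.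
  by rewrite pol_sum big_ord1 Gam0 mul1r.
have w1 : bigO 1 (fun N => shw N - 1).
  apply: bigO_ext (asy_shw 1) _ => N; rewrite pol_sum big_ord1 fps_exp0 mul1r //.
have near1 (f : nat -> R) : bigO 1 (fun N => f N - 1) -> exists N0, forall N, (N0 < N)%N -> 1/2 <= f N <= 2.
  move=> /bigO_ge0[C C0 [N0 H]]; exists (maxn N0 (Num.bound (2 * C))) => N.
  rewrite gtn_max => /andP[a b]; have := H N a.
  have N1 : 0 < N%:R :> R by rewrite ltr0n (leq_ltn_trans _ a).
  have : C * eps N ^+ 1 <= 1/2.
    rewrite expr1 -ler_pdivlMr ?invr_gt0 // invrK.
    have : 2 * C < N%:R.
      apply: lt_le_trans (archi_boundP _) _; first by rewrite mulr_ge0.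
      by rewrite ler_nat ltnW.
    by lra.
  by rewrite ler_norml => h /andP[]; lra.
have [Ng Hg] := near1 _ g1; have [Nw Hw] := near1 _ w1; have [Nz Hz] := near1 _ zst_bigO.
have [C C0 [Nr Hr]] := bigO_ge0 rec.
pose rho M := zst M / g M.*2.
pose M0 := maxn (maxn Ng Nw) (maxn Nz Nr).
have dbl M K : (K < M)%N -> (K < M.*2)%N.
  by move=> h; rewrite -addnn (leq_trans h) // leq_addr.
(* A factor 2 bounds [zst M], and a factor 8 bounds the inverse of [w G G'], whose three factors are
   at least 1/2. *)
pose K := 16 * C.
have step M : (M0 < M)%N -> `|rho M.+1 - rho M| <= K * eps M ^+ r.+1.
  rewrite !gtn_max => /andP[/andP[a b] /andP[c d]].
  have := Hg _ (dbl _ _ a); have := Hg _ (dbl M.+1 _ (ltnW a)).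
  have := Hw _ (dbl _ _ b); have := Hz _ c; have := Hr _ (dbl _ _ d).
  have := zst_rec (leq_ltn_trans (leq0n _) a).
  rewrite -doubleS /rho; set z := zst M; set z' := zst M.+1.
  set G := g M.*2; set G' := g M.+1.*2; set w := shw M.*2; set e := eps M.*2.
  move=> E hd /andP[z1 z2] /andP[w1' w2] /andP[G1' G2'] /andP[G1 G2].
  have G'0 : G' != 0 by rewrite gt_eqF //; lra.
  have G0 : G != 0 by rewrite gt_eqF //; lra.
  have w0 : w != 0 by rewrite gt_eqF //; lra.
  have -> : z' / G' - z / G = - (z * (G' * w - (1 + e) * G)) / (w * G * G').
    have -> : - (z * (G' * w - (1 + e) * G)) = (z' * w) * G - z * G' * w by rewrite E; ring.
    by field; rewrite G0 G'0 w0.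
  rewrite normrM normrN normrM normfV.
  have wGG : 1/8 <= w * G * G'.
    have h1 : 1/4 <= w * G by have := ler_pM _ _ w1' G1; lra.
    by have := ler_pM _ _ h1 G1'; lra.
  rewrite (@ger0_norm _ (w * G * G')); last lra.
  rewrite (@ger0_norm _ z); last lra.
  rewrite ler_pdivrMr; last lra.
  have ee : e ^+ r.+1 <= eps M ^+ r.+1.
    by have /andP[h0 h1] := eps2le M; rewrite lerXn2r ?nnegrE // (le_trans h0).
  have ee0 : 0 <= eps M ^+ r.+1 by rewrite exprn_ge0 ?eps_ge0.
  have hd' : `|G' * w - (1 + e) * G| <= C * eps M ^+ r.+1.
    by apply: le_trans hd _; rewrite ler_wpM2l.
  have h2 : z * `|G' * w - (1 + e) * G| <= 2 * (C * eps M ^+ r.+1).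
    by apply: ler_pM => //; lra.
  apply: le_trans h2 _; rewrite /K.
  have h3 : 0 <= C * eps M ^+ r.+1 by rewrite mulr_ge0.
  have := ler_wpM2l (_ : 0 <= 16 * (C * eps M ^+ r.+1)) wGG; rewrite mulr_ge0 // => /(_ isT).
  by rewrite -!mulrA; lra.
have K0 : 0 <= K by rewrite mulr_ge0.
(* Two powers of [1/L] are summed through [1/L - 1/(L+1) = 1/(L (L+1))], at the price of a factor 2;
   the remaining [r - 1] powers are estimated at [M], which is why [0 < r] was arranged. *)
have tele M n : (M0 < M)%N ->
    `|rho (M + n)%N - rho M| <= 2 * K * eps M ^+ r.-1 * (eps M - eps (M + n)%N).
  move=> lM; have Mp : (0 < M)%N by apply: leq_ltn_trans lM.
  elim: n => [|n IHn]; first by rewrite addn0 !subrr normr0 mulr0.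
  have -> : rho (M + n.+1)%N - rho M = (rho (M + n)%N.+1 - rho (M + n)%N) + (rho (M + n)%N - rho M).
    by rewrite addnS; ring.
  apply: le_trans (ler_normD _ _) _.
  have -> : eps M - eps (M + n.+1)%N = (eps (M + n)%N - eps (M + n)%N.+1) + (eps M - eps (M + n)%N).
    by rewrite addnS; ring.
  rewrite [X in _ <= X]mulrDr; apply: lerD => //.
  have Mn : (M <= M + n)%N := leq_addr _ _.
  apply: le_trans (step _ (leq_trans lM Mn)) _.
  move: (M + n)%N Mn {IHn} => L ML; have Lp := leq_trans Mp ML.
  have Lr : 1 <= L%:R :> R by rewrite ler1n.
  rewrite -(prednK r0) /= !exprS mulrA [2 * K]mulrC -!mulrA ler_wpM2l //.
  have -> : eps L - eps L.+1 = eps L * eps L.+1.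
    by rewrite !epsE -natr1; field; rewrite !gt_eqF //; lra.
  have h : eps L <= 2 * eps L.+1.
    rewrite !epsE -natr1 -[_^-1]mul1r ler_pdivrMr; last lra.
    by rewrite mulrAC ler_pdivlMr; lra.
  have e0 := eps_ge0 R L; have p0 : 0 <= eps L ^+ r.-1 by rewrite exprn_ge0.
  have hp : eps L ^+ r.-1 <= eps M ^+ r.-1.
    by rewrite lerXn2r ?nnegrE ?eps_ge0 // eps_le.
  have -> : 2 * (eps M ^+ r.-1 * (eps L * eps L.+1)) = eps L * ((2 * eps L.+1) * eps M ^+ r.-1) by ring.
  by rewrite ler_wpM2l // ler_wpM2l // ler_pM.
have [C1 C10 [N1 H1]] : exists2 C : R, 0 <= C & exists N0 : nat,
    forall L, (N0 < L)%N -> `|rho L - 1| <= C * eps L.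
  have [Cz Cz0 [Nz' Hz']] := bigO_ge0 zst_bigO; have [Cg Cg0 [Ng' Hg']] := bigO_ge0 g1.
  exists (2 * (Cz + Cg)); first by rewrite mulr_ge0 // addr_ge0.
  exists (maxn (maxn Nz' Ng') Ng) => L; rewrite !gtn_max => /andP[/andP[a b] c].
  have /andP[G1 G2] := Hg _ (dbl _ _ c); have := Hg' _ (dbl _ _ b); have := Hz' _ a.
  have := eps2le L; rewrite !expr1 /rho; set G := g L.*2 in G1 G2 *; set z := zst L => /andP[_ le2] hz hg.
  have G0 : G != 0 by rewrite gt_eqF //; lra.
  have -> : z / G - 1 = (z - G) / G by rewrite mulrBl divff.
  rewrite normrM normfV (@ger0_norm _ G); last lra.
  rewrite ler_pdivrMr; last lra.
  have : `|z - G| <= (Cz + Cg) * eps L.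
    have -> : z - G = (z - 1) - (G - 1) by ring.
    apply: le_trans (ler_normB _ _) _; rewrite mulrDl; apply: lerD => //.
    by apply: le_trans hg _; rewrite ler_wpM2l.
  move=> h; apply: le_trans h _.
  have p : 0 <= (Cz + Cg) * eps L by rewrite mulr_ge0 ?eps_ge0 ?addr_ge0.
  have := ler_wpM2l p G1; lra.
have main M : (M0 < M)%N -> `|rho M - 1| <= 2 * K * eps M ^+ r.
  move=> lM; have Mp : (0 < M)%N by apply: leq_ltn_trans lM.
  apply: (@le_limit _ _ C1 (maxn N1 M)) => L; rewrite gtn_max => /andP[aL ML].
  have := tele M (L - M)%N lM; rewrite subnKC; last exact: ltnW.
  have := H1 _ aL => h1 h2.
  have -> : rho M - 1 = (rho L - 1) - (rho L - rho M) by ring.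
  apply: le_trans (ler_normB _ _) _; rewrite addrC; apply: lerD => //.
  apply: le_trans h2 _; rewrite -{2}(prednK r0) exprSr mulrA ler_wpM2l //.
    by rewrite mulr_ge0 ?exprn_ge0 ?eps_ge0 // mulr_ge0.
  by rewrite lerBlDr lerDl eps_ge0.
have H2 : bigO r (fun M => zst M - g M.*2).
  exists (2 * (2 * K)), (maxn M0 Ng) => M; rewrite gtn_max => /andP[a b].
  have /andP[G1 G2] := Hg _ (dbl _ _ b); have := main _ a; rewrite /rho.
  set G := g M.*2 in G1 G2 *; set z := zst M => h.
  have G0 : G != 0 by rewrite gt_eqF //; lra.
  have -> : z - G = G * (z / G - 1) by field.
  rewrite normrM (@ger0_norm _ G); last lra.
  by rewrite -[2 * _ * _]mulrA; apply: ler_pM => //; lra.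
have P : bigO r (fun M => (pol r.+1 (Gam R) - pol r (Gam R)).[eps M.*2]).
  apply: (even_bigO r (fun N => (pol r.+1 (Gam R) - pol r (Gam R)).[eps N])).
  by apply: bigO_poly => j jr; rewrite coefB !coef_poly jr ltnS (ltnW jr) subrr.
apply: bigO_ext (bigOD H2 P) _ => M; rewrite hornerD hornerN /g; ring.
Qed.
End Stirling.

(** * Regular graphs as a Gaussian functional *)

Section Functional.
Variables (R : realType) (K : nat).
Notation A := {mpoly R[K]}.
Implicit Types (p q : A) (om : 'I_K -> nat -> R).

(** The linear functional with prescribed values on the powers of each variable; [hadamard1] is the
    case of the weights [hw]. *)
Definition mfun om p : R := \sum_(m <- msupp p) p@_m * \prod_i om i (m i).

Lemma mfun_sup om p (s : seq 'X_{1..K}) : uniq s -> {subset msupp p <= s} ->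
  mfun om p = \sum_(m <- s) p@_m * \prod_i om i (m i).
Proof.
move=> us ps; rewrite /mfun [RHS](bigID (mem (msupp p))) /= [X in _ + X]big1 ?addr0.
  rewrite -[RHS]big_filter; apply: perm_big; apply: uniq_perm; rewrite ?filter_uniq ?msupp_uniq //.
  by move=> m; rewrite mem_filter; case: (boolP (m \in _)) => //= /ps ->.
by move=> m /memN_msupp_eq0 ->; rewrite mul0r.
Qed.

Lemma mfunD om : {morph mfun om : p q / p + q}.
Proof.
move=> p q; pose s := undup (msupp p ++ msupp q).
have us : uniq s by apply: undup_uniq.
rewrite (@mfun_sup om p s) // ?(@mfun_sup om q s) // ?(@mfun_sup om (p + q) s) //.
- by rewrite -big_split; apply: eq_bigr => m _; rewrite mcoeffD mulrDl.
- by move=> m /msuppD_le; rewrite mem_undup.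
- by move=> m mq; rewrite mem_undup mem_cat mq orbT.
- by move=> m mq; rewrite mem_undup mem_cat mq.
Qed.
Lemma mfunZ om (x : R) p : mfun om (x *: p) = x * mfun om p.
Proof.
rewrite (@mfun_sup om (x *: p) (msupp p)) ?msupp_uniq //; last exact: msuppZ_le.
by rewrite mulr_sumr; apply: eq_bigr => m _; rewrite mcoeffZ mulrA.
Qed.
Lemma mfun0 om : mfun om 0 = 0.
Proof. by rewrite -(scale0r (0 : A)) mfunZ mul0r. Qed.
Lemma mfun_sum om (I : Type) (r : seq I) (P : pred I) (F : I -> A) :
  mfun om (\sum_(i <- r | P i) F i) = \sum_(i <- r | P i) mfun om (F i).
Proof. exact: (big_morph _ (mfunD om) (mfun0 om)). Qed.
Lemma mfunX om m : mfun om 'X_[m] = \prod_i om i (m i).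
Proof. by rewrite /mfun msuppX big_seq1 mcoeffX eqxx mul1r. Qed.

Lemma mpoly_lin_ind (P : A -> Prop) : (forall p q, P p -> P q -> P (p + q)) -> P 0 ->
  (forall (x : R) p, P p -> P (x *: p)) -> (forall m, P 'X_[m]) -> forall p, P p.
Proof.
move=> PD P0 PZ PX p; rewrite (mpolyE p); elim/big_ind: _ => // m _.
by apply: PZ.
Qed.

Lemma mfunXn om (e : 'I_K -> nat) : mfun om (\prod_i 'X_i ^+ e i) = \prod_i om i (e i).
Proof.
have -> : \prod_i 'X_i ^+ e i = 'X_[[multinom e i | i < K]] :> A.
  by rewrite mpolyXE_id; apply: eq_bigr => i _; rewrite mnmE.
by rewrite mfunX; apply: eq_bigr => i _; rewrite mnmE.
Qed.

Lemma mfun_ibp om i (c : R) p :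
  (forall e, om i e.+1 = 2 * c * (e%:R * om i e.-1)) ->
  mfun om ('X_i * p) = 2 * c * mfun om p^`M(i).
Proof.
move=> omi; elim/mpoly_lin_ind: p.
- by move=> p q Hp Hq; rewrite mulrDr mderivD !mfunD Hp Hq mulrDr.
- by rewrite mulr0 mderiv0 !mfun0 mulr0.
- by move=> x p Hp; rewrite -scalerAr mderivZ !mfunZ Hp; ring.
move=> m; rewrite mderivX mfunZ -mpolyXD !mfunX.
rewrite (bigD1 i) //= [in RHS](bigD1 i) //= mnmDE mnm1E eqxx add1n omi.
rewrite mnmBE mnm1E eqxx subn1 !mulrA; congr (_ * _); apply: eq_bigr => j ji.
by rewrite mnmDE mnmBE mnm1E eq_sym (negbTE ji) add0n subn0.
Qed.

Lemma mderiv0_msupp i p m : p^`M(i) = 0 -> m \in msupp p -> m i = 0%N.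
Proof.
move=> p0; rewrite mcoeff_msupp; apply: contraNeq => mi.
have := congr1 (mcoeff (m - U_(i))%MM) p0; rewrite mcoeff_deriv mcoeff0.
have -> : (m - U_(i) + U_(i))%MM = m.
  apply/mnmP => j; rewrite mnmDE mnmBE mnm1E; case: eqP => [<-|_].
    by rewrite subnK // lt0n.
  by rewrite subn0 addn0.
by move=> /eqP; rewrite mulrn_eq0.
Qed.

Lemma mfun_mulXn om i d p : p^`M(i) = 0 ->
  mfun om ('X_i ^+ d * p) = \sum_(m <- msupp p) p@_m * (om i d * \prod_(j | j != i) om j (m j)).
Proof.
move=> p0; rewrite [p in LHS]mpolyE mulr_sumr mfun_sum !big_seq; apply: eq_bigr => m mp.
rewrite -scalerAr mfunZ mpolyXn -mpolyXD mfunX (bigD1 i) //= mnmDE mulmnE mnm1E eqxx.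
rewrite mul1n (mderiv0_msupp p0 mp) addn0; congr (_ * (_ * _)); apply: eq_bigr => j ji.
by rewrite mnmDE mulmnE mnm1E eq_sym (negbTE ji) mul0n.
Qed.

Lemma mfun_mulXn0 om i d p : p^`M(i) = 0 -> om i d = 0 -> mfun om ('X_i ^+ d * p) = 0.
Proof.
by move=> p0 o0; rewrite mfun_mulXn // o0 big1 // => m _; rewrite mul0r mulr0.
Qed.

Lemma mfun_mulXn1 om i d p : p^`M(i) = 0 -> om i 0%N = 1 ->
  mfun om ('X_i ^+ d * p) = om i d * mfun om p.
Proof.
move=> p0 o1; rewrite mfun_mulXn // -[p in RHS]mul1r -(expr0 'X_i) mfun_mulXn // o1 mulr_sumr.
by apply: eq_bigr => m _; rewrite mul1r mulrCA.
Qed.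

Lemma eq_mfun om om' p : (forall m, m \in msupp p -> forall i, om i (m i) = om' i (m i)) ->
  mfun om p = mfun om' p.
Proof.
move=> H; rewrite /mfun !big_seq; apply: eq_bigr => m mp; congr (_ * _).
by apply: eq_bigr => i _; apply: H.
Qed.

Lemma mderiv_alg i (x : R) : (x%:A : A)^`M(i) = 0.
Proof. by rewrite mderivZ -mpolyC1 mderivC scaler0. Qed.
Lemma mderivXX i j : ('X_i : A)^`M(j) = (i == j)%:R.
Proof.
rewrite mderivX mnm1E; case: eqP => [->|_]; last by rewrite scale0r.
have -> : (U_(j) - U_(j))%MM = 0%MM by apply/mnmP => l; rewrite mnmBE mnm0E subnn.
by rewrite mpolyX0 scale1r.
Qed.

Definition cder i : fps A -> fps A := cmap (mderiv i).

Lemma cder_fder i : fder (cder i).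
Proof. by apply: cmap_fder; [exact: mderivD | exact: mderivM | exact: mderiv_alg]. Qed.

(** Variables that enter the exponent linearly are integrated out one by one; neither the
    coefficients [w] nor the factor [Z] may contain them, so no cross terms arise. *)
Lemma mgauss_elim om (c : 'I_K -> R) (J : seq 'I_K) (w : 'I_K -> fps A) (Z : fps A) n :
  uniq J ->
  (forall i, i \in J -> forall e, om i e.+1 = 2 * c i * (e%:R * om i e.-1)) ->
  (forall i j, i \in J -> j \in J -> cder i (w j) = 0) ->
  (forall i, i \in J -> vge 1 (w i)) ->
  (forall i, i \in J -> cder i Z = 0) ->
  mfun om ((fps_exp (\sum_(i <- J) w i * fps_const 'X_i) * Z) n) =
  mfun om ((fps_exp (\sum_(i <- J) c i *: w i ^+ 2) * Z) n).
Proof.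
elim: J Z => [|i J IHJ] Z; first by rewrite !big_nil.
move=> /= /andP[iJ uJ] omJ wJ w1 ZJ.
have wi1 : vge 1 (w i) by apply: w1; rewrite mem_head.
have wc1 j : j \in J -> vge 1 (w j * fps_const 'X_j).
  by move=> jJ; apply: vgeMr; apply: w1; rewrite inE jJ orbT.
have wq1 j : j \in J -> vge 1 (c j *: w j ^+ 2).
  move=> jJ; apply: vgeZ; rewrite expr2; apply: vgeMr.
  by apply: w1; rewrite inE jJ orbT.
have s1 : vge 1 (\sum_(j <- J) w j * fps_const 'X_j).
  by rewrite big_seq; apply: vge_sum.
have s2 : vge 1 (\sum_(j <- J) c j *: w j ^+ 2).
  by rewrite big_seq; apply: vge_sum.
rewrite !big_cons fps_expD //; last by apply: vgeMr.
rewrite -mulrA fps_expD //; last by apply: vgeZ; rewrite expr2; apply: vgeMr.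
rewrite (@gauss_elim _ _ (mderiv i) 'X_i (mfun om) (c i)) //.
- rewrite mulrCA -[in RHS]mulrA [in RHS]mulrCA; apply: IHJ => //.
  + by move=> j jJ; apply: omJ; rewrite inE jJ orbT.
  + by move=> j l jJ lJ; apply: wJ; rewrite inE ?jJ ?lJ orbT.
  + by move=> j jJ; apply: w1; rewrite inE jJ orbT.
  + move=> j jJ; have D := cder_fder j; rewrite (fderM D) (fder_exp D).
      rewrite (fderZ D) (fderX D) (wJ j i) ?mem_head ?inE ?jJ ?orbT //.
      by rewrite mulr0 !scaler0 mulr0 mul0r add0r ZJ ?mulr0 // inE jJ orbT.
    by apply: vgeZ; rewrite expr2; apply: vgeMr.
- exact: mderivD.
- exact: mderivM.
- exact: mderiv_alg.
- by rewrite mderivXX eqxx.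
- exact: mfunD.
- exact: mfunZ.
- by move=> g; apply: mfun_ibp; apply: omJ; rewrite mem_head.
- by apply: wJ; rewrite mem_head.
- have D := cder_fder i; rewrite -/(cder i _) (fderM D) (fder_exp D) //.
  rewrite ZJ ?mem_head // mulr0 addr0.
  have -> : cder i (\sum_(j <- J) w j * fps_const 'X_j) = 0; last by rewrite mulr0 mul0r.
  rewrite (fder_sum D) big_seq big1 // => j jJ; rewrite (fderM D).
  rewrite wJ ?mem_head ?inE ?jJ ?orbT // mul0r add0r.
  have -> : cder i (fps_const 'X_j) = 0; last by rewrite mulr0.
  apply/fpsP=> m; rewrite /cder /cmap /fps_const; case: eqP => _; last exact: mderiv0.
  by rewrite mderivXX; case: eqP jJ iJ => // -> ->.
Qed.
End Functional.

Section Hw.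
Variable R : realType.
Lemma hwS (c : R) e : hw c e.+1 = 2 * c * (e%:R * hw c e.-1).
Proof.
rewrite /hw; case: e => [|e]; first by rewrite /= mul0r mulr0.
rewrite /= negbK; case: ifP => oe; first by rewrite !mulr0.
have -> : e./2.+1`! = (e./2.+1 * e./2`!)%N by rewrite factS.
have E : e.+2%:R = 2 * e./2.+1%:R :> R.
  by rewrite -natrM; congr _%:R; have := odd_double_half e; rewrite oe; lia.
rewrite factS natrM E natrM factS natrM exprS.
have a0 : e./2.+1%:R != 0 :> R by rewrite pnatr_eq0.
have b0 : e./2`!%:R != 0 :> R by rewrite pnatr_eq0 -lt0n fact_gt0.
set x := e./2.+1%:R in a0 *; set y := e./2`!%:R in b0 *.
set g := e`!%:R; set s := e.+1%:R; set z := c ^+ _.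
by field; rewrite b0 nat1r a0.
Qed.
Lemma hw0 (c : R) : hw c 0 = 1.
Proof. by rewrite /hw /= expr0 fact0 mul1r divr1. Qed.
End Hw.

Section LogSeries.
Variables (R : realType) (A : comAlgType R).
Definition Lg (a : A) : fps A := fps_log1p (- (fps_const a * fX ^+ 2)).

Lemma lgarg_vge (a : A) : vge 1 (- (fps_const a * fX ^+ 2)).
Proof. by apply: vgeN; apply: vgeMl; rewrite expr2; apply: vgeMr; apply: vge1P. Qed.

Lemma Lg_coef (a : A) n : Lg a n =
  if odd n || (n == 0%N) then 0 else - (n./2%:R^-1 *: a ^+ n./2).
Proof.
rewrite /Lg fps_logE /bsubst.
have E m : ((- (fps_const a * fX ^+ 2)) ^+ m) n = (-1) ^+ m *: (a ^+ m * (n == m.*2)%:R).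
  rewrite -scaleN1r exprZn exprMn -rmorphXn -exprM fpsZE fps_constM fps_XnE.
  by rewrite mulnC muln2.
under eq_bigr => m _ do rewrite E.
have [on|en] := boolP (odd n).
  rewrite big1 // => m _; have -> : (n == m.*2) = false; last by rewrite mulr0 scaler0 mulr0.
  by apply: contraTF on => /eqP ->; rewrite odd_double.
rewrite /=; have En : n = n./2.*2 by rewrite even_halfK.
have Hn : (n./2 < n.+1)%N by rewrite {2}En -addnn; lia.
rewrite (bigD1 (Ordinal Hn)) //= [X in _ + X]big1 ?addr0 => [|m mn]; last first.
  have -> : (n == m.*2) = false; last by rewrite mulr0 scaler0 mulr0.
  apply: contraNF mn => /eqP nm; apply/eqP/val_inj.
  by rewrite /= -[LHS](doubleK m) -nm.
rewrite -En eqxx mulr1; have -> : (n./2 == 0%N) = (n == 0%N) by rewrite {2}En double_eq0.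
case: eqP => [|_]; first by rewrite scale0r mul0r.
by rewrite -scalerAl mul1r scalerA mulrAC -exprD addSn addnn exprS -signr_odd odd_double mulr1 mulN1r scaleNr.
Qed.
End LogSeries.

Section SymSum.
Variables (V : zmodType) (n : nat) (f : 'I_n -> 'I_n -> V) (g : {set 'I_n} -> V).
Hypothesis fg : forall i j, i != j -> f i j = g [set i; j].

Lemma sum_pairs : \sum_i \sum_j f i j =
  \sum_i f i i + (\sum_(e : {set 'I_n} | #|e| == 2%N) g e) *+ 2.
Proof.
have -> : \sum_i \sum_j f i j = \sum_i f i i + \sum_i \sum_(j | j != i) f i j.
  by rewrite -big_split; apply: eq_bigr => i _; rewrite (bigD1 i).
congr (_ + _); rewrite pair_big_dep /=.
rewrite (partition_big (fun p : 'I_n * 'I_n => [set p.1; p.2]) (fun e => #|e| == 2%N)) /=; last first.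
  by move=> [i j] /= ji; rewrite cards2 [i == j]eq_sym ji.
rewrite -sumrMnl; apply: eq_bigr => e /cards2P[a [b [ab ->]]].
have ba : b != a by rewrite eq_sym.
rewrite (bigD1 (a, b)) /= ?eqxx ?ba //.
rewrite (bigD1 (b, a)) /=; last by rewrite setUC eqxx ab xpair_eqE negb_and ba.
rewrite big1 ?addr0 => [|[i j] /= /andP[/andP[/andP[ji /eqP E] h1] h2]].
  by rewrite fg // fg // [[set b; a]]setUC mulr2n.
have : i \in [set a; b] by rewrite -E !inE eqxx.
have : j \in [set a; b] by rewrite -E !inE eqxx orbT.
rewrite !inE => /orP[]/eqP jE /orP[]/eqP iE; move: ji h1 h2; rewrite jE iE ?eqxx //.
Qed.
End SymSum.

(** * An exact formula for the number of regular graphs *)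

Section Exact.
Variables (R : realType) (n k M : nat).
Hypothesis kM : (k <= M)%N.
Notation B := {mpoly R[M + n]}.
Notation A := {mpoly R[M]}.
Notation tX j := ('X_(lshift n j) : B).
Notation xX i := ('X_(rshift M i) : B).

Definition cfull (j : 'I_M) : R := - (2 * j.+1%:R)^-1.
(* Gaussian in the variables t_1, ..., t_M, and extraction of the coefficient of
   x_1^k ... x_n^k in the other ones. *)
Definition omx (l : 'I_(M + n)) : nat -> R :=
  match split l with inl j => hw (cfull j) | inr _ => fun e => (e == k)%:R end.
Notation h := (mfun omx).

Lemma omx_l j : omx (lshift n j) = hw (cfull j).
Proof. by rewrite /omx (unsplitK (inl j)). Qed.
Lemma omx_r i : omx (rshift M i) = fun e => (e == k)%:R.
Proof. by rewrite /omx (unsplitK (inr i)). Qed.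

Definition xe (e : {set 'I_n}) : B := \prod_(v in e) xX v.
Lemma xe_pair i j : i != j -> xX i * xX j = xe [set i; j].
Proof. by move=> ij; rewrite /xe big_setU1 ?big_set1 // inE. Qed.
Definition psum (m : nat) : B := \sum_i xX i ^+ m.
Definition wj (j : 'I_M) : fps B := fps_const (psum j.+1) * fX ^+ j.+1.
(** The diagonal terms of the squared power sums contribute factors [(1 - x_v^2 X^2)^(1/2)], foreign
    to the product over edges; [Zx] cancels them. *)
Definition Zx : fps B := \prod_(i : 'I_n) fps_binom (- (1/2)) (- (fps_const (xX i ^+ 2) * fX ^+ 2)).
Definition Fx (i : 'I_n) : fps B :=
  fps_exp (\sum_(j < M) fps_const (tX j * xX i ^+ j.+1) * fX ^+ j.+1) *
  fps_binom (- (1/2)) (- (fps_const (xX i ^+ 2) * fX ^+ 2)).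

Lemma cXn_vge (a : B) j : vge 1 (fps_const a * fX ^+ j.+1).
Proof. by apply: vgeMl; rewrite exprS; apply: vgeMr; apply: vge1P. Qed.

Lemma dx_const j (a : B) : a^`M(j) = 0 -> cder j (fps_const a) = 0.
Proof.
by move=> a0; apply/fpsP=> m; rewrite /cder /cmap /fps_const; case: eqP => _ //; apply: mderiv0.
Qed.
Lemma dx_constX j (a : B) m : a^`M(j) = 0 -> cder j (fps_const a * fX ^+ m) = 0.
Proof.
move=> a0; rewrite (fderM (@cder_fder R _ j)) dx_const // mul0r add0r.
have -> : cder j (fX ^+ m : fps B) = 0; last by rewrite mulr0.
apply/fpsP=> i; rewrite /cder /cmap fps_XnE; case: (_ == _); last exact: mderiv0.
by rewrite -mpolyC1 mderivC.
Qed.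
Lemma mderivXn0 (i j : 'I_(M + n)) m : i != j -> ('X_i ^+ m : B)^`M(j) = 0.
Proof.
move=> ij; elim: m => [|m IHm]; first by rewrite expr0 -mpolyC1 mderivC.
by rewrite exprS mderivM IHm mderivXX (negbTE ij) mul0r mulr0 addr0.
Qed.
Lemma rl_neq i j : rshift M i != lshift n j.
Proof. by rewrite eq_sym; apply/eqP => /(congr1 val) /=; have := ltn_ord j; lia. Qed.
Lemma psum_tfree j m : (psum m)^`M(lshift n j) = 0.
Proof.
by rewrite /psum raddf_sum big1 // => i _; apply: mderivXn0; apply: rl_neq.
Qed.

Lemma binom_tfree j i :
  cder (lshift n j) (fps_binom (- (1/2)) (- (fps_const (xX i ^+ 2) * fX ^+ 2))) = 0.
Proof.
have D := @cder_fder R _ (lshift n j); rewrite (fder_subst D); last exact: lgarg_vge.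
rewrite (fderN D) [cder _ (_ * _)]dx_constX ?oppr0 ?mulr0 //.
by apply: mderivXn0; apply: rl_neq.
Qed.
Lemma Zx_tfree j : cder (lshift n j) Zx = 0.
Proof.
have D := @cder_fder R _ (lshift n j); rewrite /Zx; elim/big_rec: _ => [|i y _ IH].
  exact: fder1.
by rewrite (fderM D) IH binom_tfree mul0r mulr0 addr0.
Qed.

Lemma prod_Fx : \prod_i Fx i = fps_exp (\sum_(j < M) wj j * fps_const (tX j)) * Zx.
Proof.
rewrite /Fx big_split /=; congr (_ * _); rewrite -fps_exp_sum => [|i _]; last first.
  by apply: vge_sum => j _; apply: cXn_vge.
rewrite exchange_big; congr fps_exp; apply: eq_bigr => j _.
rewrite /wj /psum raddf_sum /= !mulr_suml; apply: eq_bigr => i _.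
by rewrite rmorphM /=; ring.
Qed.

Lemma elim_t D : h ((\prod_i Fx i) D) =
  h ((fps_exp (\sum_(j < M) cfull j *: wj j ^+ 2) * Zx) D).
Proof.
rewrite prod_Fx.
pose c (l : 'I_(M + n)) : R := if split l is inl j then cfull j else 0.
pose w (l : 'I_(M + n)) : fps B := if split l is inl j then wj j else 0.
have cl j : c (lshift n j) = cfull j by rewrite /c (unsplitK (inl j)).
have wl j : w (lshift n j) = wj j by rewrite /w (unsplitK (inl j)).
have := @mgauss_elim _ _ omx c [seq lshift n j | j <- index_enum 'I_M] w Zx D.
rewrite !big_map (eq_bigr (fun j => wj j * fps_const (tX j))) => [|j _]; last by rewrite wl.
have -> : \sum_(j < M) c (lshift n j) *: w (lshift n j) ^+ 2 = \sum_(j < M) cfull j *: wj j ^+ 2.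
  by apply: eq_bigr => j _; rewrite wl cl.
apply.
- by rewrite map_inj_uniq ?index_enum_uniq //; apply: lshift_inj.
- by move=> _ /mapP[j _ ->] e; rewrite omx_l cl; apply: hwS.
- move=> _ _ /mapP[i _ ->] /mapP[j _ ->]; rewrite wl /wj dx_constX //.
  exact: psum_tfree.
- by move=> _ /mapP[j _ ->]; rewrite wl; apply: cXn_vge.
- by move=> _ /mapP[j _ ->]; apply: Zx_tfree.
Qed.

(** Elements killed by the functional together with all their multiples form an ideal, modulo which
    series may be computed. It contains [x_i^m] for [m > k]. *)
Definition ann (a : B) := forall b, h (a * b) = 0.
Lemma annD a b : ann a -> ann b -> ann (a + b).
Proof. by move=> Ha Hb c; rewrite mulrDl mfunD Ha Hb addr0. Qed.
Lemma annM a b : ann a -> ann (a * b).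
Proof. by move=> Ha c; rewrite -mulrA Ha. Qed.
Lemma ann0 : ann 0. Proof. by move=> b; rewrite mul0r mfun0. Qed.
Lemma annZ (x : R) a : ann a -> ann (x *: a).
Proof. by move=> Ha c; rewrite -scalerAl mfunZ Ha mulr0. Qed.
Lemma ann_sum (I : Type) (r : seq I) (P : pred I) (F : I -> B) :
  (forall i, P i -> ann (F i)) -> ann (\sum_(i <- r | P i) F i).
Proof. by move=> H; elim/big_ind: _ => //; [exact: ann0 | exact: annD]. Qed.
Lemma ann_x i m : (k < m)%N -> ann (xX i ^+ m).
Proof.
move=> km b; elim/mpoly_lin_ind: b.
- by move=> p q Hp Hq; rewrite mulrDr mfunD Hp Hq addr0.
- by rewrite mulr0 mfun0.
- by move=> x p Hp; rewrite -scalerAr mfunZ Hp mulr0.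
move=> m'; rewrite mpolyXn -mpolyXD mfunX (bigD1 (rshift M i)) //= omx_r.
rewrite mnmDE mulmnE mnm1E eqxx mul1n gtn_eqF ?mul0r //.
by apply: leq_trans km _; apply: leq_addr.
Qed.
Definition sann (f : fps B) := forall i, ann (f i).
Lemma sannM f g : sann f -> sann (f * g).
Proof. by move=> Hf i; apply: ann_sum => j _; apply: annM. Qed.
Lemma sann_exp f : sann f -> sann (fps_exp f - 1).
Proof.
move=> Hf i; rewrite fpsBE fps_expE /bsubst big_ord_recl expr0 fact0 invr1 scale1r mul1r.
rewrite addrC addKr; apply: ann_sum => j _; rewrite -scalerAl mul1r; apply: annZ.
by rewrite /= /bump /= exprS; apply: sannM.
Qed.

Lemma elim_tail (t Y : fps B) D : sann t ->
  h ((fps_exp t * Y) D) = h (Y D).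
Proof.
move=> Ht; have := sannM Y (sann_exp Ht) D 1; rewrite mulr1 mulrBl mul1r fpsBE.
by rewrite -scaleN1r mfunD mfunZ mulN1r => /eqP; rewrite subr_eq0 => /eqP.
Qed.

(** The sum of [log (1 - x_u x_v X^2)] over pairs is half the sum over all [(u, v)] minus half the
    diagonal, and the full double sum is [- sum_j p_j^2 X^(2j) / j] with power sums [p_j]. The
    Gaussian variables produce the terms [j <= M]; the others form [tail], annihilated because
    [k <= M]. *)
Lemma edge_prod D : h ((\prod_i Fx i) D) =
  h ((\prod_(e : {set 'I_n} | #|e| == 2%N) (1 - fps_const (xe e) * fX ^+ 2)) D).
Proof.
rewrite elim_t.
pose LL : fps B := \sum_(e : {set 'I_n} | #|e| == 2%N) Lg (xe e).
have -> : \prod_(e : {set 'I_n} | #|e| == 2%N) (1 - fps_const (xe e) * fX ^+ 2) = fps_exp LL.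
  rewrite fps_exp_sum => [|e _]; last exact: vge_log.
  by apply: eq_bigr => e _; rewrite /Lg fps_log1pK //; apply: lgarg_vge.
pose tail : fps B := fun i => if odd i || (i == 0%N) || (i./2 <= M)%N then 0
   else - ((2 * i./2%:R)^-1 *: psum i./2 ^+ 2).
pose W : fps B := \sum_(j < M) cfull j *: wj j ^+ 2.
have EZ : Zx = fps_exp (- ((1/2) *: \sum_i Lg (xX i ^+ 2))).
  rewrite -scaleNr scaler_sumr fps_exp_sum => [|i _]; last by apply: vgeZ; apply: vge_log.
  apply: eq_bigr => i _; rewrite fps_binomE //; exact: lgarg_vge.
have psumE m : psum m ^+ 2 = \sum_i \sum_j (xX i * xX j) ^+ m.
  rewrite expr2 /psum mulr_suml; apply: eq_bigr => i _; rewrite mulr_sumr.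
  by apply: eq_bigr => j _; rewrite exprMn.
have pair_sum : \sum_i \sum_j Lg (xX i * xX j) = \sum_i Lg (xX i ^+ 2) + LL *+ 2.
  rewrite (@sum_pairs _ _ _ (fun e => Lg (xe e))).
    by congr (_ + _); apply: eq_bigr => i _; rewrite expr2.
  by move=> i j ij; rewrite xe_pair.
have W1 : vge 1 W.
  by apply: vge_sum => j _; apply: vgeZ; rewrite expr2; apply: vgeMr; apply: cXn_vge.
have EL : LL = tail + (W + - ((1/2) *: \sum_i Lg (xX i ^+ 2))).
  have -> : LL = (1/2) *: (\sum_i \sum_j Lg (xX i * xX j)) - (1/2) *: \sum_i Lg (xX i ^+ 2).
    rewrite -scalerBr pair_sum addrC addKr -scaler_nat scalerA.
    have -> : 1 / 2 * 2%:R = 1 :> R by lra.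
    by rewrite scale1r.
  rewrite addrA; congr (_ - _); apply/fpsP=> i; rewrite fpsDE fpsZE fps_sumE.
  have -> : \sum_(j < n) (\sum_(l < n) Lg (xX j * xX l)) i =
     if odd i || (i == 0%N) then 0 else - (i./2%:R^-1 *: psum i./2 ^+ 2).
    under eq_bigr => j _ do rewrite fps_sumE.
    under eq_bigr => j _ do under eq_bigr => l _ do rewrite Lg_coef.
    case: ifP => _; first by rewrite big1 // => j _; rewrite big1.
    rewrite psumE scaler_sumr -sumrN; apply: eq_bigr => j _.
    by rewrite scaler_sumr -sumrN.
  have EW : W i = if odd i || (i == 0%N) || (M < i./2)%N then 0
       else - ((2 * i./2%:R)^-1 *: psum i./2 ^+ 2).
    rewrite /W fps_sumE.
    have E j : (cfull j *: wj j ^+ 2) i = cfull j *: (psum j.+1 ^+ 2 * (i == j.+1.*2)%:R).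
      by rewrite fpsZE /wj exprMn -rmorphXn -exprM muln2 fps_constM fps_XnE.
    under eq_bigr => j _ do rewrite E.
    case: ifP => [H|/negbT]; last first.
      rewrite !negb_or -leqNgt => /andP[/andP[oi i0] iM].
      have iE : i = i./2.*2 by rewrite even_halfK.
      have i2 : (0 < i./2)%N by rewrite lt0n; apply: contraNneq i0 => E0; rewrite iE E0.
      have Hj : (i./2.-1 < M)%N by rewrite prednK.
      rewrite (bigD1 (Ordinal Hj)) //= big1 ?addr0 => [|j ji]; last first.
        have -> : (i == j.+1.*2) = false; last by rewrite mulr0 scaler0.
        apply: contraNF ji => /eqP iE'; apply/eqP/val_inj => /=.
        by rewrite iE' doubleK.
      by rewrite prednK // -iE eqxx mulr1 /cfull /= prednK // scaleNr.
    rewrite big1 // => j _; case: eqP => [iE|_]; last by rewrite mulr0 scaler0.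
    by move: H; rewrite iE odd_double doubleK double_eq0 /= ltnNge ltn_ord.
  rewrite EW /tail; case: (odd i || (i == 0%N)) => /=; first by rewrite scaler0 addr0.
  have S : (1 / 2) *: - (i./2%:R^-1 *: psum i./2 ^+ 2) = - ((2 * i./2%:R)^-1 *: psum i./2 ^+ 2).
    by rewrite scalerN scalerA mul1r invfM.
  by case: ltnP => _; rewrite ?addr0 ?add0r S.
have Z1 : vge 1 (- ((1/2) *: \sum_i Lg (xX i ^+ 2))).
  by apply: vgeN; apply: vgeZ; apply: vge_sum => i _; apply: vge_log.
rewrite EL fps_expD; last by apply: vgeD.
  rewrite [RHS]elim_tail; first by rewrite fps_expD // -EZ.
  move=> i; rewrite /tail; case: ifP => [_|/negbT]; first exact: ann0.
  rewrite !negb_or -ltnNge => /andP[_ iM]; rewrite -scaleNr; apply: annZ.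
  rewrite psumE; apply: ann_sum => a _; apply: ann_sum => b _; rewrite exprMn; apply: annM.
  by apply: ann_x; apply: leq_ltn_trans iM.
by move=> [|//] _; rewrite /tail.
Qed.
Lemma handshake (E : {set {set 'I_n}}) : (forall e, e \in E -> #|e| = 2%N) ->
  (forall v, #|[set e in E | v \in e]| = k) -> (2 * #|E| = n * k)%N.
Proof.
move=> E2 Ek; transitivity (\sum_(e in E) #|e|)%N.
  by rewrite (eq_bigr (fun=> 2%N)) // sum_nat_const mulnC.
transitivity (\sum_(v : 'I_n) #|[set e in E | v \in e]|)%N; last first.
  by rewrite (eq_bigr (fun=> k)) // sum_nat_const card_ord.
under eq_bigr => e _ do rewrite -sum1_card.
rewrite (exchange_big_dep xpredT) //=; apply: eq_bigr => v _.
by rewrite -sum1_card; apply: eq_bigl => e; rewrite !inE.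
Qed.

Lemma h_xprod (d : 'I_n -> nat) : h (\prod_v xX v ^+ d v) = \prod_v (d v == k)%:R.
Proof.
have := mfunXn omx (fun l => if split l is inr v then d v else 0%N).
rewrite !big_split_ord /= big1 => [|j _]; last by rewrite (unsplitK (inl j)) expr0.
rewrite mul1r [X in _ = X * _]big1 => [|j _]; last by rewrite (unsplitK (inl j)) omx_l hw0.
rewrite mul1r (eq_bigr (fun v => xX v ^+ d v)) => [->|v _]; last by rewrite (unsplitK (inr v)).
by apply: eq_bigr => v _; rewrite (unsplitK (inr v)) omx_r.
Qed.

Lemma h_edges (E : {set {set 'I_n}}) :
  h (\prod_(e in E) xe e) = [forall v, #|[set e in E | v \in e]| == k]%:R.
Proof.
have -> : \prod_(e in E) xe e = \prod_v xX v ^+ #|[set e in E | v \in e]|.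
  rewrite /xe (exchange_big_dep xpredT) //=; apply: eq_bigr => v _.
  by rewrite -prodr_const; apply: eq_bigl => e; rewrite !inE.
rewrite h_xprod; case: forallP => [H|/forallP].
  by rewrite big1 // => v _; rewrite (eqP (H v)) eqxx.
rewrite negb_forall => /existsP[v Hv].
by rewrite (bigD1 v) //= (negbTE Hv) mul0r.
Qed.

(** Expanding the product amounts to choosing a set of edges, and the functional keeps those with
    all degrees [k]. By [handshake] they have [n k / 2] edges, so the sign is constant and the power
    of [X] is [n k]. *)
Lemma edge_coef :
  h ((\prod_(e : {set 'I_n} | #|e| == 2%N) (1 - fps_const (xe e) * fX ^+ 2)) (n * k)%N) =
  (-1) ^+ (n * k)./2 * (SG k n)%:R.
Proof.
pose b (e : {set 'I_n}) : fps B := if #|e| == 2%N then - (fps_const (xe e) * fX ^+ 2) else 0.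
have -> : \prod_(e : {set 'I_n} | #|e| == 2%N) (1 - fps_const (xe e) * fX ^+ 2) =
    \prod_e (b e + 1).
  rewrite big_mkcond /=; apply: eq_bigr => e _; rewrite /b.
  by case: ifP => _; rewrite ?add0r // addrC.
rewrite bigA_distr fps_sumE mfun_sum /SG -sum1dep_card natr_sum mulr_sumr [RHS]big_mkcond /=.
apply: eq_bigr => E _; rewrite -big_mkcond /=.
have [/forall_inP E2|] := boolP [forall e in E, #|e| == 2%N]; last first.
  rewrite negb_forall_in => /exists_inP[e eE /negbTE e2].
  by rewrite (bigD1 e) //= /b e2 mul0r mfun0.
have -> : \prod_(e in E) b e = (-1) ^+ #|E| *: (fps_const (\prod_(e in E) xe e) * fX ^+ (2 * #|E|)).
  rewrite (eq_bigr (fun e => (-1 : R) *: (fps_const (xe e) * fX ^+ 2))) => [|e eE].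
    by rewrite scaler_prod prodr_const big_split /= prodr_const rmorph_prod exprM.
  by rewrite /b E2 // scaleN1r.
rewrite fpsZE mfunZ fps_constM fps_XnE -scaler_nat mulrC.
have -> : forall (p : B) (c : R), p * c%:A = c *: p by move=> p c; rewrite mulr_algr.
rewrite mfunZ h_edges; case: forallP => [H|_]; last by rewrite mulr0 mul0r.
have := handshake (fun e eE => eqP (E2 e eE)) (fun v => eqP (H v)) => Enk.
by rewrite -Enk eqxx mul2n doubleK !mul1r /= mulr1.
Qed.

Definition emb (p : A) : B := p \mPo [tuple tX j | j < M].
Definition bfull : fps A :=
  fps_exp (\sum_(j < M) fps_const 'X_j * fX ^+ j.+1) * fps_binom (- (1/2)) (- fX ^+ 2).

Lemma emb_alg (x : R) p : emb (x *: p) = x *: emb p.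
Proof. exact: comp_mpolyZ. Qed.
Lemma emb_X j : emb 'X_j = tX j.
Proof. by rewrite /emb comp_mpolyXU -tnth_nth tnth_mktuple. Qed.

(** In [Fx i] the variables [x_i] and [X] occur only through their product, so the degree in [X] is
    the degree in [x_i]. *)
Lemma Fx_coef i d : Fx i d = xX i ^+ d * emb (bfull d).
Proof.
pose rho (d : nat) (a : A) (a' : B) := a' = xX i ^+ d * emb a.
have r0 j : rho j 0 0 by rewrite /rho /emb raddf0 mulr0.
have r1 : rho 0%N 1 1 by rewrite /rho /emb rmorph1 mulr1.
have rD j (a b : A) (a' b' : B) : rho j a a' -> rho j b b' -> rho j (a + b) (a' + b').
  by move=> -> ->; rewrite /rho /emb raddfD mulrDr.
have rZ j (x : R) (a : A) (a' : B) : rho j a a' -> rho j (x *: a) (x *: a').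
  by move=> ->; rewrite /rho emb_alg scalerAr.
have rM u v (a b : A) (a' b' : B) : rho u a a' -> rho v b b' -> rho (u + v)%N (a * b) (a' * b').
  by move=> -> ->; rewrite /rho /emb rmorphM exprD /=; ring.
have rX m (a : A) (a' : B) : a' = xX i ^+ m * emb a ->
    frel rho d.+1 (fps_const a * fX ^+ m) (fps_const a' * fX ^+ m).
  move=> E j _; rewrite !fps_constM !fps_XnE; case: eqP => [->|_].
    by rewrite !mulr1.
  by rewrite !mulr0; apply: r0.
suff : frel rho d.+1 bfull (Fx i) by move/(_ d (ltnSn d)).
apply: (frelM r0 rD rM).
  apply: (frel_subst r0 r1 rD rZ rM).
  move=> j jd; rewrite !fps_sumE; apply: (rho_sum r0 rD) => l _.
  by apply: rX => //; rewrite emb_X mulrC.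
apply: (frel_subst r0 r1 rD rZ rM); rewrite -[fX ^+ 2 in X in frel _ _ X _]mul1r -(rmorph1 (@fps_const R A)).
apply: (frelN rZ); apply: rX; by rewrite /emb rmorph1 mulr1.
Qed.

Lemma emb_xfree p i : (emb p)^`M(rshift M i) = 0.
Proof.
elim/mpoly_lin_ind: p.
- by move=> p q Hp Hq; rewrite /emb raddfD /= mderivD [X in X + _]Hp [X in _ + X]Hq addr0.
- by rewrite /emb raddf0 mderiv0.
- by move=> x p Hp; rewrite emb_alg mderivZ Hp scaler0.
move=> m; rewrite /emb comp_mpolyX; elim/big_rec: _ => [|j y _ IH].
  by rewrite -mpolyC1 mderivC.
rewrite mderivM IH mulr0 addr0 tnth_mktuple mderivXn0 ?mul0r //.
by rewrite eq_sym; apply: rl_neq.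
Qed.

(** Only the factor [Fx i] contains [x_i], so extracting [x_i^k] selects its coefficient of [X^k]
    and leaves degree [D - k] to the other factors. *)
Lemma extract_x (s : seq 'I_n) (q : B) D : uniq s ->
  (forall i, i \in s -> q^`M(rshift M i) = 0) ->
  h (q * (\prod_(i <- s) Fx i) D) =
  (D == k * size s)%N%:R * h (q * \prod_(i <- s) (xX i ^+ k * emb (bfull k))).
Proof.
elim: s q D => [|i s IHs] q D /=.
  by rewrite !big_nil fpsE1 muln0 mulr1; case: eqP => _ _ _; rewrite ?mulr1 ?mul1r // mulr0 mfun0 mul0r.
move=> /andP[is_ us] qs; rewrite !big_cons.
have xneq j : j \in s -> rshift M i != rshift M j.
  by move=> js; rewrite (inj_eq (@rshift_inj _ _)); apply: contraNneq is_ => ->.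
have Gfree d : ((\prod_(j <- s) Fx j) d)^`M(rshift M i) = 0.
  have D0 := @cder_fder R _ (rshift M i).
  suff /fpsP/(_ d) : cder (rshift M i) (\prod_(j <- s) Fx j) = 0 by [].
  rewrite big_seq; elim/big_rec: _ => [|j y js IH]; first exact: fder1.
  rewrite (fderM D0) IH mulr0 addr0.
  have -> : cder (rshift M i) (Fx j) = 0; last by rewrite mul0r.
  apply/fpsP=> e; rewrite /cder /cmap Fx_coef mderivM emb_xfree mulr0 addr0.
  by rewrite mderivXn0 ?mul0r // eq_sym xneq.
rewrite fpsME mulr_sumr mfun_sum.
have T (d : nat) : d != k -> h (q * (Fx i d * (\prod_(j <- s) Fx j) (D - d)%N)) = 0.
  move=> dk; rewrite Fx_coef -mulrA mulrCA mfun_mulXn0 ?omx_r ?(negbTE dk) //.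
  by rewrite !mderivM qs ?mem_head // emb_xfree Gfree; ring.
have -> : (D == k * (size s).+1)%N = (k <= D)%N && (D - k == k * size s)%N.
  by rewrite mulnS; move: (k * size s)%N => z; lia.
have [kD|Dk] := leqP k D; last first.
  rewrite mul0r big1 // => d _; apply: T.
  by have := ltn_ord d; lia.
have Hk : (k < D.+1)%N by [].
rewrite (bigD1 (Ordinal Hk)) //= [X in _ + X]big1 ?addr0 => [|d dk]; last first.
  by apply: T; apply: contraNneq dk => dE; apply/eqP/val_inj.
rewrite Fx_coef [q * (_ * (\prod_(j <- s) Fx j) _)]mulrA IHs //.
  by rewrite -mulrA.
move=> j js.
rewrite !mderivM qs ?inE ?js ?orbT // emb_xfree mderivXn0 ?xneq //; ring.
Qed.

Lemma h_emb (om : 'I_M -> nat -> R) (p : A) : om =2 (fun j => hw (cfull j)) ->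
  h (emb p * \prod_v xX v ^+ k) = mfun om p.
Proof.
move=> omE; elim/mpoly_lin_ind: p.
- by move=> p q Hp Hq; rewrite /emb raddfD /= mulrDl !mfunD -Hp -Hq.
- by rewrite /emb raddf0 mul0r !mfun0.
- by move=> x p Hp; rewrite emb_alg -scalerAl !mfunZ Hp.
move=> m; rewrite mfunX.
have := mfunXn omx (fun l => match split l with inl j => m j | inr v => k end).
rewrite !big_split_ord /=.
rewrite (eq_bigr (fun j => tX j ^+ m j)) => [|j _]; last by rewrite (unsplitK (inl j)).
rewrite [X in _ * X](eq_bigr (fun v => xX v ^+ k)) => [|v _]; last by rewrite (unsplitK (inr v)).
rewrite [X in _ = X * _](eq_bigr (fun j => om j (m j))) => [|j _]; last first.
  by rewrite (unsplitK (inl j)) omx_l omE.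
rewrite [X in _ = _ * X]big1 ?mulr1 => [<-|v _]; last first.
  by rewrite (unsplitK (inr v)) omx_r eqxx.
congr (mfun _ (_ * _)); rewrite /emb comp_mpolyX; apply: eq_bigr => j _.
by rewrite tnth_mktuple.
Qed.

Lemma SG_exact : (-1) ^+ (n * k)./2 * (SG k n)%:R =
  mfun (fun j => hw (cfull j)) (bfull k ^+ n).
Proof.
rewrite -edge_coef -edge_prod -(@h_emb (fun j => hw (cfull j))) //.
have := @extract_x (index_enum 'I_n) 1 (n * k) (index_enum_uniq _).
have Hs : size (index_enum 'I_n) = n by rewrite -[RHS](card_ord n) cardT enumT.
rewrite Hs mulnC eqxx !mul1r => -> //; last by move=> i _; rewrite -mpolyC1 mderivC.
rewrite big_split /= mulrC; congr (mfun _ (_ * _)).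
rewrite /emb rmorphXn /= big_const iter_mulr_1; congr (_ ^+ _).
by rewrite -[RHS](card_ord n); apply: eq_card.
Qed.
End Exact.

(** * Expansion in t_1 *)

Section Homogenize.
Variables (R : realType) (A : comAlgType R) (a : A).
Implicit Types f g : fps A.

(** The homogenization of [f] in degree [K], with [a] as second variable, taken at [X = 1]. It is
    used with [a = t_1]. *)
Definition homz K f : A := \sum_(m < K.+1) a ^+ (K - m) * f m.

Lemma homzD K f g : homz K (f + g) = homz K f + homz K g.
Proof. by rewrite -big_split; apply: eq_bigr => m _; rewrite fpsDE mulrDr. Qed.
Lemma homz0 K : homz K 0 = 0.
Proof. by rewrite /homz big1 // => m _; rewrite mulr0. Qed.
Lemma homz_sum K (I : Type) (r : seq I) (P : pred I) (F : I -> fps A) :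
  homz K (\sum_(i <- r | P i) F i) = \sum_(i <- r | P i) homz K (F i).
Proof. exact: (big_morph _ (@homzD K) (homz0 K)). Qed.
Lemma homz_mon K c i : (i <= K)%N -> homz K (fps_const c * fX ^+ i) = a ^+ (K - i) * c.
Proof.
rewrite -ltnS => iK; rewrite /homz (bigD1 (Ordinal iK)) //= big1 ?addr0 => [|m mi].
  by rewrite fps_constM fps_XnE eqxx mulr1.
by rewrite fps_constM fps_XnE -[_ == _]/(m == Ordinal iK) (negbTE mi) !mulr0.
Qed.
Lemma fps_finite K f : (forall i, (K < i)%N -> f i = 0) ->
  f = \sum_(i < K.+1) fps_const (f i) * fX ^+ i.
Proof.
move=> f0; apply/fpsP=> n; rewrite fps_sumE.
have [nK|Kn] := ltnP K n.
  rewrite f0 // big1 // => i _; rewrite fps_constM fps_XnE.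
  by have -> : (n == i) = false; [have := ltn_ord i; lia | rewrite mulr0].
rewrite -ltnS in Kn; rewrite (bigD1 (Ordinal Kn)) //= big1 ?addr0 => [|m mi].
  by rewrite fps_constM fps_XnE eqxx mulr1.
rewrite fps_constM fps_XnE eq_sym -[_ == _]/(m == Ordinal Kn) (negbTE mi) mulr0 //.
Qed.
Lemma homzM K L f g : (forall i, (K < i)%N -> f i = 0) -> (forall i, (L < i)%N -> g i = 0) ->
  homz K f * homz L g = homz (K + L) (f * g).
Proof.
move=> f0 g0; rewrite {2}(fps_finite f0) {2}(fps_finite g0) [in RHS]mulr_suml homz_sum mulr_suml.
apply: eq_bigr => i _; rewrite [in RHS]mulr_sumr homz_sum mulr_sumr; apply: eq_bigr => j _.
have -> : fps_const (f i) * fX ^+ i * (fps_const (g j) * fX ^+ j) =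
   fps_const (f i * g j) * fX ^+ (i + j) by rewrite rmorphM exprD /=; ring.
have := ltn_ord i; have := ltn_ord j; rewrite !ltnS => jL iK.
rewrite homz_mon ?leq_add //; have -> : (K + L - (i + j) = (K - i) + (L - j))%N by lia.
rewrite exprD; ring.
Qed.
Lemma homzX K f n : (forall i, (K < i)%N -> f i = 0) ->
  homz K f ^+ n = homz (n * K) (f ^+ n) /\ (forall i, (n * K < i)%N -> (f ^+ n) i = 0).
Proof.
move=> f0; elim: n => [|n [IH1 IH2]].
  rewrite !expr0; split=> [|i]; first by rewrite /homz big_ord1 fpsE1 mulr1.
  by rewrite mul0n fpsE1; case: i.
rewrite !exprS IH1 homzM // -mulSn; split=> // i Hi; rewrite fpsME big1 // => j _.
have [Kj|jK] := ltnP K j; first by rewrite f0 ?mul0r.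
by rewrite IH2 ?mulr0 //; have := ltn_ord j; rewrite mulSn in Hi; lia.
Qed.
End Homogenize.

Lemma sum_ord_supp (V : nmodType) a b (F : nat -> V) :
  (forall j, (minn a b <= j)%N -> F j = 0) -> \sum_(j < a) F j = \sum_(j < b) F j.
Proof.
wlog ab : a b / (a <= b)%N => [W H|].
  have [ab|ba] := leqP a b; first exact: W.
  by symmetry; apply: W => [|j]; [apply: ltnW | rewrite minnC; apply: H].
rewrite (minn_idPl ab) => H; rewrite (big_ord_widen b F ab) [RHS](bigID (fun i : 'I_b => (i < a)%N)) /=.
by rewrite [X in _ + X]big1 ?addr0 // => j; rewrite -leqNgt => /H.
Qed.

Section ExpandT1.
Variables (R : realType) (M' k : nat).
Hypothesis kM : (k <= M'.+1)%N.
Notation A := {mpoly R[M'.+1]}.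

(** The series [bfull] deprived of [t_1]. Its coefficient of [X] vanishes ([gser1]), so that [Bt]
    starts in degree 2. *)
Definition gser : fps A := fps_exp (fX * Wser R M') * isqrt1mz2 R M'.
Definition Bt : fps A := fun d => if d == 0%N then 0 else (k ^_ d)%:R *: gser d.

Lemma Wser_vge : vge 1 (fX * Wser R M').
Proof. by apply: vgeMr; apply: vge1P. Qed.
Lemma isqrtE : isqrt1mz2 R M' = fps_binom (- (1/2)) (- fX ^+ 2).
Proof.
congr fps_binom; apply/fpsP=> m; rewrite fpsNE fps_XnE; case: eqP => //.
by rewrite mulr0n oppr0.
Qed.
Lemma mX2_vge : vge 1 (- fX ^+ 2 : fps A).
Proof. by apply: vgeN; rewrite expr2; apply: vgeMr; apply: vge1P. Qed.

Lemma gser0 : gser 0%N = 1.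
Proof. by rewrite /gser fpsM0 fps_exp0 isqrtE fps_binom0 mulr1. Qed.

Lemma WserE : fX * Wser R M' = \sum_(j < M') fps_const 'X_(lift ord0 j) * fX ^+ j.+2.
Proof.
apply/fpsP=> m; rewrite fps_XM fps_sumE.
under eq_bigr => j _ do rewrite fps_constM fps_XnE.
case: m => [|[|m]].
- by rewrite big1 // => j _; rewrite mulr0.
- by rewrite big1 // => j _; rewrite mulr0.
rewrite /Wser /= /tv /=; case: ltnP => [lt1|ge].
  have lt : (m < M')%N := lt1.
  rewrite (bigD1 (Ordinal lt)) //= eqxx mulr1 big1 ?addr0.
    by congr 'X_(_); apply/val_inj; rewrite /= inordK ?ltnS.
  move=> j jm; rewrite !eqSS eq_sym -[_ == _]/(j == Ordinal lt) (negbTE jm) mulr0 //.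
rewrite big1 // => j _; rewrite !eqSS gtn_eqF ?mulr0 //; exact: leq_trans (ltn_ord j) ge.
Qed.

Lemma bfull_gser : bfull R M'.+1 = fps_exp (fps_const 'X_ord0 * fX) * gser.
Proof.
rewrite /bfull /gser isqrtE mulrA -fps_expD ?WserE.
- by congr (fps_exp _ * _); rewrite big_ord_recl expr1.
- by apply: vgeMl; apply: vge1P.
- by apply: vge_sum => j _; apply: vgeMl; rewrite exprS; apply: vgeMr; apply: vge1P.
Qed.

Lemma exp_constX (a : A) i : fps_exp (fps_const a * fX) i = i`!%:R^-1 *: a ^+ i.
Proof.
have E m : (fps_const a * fX) ^+ m = fps_const (a ^+ m) * fX ^+ m.
  by rewrite exprMn rmorphXn.
rewrite fps_expE /bsubst big_ord_recr /= E fps_constM fps_XnE eqxx mulr1.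
rewrite big1 ?add0r -?scalerAl ?mul1r // => j _.
by rewrite E fps_constM fps_XnE (gtn_eqF (ltn_ord j)) !mulr0.
Qed.

Definition qser : fps A := fun d => (k ^_ d)%:R *: gser d.

Lemma qserE : qser = 1 + Bt.
Proof.
apply/fpsP=> d; rewrite fpsDE fpsE1 /Bt /qser; case: eqP => [->|_].
  by rewrite ffactn0 scale1r gser0 addr0.
by rewrite add0r.
Qed.
Lemma qser_sup d : (k < d)%N -> qser d = 0.
Proof. by move=> kd; rewrite /qser ffact_small // scale0r. Qed.

Lemma bfull_k : k`!%:R *: bfull R M'.+1 k = homz 'X_ord0 k qser.
Proof.
rewrite bfull_gser mulrC fpsME scaler_sumr; apply: eq_bigr => d _.
have dk : (d <= k)%N by rewrite -ltnS.
rewrite exp_constX /qser [gser d * _]mulrC -scalerAl -scalerAr scalerA; congr (_ *: _).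
by rewrite -(ffact_fact dk) natrM mulfK // pnatr_eq0 -lt0n fact_gt0.
Qed.

Lemma tv_free1 j : (tv R M' j.+2)^`M(ord0) = 0.
Proof.
rewrite /tv; case: ifP => [jM|_]; last exact: mderiv0.
rewrite mderivXX; case: eqP => // /(congr1 val) /=.
by rewrite inordK.
Qed.

Lemma cder_X i m : cder i (fX ^+ m : fps A) = 0.
Proof.
apply/fpsP=> j; rewrite /cder /cmap fps_XnE; case: (_ == _); last exact: mderiv0.
by rewrite -mpolyC1 mderivC.
Qed.

Lemma isqrt_free i : cder i (isqrt1mz2 R M') = 0.
Proof.
have D := @cder_fder R _ i; rewrite isqrtE (fder_subst D); last exact: mX2_vge.
by rewrite (fderN D) cder_X oppr0 mulr0.
Qed.

Lemma gser_free1 : cder ord0 gser = 0.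
Proof.
have D := @cder_fder R M'.+1 ord0; rewrite /gser (fderM D) isqrt_free mulr0 addr0.
rewrite (fder_exp D) ?(fderM D); last exact: Wser_vge.
have -> : cder ord0 (Wser R M') = 0.
  apply/fpsP=> -[|m]; rewrite /cder /cmap /Wser /=; first exact: mderiv0.
  exact: tv_free1.
by rewrite -[fX]expr1 cder_X mul0r mulr0 addr0 mulr0 mul0r.
Qed.
Lemma Bt_free1 : cder ord0 Bt = 0.
Proof.
apply/fpsP=> d; rewrite /cder /cmap /Bt; case: eqP => _; first exact: mderiv0.
have /fpsP/(_ d) := gser_free1; rewrite /cder /cmap => E.
by rewrite mderivZ E scaler0.
Qed.
Lemma BtX_free1 j m : ((Bt ^+ j) m)^`M(ord0) = 0.
Proof.
have D := @cder_fder R M'.+1 ord0.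
suff /fpsP/(_ m) : cder ord0 (Bt ^+ j) = 0 by [].
by rewrite (fderX D) Bt_free1 mulr0 scaler0.
Qed.

Definition cH (i : 'I_M'.+1) : R := hcoef R k i.
(** Here [t_1] carries the weight of the statement instead of that of [SG_exact]; both give the same
    value since [Bt] is free of [t_1] ([mfun_free1]). *)
Definition chi m j : R := mfun (fun i => hw (cH i)) ((Bt ^+ j) m).

Lemma mfun_free1 (om om' : 'I_M'.+1 -> nat -> R) (p : A) :
  (forall i, i != ord0 -> om i =1 om' i) -> om ord0 0%N = om' ord0 0%N ->
  p^`M(ord0) = 0 -> mfun om p = mfun om' p.
Proof.
move=> E E0 p0; apply: eq_mfun => m mp i; have [->|i0] := eqVneq i ord0; last exact: E.
by rewrite (mderiv0_msupp p0 mp).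
Qed.

Lemma cH_full i : i != ord0 -> cH i = cfull R i.
Proof.
by move=> i0; rewrite /cH /hcoef /cfull -[_ == 0%N]/(i == ord0) (negbTE i0).
Qed.

Lemma gser1 : gser 1%N = 0.
Proof.
have E : vge 2 (fps_exp (fX * Wser R M') - 1).
  move=> i i2; rewrite fpsBE fps_expE /bsubst fpsE1.
  case: i i2 => [|[|//]] _; first by rewrite big_ord1 expr0 fpsE1 mulr1 fact0 invr1 scale1r subrr.
  rewrite !big_ord_recl big_ord0 expr0 fpsE1 mulr0 expr1 fps_XM /Wser /= mulr0 !addr0 subrr //.
have := vgeMr (isqrt1mz2 R M') E (ltnSn 1); rewrite mulrBl mul1r fpsBE -/gser => /eqP.
rewrite subr_eq0 => /eqP ->; rewrite isqrtE fps_binE /bsubst !big_ord_recl big_ord0.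
by rewrite expr0 fpsE1 mulr0 expr1 fpsNE fps_XnE /= mulr0n oppr0 mulr0 !addr0.
Qed.

Lemma Bt_vge : vge 2 Bt.
Proof. by case=> [|[|//]] _; rewrite /Bt //= gser1 scaler0. Qed.
Lemma BtX_vge j : vge j.*2 (Bt ^+ j).
Proof.
elim: j => // j IHj; rewrite exprS doubleS -addn2 addnC.
by apply: vgeM => //; apply: Bt_vge.
Qed.

(** With [N = n k], the power [t_1^(N - m)] integrates, up to sign, to a double factorial when [m]
    is even and to 0 when [m] is odd. The bound [j <= q] reflects that [Bt] has order 2. *)
Lemma SG_expand n : ~~ odd (n * k) ->
  k`!%:R ^+ n * (SG k n)%:R =
  \sum_(q < (n * k)./2.+1) (-1) ^+ q * oddf R ((n * k)./2 - q) *
     \sum_(j < q.+1) 'C(n, j)%:R * chi q.*2 j.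
Proof.
move=> evN; set N := (n * k)%N; have EN : N./2.*2 = N by rewrite even_halfK.
have -> : k`!%:R ^+ n * (SG k n)%:R =
   (-1) ^+ N./2 * (k`!%:R ^+ n * ((-1) ^+ N./2 * (SG k n)%:R)) :> R.
  by rewrite [in RHS]mulrCA signrMK.
rewrite (@SG_exact R n k _ kM) -mfunZ -exprZn bfull_k.
have [-> _] := homzX 'X_ord0 n qser_sup; rewrite -/N.
rewrite /homz mfun_sum mulr_sumr.
pose F m : R := (-1) ^+ m./2 * oddf R (N./2 - m./2) * \sum_(j < m./2.+1) 'C(n, j)%:R * chi m j.
have T (m : 'I_N.+1) : (-1) ^+ N./2 * mfun (fun j => hw (cfull R j)) ('X_ord0 ^+ (N - m) * (qser ^+ n) m) =
   (if odd m then 0 else F m).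
  have E : (qser ^+ n) m = \sum_(j < m./2.+1) 'C(n, j)%:R *: (Bt ^+ j) m.
    rewrite qserE addrC exprD1n fps_sumE.
    under eq_bigr => j _ do rewrite -scaler_nat fpsZE.
    apply: (@sum_ord_supp _ _ _ (fun j => 'C(n, j)%:R *: (Bt ^+ j) m)) => j.
    rewrite geq_min => /orP[nj|mj]; first by rewrite bin_small // scale0r.
    by rewrite (@BtX_vge j) ?scaler0 //; have := odd_double_half m; lia.
  have qfree : ((qser ^+ n) m)^`M(ord0) = 0.
    rewrite E raddf_sum big1 // => j _.
    by rewrite [LHS]mderivZ BtX_free1 scaler0.
  have mN : (m <= N)%N by rewrite -ltnS.
  rewrite mfun_mulXn1 ?hw0 // /hw oddB // (negbTE evN) /=.
  case: ifP => om; first by rewrite mul0r mulr0.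
  have Em : m./2.*2 = m by rewrite even_halfK ?om.
  have -> : (N - m)%N = (N./2 - m./2).*2 by rewrite doubleB EN Em.
  rewrite doubleK /F E mfun_sum.
  have -> : (\sum_(j < m./2.+1) mfun (fun j => hw (cfull R j)) ('C(n, j)%:R *: (Bt ^+ j) m)) =
     \sum_(j < m./2.+1) 'C(n, j)%:R * chi m j.
    apply: eq_bigr => j _; rewrite mfunZ; congr (_ * _); apply: mfun_free1.
    - by move=> i i0 e; rewrite cH_full.
    - by rewrite !hw0.
    - exact: BtX_free1.
  rewrite mulrA; congr (_ * _); rewrite /oddf.
  have mh : (m./2 <= N./2)%N by apply: half_leq.
  have -> : (-1) ^+ m./2 = (-1) ^+ N./2 * (-1) ^+ (N./2 - m./2) :> R.
    by rewrite -[in RHS](subnKC mh) addKn exprD -mulrA -expr2 sqrr_sign mulr1.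
  have -> : cfull R (ord0 : 'I_M'.+1) = - 2^-1 by rewrite /cfull mulr1.
  rewrite [(- 2^-1) ^+ _]exprNn exprVn invfM; ring.
rewrite (eq_bigr _ (fun m _ => T m)).
rewrite -(big_mkord xpredT (fun m => if odd m then 0 else F m)).
rewrite -(big_mkord xpredT (fun q => (-1) ^+ q * oddf R (N./2 - q) * \sum_(j < q.+1) 'C(n, j)%:R * chi q.*2 j)).
rewrite -{1}EN.
suff H h : \sum_(0 <= m < h.*2.+1) (if odd m then 0 else F m) =
  \sum_(0 <= q < h.+1) (-1) ^+ q * oddf R (N./2 - q) * \sum_(j < q.+1) 'C(n, j)%:R * chi q.*2 j.
  exact: H.
elim: h => [|h IHh]; first by rewrite !big_nat1.
rewrite doubleS big_nat_recr //= [in RHS]big_nat_recr //= -IHh big_nat_recr //=.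
by rewrite odd_double /= addr0 /F -doubleS doubleK.
Qed.
End ExpandT1.

(** * Majorants *)

Section Positivity.
Variables (R : realType) (K : nat).
Notation A := {mpoly R[K]}.
Implicit Types (p q : A) (f g : fps A).

Definition nnp p := forall m, 0 <= p@_m.
Definition nnf f := forall i, nnp (f i).

Lemma nnpD p q : nnp p -> nnp q -> nnp (p + q).
Proof. by move=> Hp Hq m; rewrite mcoeffD addr_ge0. Qed.
Lemma nnpM p q : nnp p -> nnp q -> nnp (p * q).
Proof. by move=> Hp Hq m; rewrite mcoeffM sumr_ge0 // => i _; rewrite mulr_ge0. Qed.
Lemma nnpZ (x : R) p : 0 <= x -> nnp p -> nnp (x *: p).
Proof. by move=> x0 Hp m; rewrite mcoeffZ mulr_ge0. Qed.
Lemma nnp0 : nnp 0. Proof. by move=> m; rewrite mcoeff0. Qed.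
Lemma nnp1 : nnp 1. Proof. by move=> m; rewrite mcoeff1 ler0n. Qed.
Lemma nnpX m : nnp 'X_[m]. Proof. by move=> m'; rewrite mcoeffX ler0n. Qed.
Lemma nnp_sum (I : Type) (r : seq I) (P : pred I) (F : I -> A) :
  (forall i, P i -> nnp (F i)) -> nnp (\sum_(i <- r | P i) F i).
Proof. by move=> H; elim/big_ind: _ => //; [exact: nnp0 | exact: nnpD]. Qed.
Lemma nnfD f g : nnf f -> nnf g -> nnf (f + g).
Proof. by move=> Hf Hg i; apply: nnpD. Qed.
Lemma nnfM f g : nnf f -> nnf g -> nnf (f * g).
Proof. by move=> Hf Hg i; apply: nnp_sum => j _; apply: nnpM. Qed.
Lemma nnf1 : nnf 1.
Proof. by move=> i; rewrite fpsE1; case: eqP => _; [exact: nnp1 | exact: nnp0]. Qed.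
Lemma nnfX f n : nnf f -> nnf (f ^+ n).
Proof. by move=> Hf; elim: n => [|n IHn]; [exact: nnf1 | rewrite exprS; apply: nnfM]. Qed.
Lemma nnf_bsubst (c : nat -> R) f : (forall m, 0 <= c m) -> nnf f ->
  nnf (bsubst (fun m => (c m)%:A) f).
Proof.
move=> c0 Hf i; apply: nnp_sum => m _; rewrite -scalerAl mul1r; apply: nnpZ => //.
exact: nnfX.
Qed.

Lemma nnf_dom_exp f g n : nnf f -> nnf (g - f) -> nnf (g ^+ n - f ^+ n).
Proof.
move=> Hf Hgf; have Hg : nnf g by rewrite -(subrK f g); apply: nnfD.
elim: n => [|n IHn]; first by rewrite subrr => i m; rewrite mcoeff0.
have -> : g ^+ n.+1 - f ^+ n.+1 = g * (g ^+ n - f ^+ n) + (g - f) * f ^+ n.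
  by rewrite !exprS; ring.
by apply: nnfD; apply: nnfM => //; apply: nnfX.
Qed.

Lemma mfun_mono (om : 'I_K -> nat -> R) p q : (forall i e, 0 <= om i e) -> nnp (q - p) ->
  mfun om p <= mfun om q.
Proof.
move=> om0 pq; rewrite -subr_ge0 -mulN1r -mfunZ -mfunD scaleN1r sumr_ge0 // => m _.
by rewrite mulr_ge0 // prodr_ge0.
Qed.

Lemma hw_abs (c : R) e : `|hw c e| = hw `|c| e.
Proof.
rewrite /hw; case: ifP => _; first by rewrite normr0.
by rewrite normrM normrM normrX normfV !(ger0_norm (ler0n _ _)).
Qed.
Lemma hw_ge0 (c : R) e : 0 <= c -> 0 <= hw c e.
Proof. by move=> c0; rewrite -(ger0_norm c0) -hw_abs. Qed.

Lemma mfun_abs (c : 'I_K -> R) p : nnp p ->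
  `|mfun (fun i => hw (c i)) p| <= mfun (fun i => hw `|c i|) p.
Proof.
move=> Hp; apply: le_trans (ler_norm_sum _ _ _) _; apply: ler_sum => m _.
rewrite normrM ger0_norm // normr_prod; rewrite le_eqVlt; apply/orP; left; apply/eqP.
by congr (_ * _); apply: eq_bigr => i _; rewrite hw_abs.
Qed.
Lemma mfun_alg (c : 'I_K -> R) (x : R) : mfun (fun i => hw (c i)) (x%:A : A) = x.
Proof.
rewrite mfunZ -mpolyX0 mfunX big1 ?mulr1 // => i _.
by rewrite mnm0E hw0.
Qed.
End Positivity.

(** * Coefficient bounds for exponentials *)

Section ExpBound.
Variable R : realType.
Notation S := (fps R^o).

Lemma trunc_pow (A : comAlgType R) (f : fps A) n a m : (m <= n)%N ->
  (fps_trunc n f ^+ a)`_m = (f ^+ a) m.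
Proof.
elim: a m => [|a IHa] m mn; first by rewrite !expr0 coef1 fpsE1.
rewrite !exprS coefM fpsME; apply: eq_bigr => i _; rewrite IHa; last first.
  exact: leq_trans (leq_subr _ _) mn.
by rewrite coef_poly ltnS (leq_trans _ mn) // -ltnS.
Qed.

Lemma coef_le_eval (p : {poly R}) x i : (forall j, 0 <= p`_j) -> 0 <= x ->
  p`_i * x ^+ i <= p.[x].
Proof.
move=> p0 x0; have [ip|pi] := ltnP i (size p); last first.
  by rewrite nth_default // mul0r horner_coef sumr_ge0 // => j _; rewrite mulr_ge0 ?exprn_ge0.
rewrite horner_coef (bigD1 (Ordinal ip)) //= lerDl sumr_ge0 // => j _.
by rewrite mulr_ge0 ?exprn_ge0.
Qed.

(** Cauchy's estimate for nonnegative coefficients: a single term is at most the whole sum at [x].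
    Only the coefficients of [G] up to [i] matter, so [G] is truncated and convergence is not an
    issue. *)
Lemma exp_coef_bound (G : S) (x : R) i : (forall j, 0 <= G j) -> 0 <= x ->
  (fps_exp G) i * x ^+ i <= expR (\sum_(j < i.+1) G j * x ^+ j).
Proof.
move=> G0 x0; set y := \sum_(j < i.+1) _.
have y0 : 0 <= y by rewrite sumr_ge0 // => j _; rewrite mulr_ge0 ?exprn_ge0.
have key a : (G ^+ a) i * x ^+ i <= y ^+ a.
  rewrite -(@trunc_pow _ G i) //.
  have -> : y = (fps_trunc i G).[x] by rewrite horner_poly.
  rewrite -horner_exp; apply: (@coef_le_eval (fps_trunc i G ^+ a)) => // j.
  elim: a j => [|a IHa] j; first by rewrite expr0 coef1 ler0n.
  rewrite exprS coefM sumr_ge0 // => l _; rewrite mulr_ge0 // coef_poly.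
  by case: ifP.
apply: le_trans (expR_partial i.+1 y0).
rewrite fps_expE /bsubst mulr_suml; apply: ler_sum => a _.
by rewrite alg_regular -mulrA mulrC ler_wpM2r ?invr_ge0 // key.
Qed.

Lemma geo_half (x : R) n : 0 <= x -> x <= 1/2 -> \sum_(j < n) x ^+ j <= 2.
Proof.
move=> x0 x2; have h : (1 - x) * \sum_(j < n) x ^+ j = 1 - x ^+ n.
  by rewrite -[RHS]opprB subrX1 -mulNr opprB.
have s0 : 0 <= \sum_(j < n) x ^+ j by rewrite sumr_ge0 // => j _; rewrite exprn_ge0.
have := exprn_ge0 n x0; nra.
Qed.
End ExpBound.

Section Majorant.
Variables (R : realType) (M' k : nat).
Hypotheses (kM : (k <= M'.+1)%N) (k0 : (0 < k)%N).
Notation A := {mpoly R[M'.+1]}.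
Notation S := (fps R^o).
Notation gserM := (gser R M').
Notation BtM := (Bt R M' k).
Notation ha := (fun i => hw `|@cH R M' k i|).

(** The weights are replaced by their absolute values; this dominates [chi] because [Bt] has
    nonnegative coefficients. *)
Definition beta m j : R := mfun ha ((BtM ^+ j) m).

Lemma ha_ge0 i e : 0 <= ha i e. Proof. exact: hw_ge0. Qed.

Lemma gbinom_sign m : 0 <= (-1) ^+ m * gbinom (- (1/2) : R) m.
Proof.
rewrite /gbinom mulrA divr_ge0 //.
have -> : (-1) ^+ m = \prod_(i < m) (-1 : R) by rewrite prodr_const card_ord.
rewrite -big_split prodr_ge0 //= => i _.
by have := ler0n R i; lra.
Qed.

Lemma isqrt_nnf : nnf (isqrt1mz2 R M').
Proof.
rewrite isqrtE fps_binE.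
have -> : bsubst (fun m => (gbinom (- (1/2)) m)%:A) (- fX ^+ 2 : fps A) =
   bsubst (fun m => ((-1) ^+ m * gbinom (- (1/2)) m)%:A) (fX ^+ 2).
  apply/fpsP=> i; apply: eq_bigr => m _.
  by rewrite -scaleN1r exprZn fpsZE -!scalerAl !mul1r scalerA mulrC.
apply: nnf_bsubst => [m|i]; first exact: gbinom_sign.
by rewrite fps_XnE; case: (_ == _); [exact: nnp1 | exact: nnp0].
Qed.
Lemma gser_nnf : nnf gserM.
Proof.
apply: nnfM isqrt_nnf; rewrite fps_expE; apply: nnf_bsubst => [m|i].
  by rewrite invr_ge0.
rewrite fps_XM /Wser; case: i => [|[|i]] /=; [exact: nnp0 | exact: nnp0 |].
by rewrite /tv; case: ifP => _; [exact: nnpX | exact: nnp0].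
Qed.
Lemma Bt_nnf : nnf BtM.
Proof.
move=> i; rewrite /Bt; case: eqP => _; first exact: nnp0.
by apply: nnpZ => //; apply: gser_nnf.
Qed.

Lemma chi_beta m j : `|chi R M' k m j| <= beta m j.
Proof. by apply: mfun_abs; apply: nnfX; apply: Bt_nnf. Qed.
Lemma beta_ge0 m j : 0 <= beta m j.
Proof. by apply: le_trans (normr_ge0 _) (chi_beta m j). Qed.

Lemma sum_beta n m : \sum_(j < n.+1) 'C(n, j)%:R * beta m j = mfun ha ((qser R M' k ^+ n) m).
Proof.
rewrite qserE addrC exprD1n fps_sumE mfun_sum; apply: eq_bigr => j _.
by rewrite -scaler_nat fpsZE mfunZ.
Qed.

Lemma ffact_le_exp d : (k ^_ d <= k ^ d)%N.
Proof.
by elim: d => // d IHd; rewrite ffactnSr expnSr leq_mul // leq_subr.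
Qed.

(** Falling factorials are at most powers, so [qser] is dominated coefficientwise by [gser (k X)];
    powers and the positive functional preserve the domination. *)
Lemma sum_beta_le n m : \sum_(j < n.+1) 'C(n, j)%:R * beta m j <=
  k%:R ^+ m * mfun ha ((gserM ^+ n) m).
Proof.
rewrite sum_beta -mfunZ.
pose gk : fps A := fun d => k%:R ^+ d *: gserM d.
have -> : k%:R ^+ m *: (gserM ^+ n) m = (gk ^+ n) m.
  pose rho (j : nat) (a b : A) := b = (k%:R ^+ j : R) *: a.
  suff /(_ m.+1 m (ltnSn m)) : forall K, frel rho K (gserM ^+ n) (gk ^+ n) by [].
  move=> K; apply: frelX => //.
  - by move=> j; rewrite /rho scaler0.
  - by rewrite /rho expr0 scale1r.
  - by move=> j a b a' b' -> ->; rewrite /rho scalerDr.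
  - by move=> i j a b a' b' -> ->; rewrite /rho -scalerAl -scalerAr scalerA exprD.
apply: mfun_mono; first exact: ha_ge0.
apply: (@nnf_dom_exp R M'.+1 (qser R M' k) gk n) => i.
  by apply: nnpZ => //; apply: gser_nnf.
rewrite fpsBE /gk /qser -scalerBl; apply: nnpZ; last exact: gser_nnf.
by rewrite subr_ge0 -natrX ler_nat ffact_le_exp.
Qed.

(** The exponent that remains when all Gaussian variables of the [n]-th power of [gser] are
    integrated out with positive weights. *)
Definition Gmaj n : S := \sum_(j < M') (`|@cH R M' k (lift ord0 j)| * n%:R ^+ 2) *: fX ^+ (j.+2).*2 +
   (n%:R / 2) *: (- Lg (1 : R^o)).

Lemma gauss_gser n m : mfun ha ((gserM ^+ n) m) = fps_exp (Gmaj n) m.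
Proof.
have -> : gserM ^+ n = fps_exp (\sum_(j < M') (n%:R *: fX ^+ j.+2) * fps_const 'X_(lift ord0 j)) *
    isqrt1mz2 R M' ^+ n.
  rewrite /gser exprMn -fps_expMn; last exact: Wser_vge.
  rewrite WserE -sumrMnl; congr (fps_exp _ * _); apply: eq_bigr => j _.
  by rewrite -scaler_nat -scalerAl mulrC.
have D i := @cder_fder R M'.+1 i.
have := @mgauss_elim R M'.+1 ha (fun i => `|@cH R M' k i|) [seq lift ord0 j | j <- index_enum 'I_M']
   (fun i => n%:R *: fX ^+ i.+1) (isqrt1mz2 R M' ^+ n) m.
rewrite !big_map => ->.
- rewrite -[RHS](@mfun_alg R M'.+1 (fun i => `|@cH R M' k i|)).
  rewrite -[(fps_exp (Gmaj n) m)%:A]/(liftA A (fps_exp (Gmaj n)) m).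
  congr (mfun _ (_ m)); rewrite [in RHS]/fps_exp liftA_subst -/(fps_exp _).
  have l1 : vge 1 (liftA A (- Lg (1 : R^o))).
    by apply: vge1P; rewrite /liftA fpsNE /Lg fps_log0 oppr0 scale0r.
  rewrite /Gmaj liftAD liftAZ fps_expD.
  + have LS (F : 'I_M' -> S) : liftA A (\sum_j F j) = \sum_j liftA A (F j).
      apply: (big_morph (liftA A)); first exact: liftAD.
      by rewrite -[0 in LHS](scale0r (0 : S)) liftAZ scale0r.
    have E1 : liftA A (\sum_(j < M') (`|@cH R M' k (lift ord0 j)| * n%:R ^+ 2) *: fX ^+ (j.+2).*2) =
        \sum_(j < M') `|@cH R M' k (lift ord0 j)| *: (n%:R *: fX ^+ (lift ord0 j).+1) ^+ 2.
      rewrite LS; apply: eq_bigr => j _; rewrite liftAZ liftAX liftA_X exprZn scalerA -exprM.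
      by rewrite lift0 muln2.
    have E2 : isqrt1mz2 R M' ^+ n = fps_exp ((n%:R / 2) *: liftA A (- Lg (1 : R^o))).
      have -> : isqrt1mz2 R M' = fps_exp ((1/2) *: liftA A (- Lg (1 : R^o))).
        rewrite isqrtE fps_binomE; last exact: mX2_vge.
        congr fps_exp; rewrite liftAN scaleNr scalerN; congr (- (_ *: _)).
        by rewrite /Lg /fps_log1p liftA_subst liftAN rmorph1 mul1r liftAX liftA_X.
      rewrite -fps_expMn; last exact: vgeZ.
      by congr fps_exp; rewrite -scaler_nat scalerA mulrA mulr1.
    by rewrite E1 E2.
  + apply: vge1P; rewrite /liftA fps_sumE big1 ?scale0r // => j _.
    by rewrite fpsZE fps_XnE scaler0.
  + exact: vgeZ.
- by rewrite map_inj_uniq ?index_enum_uniq //; apply: lift_inj.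
- by move=> i _ e; apply: hwS.
- by move=> i j _ _; rewrite (fderZ (D i)) cder_X scaler0.
- by move=> i _; apply: vgeZ; rewrite exprS; apply: vgeMr; apply: vge1P.
- by move=> i _; rewrite (fderX (D i)) isqrt_free mulr0 scaler0.
Qed.

(** Terms quadratic in [n] start with the contribution of [t_2], in degree 4; in degree 2 only
    [- (n/2) log (1 - X^2)] contributes. The variable [t_1] would have produced [n^2] there. *)
Lemma Gmaj_coef n i : (0 < n)%N ->
  0 <= Gmaj n i <= (if (i < 2)%N then 0 else if (i < 4)%N then n%:R else n%:R ^+ 2).
Proof.
move=> n0; have n1 : 1 <= n%:R :> R by rewrite ler1n.
have nn : n%:R <= n%:R ^+ 2 :> R by rewrite expr2 ler_peMl // (le_trans ler01).
rewrite /Gmaj fpsDE fpsZE fpsNE Lg_coef fps_sumE.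
have E : \sum_(j < M') ((`|@cH R M' k (lift ord0 j)| * n%:R ^+ 2) *: fX ^+ (j.+2).*2 : S) i =
   if [&& ~~ odd i, (4 <= i)%N & (i./2 <= M'.+1)%N] then n%:R ^+ 2 / (2 * i./2%:R) else 0.
  have T (j : 'I_M') : ((`|@cH R M' k (lift ord0 j)| * n%:R ^+ 2) *: fX ^+ (j.+2).*2 : S) i =
      (n%:R ^+ 2 / (2 * j.+2%:R)) * (i == (j.+2).*2)%:R.
    rewrite fpsZE fps_XnE /cH /hcoef /= normrN ger0_norm ?invr_ge0 ?mulr_ge0 //.
    by rewrite [_^-1 * _]mulrC.
  rewrite (eq_bigr _ (fun j _ => T j)).
  case: ifP => [/and3P[oi i4 iM]|H].
    have iE : i = i./2.*2 by rewrite even_halfK.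
    have i2 : (2 <= i./2)%N by rewrite -leq_double -iE.
    have Hj : (i./2.-2 < M')%N by lia.
    have jE : (Ordinal Hj).+2 = i./2 by rewrite /=; lia.
    rewrite (bigD1 (Ordinal Hj)) //= big1 ?addr0 => [|j ji].
      have -> : i./2.-2.+2 = i./2 by lia.
      by rewrite -iE eqxx mulr1.
    have -> : (i == j.+2.*2) = false; last by rewrite mulr0.
    apply: contraNF ji => /eqP iE'; apply/eqP/val_inj => /=.
    by rewrite iE' doubleK.
  rewrite big1 // => j _; case: eqP => [iE|_]; last by rewrite mulr0.
  by exfalso; move: H; rewrite iE odd_double doubleK; have := ltn_ord j; lia.
rewrite E; case: (boolP (odd i)) => oi /=.
  rewrite oppr0 scaler0 addr0 lexx /=; case: ifP => // _; case: ifP => // _.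
  by rewrite exprn_ge0.
have iE : i = i./2.*2 by rewrite even_halfK.
move: iE; move: (i./2) => h ->; rewrite expr1n.
case: h => [|[|h]] /=; first by rewrite oppr0 scaler0 addr0 lexx.
  by rewrite add0r opprK /GRing.scale /= invr1; lra.
rewrite opprK /GRing.scale /= !mulr1.
have h2 : 2 <= h.+2%:R :> R by rewrite ler_nat.
have b : (0:R) <= n%:R ^+ 2 / (2 * h.+2%:R) <= (n%:R ^+ 2 / 4 : R).
  apply/andP; split; first by rewrite divr_ge0 ?exprn_ge0 // mulr_ge0.
  have : (2 * h.+2%:R)^-1 <= (4^-1 : R) by rewrite lef_pV2 ?posrE //; lra.
  by move=> H; apply: ler_wpM2l H; apply: exprn_ge0.
have c : (0:R) <= n%:R / 2 * h.+2%:R^-1 <= (n%:R / 4 : R).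
  apply/andP; split; first by rewrite !mulr_ge0 // invr_ge0.
  have H : h.+2%:R^-1 <= (2^-1 : R) by rewrite lef_pV2 ?posrE //; lra.
  by apply: le_trans (ler_wpM2l _ H) _; [rewrite divr_ge0|lra].
have aux (X Y Z W : R) : 0 <= X <= Z / 4 -> 0 <= Y <= W / 4 -> W <= Z -> 0 <= Z ->
    0 <= X + Y <= Z /\ 0 <= 0 + Y <= Z.
  by move=> /andP[? ?] /andP[? ?] ? ?; split; apply/andP; split; lra.
have [H1 H2] := aux _ _ _ _ b c nn (exprn_ge0 2 (ler0n _ _)).
by case: ifP => _; [exact: H1|exact: H2].
Qed.

(** Cauchy's estimate at [x = sqrt (C/n)]. For [N = n (k+1)] the quantity [N x^2] is the constant
    [(k+1) C], and the degrees from 4 on sum to at most [2 (N x^2)^2] since [x <= 1/2]. Taking [N]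
    larger than [n] leaves room for the rising factorials met in [aval_le]. *)
Lemma majorant (C : R) n q : 0 < C -> 4 * C <= n%:R ->
  \sum_(j < (n * k.+1).+1) 'C(n * k.+1, j)%:R * beta q.*2 j <=
  k%:R ^+ q.*2 * (n%:R / C) ^+ q * expR (k.+1%:R * C + 2 * (k.+1%:R * C) ^+ 2).
Proof.
move=> C0 Cn; have n0 : 0 < n%:R :> R by lra.
have nN : (0 < n)%N by rewrite ltr0n in n0.
set n2 := (n * k.+1)%N; have n20 : (0 < n2)%N by rewrite muln_gt0 nN.
apply: le_trans (sum_beta_le _ _) _; rewrite -mulrA ler_wpM2l ?exprn_ge0 // gauss_gser.
pose y : R := C / n%:R; have y0 : 0 < y by rewrite divr_gt0.
have y4 : y <= 1/4 by rewrite ler_pdivrMr //; lra.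
pose x := Num.sqrt y; have x0 : 0 <= x by apply: sqrtr_ge0.
have xy : x ^+ 2 = y by rewrite sqr_sqrtr // ltW.
have xx : x * x <= 1/4 by rewrite -expr2 xy.
have x2 : x <= 1/2 by nra.
have yq : (n%:R / C) ^+ q = (x ^+ q.*2)^-1.
  by rewrite -mul2n exprM xy -exprVn /y invf_div.
rewrite yq mulrC ler_pdivlMr; last by rewrite -mul2n exprM xy exprn_gt0.
apply: le_trans (exp_coef_bound _ _ x0) _ => [j|].
  by case/andP: (Gmaj_coef j n20).
rewrite ler_expR.
have n2y : n2%:R * y = k.+1%:R * C.
  by rewrite /y /n2 natrM; field; rewrite gt_eqF.
apply: le_trans (_ : n2%:R * x ^+ 2 + 2 * (n2%:R * x ^+ 2) ^+ 2 <= _); last by rewrite xy n2y.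
(* The range is enlarged by four indices so that the degrees 0 to 3 can be split off; of these only
   degree 2 contributes. *)
apply: le_trans (_ : \sum_(j < (q.*2.+1) + 4) (if (j < 2)%N then 0 else if (j < 4)%N
     then (if j == 2 :> nat then n2%:R * x ^+ 2 else 0) else n2%:R ^+ 2 * x ^+ j) <= _).
  rewrite [X in _ <= X]big_split_ord /= -[X in X <= _]addr0; apply: lerD; last first.
    apply: sumr_ge0 => j _; case: ifP => // _; case: ifP => [_|_].
      by case: ifP => // _; rewrite mulr_ge0 ?exprn_ge0.
    by rewrite mulr_ge0 ?exprn_ge0.
  apply: ler_sum => j _; have /andP[g0 g1] := Gmaj_coef j n20.
  have xj : 0 <= x ^+ j by rewrite exprn_ge0.
  case: ifP g1 => [_ g1|j2]; first by have := le_anti (introT andP (conj g1 g0)) => ->; rewrite mul0r.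
  case: ifP => [j4 g1|_ g1]; last by rewrite ler_wpM2r.
  case: eqP => [jE|j3]; first by move: g1; rewrite jE => g1; rewrite ler_wpM2r ?exprn_ge0.
  have -> : nat_of_ord j = 3 by move: j2 j4 j3; clear; lia.
  have -> : Gmaj n2 3 = 0; last by rewrite mul0r.
  rewrite /Gmaj fpsDE fpsZE fpsNE Lg_coef /= oppr0 scaler0 addr0 fps_sumE big1 // => l _.
  rewrite fpsZE fps_XnE; have -> : (3 == l.+2.*2)%N = false; last by rewrite scaler0.
  by clear; apply/eqP; lia.
rewrite addnC; do 4 rewrite big_ord_recl /=.
rewrite !add0r; apply: lerD => //.
have -> : \sum_(i < q.*2.+1) n2%:R ^+ 2 * x ^+ bump 0 (bump 0 (bump 0 (bump 0 i))) =
    (n2%:R * x ^+ 2) ^+ 2 * \sum_(i < q.*2.+1) x ^+ i.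
  rewrite mulr_sumr; apply: eq_bigr => i _; rewrite /bump /= !add1n !exprS; ring.
by rewrite mulrC ler_wpM2r ?exprn_ge0 ?mulr_ge0 ?exprn_ge0 // geo_half.
Qed.
End Majorant.

(* Convergent expansions with a uniform remainder: [V] majorizes
   [\sum_l `|F l| e' ^+ l], and the bound is shaped to be stable under products. *)
Section Rep.
Variables (R : realType) (e' : R).
Hypothesis e'0 : 0 < e'.
Notation S := (fps R^o).
Implicit Types (f g : R -> R) (F G : S).

Definition psum' r F (x : R) : R := \sum_(l < r) F l * x ^+ l.
Definition asum r F (x : R) : R := \sum_(l < r) `|F l| * x ^+ l.

Definition Rep f F V := forall e, 0 <= e -> e <= e' -> forall r,
  `|f e - psum' r F e| <= (e / e') ^+ r * (V - asum r F e').

Lemma psumM (u v : nat -> R) (x : R) r :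
  \sum_(m < r) (\sum_(i < m.+1) u i * v (m - i)%N) * x ^+ m =
  \sum_(l < r) u l * x ^+ l * \sum_(l' < (r - l)%N) v l' * x ^+ l'.
Proof.
elim: r => [|r IHr]; first by rewrite !big_ord0.
rewrite big_ord_recr /= IHr mulr_suml [in RHS]big_ord_recr /= subSn // subnn big_ord1.
rewrite [X in _ + X = _]big_ord_recr /= subnn addrA; congr (_ + _); last first.
  by rewrite expr0 mulr1 mulrAC.
rewrite -big_split; apply: eq_bigr => i _ /=.
have ir : (i <= r)%N by rewrite ltnW.
rewrite subSn // big_ord_recr /= mulrDr; congr (_ + _).
have E : x ^+ r = x ^+ i * x ^+ (r - i) by rewrite -exprD subnKC.
by rewrite E; ring.
Qed.

Lemma ee0 e r : 0 <= e -> 0 <= (e / e') ^+ r.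
Proof. by move=> e0; rewrite exprn_ge0 // divr_ge0 // ltW. Qed.

(** The low terms of [F] meet remainders of [g] of complementary order, and the remainder of [f]
    meets [g] itself. Since the bounds subtract the partial sums, the contributions add up to [V W]
    minus the partial sum of the product. *)
Lemma RepM f F V g G W : Rep f F V -> Rep g G W -> Rep (fun e => f e * g e) (F * G) (V * W).
Proof.
move=> Hf Hg e e0 ee r.
pose rg l := g e - psum' (r - l) G e.
have -> : f e * g e - psum' r (F * G) e =
   \sum_(l < r) F l * e ^+ l * rg l + (f e - psum' r F e) * g e.
  rewrite /psum' [X in _ - X](psumM F G) mulrBl mulr_suml.
  have -> : \sum_(l < r) F l * e ^+ l * rg l = \sum_(l < r) F l * e ^+ l * g e -
     \sum_(l < r) F l * e ^+ l * psum' (r - l) G e.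
    by rewrite -sumrB; apply: eq_bigr => l _; rewrite mulrBr.
  by rewrite /psum'; ring.
have gW : `|g e| <= W.
  have := Hg e e0 ee 0%N; rewrite /psum' /asum !big_ord0 !subr0 expr0 mul1r //.
have Fr := Hf e e0 ee r.
apply: le_trans (ler_normD _ _) _.
have B1 : `|\sum_(l < r) F l * e ^+ l * rg l| <=
    (e / e') ^+ r * \sum_(l < r) `|F l| * e' ^+ l * (W - asum (r - l) G e').
  apply: le_trans (ler_norm_sum _ _ _) _; rewrite mulr_sumr; apply: ler_sum => l _.
  rewrite normrM normrM (ger0_norm (exprn_ge0 _ e0)).
  apply: le_trans (ler_wpM2l _ (Hg e e0 ee (r - l)%N)) _; first by rewrite mulr_ge0 ?exprn_ge0.
  have lr : (l <= r)%N by rewrite ltnW.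
  have E : e ^+ l = (e / e') ^+ l * e' ^+ l by rewrite -exprMn divfK // gt_eqF.
  have E2 : (e / e') ^+ r = (e / e') ^+ l * (e / e') ^+ (r - l) by rewrite -exprD subnKC.
  by rewrite E2 E le_eqVlt; apply/orP; left; apply/eqP; ring.
have B2 : `|(f e - psum' r F e) * g e| <= (e / e') ^+ r * ((V - asum r F e') * W).
  by rewrite normrM mulrA; apply: ler_pM.
apply: le_trans (lerD B1 B2) _; rewrite -mulrDr ler_wpM2l ?ee0 //.
have -> : \sum_(l < r) `|F l| * e' ^+ l * (W - asum (r - l) G e') + (V - asum r F e') * W =
   V * W - \sum_(l < r) `|F l| * e' ^+ l * asum (r - l) G e'.
  have -> : \sum_(l < r) `|F l| * e' ^+ l * (W - asum (r - l) G e') =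
     asum r F e' * W - \sum_(l < r) `|F l| * e' ^+ l * asum (r - l) G e'.
    by rewrite /asum mulr_suml -sumrB; apply: eq_bigr => l _; rewrite mulrBr.
  ring.
rewrite lerD2l lerN2 /asum -(psumM (fun l => `|F l|) (fun l => `|G l|)).
apply: ler_sum => m _; rewrite ler_wpM2r ?exprn_ge0 ?(ltW e'0) //.
apply: le_trans (ler_norm_sum _ _ _) _; apply: ler_sum => i _.
by rewrite normrM.
Qed.

Lemma RepD f F V g G W : Rep f F V -> Rep g G W -> Rep (fun e => f e + g e) (F + G) (V + W).
Proof.
move=> Hf Hg e e0 ee r.
have -> : f e + g e - psum' r (F + G) e = (f e - psum' r F e) + (g e - psum' r G e).
  rewrite /psum' (eq_bigr (fun l : 'I_r => F l * e ^+ l + G l * e ^+ l)) => [|l _].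
    by rewrite big_split /=; ring.
  by rewrite fpsDE mulrDl.
apply: le_trans (ler_normD _ _) _; apply: le_trans (lerD (Hf e e0 ee r) (Hg e e0 ee r)) _.
rewrite -mulrDr ler_wpM2l ?ee0 //.
have : asum r (F + G) e' <= asum r F e' + asum r G e'.
  rewrite /asum -big_split; apply: ler_sum => l _ /=.
  by rewrite fpsDE -mulrDl ler_wpM2r ?exprn_ge0 ?(ltW e'0) //; apply: ler_normD.
by lra.
Qed.
Lemma RepZ f F V (x : R) : Rep f F V -> Rep (fun e => x * f e) (x *: F) (`|x| * V).
Proof.
move=> Hf e e0 ee r.
have -> : x * f e - psum' r (x *: F) e = x * (f e - psum' r F e).
  rewrite mulrBr /psum' mulr_sumr; congr (_ - _); apply: eq_bigr => l _.
  by rewrite fpsZE /GRing.scale /= mulrA.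
have -> : asum r (x *: F) e' = `|x| * asum r F e'.
  rewrite /asum mulr_sumr; apply: eq_bigr => l _.
  by rewrite fpsZE /GRing.scale /= normrM mulrA.
by rewrite normrM -mulrBr mulrCA ler_wpM2l //; apply: Hf.
Qed.
Lemma Rep_geo (c : R) : 0 <= c -> c * e' < 1 ->
  Rep (fun e => (1 - c * e)^-1) (fps_binom (- 1) (- (c *: fX))) ((1 - c * e')^-1).
Proof.
move=> c0 ce' e e0 ee r.
have X1 : vge 1 (- (c *: fX) : S) by apply: vgeN; apply: vgeZ; apply: vge1P.
have FE l : fps_binom (- 1) (- (c *: fX) : S) l = c ^+ l.
  have U := fps_binomN 1 X1; rewrite (fps_binom_nat 1) // expr1 in U.
  set F := fps_binom _ _ in U *.
  elim: l => [|l IHl]; first by rewrite /F fps_binom0.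
  have /fpsP/(_ l.+1) := U; rewrite mulrDr mulr1 mulrN -scalerAr fpsDE fpsNE fpsZE.
  rewrite [F * fX]mulrC fps_XM fpsE1 IHl /GRing.scale /= => /eqP.
  by rewrite subr_eq0 => /eqP ->; rewrite exprS.
have G (x : R) : c * x < 1 -> (1 - c * x) * \sum_(l < r) c ^+ l * x ^+ l = 1 - (c * x) ^+ r.
  move=> _; rewrite (eq_bigr (fun l : 'I_r => (c * x) ^+ l)) => [|l _]; last by rewrite exprMn.
  by rewrite -(opprB (c * x) 1) mulNr -subrX1 opprB.
have ce : c * e < 1 by apply: le_lt_trans ce'; rewrite ler_wpM2l.
have nz : 1 - c * e != 0 by rewrite gt_eqF // subr_gt0.
have nz' : 1 - c * e' != 0 by rewrite gt_eqF // subr_gt0.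
have T x : c * x < 1 -> (1 - c * x)^-1 - \sum_(l < r) c ^+ l * x ^+ l = (c * x) ^+ r / (1 - c * x).
  move=> cx; have nzx : 1 - c * x != 0 by rewrite gt_eqF // subr_gt0.
  apply: (mulfI nzx); rewrite mulrBr G // divff // mulrCA divff // mulr1; ring.
have -> : psum' r (fps_binom (- 1) (- (c *: fX))) e = \sum_(l < r) c ^+ l * e ^+ l.
  by apply: eq_bigr => l _; rewrite FE.
have -> : asum r (fps_binom (- 1) (- (c *: fX))) e' = \sum_(l < r) c ^+ l * e' ^+ l.
  by apply: eq_bigr => l _; rewrite FE ger0_norm ?exprn_ge0.
rewrite !T // ger0_norm; last first.
  by rewrite divr_ge0 ?exprn_ge0 ?mulr_ge0 // subr_ge0 ltW.
rewrite mulrA -exprMn; have -> : e / e' * (c * e') = c * e by field; rewrite gt_eqF.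
rewrite ler_wpM2l ?exprn_ge0 ?mulr_ge0 // lef_pV2 ?posrE ?subr_gt0 //.
by rewrite lerD2l lerN2 ler_wpM2l.
Qed.
Lemma Rep_1 : Rep (fun=> 1) 1 1.
Proof.
move=> e e0 ee [|r]; first by rewrite /psum' /asum !big_ord0 !subr0 normr1 expr0 mul1r.
rewrite /psum' /asum !big_ord_recl !big1 ?addr0; last first.
- by move=> i _; rewrite fpsE1 mul0r.
- by move=> i _; rewrite fpsE1 normr0 mul0r.
by rewrite fpsE1 normr1 !expr0 mulr1 subrr normr0 mulr0.
Qed.
Lemma Rep_X : Rep id fX e'.
Proof.
move=> e e0 ee [|[|r]].
- by rewrite /psum' /asum !big_ord0 !subr0 expr0 mul1r ger0_norm.
- by rewrite /psum' /asum !big_ord1 fps_XE normr0 !mul0r !subr0 expr1 ger0_norm // divfK // gt_eqF.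
rewrite /psum' /asum !big_ord_recl !big1 ?addr0; last first.
- by move=> i _; rewrite fps_XE mul0r.
- by move=> i _; rewrite fps_XE normr0 mul0r.
by rewrite !fps_XE /= normr0 normr1 !mul0r !add0r !mul1r /bump /= !expr1 !subrr normr0 mulr0.
Qed.
Lemma Rep_prod n (f : nat -> R -> R) (F : nat -> S) (V : nat -> R) :
  (forall i, (i < n)%N -> Rep (f i) (F i) (V i)) ->
  Rep (fun e => \prod_(i < n) f i e) (\prod_(i < n) F i) (\prod_(i < n) V i).
Proof.
elim: n => [|n IHn] H e e0 ee r; first by rewrite !big_ord0; apply: Rep_1.
rewrite !big_ord_recr /=; apply: (@RepM (fun e => \prod_(i < n) f i e)) => //.
  by apply: IHn => i ni; apply: H; rewrite ltnS ltnW.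
exact: H.
Qed.
Lemma Rep_sum n (f : nat -> R -> R) (F : nat -> S) (V : nat -> R) :
  (forall i, (i < n)%N -> Rep (f i) (F i) (V i)) ->
  Rep (fun e => \sum_(i < n) f i e) (\sum_(i < n) F i) (\sum_(i < n) V i).
Proof.
elim: n => [|n IHn] H e e0 ee r.
  rewrite !big_ord0; have := RepZ 0 Rep_1 e0 ee r.
  by rewrite scale0r normr0 !mul0r.
rewrite !big_ord_recr /=; apply: (@RepD (fun e => \sum_(i < n) f i e)) => //.
  by apply: IHn => i ni; apply: H; rewrite ltnS ltnW.
exact: H.
Qed.
Lemma Rep_Xn n : Rep (fun e => e ^+ n) (fX ^+ n) (e' ^+ n).
Proof.
have := @Rep_prod n (fun _ => id) (fun _ => fX) (fun _ => e') (fun _ _ => Rep_X).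
rewrite !prodr_const card_ord => H e e0 ee r; have := H e e0 ee r.
by rewrite prodr_const card_ord.
Qed.
Lemma Rep_asum f F V r : Rep f F V -> asum r F e' <= V.
Proof.
move=> /(_ e' (ltW e'0) (lexx _) r); rewrite divff ?gt_eqF // expr1n mul1r => H.
by have := le_trans (normr_ge0 _) H; rewrite subr_ge0.
Qed.
Lemma asum_ge0 F r : 0 <= asum r F e'.
Proof. by rewrite sumr_ge0 // => l _; rewrite mulr_ge0 ?exprn_ge0 // ltW. Qed.
Lemma Rep_le f F V r e : Rep f F V -> 0 <= e -> e <= e' ->
  `|f e - psum' r F e| <= (e / e') ^+ r * V.
Proof.
move=> H e0 ee; apply: le_trans (H e e0 ee r) _.
by rewrite ler_wpM2l ?ee0 // lerBlDr lerDl asum_ge0.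
Qed.
(** Beyond the radius [e'] nothing is known about [f], but the truncated series is a polynomial of
    degree below [r] and grows at most like [(e/e')^r]. *)
Lemma Rep_psum f F V r e : Rep f F V -> e' <= e -> `|psum' r F e| <= (e / e') ^+ r * V.
Proof.
move=> H ee; have q1 : 1 <= e / e' by rewrite ler_pdivlMr // mul1r.
apply: le_trans (_ : (e / e') ^+ r * asum r F e' <= _); last first.
  by rewrite ler_wpM2l ?(Rep_asum _ H) // ee0 // (le_trans (ltW e'0)).
apply: le_trans (ler_norm_sum _ _ _) _; rewrite mulr_sumr; apply: ler_sum => l _.
have e0 : 0 <= e by apply: le_trans ee; apply: ltW.
rewrite normrM (ger0_norm (exprn_ge0 _ e0)) mulrCA ler_wpM2l //.
have -> : e ^+ l = (e / e') ^+ l * e' ^+ l by rewrite -exprMn divfK // gt_eqF.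
by rewrite ler_wpM2r ?exprn_ge0 ?(ltW e'0) // ler_weXn2l // ltnW.
Qed.
End Rep.

(** * Tannery's theorem for the sum over q *)
Section Tannery.
Variables (R : realType) (M' k : nat).
Hypotheses (kM : (k <= M'.+1)%N) (k2 : (2 <= k)%N).
Notation S := (fps R^o).
Notation chi := (chi R M' k).
Notation beta := (beta R M' k).

(** The [q]-th term of [SG_expand] over the double factorial for [q = 0], as a function of [e = 1/n]
    ([term_exact]). *)
Definition aterm q (e : R) : R := ((-1) ^+ q / k%:R ^+ q) *
  ((\sum_(j < q.+1) chi q.*2 j / j`!%:R * (e ^+ (q - j) * \prod_(i < j) (1 + - i%:R * e))) *
   \prod_(i < q) (1 - (i.*2.+1)%:R / k%:R * e)^-1).
Definition aser q : S := ((-1) ^+ q / k%:R ^+ q) *: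
  ((\sum_(j < q.+1) (chi q.*2 j / j`!%:R) *: (fX ^+ (q - j) * \prod_(i < j) (1 + (- i%:R) *: fX))) *
   \prod_(i < q) fps_binom (- 1) (- (((i.*2.+1)%:R / k%:R) *: fX))).
Definition aval q (e : R) : R := `|(-1) ^+ q / k%:R ^+ q| *
  ((\sum_(j < q.+1) `|chi q.*2 j / j`!%:R| * (e ^+ (q - j) * \prod_(i < j) (1 + `|- i%:R| * e))) *
   \prod_(i < q) (1 - (i.*2.+1)%:R / k%:R * e)^-1).

Let k0 : (0 < k)%N. Proof. exact: ltnW. Qed.
Let kR0 : 0 < k%:R :> R. Proof. by rewrite ltr0n. Qed.
Let kR2 : 2 <= k%:R :> R. Proof. by rewrite ler_nat. Qed.

Lemma small_c q i (e : R) : (i < q)%N -> 0 < e -> (4 * q)%:R * e <= 1 -> (i.*2.+1)%:R / k%:R * e <= 1/2.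
Proof.
move=> iq e0 qe; apply: le_trans (_ : (2 * q)%:R * e <= _).
  apply: ler_wpM2r; first exact: ltW.
  rewrite ler_pdivrMr // -natrM ler_nat (leq_trans (_ : _ <= 2 * q)%N) ?leq_pmulr //.
  by move: iq; clear; lia.
move: qe; rewrite !natrM; lra.
Qed.

Lemma aterm_Rep q (e : R) : 0 < e -> (4 * q)%:R * e <= 1 -> Rep e (aterm q) (aser q) (aval q e).
Proof.
move=> e0 qe; apply: (@RepZ _ _ (fun e => _)); apply: (@RepM _ _ e0 (fun e => \sum_(j < q.+1) _)).
  apply: (@Rep_sum _ _ e0 _ (fun j e => chi q.*2 j / j`!%:R * (e ^+ (q - j) * \prod_(i < j) (1 + - i%:R * e)))
    (fun j => (chi q.*2 j / j`!%:R) *: (fX ^+ (q - j) * \prod_(i < j) (1 + (- i%:R) *: fX)))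
    (fun j => `|chi q.*2 j / j`!%:R| * (e ^+ (q - j) * \prod_(i < j) (1 + `|- i%:R| * e)))) => j _.
  apply: (@RepZ _ _ (fun e => _)); apply: (@RepM _ _ e0 (fun e => e ^+ (q - j))); first exact: Rep_Xn.
  apply: (@Rep_prod _ _ e0 j (fun i e => 1 + - i%:R * e) (fun i => 1 + (- i%:R) *: fX)
     (fun i => 1 + `|- i%:R| * e)) => i _.
  apply: (@RepD _ _ e0 (fun=> 1)); first exact: Rep_1.
  by apply: (@RepZ _ _ id); apply: Rep_X.
apply: (@Rep_prod _ _ e0 q (fun i e => (1 - (i.*2.+1)%:R / k%:R * e)^-1)
   (fun i => fps_binom (- 1) (- (((i.*2.+1)%:R / k%:R) *: fX)))
   (fun i => (1 - (i.*2.+1)%:R / k%:R * e)^-1)) => i iq.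
apply: Rep_geo => //; first by rewrite divr_ge0.
by apply: le_lt_trans (small_c iq e0 qe) _; lra.
Qed.

(** 128 is [8 * 16]: the 16 pays for [n^q <= q! 16^q] when [n <= 4 q], and the 8 leaves [8^-q],
    which survives multiplication by [2^q]. The threshold [n0] is [4 C]. *)
Let C : R := 128 * k%:R ^+ 2.
Let C0 : 0 < C. Proof. by rewrite mulr_gt0 // exprn_gt0. Qed.
Definition Mc : R := expR (k.+1%:R * C + 2 * (k.+1%:R * C) ^+ 2).
Let Mc0 : 0 < Mc. Proof. exact: expR_gt0. Qed.
Definition n0 : nat := 512 * k ^ 2.
Let n0C n : (n0 <= n)%N -> 4 * C <= n%:R.
Proof. by rewrite -(ler_nat R) => H; apply: le_trans H; rewrite /n0 natrM natrX /C; lra. Qed.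

Lemma bin_prodR n j : 'C(n, j)%:R = (\prod_(i < j) (n%:R - i%:R)) / j`!%:R :> R.
Proof.
have f0 : j`!%:R != 0 :> R by rewrite pnatr_eq0 -lt0n fact_gt0.
apply: (mulIf f0); rewrite divfK // -natrM bin_ffact.
elim: j n {f0} => [|j IHj] n; first by rewrite ffactn0 big_ord0.
rewrite big_ord_recr /= -IHj ffactnSr natrM.
case: (leqP j n) => jn; first by rewrite natrB.
by rewrite ffact_small // !mul0r.
Qed.

Lemma sum_wide n q : (q < (n * k.+1).+1)%N ->
  \sum_(j < q.+1) 'C(n * k.+1, j)%:R * beta q.*2 j <=
  \sum_(j < (n * k.+1).+1) 'C(n * k.+1, j)%:R * beta q.*2 j.
Proof.
move=> qn; rewrite -(subnKC qn) big_split_ord /= lerDl sumr_ge0 // => j _.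
by rewrite mulr_ge0 ?beta_ge0.
Qed.

Lemma half_inv (x : R) : x <= 1/2 -> 0 <= (1 - x)^-1 <= 2.
Proof.
move=> x2; have p : 0 < 1 - x by lra.
by rewrite invr_ge0 ltW //= -[2]invrK lef_pV2 ?posrE // ?invr_gt0 //; lra.
Qed.

(** For [4 q <= n] each geometric factor is at most 2, and the rising factorial of [n] is at most
    the falling factorial of [n (k+1)], to which [majorant] applies. The powers collect to
    [(2 k / C)^q]. *)
Lemma aval_le n q : (n0 <= n)%N -> (4 * q <= n)%N -> aval q (n%:R^-1) <= Mc * (8^-1) ^+ q.
Proof.
move=> nn qn; have Cn := n0C nn.
have nR : 0 < n%:R :> R by apply: lt_le_trans Cn; rewrite mulr_gt0.
have nN : (0 < n)%N by rewrite ltr0n in nR.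
have e0 : 0 < n%:R^-1 :> R by rewrite invr_gt0.
have nz := lt0r_neq0 nR.
have qe : (4 * q)%:R * n%:R^-1 <= 1 :> R by rewrite ler_pdivrMr // mul1r ler_nat.
have P2 : (0 : R) <= \prod_(i < q) (1 - (i.*2.+1)%:R / k%:R * n%:R^-1)^-1 <= (2 ^+ q : R).
  have H (i : 'I_q) : (0 : R) <= (1 - (i.*2.+1)%:R / k%:R * n%:R^-1)^-1 <= (2 : R).
    by apply/half_inv/(small_c _ e0 qe).
  rewrite prodr_ge0 => [|i _]; last by case/andP: (H i).
  rewrite -[in X in _ <= X](card_ord q) -prodr_const; exact: ler_prod.
have [P0 P3] := andP P2.
have S1 : \sum_(j < q.+1) `|chi q.*2 j / j`!%:R| * (n%:R^-1 ^+ (q - j) * \prod_(i < j) (1 + `|- i%:R| * n%:R^-1)) <=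
   n%:R^-1 ^+ q * \sum_(j < q.+1) 'C(n * k.+1, j)%:R * beta q.*2 j.
  rewrite mulr_sumr; apply: ler_sum => j _.
  have jq : (j <= q)%N by rewrite -ltnS.
  rewrite normrM [`|_^-1|]ger0_norm ?invr_ge0 // bin_prodR.
  have -> : n%:R^-1 ^+ q * (\prod_(i < j) ((n * k.+1)%:R - i%:R) / j`!%:R * beta q.*2 j) =
     beta q.*2 j / j`!%:R * (n%:R^-1 ^+ (q - j) * (n%:R^-1 ^+ j * \prod_(i < j) ((n * k.+1)%:R - i%:R))) :> R.
    have -> : n%:R^-1 ^+ q = n%:R^-1 ^+ (q - j) * n%:R^-1 ^+ j :> R by rewrite -exprD subnK.
    ring.
  apply: ler_pM; rewrite ?mulr_ge0 ?invr_ge0 ?exprn_ge0 ?invr_ge0 //.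
  - by apply: prodr_ge0 => i _; rewrite addr_ge0 // mulr_ge0 // ltW.
  - by rewrite ler_wpM2r ?invr_ge0 // chi_beta.
  rewrite ler_wpM2l ?exprn_ge0 ?(ltW e0) //.
  have -> : n%:R^-1 ^+ j = \prod_(i < j) n%:R^-1 :> R by rewrite prodr_const card_ord.
  rewrite -big_split /=.
  apply: ler_prod => i _; rewrite addr_ge0 ?mulr_ge0 ?(ltW e0) //=.
  rewrite normrN ger0_norm //.
  have -> : 1 + i%:R / n%:R = n%:R^-1 * (n%:R + i%:R) :> R by field.
  apply: ler_wpM2l; first exact: ltW.
  rewrite lerBrDr -!natrD ler_nat mulnS -addnA leq_add2l; apply: leq_trans (leq_pmulr _ k0).
  by move: (ltn_ord i) jq qn; clear; lia.
have qw : (q < (n * k.+1).+1)%N.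
  by rewrite ltnS; apply: leq_trans (leq_pmulr n (ltn0Sn k)); move: qn; clear; lia.
have S2 := le_trans S1 (ler_wpM2l (exprn_ge0 q (ltW e0)) (le_trans (sum_wide qw) (majorant kM k0 q C0 Cn))).
rewrite /aval normrM normrX normrN1 expr1n mul1r ger0_norm ?invr_ge0 ?exprn_ge0 //.
apply: le_trans (_ : k%:R ^- q * (n%:R^-1 ^+ q * (k%:R ^+ q.*2 * (n%:R / C) ^+ q * Mc) * 2 ^+ q) <= _).
  rewrite ler_wpM2l ?invr_ge0 ?exprn_ge0 //; apply: ler_pM => //.
  apply: sumr_ge0 => j _; rewrite !mulr_ge0 ?exprn_ge0 ?(ltW e0) //.
  by apply: prodr_ge0 => i _; rewrite addr_ge0 // mulr_ge0 // ltW.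
have -> : k%:R ^- q * (n%:R^-1 ^+ q * (k%:R ^+ q.*2 * (n%:R / C) ^+ q * Mc) * 2 ^+ q) =
   Mc * (k%:R^-1 * n%:R^-1 * k%:R ^+ 2 * (n%:R / C) * 2) ^+ q.
  by rewrite -mul2n exprM -exprVn !exprMn; ring.
rewrite ler_wpM2l ?(ltW Mc0) // lerXn2r ?nnegrE //.
  by rewrite !mulr_ge0 ?invr_ge0 ?exprn_ge0 // ltW.
  by rewrite invr_ge0.
have -> : k%:R^-1 * n%:R^-1 * k%:R ^+ 2 * (n%:R / C) * 2 = (64 * k%:R)^-1 :> R.
  by rewrite /C; field; rewrite nz lt0r_neq0.
have k8 : 8 <= 64 * k%:R :> R by have : (2:R) <= k%:R := kR2; lra.
by rewrite lef_pV2 ?posrE ?mulr_gt0.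
Qed.

(** [(a+1)^r] is at most [(a+1) ... (a+r)], which is [r!] times a binomial coefficient. *)
Lemma pow_le_fact a r : (a.+1 ^ r <= r`! * 2 ^ (a + r))%N.
Proof.
have H : (a.+1 ^ r <= (a + r) ^_ r)%N.
  elim: r => [|r IHr]; first by rewrite ffactn0.
  by rewrite addnS ffactSS expnS leq_mul // ltnS leq_addr.
apply: leq_trans H _; rewrite -bin_ffact mulnC leq_mul2l.
rewrite orbC; apply/orP; left.
have -> : (2 ^ (a + r) = \sum_(i < (a + r).+1) 'C(a + r, i))%N.
  by rewrite -[2%N]/(1 + 1)%N expnDn; apply: eq_bigr => i _; rewrite !exp1n !muln1.
have rl : (r < (a + r).+1)%N by rewrite ltnS leq_addl.
by rewrite (bigD1 (Ordinal rl)) //= leq_addr.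
Qed.

Lemma oddf_shift h q : (q <= h)%N ->
  oddf R h = oddf R (h - q) * \prod_(i < q) (h.*2%:R - (i.*2.+1)%:R).
Proof.
elim: q => [|q IHq] qh; first by rewrite subn0 big_ord0 mulr1.
rewrite IHq ?(ltnW qh) // big_ord_recr /= -subSS subSn // oddfS.
have -> : h.*2%:R - q.*2.+1%:R = (h - q.+1).*2.+1%:R :> R.
  by rewrite -natrB ?ltn_double //; congr _%:R; move: qh; clear; lia.
ring.
Qed.

Lemma term_exact n q : (0 < n)%N -> ~~ odd (n * k) -> (q <= (n * k)./2)%N ->
  (-1) ^+ q * oddf R ((n * k)./2 - q) * (\sum_(j < q.+1) 'C(n, j)%:R * chi q.*2 j) =
  oddf R (n * k)./2 * aterm q (n%:R^-1).
Proof.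
move=> n1 ev qh; set h := (n * k)./2; have hE : h.*2 = (n * k)%N by rewrite even_halfK.
have nz : n%:R != 0 :> R by rewrite pnatr_eq0 -lt0n.
have kz : k%:R != 0 :> R by rewrite pnatr_eq0 -lt0n.
rewrite (oddf_shift qh) /aterm.
have Pz : \prod_(i < q) (h.*2%:R - (i.*2.+1)%:R) != 0 :> R.
  apply/prodf_neq0 => i _; rewrite subr_eq0 eqr_nat; apply/eqP => H.
  by have := congr1 odd H; rewrite /= !odd_double.
have -> : \prod_(i < q) (1 - (i.*2.+1)%:R / k%:R * n%:R^-1)^-1 =
   (n%:R * k%:R) ^+ q / \prod_(i < q) (h.*2%:R - (i.*2.+1)%:R) :> R.
  have -> : (n%:R * k%:R) ^+ q = \prod_(i < q) (n%:R * k%:R) :> R by rewrite prodr_const card_ord.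
  rewrite -prodf_div; apply: eq_bigr => i _.
  have H : h.*2%:R - (i.*2.+1)%:R != 0 :> R.
    rewrite subr_eq0 eqr_nat; apply/eqP => H.
    by have := congr1 odd H; rewrite /= !odd_double.
  rewrite hE natrM in H *.
  rewrite -[RHS]invf_div; congr (_^-1); field.
  by rewrite nz kz.
have -> : \sum_(j < q.+1) chi q.*2 j / j`!%:R * (n%:R^-1 ^+ (q - j) * \prod_(i < j) (1 + - i%:R * n%:R^-1)) =
   n%:R^-1 ^+ q * \sum_(j < q.+1) 'C(n, j)%:R * chi q.*2 j.
  rewrite mulr_sumr; apply: eq_bigr => j _; have jq : (j <= q)%N by rewrite -ltnS.
  rewrite bin_prodR.
  have -> : \prod_(i < j) (n%:R - i%:R) = n%:R ^+ j * \prod_(i < j) (1 + - i%:R * n%:R^-1) :> R.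
    have -> : n%:R ^+ j = \prod_(i < j) n%:R :> R by rewrite prodr_const card_ord.
    by rewrite -big_split; apply: eq_bigr => i _ /=; field.
  have -> : n%:R^-1 ^+ q = n%:R^-1 ^+ (q - j) * n%:R^-1 ^+ j :> R by rewrite -exprD subnK.
  have E : n%:R^-1 ^+ j * n%:R ^+ j = 1 :> R by rewrite -exprMn mulVf ?expr1n.
  move: (n%:R^-1 ^+ j) (n%:R ^+ j) E => u v E.
  by rewrite -[LHS]mulr1 -E; ring.
rewrite exprMn !exprVn; field.
by rewrite Pz !expf_neq0.
Qed.

(** For [n <= 4 q] an expansion in [1/n] is of no use; the exact term is bounded, the quotient of
    double factorials being at most [1/q!], which absorbs [n^q]. *)
Lemma aterm_big n q : (n0 <= n)%N -> ~~ odd (n * k) -> (q <= (n * k)./2)%N -> (n <= 4 * q)%N ->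
  `|aterm q (n%:R^-1)| <= Mc * (8^-1) ^+ q.
Proof.
move=> nn ev qh nq; have Cn := n0C nn.
have nR : 0 < n%:R :> R by apply: lt_le_trans Cn; rewrite mulr_gt0.
have nN : (0 < n)%N by rewrite ltr0n in nR.
have D0 : 0 < oddf R (n * k)./2 by apply: oddf_gt0.
have -> : aterm q (n%:R^-1) = (-1) ^+ q * (oddf R ((n * k)./2 - q) / oddf R (n * k)./2) *
    (\sum_(j < q.+1) 'C(n, j)%:R * chi q.*2 j).
  apply: (mulfI (lt0r_neq0 D0)); rewrite -term_exact //.
  by field; rewrite lt0r_neq0.
set h := (n * k)./2.
have fq : oddf R (h - q) / oddf R h <= (q`!%:R)^-1.
  rewrite (oddf_shift qh) invfM mulrA divff ?mul1r; last by rewrite lt0r_neq0 ?oddf_gt0.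
  have fp : (q`!%:R : R) <= \prod_(i < q) (h.*2%:R - (i.*2.+1)%:R).
    have -> : q`!%:R = \prod_(i < q) (q - i)%:R :> R by rewrite -ffactnn ffact_prod natr_prod.
    apply: ler_prod => i _; rewrite ler0n /= -natrB ?ler_nat; last by have := ltn_ord i; lia.
    have := ltn_ord i; lia.
  by rewrite lef_pV2 // posrE ?ltr0n ?fact_gt0 // (lt_le_trans _ fp) // ltr0n fact_gt0.
have qw : (q < (n * k.+1).+1)%N.
  by rewrite ltnS (leq_trans qh) // (leq_trans (half_leq (leqnn _))) // ; lia.
have S1 : `|\sum_(j < q.+1) 'C(n, j)%:R * chi q.*2 j| <= k%:R ^+ q.*2 * (n%:R / C) ^+ q * Mc.
  apply: le_trans (ler_norm_sum _ _ _) _.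
  apply: le_trans (le_trans (sum_wide qw) (majorant kM k0 q C0 Cn)).
  apply: ler_sum => j _; rewrite normrM ger0_norm //; apply: ler_pM => //; last exact: chi_beta.
  by rewrite ler_nat leq_bin2l // leq_pmulr.
rewrite normrM (normrM ((-1) ^+ q)) normrX normrN1 expr1n mul1r.
rewrite (ger0_norm (divr_ge0 (ltW (oddf_gt0 _ _)) (ltW (oddf_gt0 _ _)))).
apply: le_trans (_ : q`!%:R^-1 * (k%:R ^+ q.*2 * (n%:R / C) ^+ q * Mc) <= _).
  by apply: ler_pM => //; rewrite divr_ge0 // ltW // oddf_gt0.
have nq4 : n%:R ^+ q <= q`!%:R * 16 ^+ q :> R.
  apply: le_trans (_ : (4 * q)%:R ^+ q <= _); first by rewrite lerXn2r ?nnegrE // ler_nat.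
  rewrite -!natrX -natrM ler_nat expnMn.
  have := pow_le_fact q q; rewrite addnn -mul2n expnM => H.
  have -> : (16 ^ q = 4 ^ q * (2 ^ 2) ^ q)%N by rewrite -expnMn.
  rewrite mulnCA leq_mul2l; apply/orP; right.
  by apply: leq_trans H; case: (q) => // a; rewrite leq_exp2r.
rewrite expr_div_n.
apply: le_trans (_ : q`!%:R^-1 * (k%:R ^+ q.*2 * ((q`!%:R * 16 ^+ q) / C ^+ q) * Mc) <= _).
  rewrite ler_wpM2l ?invr_ge0 // ler_wpM2r ?(ltW Mc0) // ler_wpM2l ?exprn_ge0 //.
  by rewrite ler_wpM2r // invr_ge0 exprn_ge0 // ltW.
rewrite le_eqVlt; apply/orP; left; apply/eqP.
have -> : 8^-1 = k%:R ^+ 2 * (16 / C) :> R by rewrite /C; field; rewrite lt0r_neq0.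
rewrite -mul2n exprM; have Cq : C ^+ q != 0 by rewrite expf_neq0 // lt0r_neq0.
have f0 : q`!%:R != 0 :> R by rewrite pnatr_eq0 -lt0n fact_gt0.
rewrite (exprMn q (k%:R ^+ 2) (16 / C)) (exprMn q 16 C^-1) exprVn.
move: (k%:R ^+ 2 ^+ q) (16 ^+ q) (C ^+ q) (q`!%:R) Cq f0 => x1 x2 x3 x4 Cq f0.
by field; rewrite Cq.
Qed.

(** If [4 q <= n], the remainder estimate is applied with [e' = 1 / max (n0, 4 q)]. Otherwise the
    term and its truncated expansion are bounded separately, which costs nothing since
    [(n0 + 4 q)/n >= 1] there. *)
Lemma term_bound n q r : (n0 <= n)%N -> ~~ odd (n * k) ->
  `|(if (q <= (n * k)./2)%N then aterm q (n%:R^-1) else 0) - psum' r (aser q) (n%:R^-1)| <=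
  2 * Mc * (8^-1) ^+ q * ((n0 + 4 * q)%:R / n%:R) ^+ r.
Proof.
move=> nn ev; have Cn := n0C nn.
have nR : 0 < n%:R :> R by apply: lt_le_trans Cn; rewrite mulr_gt0.
have nN : (0 < n)%N by rewrite ltr0n in nR.
have n00 : (0 < n0)%N by rewrite muln_gt0 expn_gt0 k0.
have V0 : 0 <= Mc * 8^-1 ^+ q by apply: mulr_ge0; [exact: ltW|rewrite exprn_ge0 // invr_ge0].
case: (leqP (4 * q) n) => nq.
  have -> : (q <= (n * k)./2)%N by rewrite -leq_double even_halfK //; nia.
  pose n' := maxn n0 (4 * q); have n'0 : (0 < n')%N by rewrite leq_max n00.
  have q' : (4 * q)%:R * n'%:R^-1 <= 1 :> R.
    by rewrite ler_pdivrMr ?ltr0n // mul1r ler_nat leq_maxr.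
  have e'0 : 0 < n'%:R^-1 :> R by rewrite invr_gt0 ltr0n.
  have ee : n%:R^-1 <= n'%:R^-1 :> R by rewrite lef_pV2 ?posrE ?ltr0n // ler_nat geq_max nn nq.
  apply: le_trans (Rep_le e'0 r (aterm_Rep e'0 q') _ ee) _; first by rewrite invr_ge0.
  have n'n0 : (n0 <= n')%N by rewrite leq_maxl.
  apply: le_trans (ler_wpM2l _ (aval_le n'n0 (leq_maxr _ _))) _.
    by rewrite exprn_ge0 // divr_ge0 ?invr_ge0.
  rewrite mulrC -!mulrA [2 * _]mulrCA; apply: ler_wpM2l; first exact: ltW.
  rewrite [X in _ <= X]mulrCA; apply: ler_wpM2l; first by rewrite exprn_ge0 // invr_ge0.
  apply: le_trans (_ : 1 * ((n0 + 4 * q)%:R / n%:R) ^+ r <= _); last first.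
    by rewrite ler_wpM2r ?exprn_ge0 ?divr_ge0 //; lra.
  rewrite mul1r lerXn2r ?nnegrE ?divr_ge0 ?invr_ge0 // invrK mulrC ler_wpM2r ?invr_ge0 //.
  by rewrite ler_nat geq_max leq_addr leq_addl.
have q0 : (0 < 4 * q)%N by apply: leq_ltn_trans nq.
have e'0 : 0 < (4 * q)%:R^-1 :> R by rewrite invr_gt0 ltr0n.
have q' : (4 * q)%:R * (4 * q)%:R^-1 <= 1 :> R by rewrite divff ?pnatr_eq0 -?lt0n.
have ee : (4 * q)%:R^-1 <= n%:R^-1 :> R by rewrite lef_pV2 ?posrE ?ltr0n // ler_nat ltnW.
have n0q : (n0 <= 4 * q)%N by apply: leq_trans nn (ltnW nq).
have B1 := Rep_psum e'0 r (aterm_Rep e'0 q') ee.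
have X1 : n%:R^-1 / (4 * q)%:R^-1 <= (n0 + 4 * q)%:R / n%:R :> R.
  by rewrite invrK mulrC ler_wpM2r ?invr_ge0 // ler_nat leq_addl.
have Y1 : 1 <= (n0 + 4 * q)%:R / n%:R :> R.
  by rewrite ler_pdivlMr // mul1r ler_nat (leq_trans (ltnW nq)) // leq_addl.
have B2 : `|psum' r (aser q) n%:R^-1| <= Mc * 8^-1 ^+ q * ((n0 + 4 * q)%:R / n%:R) ^+ r.
  apply: le_trans B1 _; rewrite mulrC; apply: ler_pM => //.
  - by have := asum_ge0 e'0 (aser q) 0; move/le_trans; apply; apply: Rep_asum => //; apply: aterm_Rep.
  - by rewrite exprn_ge0 // divr_ge0 ?invr_ge0.
  - exact: aval_le.
  by rewrite lerXn2r ?nnegrE ?divr_ge0 ?invr_ge0.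
have B3 : `|if (q <= (n * k)./2)%N then aterm q (n%:R^-1) else 0| <=
    Mc * 8^-1 ^+ q * ((n0 + 4 * q)%:R / n%:R) ^+ r.
  case: ifP => qh; last by rewrite normr0 mulr_ge0 // exprn_ge0 // divr_ge0.
  apply: le_trans (aterm_big nn ev qh (ltnW nq)) _.
  by rewrite ler_peMr // exprn_ege1.
apply: le_trans (ler_normB _ _) _; apply: le_trans (lerD B3 B2) _.
by rewrite le_eqVlt; apply/orP; left; apply/eqP; ring.
Qed.

(** The growth [(n0 + 4 q)^r] is absorbed by [2^q], and [4^-q] remains to be summed. The cut-off [Q]
    is arbitrary beyond the last nonzero term, so it can tend to infinity later with [n] fixed. *)
Theorem SG_tannery r : exists K : R, exists n1 : nat, forall n Q, (n1 <= n)%N -> ~~ odd (n * k) ->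
  ((n * k)./2 < Q)%N ->
  `|k`!%:R ^+ n * (SG k n)%:R / oddf R (n * k)./2 -
    \sum_(l < r) (\sum_(q < Q) aser q l) * n%:R^-1 ^+ l| <= K * n%:R^-1 ^+ r.
Proof.
exists (4 * Mc * ((n0 + 4)%:R ^+ r * (r`! * 2 ^ r)%:R)), n0 => n Q nn ev hQ.
have Cn := n0C nn.
have nR : 0 < n%:R :> R by apply: lt_le_trans Cn; rewrite mulr_gt0.
have nN : (0 < n)%N by rewrite ltr0n in nR.
have -> : k`!%:R ^+ n * (SG k n)%:R / oddf R (n * k)./2 =
   \sum_(q < Q) (if (q <= (n * k)./2)%N then aterm q (n%:R^-1) else 0).
  rewrite (SG_expand _ kM ev) mulr_suml -[in RHS]big_mkcond /=.
  rewrite (big_ord_widen_cond Q xpredT (fun q => (-1) ^+ q * oddf R ((n * k)./2 - q) *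
    (\sum_(j < q.+1) 'C(n, j)%:R * chi q.*2 j) / oddf R (n * k)./2)) //.
  apply: eq_big => q //; rewrite /= ltnS => qh; rewrite term_exact //.
  by rewrite mulrAC divff ?mul1r // lt0r_neq0 // oddf_gt0.
have -> : \sum_(l < r) (\sum_(q < Q) aser q l) * n%:R^-1 ^+ l =
    \sum_(q < Q) psum' r (aser q) n%:R^-1.
  by rewrite /psum' exchange_big /=; apply: eq_bigr => l _; rewrite mulr_suml.
rewrite -sumrB; apply: le_trans (ler_norm_sum _ _ _) _.
apply: le_trans (ler_sum _ (fun (q : 'I_Q) _ => @term_bound n q r nn ev)) _.
apply: le_trans (_ : \sum_(q < Q) (2 * Mc * ((n0 + 4)%:R ^+ r * (r`! * 2 ^ r)%:R) * n%:R^-1 ^+ r) * (4^-1) ^+ q <= _).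
  apply: ler_sum => q _.
  have H : (n0 + 4 * q)%:R ^+ r <= (n0 + 4)%:R ^+ r * ((r`! * 2 ^ r)%:R * 2 ^+ q) :> R.
    apply: le_trans (_ : (n0 + 4)%:R ^+ r * q.+1%:R ^+ r <= _).
      by rewrite -exprMn -natrM lerXn2r ?nnegrE // ler_nat; nia.
    rewrite ler_wpM2l ?exprn_ge0 // -!natrX -natrM ler_nat.
    by apply: leq_trans (pow_le_fact q r) _; rewrite expnD -mulnA [(2 ^ q * _)%N]mulnC.
  have E : (4^-1 : R) ^+ q = 8^-1 ^+ q * 2 ^+ q by rewrite -exprMn; congr (_ ^+ _); field.
  rewrite expr_div_n E -exprVn.
  apply: le_trans (ler_wpM2l _ (ler_wpM2r _ H)) _.
  - by rewrite !mulr_ge0 ?exprn_ge0 ?invr_ge0 // ltW.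
  - by rewrite exprn_ge0 // invr_ge0.
  by rewrite le_eqVlt; apply/orP; left; apply/eqP; ring.
rewrite -mulr_sumr; apply: le_trans (ler_wpM2l _ (@geo_half _ _ Q _ _)) _.
- by rewrite !mulr_ge0 ?exprn_ge0 ?invr_ge0 // ltW.
- by rewrite invr_ge0.
- by lra.
by rewrite le_eqVlt; apply/orP; left; apply/eqP; ring.
Qed.
End Tannery.

(** * Two-variable series: exchanging variables, and the power (1 + B) ^ (-1/s^2) *)
Section Swap.
Variables (R : realType) (A : comAlgType R).
Implicit Types F G : fps (fps A).

Definition swp F : fps (fps A) := fun m j => F j m.
Lemma swpD F G : swp (F + G) = swp F + swp G. Proof. by []. Qed.
Lemma swpM F G : swp (F * G) = swp F * swp G.
Proof.
apply/fpsP=> m; apply/fpsP=> j; rewrite /swp !fpsME !fps_sumE.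
rewrite (eq_bigr (fun i : 'I_j.+1 => \sum_(l < m.+1) F i l * G (j - i)%N (m - l)%N)) => [|i _].
  by rewrite exchange_big; apply: eq_bigr => l _; rewrite fpsME.
by rewrite fpsME.
Qed.
Lemma swp1 : swp 1 = 1.
Proof. by apply/fpsP=> m; apply/fpsP=> -[|j]; rewrite /swp !fpsE1; case: m => [|m]; rewrite ?fpsE1. Qed.
Lemma swpX F n : swp (F ^+ n) = swp F ^+ n.
Proof. by elim: n => [|n IHn]; [exact: swp1|rewrite !exprS swpM IHn]. Qed.
Lemma swp_subst (c : nat -> R) F : vge 1 F -> vge 1 (swp F) ->
  swp (fps_subst c F) = fps_subst c (swp F).
Proof.
move=> F1 G1; apply/fpsP=> j; apply/fpsP=> m; rewrite /swp /fps_subst !fps_sumE.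
rewrite (@sum_ord_supp _ m.+1 j.+1 (fun i => (c i *: fps_pow F i m) j)) => [|i].
  by apply: eq_bigr => i _; rewrite !fpsZE !fps_powE -swpX.
rewrite geq_min => /orP[mi|ji]; rewrite fpsZE fps_powE.
  by rewrite (vgeX F1) // scaler0.
by rewrite -[(F ^+ i) m j]/(swp (F ^+ i) j m) swpX (vgeX G1) // scaler0.
Qed.
End Swap.

Lemma vge_subst (R : realType) (A : comAlgType R) (c : nat -> R) (w : fps A) k :
  c 0%N = 0 -> vge k w -> vge k (fps_subst c w).
Proof.
move=> c0 wk n nk; rewrite /fps_subst big1 // => -[[|i] ii] _; first by rewrite c0 scale0r.
by rewrite fps_powE exprS (vgeMr _ wk) ?scaler0.
Qed.

Section Twist.
Variables (R : realType) (A : comAlgType R) (y : fps A).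
Implicit Types f g : fps A.

(** The series [f (y v)] in a new outer variable [v]; the inner variable is [s]. *)
Definition tw f : fps (fps A) := fun m => fps_const (f m) * y ^+ m.
Lemma twD : {morph tw : f g / f + g}.
Proof. by move=> f g; apply/fpsP=> m; rewrite /tw !fpsDE raddfD mulrDl. Qed.
Lemma twM : {morph tw : f g / f * g}.
Proof.
move=> f g; apply/fpsP=> m; rewrite /tw !fpsME rmorph_sum mulr_suml; apply: eq_bigr => i _.
have im : (i <= m)%N by rewrite -ltnS.
have -> : y ^+ m = y ^+ i * y ^+ (m - i) by rewrite -exprD subnKC.
by rewrite rmorphM mulrACA.
Qed.
Lemma tw_alg (a : R) : tw a%:A = a%:A.
Proof.
apply/fpsP=> m; rewrite /tw !fpsZE !fpsE1; case: m => [|m].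
  by rewrite expr0 mulr1 linearZ /= rmorph1.
by rewrite !scaler0 raddf0 mul0r.
Qed.
Lemma tw_vge k f : vge k f -> vge k (tw f).
Proof. by move=> fk i ik; rewrite /tw fk // raddf0 mul0r. Qed.
Lemma tw_subst (c : nat -> R) f : vge 1 f -> tw (fps_subst c f) = fps_subst c (tw f).
Proof.
by apply: cmorph_subst; [exact: twD|exact: twM|exact: tw_alg|exact: tw_vge].
Qed.
Lemma twX f n : tw (f ^+ n) = tw f ^+ n.
Proof. by apply: cmorphX; [exact: twM|exact: tw_alg]. Qed.
End Twist.

Section PowerSquare.
Variables (R : realType) (A : comAlgType R) (U b : fps A).
Hypothesis b2 : vge 2 b.
Notation Q := (fps (fps A)).
Notation z := (fps_const (fX ^+ 2) : Q).
Notation tw := (tw (fX * U)).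

(* [dtw f] is [tw f] divided by [s^2], where [s] is the inner variable. *)
Definition dtw (f : fps A) : Q := fun m => fps_const (f m) * (fX ^+ (m - 2) * U ^+ m).
Lemma dtwK f : vge 2 f -> z * dtw f = tw f.
Proof.
move=> f2; apply/fpsP=> m; rewrite fps_constM /dtw /tw.
case: (ltnP m 2) => m2; first by rewrite f2 // raddf0 !mul0r mulr0.
rewrite mulrCA exprMn; congr (_ * _); rewrite mulrA -exprD subnKC //.
Qed.
Lemma z_reg (f g : Q) : z * f = z * g -> f = g.
Proof.
move=> E; apply/fpsP=> m; apply: (@fps_Xreg _ _ 2).
have /fpsP/(_ m) := E; by rewrite !fps_constM.
Qed.

Definition Xi : Q := - dtw b.
Definition La : Q := - dtw (fps_log1p b).
(** The coefficients of [(1 - z w)^(-1/z)] as a series in [w], for [z = s^2]. At [s^2 = - 1/n] they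
    are [binomial(n, j) / n^j]. *)
Definition rr (j : nat) : fps A := j`!%:R^-1 *: \prod_(i < j) (1 + i%:R *: fX ^+ 2).

Lemma log_b2 : vge 2 (fps_log1p b). Proof. exact: vge_subst. Qed.
Lemma dtw_vge f : vge 2 f -> vge 2 (dtw f).
Proof. by move=> f2 i ik; rewrite /dtw f2 // raddf0 mul0r. Qed.
Lemma Xi_vge : vge 2 Xi. Proof. by apply: vgeN; apply: dtw_vge. Qed.
Lemma La_vge : vge 2 La. Proof. by apply: vgeN; apply: dtw_vge; apply: log_b2. Qed.
Lemma zXi : z * Xi = - tw b. Proof. by rewrite mulrN dtwK. Qed.
Lemma zLa : z * La = - fps_log1p (tw b).
Proof.
rewrite mulrN dtwK; last exact: log_b2.
by congr (- _); apply: tw_subst; apply: vge_le b2.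
Qed.

Lemma rrS j : j.+1%:R *: rr j.+1 = rr j + j%:R *: (fX ^+ 2 * rr j).
Proof.
rewrite /rr big_ord_recr /= scalerA factS natrM invfM mulrA divff ?pnatr_eq0 // mul1r.
by rewrite mulrDr mulr1 scalerDr -!scalerAr scalerA mulrC scalerA; congr (_ + _ *: _); rewrite mulrC.
Qed.

(** Newton's binomial series for [(1 + B)^(-1/s^2)], whose exponent is not a scalar. Both sides
    solve [(1 - z w) y' = w' y] with [w = Xi]; the equation for [La] is obtained after
    multiplication by [z], which is cancelled by [z_reg]. *)
Lemma Phi_exp : fps_exp La = bsubst rr Xi.
Proof.
have D := @fps_deriv_fder R (fps A).
have X1 : vge 1 Xi by apply: vge_le Xi_vge.
have L1 : vge 1 La by apply: vge_le La_vge.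
have B1 : vge 1 (tw b) by apply: tw_vge; apply: vge_le b2.
have P0 : (1 - z * Xi) 0%N = 1.
  by rewrite fpsBE fpsE1 fps_constM X1 // mulr0 subr0.
have dz (f : Q) : fps_deriv (z * f) = z * fps_deriv f.
  rewrite (fderM D) (_ : fps_deriv z = 0) ?mul0r ?add0r //.
  by apply/fpsP=> m; rewrite /fps_deriv /fps_const scaler0.
have dL : (1 - z * Xi) * fps_deriv La = fps_deriv Xi.
  apply: z_reg; rewrite mulrCA -!dz zLa zXi opprK !(fderN D) mulrN.
  by rewrite (fder_log D).
apply: (@ode_uniq _ _ (1 - z * Xi) (fps_deriv Xi)) => //.
- by rewrite (fder_exp D) // mulrCA dL mulrC.
- rewrite (fder_bsubst D) //; last first.
    by move=> m; apply/fpsP=> l; rewrite /fps_deriv /fps_const scaler0.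
  rewrite mulrA [RHS]mulrC; congr (_ * _).
  have -> : 1 - z * Xi = bsubst (1 - fps_const (fX ^+ 2) * fX : Q) Xi.
    have E : (1 - fps_const (fX ^+ 2) * fX : Q) =1
        (fun m => (1 : Q) m + (- fX ^+ 2) * (fX : Q) m).
      by move=> m; rewrite fpsBE fps_constM mulNr.
    rewrite (eq_bsubst _ E) bsubstD bsubstZ bsubst_X // raddfN mulNr; congr (_ - _).
    by rewrite -[1 in RHS]scale1r bsubst_alg // scale1r.
  rewrite -bsubst_mul //; apply: eq_bsubst => m.
  rewrite mulrBl mul1r fpsBE -mulrA fps_constM fps_XM; case: m => [|m].
    by rewrite mulr0 subr0 rrS scale0r addr0.
  by rewrite rrS scalerAr addrK.
- by rewrite fps_exp0 bsubstE0 /rr big_ord0 fact0 invr1 scale1r.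
Qed.

Lemma XiX j m : (Xi ^+ j) m = if (j.*2 <= m)%N then
   (-1) ^+ j *: (fps_const ((b ^+ j) m) * (fX ^+ (m - j.*2) * U ^+ m)) else 0.
Proof.
have E : z ^+ j * Xi ^+ j = (-1) ^+ j *: tw (b ^+ j).
  by rewrite -exprMn zXi -scaleN1r exprZn twX.
have /fpsP/(_ m) := E; rewrite -rmorphXn /= fps_constM fpsZE /tw -exprM mul2n => Em.
apply: (@fps_Xreg _ _ j.*2); rewrite Em; case: leqP => mj; last first.
  have bj : vge j.*2 (b ^+ j).
    elim: (j) => // i IHi; rewrite exprS doubleS -addn2 addnC; exact: vgeM.
  by rewrite bj // raddf0 mul0r scaler0 mulr0.
rewrite -scalerAr exprMn; congr (_ *: _).
have -> : fX ^+ m = fX ^+ j.*2 * fX ^+ (m - j.*2) :> fps A by rewrite -exprD subnKC.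
ring.
Qed.
End PowerSquare.

(** * The terms of the expansion as functionals of a formal power *)
Section Scale.
Variables (R : realType) (A : comAlgType R) (a : A).
Notation S := (fps R^o).
Implicit Types f g : S.

Definition scl f : fps A := fun m => f m *: a ^+ m.
Lemma sclD f g : scl (f + g) = scl f + scl g.
Proof. by apply/fpsP=> m; rewrite /scl !fpsDE scalerDl. Qed.
Lemma sclM f g : scl (f * g) = scl f * scl g.
Proof.
apply/fpsP=> m; rewrite /scl !fpsME scaler_suml; apply: eq_bigr => i _.
have im : (i <= m)%N by rewrite -ltnS.
have -> : a ^+ m = a ^+ i * a ^+ (m - i) by rewrite -exprD subnKC.
by rewrite -scalerAl -scalerAr scalerA.
Qed.
Lemma scl_alg (x : R) : scl x%:A = x%:A.
Proof.
apply/fpsP=> m; rewrite /scl !fpsZE !fpsE1; case: m => [|m].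
  by rewrite expr0 alg_regular.
by rewrite !scaler0 scale0r.
Qed.
Lemma scl_vge k f : vge k f -> vge k (scl f).
Proof. by move=> fk i ik; rewrite /scl fk // scale0r. Qed.
Lemma scl_subst (c : nat -> R) f : vge 1 f -> scl (fps_subst c f) = fps_subst c (scl f).
Proof.
by apply: cmorph_subst; [exact: sclD|exact: sclM|exact: scl_alg|exact: scl_vge].
Qed.
Lemma scl1 : scl 1 = 1. Proof. by rewrite -(scale1r (1 : S)) scl_alg scale1r. Qed.
Lemma sclN f : scl (- f) = - scl f.
Proof. by apply/fpsP=> m; rewrite /scl !fpsNE scaleNr. Qed.
Lemma sclZ (x : R) f : scl (x *: f) = x *: scl f.
Proof. by apply/fpsP=> m; rewrite /scl !fpsZE scalerA. Qed.
Lemma sclX f n : scl (f ^+ n) = scl f ^+ n.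
Proof. by apply: cmorphX; [exact: sclM|exact: scl_alg]. Qed.
Lemma scl_X : scl fX = fps_const a * fX.
Proof.
apply/fpsP=> m; rewrite /scl fps_constM !fps_XE; case: eqP => [->|_].
  by rewrite scale1r expr1 mulr1.
by rewrite scale0r mulr0.
Qed.
End Scale.

Section EvenSubst.
Variables (R : realType) (A : comAlgType R).
Notation S := (fps R^o).

(** The substitution of [- s^2] for [1/n]. *)
Definition negsq (F : S) : fps A := bsubst (liftA A F) (- fX ^+ 2).
Lemma negX2_vge : vge 1 (- fX ^+ 2 : fps A).
Proof. by apply: vgeN; rewrite expr2; apply: vgeMl; apply: vge1P. Qed.
Lemma negsqM F G : negsq (F * G) = negsq F * negsq G.
Proof. by rewrite /negsq liftAM bsubst_mul //; exact: negX2_vge. Qed.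
Lemma negsqD F G : negsq (F + G) = negsq F + negsq G.
Proof. by rewrite /negsq liftAD -bsubstD. Qed.
Lemma negsqZ (x : R) F : negsq (x *: F) = x *: negsq F.
Proof.
rewrite /negsq liftAZ -[RHS]mulr_algl fps_alg -bsubstZ; apply: eq_bsubst => m.
by rewrite fpsZE mulr_algl.
Qed.
Lemma negsq1 : negsq 1 = 1.
Proof.
rewrite /negsq liftA1; have := @bsubst_alg R A (- fX ^+ 2) 1; rewrite scale1r; apply.
Qed.
Lemma negsqXn F n : negsq (F ^+ n) = negsq F ^+ n.
Proof. by elim: n => [|n IHn]; [exact: negsq1|rewrite !exprS negsqM IHn]. Qed.
Lemma negsq_X : negsq fX = - fX ^+ 2.
Proof. by rewrite /negsq liftA_X bsubst_X //; exact: negX2_vge. Qed.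
Lemma negsqE F n : negsq F n = if odd n then 0 else ((-1) ^+ n./2 * F n./2)%:A.
Proof.
have E m : ((- fX ^+ 2 : fps A) ^+ m) n = ((-1) ^+ m * (n == m.*2)%:R : R)%:A.
  by rewrite -scaleN1r exprZn fpsZE -exprM mul2n fps_XnE -scalerA; congr (_ *: _); rewrite scaler_nat.
rewrite /negsq /bsubst; case: ifP => on.
  rewrite big1 // => m _; rewrite E (_ : (_ == _) = false) ?mulr0 ?scale0r ?mulr0 //.
  by apply/eqP => nE; move: on; rewrite nE odd_double.
have nE : n./2.*2 = n by rewrite even_halfK // on.
have hn : (n./2 < n.+1)%N by rewrite ltnS -{2}nE -addnn leq_addr.
rewrite (bigD1 (Ordinal hn)) //= big1 ?addr0 => [|m mh].
  by rewrite E nE eqxx mulr1 /liftA mulr_algl scalerA mulrC.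
rewrite E (_ : (_ == _) = false) ?mulr0 ?scale0r ?mulr0 //.
apply: contraNF mh => /eqP/(congr1 half); rewrite doubleK => H.
by apply/eqP/val_inj; exact: esym H.
Qed.
End EvenSubst.

Lemma sum_even (V : nmodType) (F : nat -> V) h :
  \sum_(m < h.*2.+1) (if odd m then 0 else F m./2) = \sum_(q < h.+1) F q.
Proof.
elim: h => [|h IHh]; first by rewrite !big_ord1.
rewrite doubleS big_ord_recr /= [RHS]big_ord_recr /= -IHh big_ord_recr /=.
by rewrite odd_double /= addr0 doubleK.
Qed.

Section Terms.
Variables (R : realType) (M' k : nat).
Hypothesis k0 : (0 < k)%N.
Notation A := {mpoly R[M'.+1]}.
Notation S := (fps R^o).
Notation T := (Tser R : S).
Notation x0 := ('X_ord0 : A).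
Notation om := (fun i => hw (@cH R M' k i)).

Lemma tv1 : tv R M' 1 = x0.
Proof. by rewrite /tv /=; congr ('X_ _); apply/val_inj; rewrite /= inordK. Qed.
Lemma Tst1E : Tst1 R M' = scl x0 T.
Proof. by apply/fpsP=> m; rewrite /Tst1 tv1. Qed.
Lemma dTst1E : dTst1 R M' = scl x0 (fps_deriv T).
Proof. by apply/fpsP=> m; rewrite /dTst1 tv1. Qed.
Definition Uo : fps A := fps_binom (- 1) (Tst1 R M').
Lemma UoE : Uo = scl x0 (fps_binom (- 1) T).
Proof. by rewrite /Uo Tst1E /fps_binom scl_subst //; exact: Tser_vge. Qed.
Lemma UoX q : Uo ^+ q = scl x0 (fps_binom (- q%:R) T).
Proof.
by rewrite UoE -sclX -fps_binomMn ?mulrN1 //; exact: Tser_vge.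
Qed.

Definition hfun r (F : fps A) : R := mfun om (F r.*2).
Lemma hfunD r : {morph hfun r : F G / F + G}.
Proof. by move=> F G; rewrite /hfun fpsDE mfunD. Qed.
Lemma hfunZ r (x : R) F : hfun r (x *: F) = x * hfun r F.
Proof. by rewrite /hfun fpsZE mfunZ. Qed.
Lemma hfun_sum r (I : Type) (s : seq I) (P : pred I) (F : I -> fps A) :
  hfun r (\sum_(i <- s | P i) F i) = \sum_(i <- s | P i) hfun r (F i).
Proof. by rewrite /hfun fps_sumE mfun_sum. Qed.

Notation kap f := (scl (k%:R^-1 : R^o) f).

(** The weight [- 1/(4 k)] gives [t_1^(2j)] the value [mom j / (- k)^j], so the functional in [t_1]
    computes [bracket] with [1/N] replaced by [X/k]; these signs and those of [negsq] combine into
    [(-1)^r]. *)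
Lemma hfun_const r p F (c : S) : p^`M(ord0) = 0 ->
  hfun r (fps_const p * (negsq A F * scl x0 c)) = mfun om p * ((-1) ^+ r * (F * kap (bracket c)) r).
Proof.
move=> p0; rewrite /hfun fps_constM fpsME mulr_sumr mfun_sum.
pose G i : R := mfun om p * ((-1) ^+ r * (F i * (kap (bracket c)) (r - i)%N)).
rewrite (eq_bigr (fun i : 'I_r.*2.+1 => if odd i then 0 else G i./2)) => [|i _].
  by rewrite sum_even fpsME !mulr_sumr.
rewrite negsqE; case: ifP => oi; first by rewrite mul0r mulr0 mfun0.
have ir : (i <= r.*2)%N by rewrite -ltnS.
have iE : i./2.*2 = i by rewrite even_halfK // oi.
have -> : (r.*2 - i)%N = (r - i./2).*2 by rewrite doubleB iE.
have hr : (i./2 <= r)%N by rewrite -leq_double iE.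
rewrite mulr_algl /scl scalerA -scalerAr mfunZ mulrC [p * _]mulrC mfun_mulXn1 ?hw0 //.
have -> : om ord0 (r - i./2).*2 = (-1) ^+ (r - i./2) * (mom R (r - i./2) / k%:R ^+ (r - i./2)).
  rewrite /hw odd_double doubleK (_ : cH R k ord0 = - (4 * k%:R)^-1) // [in LHS]exprNn exprVn exprMn /mom.
  field.
  by rewrite !expf_neq0 ?pnatr_eq0 -?lt0n ?fact_gt0.
rewrite /G /bracket /scl; move: (mfun om p) => X.
have -> : (-1) ^+ r = (-1) ^+ i./2 * (-1) ^+ (r - i./2) :> R by rewrite -exprD subnKC.
rewrite /GRing.scale /= exprVn; ring.
Qed.

(** Iteration of [nu_rec]: every factor [1/(1 - (2 i + 1)/(n k))] from the quotient of double
    factorials adds 2 to the exponent of [1/(1 + T)]. *)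
Lemma kap_nu q : kap (Gam R) * \prod_(i < q) fps_binom (- 1) (- (((i.*2.+1)%:R / k%:R) *: fX : S)) =
  kap (nu R q.*2).
Proof.
elim: q => [|q IHq]; first by rewrite big_ord0 mulr1.
rewrite big_ord_recr /= mulrA IHq nu_rec sclM sclD scl1 sclN sclZ scl_X mulrAC.
have X1 : vge 1 (- (((q.*2.+1)%:R / k%:R) *: fX) : S) by apply/vgeN/vgeZ/vge1P.
have := fps_binomN 1 X1; rewrite (fps_binom_nat 1) // expr1 mulrC.
have -> : q.*2.+1%:R *: (fps_const (k%:R^-1 : R^o) * fX) = ((q.*2.+1)%:R / k%:R) *: fX :> S.
  by apply/fpsP=> m; rewrite !fpsZE fps_constM /GRing.scale /= mulrA.
by move=> ->; rewrite mul1r.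
Qed.

Notation Bt := (Bt R M' k).
Notation La := (La Uo Bt).
Definition pcoef r m : R := hfun r ((fps_exp La * fps_const (dTst1 R M')) m).

(** The link between the analytic terms and the formal construction: the powers of [1/(1 + T)] come
    from the twist by [Uo], the factors [1 - i/n] from [rr], and the double factorials from
    [kap_nu]. *)
Lemma pcoef_aser r q : (0 < k)%N ->
  pcoef r q.*2 = k%:R ^+ q * (-1) ^+ r * (kap (Gam R) * aser R M' k q) r.
Proof.
move=> _; have B2 := @Bt_vge R M' k; have kz : k%:R != 0 :> R by rewrite pnatr_eq0 -lt0n.
pose G j : S := ((-1) ^+ (q - j) / j`!%:R) *: (fX ^+ (q - j) * \prod_(i < j) (1 + (- i%:R) *: fX)).
have -> : pcoef r q.*2 = \sum_(j < q.+1) (-1) ^+ j * (chi R M' k q.*2 j *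
    ((-1) ^+ r * (G j * kap (nu R q.*2)) r)).
  rewrite /pcoef Phi_exp // mulrC fps_constM /bsubst mulr_sumr hfun_sum.
  rewrite (@sum_ord_supp _ _ q.+1 (fun j => hfun r (dTst1 R M' * (rr A j * (Xi Uo Bt ^+ j) q.*2)))).
    apply: eq_bigr => j _; have jq : (j <= q)%N by rewrite -ltnS.
    rewrite XiX // leq_double jq -doubleB -!scalerAr hfunZ; congr (_ * _).
    rewrite -(@hfun_const r _ (G j)); last exact: BtX_free1.
    congr (hfun r _); rewrite /G negsqZ negsqM negsqXn negsq_X UoX dTst1E sclM /rr.
    have -> : negsq A (\prod_(i < j) (1 + - i%:R *: fX)) = \prod_(i < j) (1 + i%:R *: fX ^+ 2).
      rewrite (big_morph _ (@negsqM R A) (@negsq1 R A)); apply: eq_bigr => i _.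
      by rewrite negsqD negsq1 negsqZ negsq_X scaleNr scalerN opprK.
    rewrite -[- fX ^+ 2]scaleN1r exprZn -exprM mul2n -!(scalerAl, scalerAr).
    rewrite scalerA mulrAC -exprMn mulrN1 opprK expr1n mul1r; congr (_ *: _); ring.
  move=> j; rewrite geq_min => /orP[jq|qj]; rewrite XiX //.
    by rewrite leqNgt ifF ?mulr0 ?/hfun ?mfun0 //; apply/negP => /negP; rewrite -leqNgt; lia.
  by rewrite leq_double leqNgt qj /= !mulr0 /hfun mfun0.
rewrite /aser -scalerAr [kap (Gam R) * _]mulrCA kap_nu fpsZE mulr_suml fps_sumE.
rewrite /GRing.scale /= mulr_sumr mulr_sumr; apply: eq_bigr => j _.
have jq : (j <= q)%N by rewrite -ltnS.
rewrite /G -!scalerAl !fpsZE /GRing.scale /=.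
have -> : (-1) ^+ q = (-1) ^+ j * (-1) ^+ (q - j) :> R by rewrite -exprD subnKC.
have kq : k%:R ^+ q != 0 :> R by rewrite expf_neq0.
have f0 : j`!%:R != 0 :> R by rewrite pnatr_eq0 -lt0n fact_gt0.
by field; rewrite kq f0.
Qed.
End Terms.

(** * Gaussian shift in the variable t_2 *)
Lemma shiftop_lin (R : realType) (B : comAlgType R) (d : B -> B) (be : fps B) (t : B) :
  (d 1 = 0) -> d 0 = 0 -> vge 1 be -> d t = 1 -> shiftop d be (fps_const t) = fps_const t + be.
Proof.
move=> d1 d0 be1 dt; have i1 : cmap d (fps_const t) = 1.
  by apply/fpsP=> n; rewrite /cmap fpsE1 /fps_const; case: eqP; rewrite ?dt ?d0.
have c1 : cmap d (1 : fps B) = 0.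
  by apply/fpsP=> n; rewrite /cmap fpsE1; case: n => [|n]; rewrite ?d1 ?d0.
have i2 a : iter a.+2 (cmap d) (fps_const t) = 0.
  elim: a => [|a IHa]; first by rewrite /= i1 c1.
  by rewrite iterS IHa; apply/fpsP=> n; exact: d0.
apply/fpsP=> n; rewrite /shiftop fpsDE big_ord_recl fact0 invr1 scale1r mul1r; congr (_ + _).
case: n => [|n]; first by rewrite big_ord0 be1.
rewrite big_ord_recl big1 ?addr0 => [|a _]; last by rewrite !lift0 i2 mulr0 scaler0.
by rewrite lift0 /= -[(1`!)%:R]/(1 : R) invr1 scale1r expr1 i1 mulr1.
Qed.

(* Completing the square: the linear term [al t] of the exponent is traded for
   a translation of [t]. *)
Lemma gauss_shift_exp (R : realType) (B : comAlgType R) (d : B -> B) (t : B) (h : B -> R) (c : R)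
  (c' : R) (L al be : fps B) (g : B) n :
  {morph d : a b / a + b} -> (forall a b, d (a * b) = d a * b + a * d b) ->
  (forall x : R, d x%:A = 0) -> d t = 1 ->
  {morph h : a b / a + b} -> (forall x a, h (x *: a) = x * h a) ->
  (forall f, h (t * f) = 2 * c * h (d f)) ->
  vge 1 L -> vge 1 al -> cmap d al = 0 -> d g = 0 -> be = - (2 * c) *: al -> c' = - c ->
  h ((fps_exp L * fps_const g) n) =
  h ((fps_exp (shiftop d be L + al * fps_const t + c' *: al ^+ 2) * fps_const g) n).
Proof.
move=> dD dM d_alg dt hD hZ ibp L1 al1 al0 g0 beE ->.
have C := cmap_fder dD dM d_alg.
have d00 : d 0 = 0 by rewrite -[0 in LHS](scale0r (1 : B)) d_alg.
have d10 : d 1 = 0 by rewrite -(scale1r (1 : B)) d_alg.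
have be1 : vge 1 be by rewrite beE; apply: vgeZ.
have t1 : vge 1 (al * fps_const t) by apply: vgeMr.
have a21 : vge 1 (al ^+ 2) by rewrite expr2; apply: vgeMr.
have cg : cmap d (fps_const g) = 0.
  by apply/fpsP=> m; rewrite /cmap /fps_const; case: eqP.
have -> : fps_exp L = fps_exp (- (al * fps_const t)) * fps_exp (L + al * fps_const t).
  by rewrite -fps_expD; [rewrite addrC addrK|exact: vgeN|exact: vgeD].
rewrite -mulrA (gauss_shift dD dM d_alg dt hD hZ ibp) // -beE.
rewrite (shiftopM dD dM d_alg be1) (shiftop_const dD dM d_alg _ cg).
have -> : shiftop d be (fps_exp (L + al * fps_const t)) = fps_exp (shiftop d be (L + al * fps_const t)).
  by apply: (shiftop_subst dD dM d_alg be1); apply: vgeD.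
rewrite (shiftopD dD dM d_alg) (shiftopM dD dM d_alg be1) (shiftop_const dD dM d_alg _ al0).
rewrite (shiftop_lin d10 d00 be1 dt) mulrDr mulrA -fps_expD.
- congr (h ((fps_exp _ * _) _)); rewrite beE -scalerAr -expr2 [LHS]addrC -!addrA.
  by congr (_ + (_ + _)); rewrite -scalerDl; congr (_ *: _); ring.
- exact: vgeZ.
- apply: vgeD; first exact: (shiftop_vge d_alg).
  by apply: vgeD => //; apply: vgeMr.
Qed.

Section ShiftT2.
Variables (R : realType) (M' k : nat).
Hypotheses (M1 : (0 < M')%N) (k0 : (0 < k)%N).
Notation A := {mpoly R[M'.+1]}.
Notation Q := (fps (fps A)).
Notation S := (fps R^o).
Notation i1 := (inord 1 : 'I_M'.+1).
Notation x1 := ('X_i1 : A).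
Notation om := (fun i => hw (@cH R M' k i)).
Notation Uo := (Uo R M').
Notation gserM := (gser R M').
Notation BtM := (Bt R M' k).
Notation La := (La Uo BtM).
Notation dT := (dTst1 R M').
Notation d2 := (@cder R M'.+1 i1).

Let i1E : i1 = 1%N :> nat. Proof. by rewrite inordK. Qed.
Let i10 : (ord0 == i1) = false. Proof. by apply/eqP => /(congr1 val); rewrite /= i1E. Qed.

Lemma tv2 : tv R M' 2 = x1. Proof. by rewrite /tv /= ltnS M1. Qed.
Lemma cH1 : cH R k i1 = - 4^-1.
Proof. by rewrite /cH /hcoef i1E /= -natrM. Qed.

Lemma scl_free (c : S) : d2 (scl ('X_ord0 : A) c) = 0.
Proof.
apply/fpsP=> m; rewrite /cder /cmap /scl mderivZ.
have -> : ('X_ord0 ^+ m : A)^`M(i1) = 0; last by rewrite scaler0.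
elim: m => [|m IHm]; first by rewrite expr0 -(scale1r 1) mderiv_alg.
by rewrite exprS mderivM IHm mulr0 addr0 mderivXX i10 mul0r.
Qed.
Lemma Uo_free q : d2 (Uo ^+ q) = 0. Proof. by rewrite UoX scl_free. Qed.

(** The variable [t_2] occurs in [gser] only in the factor [exp (t_2 X^2)]. *)
Lemma gser_d2 : d2 gserM = fX ^+ 2 * gserM.
Proof.
have D := @cder_fder R M'.+1 i1; rewrite /gserM (fderM D) isqrt_free mulr0 addr0.
rewrite (fder_exp D) ?(fderM D); last exact: Wser_vge.
have -> : d2 (Wser R M') = fX.
  apply/fpsP=> -[|m]; rewrite /cder /cmap /Wser fps_XE /=; first exact: mderiv0.
  rewrite /tv; case: ifP => [mM|].
    rewrite mderivXX; congr _%:R; case: m mM => [|m] mM /=; first by rewrite eqxx.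
    case: eqP => // /(congr1 val); rewrite /= i1E inordK //.
  by case: m => [|m _]; [rewrite /= ltnS M1|exact: mderiv0].
by rewrite -[fX in X in X * _]expr1 cder_X mul0r add0r expr2; ring.
Qed.
Lemma gser_d2n a d : iter a (mderiv i1) (gserM d) = if (a.*2 <= d)%N then gserM (d - a.*2)%N else 0.
Proof.
have D := @cder_fder R M'.+1 i1.
have -> : iter a (mderiv i1) (gserM d) = (iter a d2 gserM) d by rewrite /cder iter_cmapE.
suff -> : iter a d2 gserM = fX ^+ a.*2 * gserM by rewrite fps_XnM.
elim: a => [|a IHa] /=; first by rewrite mul1r.
by rewrite IHa (fderM D) cder_X mul0r add0r gser_d2 mulrA -exprD doubleS addn2.
Qed.
Lemma Bt_d2n a d : iter a (mderiv i1) (BtM d) =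
  if (0 < d)%N && (a.*2 <= d)%N then (k ^_ d)%:R *: gserM (d - a.*2)%N else 0.
Proof.
rewrite /Bt; case: d => [|d] /=.
  by elim: a => //= a ->; exact: mderiv0.
have -> : iter a (mderiv i1) ((k ^_ d.+1)%:R *: gserM d.+1) = (k ^_ d.+1)%:R *: iter a (mderiv i1) (gserM d.+1).
  by elim: a => //= a ->; rewrite mderivZ.
by rewrite gser_d2n; case: ifP; rewrite ?scaler0.
Qed.

Definition kk : R := k%:R * (k%:R - 1).
(** Chosen so that [al t_2] cancels the term of [La] that is linear in [t_2] at order [s^0]; [kk] is
    the falling factorial [k (k-1)]. *)
Definition al : Q := kk *: (fX ^+ 2 * fps_const (Uo ^+ 2)).
Definition be : Q := (1/2) *: al.
Notation sig := (shiftop d2 be).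
Definition sB : Q := sig (tw (fX * Uo) BtM).
Definition Om : Q := sig La + al * fps_const (fps_const x1) + (1/4) *: al ^+ 2.
(** The opposite of the [s^0] part of the exponent after translation; adding it makes [Ys] divisible
    by [s] ([swp_Ys_vge]). *)
Definition lam : S := (kk / 2) *: fX ^+ 2 + (kk ^+ 2 / 4) *: fX ^+ 4.
Definition Ys : Q := Om + liftA (fps A) lam.

Let dD : {morph d2 : a b / a + b}. Proof. exact: fderD (@cder_fder R M'.+1 i1). Qed.
Let dM : forall a b, d2 (a * b) = d2 a * b + a * d2 b. Proof. exact: fderM (@cder_fder R M'.+1 i1). Qed.
Let d_alg : forall x : R, d2 x%:A = 0. Proof. exact: fder_alg (@cder_fder R M'.+1 i1). Qed.
Let d2_1 : d2 1 = 0. Proof. exact: fder1 (@cder_fder R M'.+1 i1). Qed.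
Let d2_0 : d2 0 = 0. Proof. exact: fder0 (@cder_fder R M'.+1 i1). Qed.
Let dt : d2 (fps_const x1) = 1.
Proof.
apply/fpsP=> n; rewrite /cder /cmap fpsE1 /fps_const; case: eqP => _; last exact: mderiv0.
by rewrite mderivXX eqxx.
Qed.
Let C := cmap_fder dD dM d_alg.

Let const_free (f : fps A) : d2 f = 0 -> cmap d2 (fps_const f) = 0.
Proof. by move=> f0; apply/fpsP=> n; rewrite /cmap /fps_const; case: eqP => // _; exact: d2_0. Qed.
Let X_free m : cmap d2 (fX ^+ m : Q) = 0.
Proof. by apply/fpsP=> n; rewrite /cmap fps_XnE; case: (_ == _); rewrite ?d2_1 ?d2_0. Qed.
Lemma al_free : cmap d2 al = 0.
Proof.
by rewrite /al (fderZ C) (fderM C) X_free (const_free (Uo_free 2)) mulr0 mul0r addr0 scaler0.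
Qed.
Lemma al_vge : vge 2 al.
Proof.
apply: vgeZ; apply: vgeMr => i; rewrite fps_XnE; case: eqP => [->|//].
by rewrite ltnn.
Qed.
Let al1 : vge 1 al. Proof. exact: vge_le al_vge. Qed.
Let be1 : vge 1 be. Proof. exact: vgeZ. Qed.

Let La1 : vge 1 La. Proof. apply: vge_le (La_vge _ (@Bt_vge R M' k)) => //. Qed.
Let alt1 : vge 1 (al * fps_const (fps_const x1)). Proof. exact: vgeMr. Qed.
Let al21 : vge 1 (al ^+ 2). Proof. by rewrite expr2; apply: vgeMr. Qed.
Let sLa1 : vge 1 (sig La). Proof. exact: (shiftop_vge d_alg). Qed.
Lemma Om_vge : vge 1 Om.
Proof. by apply: vgeD; [apply: vgeD|apply: vgeZ]. Qed.

(** The weight of [t_2] is [c = -1/4], so the translation [- 2 c al] is [al / 2] and the completed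
    square contributes [al^2 / 4]. *)
Lemma pcoef_shift r m : pcoef R M' k r m = hfun k r ((fps_exp Om * fps_const dT) m).
Proof.
have h_ibp f : hfun k r (fps_const x1 * f) = 2 * (- 4^-1) * hfun k r (d2 f).
  rewrite /hfun fps_constM; apply: (mfun_ibp (om := om) (i := i1)) => e.
  by rewrite -cH1; exact: hwS.
have dT0 : d2 dT = 0 by rewrite dTst1E scl_free.
have bE : be = - (2 * - 4^-1) *: al by congr (_ *: _); field.
have cE : (1/4 : R) = - (- 4^-1) by field.
exact: (@gauss_shift_exp R (fps A) d2 (fps_const x1) (@hfun R M' k r) (- 4^-1) (1/4) La al be dT m
  dD dM d_alg dt (@hfunD _ _ _ r) (@hfunZ _ _ _ r) h_ibp La1 al1 al_free dT0 bE cE).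
Qed.

Lemma z_sLa : fps_const (fX ^+ 2) * sig La = - fps_log1p sB.
Proof.
have z0 : cmap d2 (fps_const (fX ^+ 2) : Q) = 0 by apply: const_free; exact: cder_X.
rewrite -{1}(shiftop_const dD dM d_alg be z0) -(shiftopM dD dM d_alg be1) zLa; last exact: Bt_vge.
have B1 : vge 1 (tw (fX * Uo) BtM) by apply: tw_vge; apply: vge_le (@Bt_vge R M' k).
rewrite /sB /fps_log1p -(shiftop_subst dD dM d_alg be1) //.
rewrite -scaleN1r -mulr_algl (shiftopM dD dM d_alg be1) (shiftop_alg dD dM d_alg).
by rewrite mulr_algl scaleN1r.
Qed.

Lemma sBE m : sB m = \sum_(a < m.+1) if (a.*2 <= m)%N then
  (a`!%:R^-1 * (kk / 2) ^+ a) *: (fps_const (iter a (mderiv i1) (BtM (m - a.*2)%N)) *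
     (fX ^+ (m - a.*2) * Uo ^+ m)) else 0.
Proof.
rewrite /sB /shiftop; apply: eq_bigr => a _.
have -> : be ^+ a = (kk / 2) ^+ a *: (fX ^+ a.*2 * fps_const (Uo ^+ a.*2)).
  have E1 : (fX ^+ 2 : Q) ^+ a = fX ^+ a.*2 by rewrite -exprM mul2n.
  have E2 : (fps_const (Uo ^+ 2) : Q) ^+ a = fps_const (Uo ^+ a.*2).
    by rewrite -(rmorphXn (@fps_const R (fps A))) -exprM mul2n.
  have E3 : 1 / 2 * kk = kk / 2 by field.
  by rewrite /be /al scalerA exprZn (exprMn a (fX ^+ 2)) E1 E2 E3.
rewrite -scalerAl fpsZE scalerA -(mulrA (fX ^+ a.*2)) fps_XnM; case: leqP => am; last by rewrite scaler0.
congr (_ *: _); rewrite fps_constM iter_cmapE.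
have y0 : d2 ((fX * Uo) ^+ (m - a.*2)) = 0.
  rewrite exprMn (fderM (@cder_fder R M'.+1 i1)) cder_X Uo_free mulr0 mul0r addr0 //.
have -> : iter a d2 (tw (fX * Uo) BtM (m - a.*2)%N) =
   fps_const (iter a (mderiv i1) (BtM (m - a.*2)%N)) * (fX * Uo) ^+ (m - a.*2).
  rewrite /tw; move: (m - a.*2)%N y0 => d y0; elim: (nat_of_ord a) => //= j ->.
  rewrite dM y0 mulr0 addr0; congr (_ * _); apply/fpsP=> n; rewrite /cder /cmap /fps_const.
  by case: eqP => // _; exact: mderiv0.
rewrite exprMn; have -> : Uo ^+ m = Uo ^+ a.*2 * Uo ^+ (m - a.*2) by rewrite -exprD subnKC.
ring.
Qed.

Lemma sB_vge : vge 1 sB.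
Proof. by apply: (shiftop_vge d_alg); apply: tw_vge; apply: vge_le (@Bt_vge R M' k). Qed.
Lemma sB_term m a j : (a.*2 <= m)%N -> (j < m - a.*2)%N \/ (m - a.*2 < 2)%N ->
  (fps_const (iter a (mderiv i1) (BtM (m - a.*2)%N)) * (fX ^+ (m - a.*2) * Uo ^+ m)) j = 0.
Proof.
move=> am; rewrite fps_constM fps_XnM => -[jm|m2]; first by rewrite leqNgt jm mulr0.
have -> : iter a (mderiv i1) (BtM (m - a.*2)%N) = 0; last by rewrite mul0r.
by rewrite (@Bt_vge R M' k _ m2); elim: (a) => //= b ->; exact: mderiv0.
Qed.
Lemma swp_sB_vge : vge 2 (swp sB).
Proof.
move=> j j2; apply/fpsP=> m; rewrite /swp sBE fps_sumE big1 // => a _.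
case: ifP => am //; rewrite fpsZE sB_term ?scaler0 //.
by case: (ltnP j (m - a.*2)) => jm; [left|right; apply: leq_ltn_trans j2].
Qed.

Lemma gser2 : gserM 2 = x1 + (1/2)%:A.
Proof.
rewrite /gserM fpsME !big_ord_recl big_ord0 /= !subSS !subn0 addr0.
set E := fps_exp _; have E0 : E 0%N = 1 by exact: fps_exp0.
have E1 : E 1%N = 0.
  rewrite /E fps_expE /bsubst !big_ord_recl big_ord0 expr0 fpsE1 mulr0 expr1 fps_XM /Wser /=.
  by rewrite mulr0 !addr0.
have E2 : E 2 = x1.
  have W2 : ((fX * Wser R M') ^+ 2) 2 = 0 by rewrite exprMn fps_XnM subnn expr2 fpsM0 mul0r.
  rewrite /E fps_expE /bsubst !big_ord_recr big_ord0 /= expr0 fpsE1 mulr0 !add0r expr1 W2 mulr0 addr0.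
  by rewrite fps_XM /Wser /= tv2 -[(1`!)%:R]/(1 : R) invr1 scale1r mul1r.
have I0 : isqrt1mz2 R M' 0%N = 1 by rewrite isqrtE fps_binom0.
have I2 : isqrt1mz2 R M' 2 = (1/2)%:A.
  have Z2 : ((- fX ^+ 2 : fps A) ^+ 2) 2 = 0 by rewrite sqrrN -exprM fps_XnE.
  rewrite isqrtE fps_binE /bsubst !big_ord_recr big_ord0 /= expr0 fpsE1 mulr0 !add0r expr1 Z2 mulr0 addr0.
  rewrite fpsNE fps_XnE /gbinom big_ord1 -[(1`!)%:R]/(1 : R) mulrN1 -scaleNr; congr (_ *: _).
  by rewrite /=; field.
by rewrite E0 E1 E2 I0 I2 mul0r add0r mul1r mulr1 addrC.
Qed.

(** A term with [a] derivatives has order at least [m - 2 a] in [s], and [Bt] starts in degree 2, so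
    [s^2] requires [m = 2 a + 2]. For [a >= 2] the derivative of the coefficient of degree 2
    vanishes. *)
Lemma sB_s2 m : sB m 2 = if m == 2%N then kk *: (x1 + (1/2)%:A) else
   if m == 4%N then (kk * (kk / 2))%:A else 0.
Proof.
have K2 : (k ^_ 2)%:R = kk :> R.
  by rewrite ffactnSr ffactn1 natrM /kk; case: (k) k0 => // j _; rewrite subn1 /= -natr1 addrK.
rewrite sBE fps_sumE.
have T (a : 'I_m.+1) : (a.*2 + 2 != m)%N -> (if (a.*2 <= m)%N then
  (a`!%:R^-1 * (kk / 2) ^+ a) *: (fps_const (iter a (mderiv i1) (BtM (m - a.*2)%N)) *
     (fX ^+ (m - a.*2) * Uo ^+ m)) else 0) 2 = 0.
  move=> am; case: ifP => // a2; rewrite fpsZE sB_term ?scaler0 //.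
  by case: (ltnP 2 (m - a.*2)) => jm; [left|right]; lia.
have U0 q : (Uo ^+ q) 0%N = 1.
  by rewrite UoX /scl fps_binom0 expr0 scale1r.
case: eqP => [m2|m2].
  subst m; rewrite big_ord_recl big1 ?addr0 => [|a _]; last by apply: T; rewrite !lift0; lia.
  rewrite /= fact0 invr1 expr0 mulr1 scale1r subn0 fps_constM fps_XnM subnn U0 mulr1.
  by rewrite /Bt /= K2 gser2.
case: eqP => [m4|m4].
  subst m; rewrite big_ord_recl big_ord_recl !big1 ?addr0 => [|a _]; last by apply: T; rewrite !lift0; lia.
  rewrite (T ord0) // add0r lift0 /= -[(1`!)%:R]/(1 : R) invr1 expr1 mul1r fpsZE fps_constM fps_XnM subnn U0 mulr1.
  have := Bt_d2n 1 2; rewrite /= => ->; by rewrite K2 gser0 scalerA mulrC.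
apply: big1 => a _; case: (eqVneq (a.*2 + 2)%N m) => [am|]; last exact: T.
have [b aE] : exists b, nat_of_ord a = b.+2 by exists (a - 2)%N; lia.
rewrite aE in am *; case: ifP => // a2; rewrite fpsZE fps_constM Bt_d2n.
by rewrite -am addKn /= mul0r scaler0.
Qed.

Lemma Ys_vge : vge 1 Ys.
Proof.
apply: vgeD; first exact: Om_vge.
apply: vge1P; rewrite /liftA /lam fpsDE !fpsZE !fps_XnE /= mulr0n.
by rewrite !scaler0 addr0 scale0r.
Qed.
(** At order [s^0] the logarithm contributes [- kk (t_2 + 1/2) v^2 - kk^2 v^4 / 2]; together with
    [al t_2] and [al^2 / 4] this is exactly [- lam]. *)
Lemma swp_Ys_vge : vge 1 (swp Ys).
Proof.
apply: vge1P; apply/fpsP=> m; rewrite /swp /Ys /Om.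
have L : (sig La m) 0%N = - sB m 2.
  have -> : (sig La m) 0%N = (fX ^+ 2 * sig La m) 2 by rewrite fps_XnM.
  rewrite -fps_constM z_sLa; congr (- _).
  rewrite -[LHS]/(swp (fps_log1p sB) 2 m) /fps_log1p swp_subst; last first.
  - exact: vge_le swp_sB_vge.
  - exact: sB_vge.
  rewrite /fps_subst !big_ord_recr big_ord0 !fps_powE /= scale0r !add0r expr1.
  by rewrite (expr2 (swp sB)) (vgeM swp_sB_vge swp_sB_vge) // scaler0 addr0 expr2 mulrNN mulr1 divr1 scale1r.
rewrite !fpsDE L sB_s2.
have a1 : (al * fps_const (fps_const x1)) m 0%N = if m == 2%N then kk *: x1 else 0.
  rewrite mulrC fps_constM fps_constM /al fpsZE fpsZE mulrC fps_XnM UoX.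
  case: eqP => [->|m2].
    by rewrite /= subnn /fps_const eqxx /scl fps_binom0 expr0 !scale1r -scalerAl mul1r.
  have -> : (if (1 < m)%N then fps_const (scl ('X_ord0 : A) (fps_binom (- 2) (Tser R : S))) (m - 2)%N else 0) 0%N = 0.
    by case: ltnP => // m1; rewrite /fps_const; case: eqP => // m0; move: m0 m1 m2; clear; lia.
  by rewrite scaler0 mul0r.
have a2 : (al ^+ 2) m 0%N = if m == 4%N then (kk ^+ 2)%:A else 0.
  have E1 : (fX ^+ 2 : Q) ^+ 2 = fX ^+ 4 by rewrite -exprM.
  have E2 : (fps_const (Uo ^+ 2) : Q) ^+ 2 = fps_const (Uo ^+ 4).
    by rewrite -(rmorphXn (@fps_const R (fps A))) -exprM.
  rewrite /al exprZn (exprMn 2 (fX ^+ 2)) E1 E2 fpsZE fpsZE mulrC fps_constM fps_XnE UoX.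
  case: eqP => _; last by rewrite mulr0 scaler0.
  by rewrite mulr1 /scl fps_binom0 expr0 scale1r.
have a4 : ((1/4) *: al ^+ 2) m 0%N = if m == 4%N then (1/4 * kk ^+ 2)%:A else 0.
  by rewrite fpsZE fpsZE a2; case: eqP; rewrite ?scaler0 ?scalerA.
have a3 : liftA (fps A) lam m 0%N = (kk / 2 * (m == 2%N)%:R + kk ^+ 2 / 4 * (m == 4%N)%:R)%:A.
  by rewrite /liftA fpsZE fpsE1 /lam fpsDE !fpsZE !fps_XnE.
rewrite a1 a4 a3; case: eqP => [->|m2] /=.
  have G (p : A) (a b x y : R) : - a * x + b * y = 0 ->
      - (a *: (p + x%:A)) + a *: p + 0 + (b * y + kk ^+ 2 / 4 * 0)%:A = 0.
    move=> E; rewrite mulr0 !addr0 scalerDr scalerA;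
    rewrite -[RHS](scale0r (1 : A)) -E scalerDl mulNr scaleNr.
    by move: (a *: p) ((a * x)%:A) ((b * y)%:A) => q1 q2 q3; ring.
  by apply: G; field.
case: eqP => m4 /=; last by rewrite !mulr0 !addr0 scale0r oppr0 ?addr0.
by rewrite mulr0 addr0 add0r mulr1 -scaleNr -!scalerDl [X in X *: _](_ : _ = 0) ?scale0r //; field.
Qed.
End ShiftT2.

(** * Evaluation at v = u *)
Lemma sum_shift (V : nmodType) N c (H : nat -> V) :
  \sum_(d < N) (if (c <= d)%N then H d else 0) = \sum_(l < N) (if (l + c < N)%N then H (l + c)%N else 0).
Proof.
rewrite -!big_mkcond /= -(big_geq_mkord _ _ xpredT) -{1}[c]add0n big_addn big_mkord.
rewrite (big_ord_widen N (fun i => H (i + c)%N)) ?leq_subr //.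
by apply: eq_bigl => i; rewrite ltn_subRL addnC.
Qed.

Section EvalRel.
Variables (R : realType) (A : comAlgType R) (u : R).
Notation Q := (fps (fps A)).

(** Evaluation makes sense only for polynomials, hence a relation: [a] has finitely many
    coefficients, and its value at [u] is [b]. *)
Definition rhou (j : nat) (a : fps A) (b : A) :=
  exists p : {poly A}, (forall m, a m = p`_m) /\ p.[u%:A] = b.
Lemma rhou0 j : rhou j 0 0.
Proof. by exists 0; split=> [m|]; rewrite ?coef0 // horner0. Qed.
Lemma rhouC j (c : A) : rhou j (fps_const c) c.
Proof. by exists c%:P; split=> [m|]; rewrite ?coefC // hornerC. Qed.
Lemma rhouX j : rhou j fX u%:A.
Proof. by exists 'X; split=> [m|]; rewrite ?coefX ?fps_XE // hornerX. Qed.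
Lemma rhouD j a b a' b' : rhou j a a' -> rhou j b b' -> rhou j (a + b) (a' + b').
Proof.
move=> [p [pa <-]] [q [qb <-]]; exists (p + q); split=> [m|]; last by rewrite hornerD.
by rewrite fpsDE coefD pa qb.
Qed.
Lemma rhouM i j a b a' b' : rhou i a a' -> rhou j b b' -> rhou (i + j) (a * b) (a' * b').
Proof.
move=> [p [pa <-]] [q [qb <-]]; exists (p * q); split=> [m|]; last by rewrite hornerM.
by rewrite fpsME coefM; apply: eq_bigr => l _; rewrite pa qb.
Qed.
Lemma rhou1 j : rhou j 1 1.
Proof. exact: rhouC. Qed.
Lemma rhouZ j (x : R) a a' : rhou j a a' -> rhou j (x *: a) (x *: a').
Proof.
move=> /(rhouM (rhouC 0 x%:A)); rewrite mulr_algl; congr (rhou _ _ _).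
by apply/fpsP=> m; rewrite fps_constM mulr_algl fpsZE.
Qed.

Definition evrel (F : Q) (g : fps A) := forall K, frel rhou K (swp F) g.
Lemma evrelD F G f g : evrel F f -> evrel G g -> evrel (F + G) (f + g).
Proof. by move=> Ff Gg K; rewrite swpD; apply: frelD (Ff K) (Gg K); exact: rhouD. Qed.
Lemma evrelM F G f g : evrel F f -> evrel G g -> evrel (F * G) (f * g).
Proof.
move=> Ff Gg K; rewrite swpM; apply: frelM (Ff K) (Gg K).
- exact: rhou0.
- exact: rhouD.
- exact: rhouM.
Qed.
Lemma evrelZ (x : R) F f : evrel F f -> evrel (x *: F) (x *: f).
Proof. by move=> Ff K; apply: frelZ (Ff K); exact: rhouZ. Qed.
Lemma evrelN F f : evrel F f -> evrel (- F) (- f).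
Proof. by rewrite -(scaleN1r F) -(scaleN1r f); apply: evrelZ. Qed.
Lemma evrelC f : evrel (fps_const f) f.
Proof.
move=> K j _; have -> : swp (fps_const f) j = fps_const (f j); last exact: rhouC.
by apply/fpsP=> m; rewrite /swp /fps_const; case: eqP.
Qed.
Lemma evrelX : evrel fX u%:A.
Proof.
move=> K j _; have -> : swp (fX : Q) j = if j == 0%N then fX else 0.
  by apply/fpsP=> m; rewrite /swp fps_XE; case: j => [|j] /=; rewrite ?fps_XE; case: (m == 1%N); rewrite ?fpsE1.
rewrite fps_alg /fps_const; case: eqP => _; [exact: rhouX|exact: rhou0].
Qed.
Lemma evrelXn n : evrel (fX ^+ n) (u ^+ n)%:A.
Proof.
elim: n => [|n IHn]; first by rewrite !expr0 scale1r; exact: evrelC.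
have -> : (u ^+ n.+1)%:A = u%:A * (u ^+ n)%:A :> fps A by rewrite mulr_algl scalerA exprS.
by rewrite exprS; apply: evrelM => //; exact: evrelX.
Qed.
Lemma evrel_subst c F f : vge 1 F -> vge 1 (swp F) -> evrel F f ->
  evrel (fps_subst c F) (fps_subst c f).
Proof.
move=> F1 F1' Ff K; rewrite swp_subst //; apply: frel_subst (Ff K).
- exact: rhou0.
- exact: rhou1.
- exact: rhouD.
- exact: rhouZ.
- exact: rhouM.
Qed.
Lemma evrel_div F f : evrel (fps_const (fX ^+ 2) * F) f -> evrel F (fps_divX2 f).
Proof.
move=> H K j _; have := H j.+3 j.+2 (ltnSn _); congr (rhou _ _ _).
apply/fpsP=> m; rewrite /swp fps_constM fps_XnM /=.
by rewrite subSS subSS subn0.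
Qed.
End EvalRel.

Section EvalU.
Variables (R : realType) (M' k : nat).
Hypotheses (M1 : (0 < M')%N) (k0 : (0 < k)%N).
Notation A := {mpoly R[M'.+1]}.
Notation Q := (fps (fps A)).
Notation S := (fps R^o).
Notation i1 := (inord 1 : 'I_M'.+1).
Notation x1 := ('X_i1 : A).
Notation x0 := ('X_ord0 : A).
Notation om := (fun i => hw (@cH R M' k i)).
Notation Uo := (Uo R M').
Notation gser := (gser R M').
Notation Bt := (Bt R M' k).
Notation sB := (sB R M' k).
Notation Ys := (Ys R M' k).

Lemma vcoefE p q : vcoef R M' p q = (Wser R M' ^+ q * isqrt1mz2 R M') p.
Proof.
have E : fps_pow (Wser R M') q = Wser R M' ^+ q by apply/fpsP=> m; rewrite fps_powE.
by rewrite /vcoef E.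
Qed.
Lemma gser_vcoef e : gser e = \sum_(b < e.+1) b`!%:R^-1 *: vcoef R M' (e - b) b.
Proof.
have W1 := Wser_vge R M'.
have := vgeMr (isqrt1mz2 R M') (@psubst_vge R _ e.+1 (fun m => (m`!%:R^-1)%:A) _ W1) (ltnSn e).
rewrite mulrBl fpsBE -fps_expE => /subr0_eq; rewrite -[fps_exp _ * _]/gser => ->.
rewrite /psubst mulr_suml fps_sumE; apply: eq_bigr => b _.
have be : (b <= e)%N by rewrite -ltnS.
rewrite -mulrA fps_constM mulr_algl exprMn -mulrA fps_XnM be; congr (_ *: _).
by rewrite vcoefE.
Qed.

Lemma kR_ffact d : \prod_(m < d) (kR R k - m%:R) = (k ^_ d)%:R.
Proof.
elim: d => [|d IHd]; first by rewrite big_ord0 ffactn0.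
rewrite big_ord_recr /= IHd ffactnSr natrM /kR; case: (leqP d k) => dk; first by rewrite natrB.
by rewrite ffact_small // !mul0r.
Qed.

Definition hterm (u : R) j a d : A :=
  ((k ^_ d)%:R * u ^+ d / a`!%:R * ((k%:R - 1) / 2) ^+ a * ucoef R (j - d) (d + a.*2)) *:
    (x0 ^+ (j - d) * gser (d - a.*2)%N).

(** Reindexing by [d = a + b + l], the length of the falling factorial; the sum over [b] then
    rebuilds [gser]. The terms with [l = 0], absent from the definition, vanish because [Wser] has
    no constant term. *)
Lemma B0E u j : B0j k M' u j =
  \sum_(a < j.+1) \sum_(d < j.+1) (if (0 < d)%N && (a.*2 <= d)%N then hterm u j a d else 0).
Proof.
pose t a b d : A := ((k ^_ d)%:R * u ^+ d / (a`!%:R * b`!%:R) * ((k%:R - 1) / 2) ^+ a * ucoef R (j - d) (d + a.*2)) *: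
    (x0 ^+ (j - d) * vcoef R M' (d - a.*2 - b) b).
transitivity (\sum_(a < j.+1) \sum_(b < j.+1) \sum_(d < j.+1)
    (if (0 < d)%N && (a.*2 + b <= d)%N then t a b d else 0)); last first.
  apply: eq_bigr => a _; rewrite exchange_big; apply: eq_bigr => d _ /=.
  case: ifP => [/andP[d0 ad]|H]; last first.
    rewrite big1 // => b _; case: ifP => // /andP[d0 adb].
    by move: H; rewrite d0 (leq_trans _ adb) // leq_addr.
  rewrite /hterm gser_vcoef.
  have D (c : R) (p : A) n (F : nat -> A) : c *: (p * \sum_(b < n) F b) = \sum_(b < n) c *: (p * F b).
    by rewrite mulr_sumr scaler_sumr.
  rewrite (D _ _ _ (fun b => b`!%:R^-1 *: vcoef R M' (d - a.*2 - b) b)).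
  have E b : (if (0 < d)%N && (a.*2 + b <= d)%N then t a b d else 0) =
     if (b < (d - a.*2).+1)%N then t a b d else 0.
    by rewrite d0 ltnS leq_subRL.
  rewrite (eq_bigr _ (fun (b : 'I_j.+1) _ => E b)) -big_mkcond /=.
  rewrite -(big_ord_widen j.+1 (fun b => t a b d)); last first.
    by rewrite ltnS (leq_trans (leq_subr _ _)) // -ltnS.
  apply: eq_bigr => b _; rewrite /t -scalerAr scalerA; congr (_ *: _).
  by rewrite invfM; ring.
transitivity (\sum_(a < j.+1) \sum_(b < j.+1) \sum_(l < j.+1)
    (if [&& (0 < l)%N, (a <= l)%N & (a + b + l <= j)%N] then t a b (a + b + l)%N else 0)).
  rewrite /B0j big_add1 big_mkord.
  have -> : \sum_(a < j.+1) \sum_(b < j.+1) \sum_(l < j.+1)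
    (if [&& (0 < l)%N, (a <= l)%N & (a + b + l <= j)%N] then t a b (a + b + l)%N else 0) =
    \sum_(l < j.+1) \sum_(a < j.+1) \sum_(b < j.+1)
    (if [&& (0 < l)%N, (a <= l)%N & (a + b + l <= j)%N] then t a b (a + b + l)%N else 0).
    rewrite [RHS]exchange_big; apply: eq_bigr => a _; exact: exchange_big.
  rewrite [RHS]big_ord_recl [X in _ = X + _]big1 ?add0r => [|a _]; last by rewrite big1.
  apply: eq_bigr => l _; rewrite lift0 /=.
  have lj : (l < j)%N by [].
  have E a : (if (a < l.+2)%N then \sum_(b < j.+1 | (a + b + l.+1 <= j)%N) t a b (a + b + l.+1)%N else 0) =
    \sum_(b < j.+1) (if (a <= l.+1)%N && (a + b + l.+1 <= j)%N then t a b (a + b + l.+1)%N else 0).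
    by rewrite ltnS; case: ifP => _ /=; [rewrite big_mkcond|rewrite big1].
  rewrite -(eq_bigr _ (fun (a : 'I_j.+1) _ => E a)) -big_mkcond /=.
  rewrite -(big_ord_widen j.+1 (fun a => \sum_(b < j.+1 | (a + b + l.+1 <= j)%N) t a b (a + b + l.+1)%N)) //.
  apply: eq_bigr => a _; apply: eq_bigr => b abl.
  have al : (a <= l.+1)%N by rewrite -ltnS.
  rewrite /t kR_ffact tv1 /kR.
  have -> : (j - a - b - l.+1)%N = (j - (a + b + l.+1))%N by rewrite !subnDA.
  have -> : (a + b + l.+1 - a.*2 - b = l.+1 - a)%N by clear -al; lia.
  by have -> : (3 * a + b + l.+1 = a + b + l.+1 + a.*2)%N by clear; lia.
apply: eq_bigr => a _; apply: eq_bigr => b _.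
have E d : (if (0 < d)%N && (a.*2 + b <= d)%N then t a b d else 0) =
  (if (a + b <= d)%N then (if (0 < d)%N && (a.*2 + b <= d)%N then t a b d else 0) else 0).
  case: (boolP ((0 < d)%N && _)) => [/andP[_ H]|_]; last by rewrite if_same.
  by rewrite ifT // (leq_trans _ H) // leq_add2r -addnn leq_addr.
rewrite [RHS](eq_bigr _ (fun (d : 'I_j.+1) _ => E d)).
rewrite (sum_shift j.+1 (a + b) (fun d => if (0 < d)%N && (a.*2 + b <= d)%N then t a b d else 0)).
apply: eq_bigr => l _; rewrite ltnS [(l + (a + b))%N]addnC.
have -> : (a.*2 + b <= a + b + l)%N = (a <= l)%N by clear; lia.
case: (leqP (a + b + l) j) => H; last by rewrite !andbF.
rewrite andbT; case: (posnP l) => l0 /=; last by rewrite addn_gt0 l0 orbT.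
rewrite l0 leqn0 addn0; case: (eqVneq (nat_of_ord a) 0%N) => [->|_]; last by rewrite andbF.
rewrite add0n andbT; case: ifP => // b0.
rewrite /t subn0 subnn vcoefE fpsM0.
have W0 : (Wser R M' ^+ b) 0%N = 0 by case: (nat_of_ord b) b0 => // b' _; rewrite exprS fpsM0 mul0r.
by rewrite W0 mul0r mulr0 scaler0.
Qed.

Variable u : R.
Hypothesis uk : u ^+ 2 * k%:R = 1.

(** The index [a] of [B0j] is the order of the Taylor expansion in [t_2]: [u^2 k = 1] turns
    [kk u^2 / 2] into [(k-1)/2], and the exponent [d + 2 a] of [1/(1 + T)] is the index
    [3 a + b + l]. *)
Lemma sB_coef m j : (u ^+ m) *: (sB m) j = \sum_(a < m.+1)
  (if (a.*2 <= m)%N then (if [&& (0 < m - a.*2)%N, (a.*2 <= m - a.*2)%N & (m - a.*2 <= j)%N]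
     then hterm u j a (m - a.*2) else 0) else 0).
Proof.
rewrite sBE // fps_sumE scaler_sumr; apply: eq_bigr => a _; case: ifP => am; last by rewrite scaler0.
rewrite fpsZE fps_constM fps_XnM Bt_d2n //; move E : (m - a.*2)%N => d.
rewrite andbA; case: ifP => H /=; last by rewrite mul0r !scaler0.
case: ifP => dj; last by rewrite mulr0 !scaler0.
have mE : m = (d + a.*2)%N by rewrite -E subnK.
have -> : u ^+ m = u ^+ (d + a.*2) by rewrite -mE.
have -> : Uo ^+ m = Uo ^+ (d + a.*2) by rewrite -mE.
rewrite UoX /scl /hterm -scalerAl -scalerAr [gser _ * _]mulrC !scalerA; congr (_ *: _).
rewrite /ucoef exprD -mul2n exprM.
have -> : (k%:R - 1) / 2 = u ^+ 2 * (kk R k / 2) by rewrite -[LHS]mul1r -[X in X * _]uk /kk; ring.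
rewrite (exprMn _ (u ^+ 2)); ring.
Qed.

(** The coefficient of [s^j] involves [v^m] only for [m = d + 2 a] with [2 a <= d <= j], so its
    degree in [v] is at most [2 j]. *)
Lemma evrel_sB : evrel u sB (B0 k M' u).
Proof.
move=> K j _; have sB0 m : (j.*2 < m)%N -> (sB m) j = 0.
  move=> mj; rewrite sBE // fps_sumE big1 // => a _; case: ifP => // am.
  rewrite fpsZE fps_constM fps_XnM Bt_d2n //; case: ifP => H; last by rewrite mul0r scaler0.
  case: ifP => dj; last by rewrite mulr0 scaler0.
  by exfalso; move: H dj mj am; clear; lia.
exists (\poly_(m < j.*2.+1) (sB m) j); split.
  by move=> m; rewrite coef_poly; case: ltnP => // /sB0.
rewrite horner_poly; have -> : \sum_(i < j.*2.+1) sB i j * u%:A ^+ i = \sum_(m < j.*2.+1) (u ^+ m) *: (sB m) j.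
  by apply: eq_bigr => m _; rewrite exprZn expr1n mulrC mulr_algl.
rewrite (eq_bigr _ (fun (m : 'I_j.*2.+1) _ => sB_coef m j)).
pose H a d := if [&& (0 < d)%N, (a.*2 <= d)%N & (d <= j)%N] then hterm u j a d else 0.
have -> : \sum_(m < j.*2.+1) \sum_(a < m.+1) (if (a.*2 <= m)%N then H a (m - a.*2)%N else 0) =
   \sum_(m < j.*2.+1) \sum_(a < j.+1) (if (a.*2 <= m)%N then H a (m - a.*2)%N else 0).
  apply: eq_bigr => m _; apply: (@sum_ord_supp _ _ _ (fun a => if (a.*2 <= m)%N then H a (m - a.*2)%N else 0)) => a.
  rewrite geq_min => ma; case: ifP => am //; rewrite /H ifF //; apply/negP => /and3P[h1 h2 h3].
  by move: ma am h1 h2 h3; clear; lia.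
rewrite exchange_big /=.
have Hj a : \sum_(m < j.*2.+1) (if (a.*2 <= m)%N then H a (m - a.*2)%N else 0) = \sum_(d < j.+1) H a d.
  rewrite (sum_shift j.*2.+1 a.*2 (fun m => H a (m - a.*2)%N)).
  rewrite (@sum_ord_supp _ j.*2.+1 j.+1 (fun l => if (l + a.*2 < j.*2.+1)%N then H a (l + a.*2 - a.*2)%N else 0)).
    apply: eq_bigr => d _; rewrite addnK; case: ifP => // dj; rewrite /H ifF //.
    by apply/negP => /and3P[h1 h2 h3]; move: dj h1 h2 h3; clear; lia.
  move=> d; rewrite addnK => hd; case: ifP => // _; rewrite /H ifF //.
  by apply/negP => /and3P[h1 h2 h3]; move: hd h1 h2 h3; clear; lia.
rewrite (eq_bigr _ (fun (a : 'I_j.+1) _ => Hj a)).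
have T : \sum_(a < j.+1) \sum_(d < j.+1) H a d = B0j k M' u j.
  rewrite B0E; apply: eq_bigr => a _; apply: eq_bigr => d _.
  by rewrite /H (_ : (d <= j)%N) ?andbT // -ltnS.
rewrite T /B0; case: eqP => // ->; rewrite /B0j big_geq //.
Qed.

Lemma evrel_Ys : evrel u Ys (C1exponent k M' u).
Proof.
have u2 : u ^+ 2 = k%:R^-1 by apply: (mulIf (_ : k%:R != 0)); rewrite ?pnatr_eq0 -?lt0n // uk mulVf // pnatr_eq0 -lt0n.
have kz : k%:R != 0 :> R by rewrite pnatr_eq0 -lt0n.
have EL : evrel u (shiftop (cder i1) (be R M' k) (La Uo Bt)) (fps_divX2 (- fps_log1p (B0 k M' u))).
  apply: evrel_div; rewrite z_sLa //; apply: evrelN; apply: evrel_subst evrel_sB.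
  - exact: sB_vge.
  - by apply: vge_le (@swp_sB_vge R M' k M1).
have Eal : evrel u (al R M' k) ((kk R k * u ^+ 2) *: Uo ^+ 2).
  rewrite -scalerA; apply: evrelZ; rewrite -mulr_algl.
  by apply: evrelM; [exact: evrelXn|exact: evrelC].
have Eat := evrelM Eal (evrelC u (fps_const x1)).
have Ea2 := evrelZ (1/4) (evrelM Eal Eal); rewrite -!expr2 in Ea2.
have Elam : evrel u (liftA (fps A) (lam R k)) (fps_const ((kk R k / 2 * u ^+ 2 + kk R k ^+ 2 / 4 * u ^+ 4)%:A)).
  rewrite /lam liftAD !liftAZ !liftAX !liftA_X -fps_alg scalerDl -(scalerA (kk R k / 2) (u ^+ 2)) -(scalerA (kk R k ^+ 2 / 4) (u ^+ 4)).
  by apply: evrelD; apply: evrelZ; exact: evrelXn.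
have := evrelD (evrelD (evrelD EL Eat) Ea2) Elam; congr (evrel _ _ _).
have U2 : fps_binom (- 2) (Tst1 R M') = Uo ^+ 2.
  by rewrite UoX Tst1E /fps_binom scl_subst //; exact: Tser_vge.
have U4 : fps_binom (- 4) (Tst1 R M') = Uo ^+ 4.
  by rewrite UoX Tst1E /fps_binom scl_subst //; exact: Tser_vge.
have s2 : s2t2 R M' = fX ^+ 2 * fps_const x1.
  apply/fpsP=> m; rewrite /s2t2 mulrC fps_constM fps_XnE tv2 //.
  by case: (m == 2%N); rewrite ?mulr1 ?mulr0.
rewrite /C1exponent U2 U4 s2.
apply/fpsP=> m; rewrite /fps_add /fps_divX2 !fpsDE.
have K1 : ((kk R k * u ^+ 2) *: Uo ^+ 2 * fps_const x1) m =
   fps_scale (kR R k * (kR R k - 1) * u ^+ 2) (fps_mul (fX ^+ 2 * fps_const x1) (Uo ^+ 2)) m.+2.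
  transitivity (((kk R k * u ^+ 2) *: (fX ^+ 2 * (fps_const x1 * Uo ^+ 2))) m.+2); last by rewrite mulrA.
  by rewrite [fps_const x1 * _]mulrC -scalerAl !fpsZE fps_XnM !subSS subn0.
have K2 : ((1/4) *: ((kk R k * u ^+ 2) *: Uo ^+ 2) ^+ 2) m = fps_scale ((kR R k - 1) ^+ 2 / 4) (Uo ^+ 4) m.
  have -> : (1/4) *: ((kk R k * u ^+ 2) *: Uo ^+ 2) ^+ 2 = ((k%:R - 1) ^+ 2 / 4) *: Uo ^+ 4; last by [].
  by rewrite exprZn -exprM scalerA; congr (_ *: _); rewrite u2 /kk; field.
have K3 : fps_const ((kk R k / 2 * u ^+ 2 + kk R k ^+ 2 / 4 * u ^+ 4)%:A : A) m =
   fps_const (((2 * kR R k ^+ 2 * u ^+ 2 - kR R k + 1) * (kR R k - 1) / 4 : R)%:MP) m.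
  congr (fps_const _ m); rewrite -mul_mpolyC mulr1; congr (_%:MP).
  have -> : u ^+ 4 = u ^+ 2 * u ^+ 2 by rewrite -exprD.
  by rewrite u2 /kk /kR; field.
by rewrite K1 K2 K3; congr (_ + _ + _); exact: addrC.
Qed.

Lemma evrel_C1 : evrel u (fps_exp Ys * fps_const (dTst1 R M')) (C1 k M' u * dTst1 R M').
Proof.
apply: evrelM (evrelC u _); apply: evrel_subst evrel_Ys.
- exact: Ys_vge.
- exact: swp_Ys_vge.
Qed.

Lemma ev_poly r : exists p : {poly R}, (forall m, hfun k r ((fps_exp Ys * fps_const (dTst1 R M')) m) = p`_m)
  /\ p.[u] = hfun k r (C1 k M' u * dTst1 R M').
Proof.
have [P [PE Pu]] := evrel_C1 (ltnSn r.*2).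
exists (\poly_(i < size P) mfun om P`_i); split.
  move=> m; rewrite /hfun -[(_ m) r.*2]/(swp _ r.*2 m) PE coef_poly.
  by case: ltnP => // sP; rewrite nth_default // mfun0.
rewrite /hfun -Pu horner_poly horner_coef mfun_sum; apply: eq_bigr => i _.
by rewrite exprZn expr1n [P`_i * _]mulrC mulr_algl mfunZ mulrC.
Qed.
End EvalU.

(** * Summation over q *)
Section Tends.
Import classical_sets numFieldNormedType.Exports.
Variable R : realType.
Implicit Types x y : nat -> R.

Definition tends x l := forall e : R, 0 < e -> exists N, forall n, (N <= n)%N -> `|x n - l| <= e.

Lemma tendsD x y l m : tends x l -> tends y m -> tends (fun n => x n + y n) (l + m).
Proof.
move=> Hx Hy e e0; have e2 : 0 < e / 2 by rewrite divr_gt0.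
have [N1 H1] := Hx _ e2; have [N2 H2] := Hy _ e2; exists (maxn N1 N2) => n.
rewrite geq_max => /andP[n1 n2]; rewrite opprD addrACA (le_trans (ler_normD _ _)) //.
by rewrite [leRHS](splitr e) lerD ?H1 ?H2.
Qed.
Lemma tendsZ (a : R) x l : tends x l -> tends (fun n => a * x n) (a * l).
Proof.
move=> Hx e e0; have p : 0 < `|a| + 1 by rewrite ltr_wpDl.
have [N H] := Hx (e / (`|a| + 1)) (divr_gt0 e0 p); exists N => n /H nN.
rewrite -mulrBr normrM; apply: le_trans (ler_wpM2l (normr_ge0 _) nN) _.
by rewrite mulrCA ler_piMr ?(ltW e0) // ler_pdivrMr // mul1r lerDl.
Qed.
Lemma tends_sum n (X : nat -> nat -> R) (L : nat -> R) : (forall i, (i < n)%N -> tends (X i) (L i)) ->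
  tends (fun Q => \sum_(i < n) X i Q) (\sum_(i < n) L i).
Proof.
elim: n => [|n IHn] H.
  by move=> e e0; exists 0%N => Q _; rewrite !big_ord0 subrr normr0 ltW.
have H1 : tends (fun Q => \sum_(i < n) X i Q + X n Q) (\sum_(i < n) L i + L n).
  by apply: tendsD; [apply: IHn => i ni; apply: H; rewrite ltnS ltnW|apply: H].
move=> e e0; have [N HN] := H1 e e0; exists N => Q /HN.
by rewrite !big_ord_recr.
Qed.
Lemma tends_eq x y l N : tends x l -> (forall n, (N <= n)%N -> x n = y n) -> tends y l.
Proof.
move=> Hx E e e0; have [N1 H] := Hx e e0; exists (maxn N1 N) => n.
by rewrite geq_max => /andP[n1 n2]; rewrite -E // H.
Qed.
Lemma tends_comp x l (f : nat -> nat) : tends x l ->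
  (forall N, exists M, forall n, (M <= n)%N -> (N <= f n)%N) -> tends (fun n => x (f n)) l.
Proof.
move=> Hx Hf e e0; have [N H] := Hx e e0; have [M HM] := Hf N.
by exists M => n /HM /H.
Qed.
Lemma tends_squeeze x y z l : tends y l -> tends z 0 ->
  (forall n, `|x n - y n| <= z n) -> tends x l.
Proof.
move=> Hy Hz H e e0; have e2 : 0 < e / 2 by rewrite divr_gt0.
have [N1 H1] := Hy _ e2; have [N2 H2] := Hz _ e2; exists (maxn N1 N2) => n.
rewrite geq_max => /andP[n1 n2].
have -> : x n - l = (x n - y n) + (y n - l) by rewrite addrA subrK.
rewrite (le_trans (ler_normD _ _)) // [leRHS](splitr e) lerD ?H1 //.
by have := H2 n n2; rewrite subr0; apply: le_trans; apply: le_trans (H n) (ler_norm _).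
Qed.
Lemma tends_bound x l (c K : R) N : tends x l -> (forall n, (N <= n)%N -> `|c - x n| <= K) -> `|c - l| <= K.
Proof.
move=> Hx H; apply/ler_addgt0Pr => e e0; have [N1 H1] := Hx e e0.
have -> : c - l = (c - x (maxn N N1)) + (x (maxn N N1) - l) by rewrite addrA subrK.
by rewrite (le_trans (ler_normD _ _)) // lerD ?H ?H1 ?leq_maxl ?leq_maxr.
Qed.

Lemma tends_expR (x : R) : tends (fun n => \sum_(j < n) x ^+ j / j`!%:R) (expR x).
Proof.
have H0 : (series (exp_coeff x) @ \oo --> expR x)%classic by exact: is_cvg_series_exp_coeff.
move=> e e0; have /cvgrPdist_le/(_ e e0)[N _ H] := H0.
by exists N => n /H; rewrite distrC /series /= big_mkord.
Qed.
End Tends.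

Section ExpPoly.
Variables (R : realType) (P : {poly R}).
Notation S := (fps R^o).
Hypotheses (P0 : P`_0 = 0) (Ppos : forall i, 0 <= P`_i).
Let F : S := fun m => P`_m.

Lemma FX j m : (F ^+ j) m = (P ^+ j)`_m.
Proof.
elim: j m => [|j IHj] m; first by rewrite !expr0 fpsE1 coef1; case: eqP.
by rewrite !exprS fpsME coefM; apply: eq_bigr => i _; rewrite IHj.
Qed.
Lemma PXpos j i : 0 <= (P ^+ j)`_i.
Proof.
elim: j i => [|j IHj] i; first by rewrite expr0 coef1 ler0n.
by rewrite exprS coefM sumr_ge0 // => l _; rewrite mulr_ge0.
Qed.

(* The partial sums of the series [exp (- P)] at [w] are compared with those of the real
   exponential at [P.[w]]. *)
Lemma exp_poly_partial (w : R) N n : (n * size P <= N)%N -> (n <= N)%N ->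
  `|\sum_(m < N) fps_exp (- F) m * w ^+ m - \sum_(j < n) (- P.[w]) ^+ j / j`!%:R| <=
  \sum_(j < N) P.[`|w|] ^+ j / j`!%:R - \sum_(j < n) P.[`|w|] ^+ j / j`!%:R.
Proof.
move=> nN nN'.
have F1 : vge 1 F by apply: vge1P.
pose D j := \sum_(m < N) (P ^+ j)`_m * w ^+ m.
have -> : \sum_(m < N) fps_exp (- F) m * w ^+ m = \sum_(j < N) (-1) ^+ j * D j / j`!%:R.
  have E (m : 'I_N) : fps_exp (- F) m * w ^+ m = \sum_(j < N) (-1) ^+ j * ((P ^+ j)`_m * w ^+ m) / j`!%:R.
    rewrite fps_expE (bsubst_wide _ (vgeN F1) (ltn_ord m)) mulr_suml; apply: eq_bigr => j _.
    by rewrite -scaleN1r exprZn fpsZE FX alg_regular /GRing.scale /=; ring.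
  rewrite (eq_bigr _ (fun m _ => E m)) exchange_big; apply: eq_bigr => j _ /=.
  by rewrite /D mulr_sumr mulr_suml.
have DE j : (j < n)%N -> D j = P.[w] ^+ j.
  move=> jn; rewrite -horner_exp (@horner_coef_wide _ N) //.
  have [->|P00] := eqVneq P 0.
    rewrite expr0n; case: j jn => [|j] jn; rewrite ?size_poly0 // size_poly1; lia.
  apply: leq_trans (size_poly_exp_leq _ _) _; apply: leq_trans nN.
  apply: leq_trans (leq_mul jn (leqnn (size P))).
  have : (0 < size P)%N by rewrite lt0n size_poly_eq0.
  by case: (size P) => // s' _; rewrite /= [(s' * j)%N]mulnC mulSn mulnS; lia.
have DB j : `|D j| <= P.[`|w|] ^+ j.
  apply: le_trans (ler_norm_sum _ _ _) _.
  have T (m : 'I_N) : `|(P ^+ j)`_m * w ^+ m| = (P ^+ j)`_m * `|w| ^+ m.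
    by rewrite normrM normrX ger0_norm // PXpos.
  rewrite (eq_bigr _ (fun m _ => T m)) -horner_exp.
  rewrite (@horner_coef_wide _ (maxn N (size (P ^+ j)))) ?leq_maxr //.
  rewrite (big_ord_widen _ (fun m => (P ^+ j)`_m * `|w| ^+ m) (leq_maxl N (size (P ^+ j)))).
  rewrite big_mkcond /=; apply: ler_sum => m _; case: ifP => // _.
  by rewrite mulr_ge0 ?PXpos ?exprn_ge0.
rewrite -(subnKC nN') !big_split_ord /=.
have -> : \sum_(i < n) (-1) ^+ i * D i / i`!%:R = \sum_(j < n) (- P.[w]) ^+ j / j`!%:R.
  by apply: eq_bigr => j _; rewrite DE // -exprNn.
rewrite addrAC subrr add0r addrAC subrr add0r.
apply: le_trans (ler_norm_sum _ _ _) _; apply: ler_sum => j _.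
rewrite !normrM normrX normrN1 expr1n mul1r [`|_^-1|]ger0_norm ?invr_ge0 //.
by rewrite ler_wpM2r ?invr_ge0.
Qed.

Lemma exp_poly_tends (w : R) : tends (fun N => \sum_(m < N) fps_exp (- F) m * w ^+ m) (expR (- P.[w])).
Proof.
(* The first [f N] powers of [P] lie entirely below degree [N]; the successor keeps the divisor
   positive when [P] is zero. *)
set s := (size P).+1; pose f N := (N %/ s)%N.
have Hf N0 : exists M, forall n, (M <= n)%N -> (N0 <= f n)%N.
  by exists (N0 * s)%N => n H; rewrite /f leq_divRL.
apply: (tends_squeeze (y := fun N => \sum_(j < f N) (- P.[w]) ^+ j / j`!%:R)
   (z := fun N => \sum_(j < N) P.[`|w|] ^+ j / j`!%:R + (-1) * \sum_(j < f N) P.[`|w|] ^+ j / j`!%:R)).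
- exact: (tends_comp (tends_expR _) Hf).
- have := tendsD (tends_expR (P.[`|w|])) (tendsZ (-1) (tends_comp (tends_expR (P.[`|w|])) Hf)).
  by rewrite mulN1r subrr.
move=> N; rewrite mulN1r; apply: exp_poly_partial.
  by apply: leq_trans (leq_divM N s); rewrite /f leq_mul2l leqnSn orbT.
exact: leq_div.
Qed.
End ExpPoly.

Section SumQ.
Variables (R : realType) (M' k : nat).
Hypotheses (M1 : (0 < M')%N) (k0 : (0 < k)%N).
Notation A := {mpoly R[M'.+1]}.
Notation S := (fps R^o).
Notation dT := (dTst1 R M').

Definition Elam : S := fps_exp (- lam R k).
Lemma lam_vge : vge 1 (lam R k).
Proof. by apply: vge1P; rewrite /lam fpsDE !fpsZE !fps_XnE /= !scaler0 addr0. Qed.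

(** The scalar factor [exp (- lam)] splits off as [Elam]; what remains is a polynomial in [v] whose
    coefficients do not depend on the root [u]. *)
Lemma pcoef_conv r : exists p : {poly R},
  (forall u, u ^+ 2 * k%:R = 1 -> p.[u] = hfun k r (C1 k M' u * dT)) /\
  forall m, pcoef R M' k r m = \sum_(i < m.+1) p`_i * Elam (m - i)%N.
Proof.
have kR0 : 0 < k%:R :> R by rewrite ltr0n.
have u0 : ((Num.sqrt k%:R)^-1 : R) ^+ 2 * k%:R = 1.
  by rewrite exprVn sqr_sqrtr ?ltW // mulVf // gt_eqF.
have [p [pE _]] := ev_poly M1 k0 u0 r.
exists p; split.
  move=> u uk; have [q [qE <-]] := ev_poly M1 k0 uk r.
  by congr (_.[u]); apply/polyP => m; rewrite -pE -qE.
move=> m; rewrite (@pcoef_shift R M' k M1).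
have sub (V : zmodType) (x y : V) : y = - x + (y + x) by rewrite addrC addrK.
have -> : Om R M' k = liftA (fps A) (- lam R k) + Ys R M' k by rewrite liftAN; exact: sub.
have L1 : vge 1 (liftA (fps A) (- lam R k)).
  by apply: vge1P; rewrite /liftA fpsNE lam_vge // oppr0 scale0r.
rewrite fps_expD //; last exact: Ys_vge.
rewrite -[fps_exp (liftA _ _)]/(fps_subst _ _) -liftA_subst -/(fps_exp _) -/Elam -mulrA mulrC fpsME hfun_sum.
apply: eq_bigr => i _.
by rewrite /liftA mulrC mulr_algl hfunZ pE mulrC.
Qed.

(** At [w^2 = 1/k] the value of [lam] is [(k-1)/2 + (k-1)^2/4 = (k^2-1)/4]. *)
Lemma Elam_tends (w : R) : w ^+ 2 * k%:R = 1 ->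
  tends (fun N => \sum_(m < N) Elam m * w ^+ m) (expR (- ((k%:R ^+ 2 - 1) / 4))).
Proof.
move=> wk; have kz : k%:R != 0 :> R by rewrite pnatr_eq0 -lt0n.
have w2 : w ^+ 2 = k%:R^-1 by apply: (mulIf kz); rewrite wk mulVf.
have w4 : w ^+ 4 = k%:R^-1 ^+ 2 by rewrite -w2 -exprM.
pose P : {poly R} := (kk R k / 2)%:P * 'X^2 + (kk R k ^+ 2 / 4)%:P * 'X^4.
have kk0 : 0 <= kk R k by rewrite /kk mulr_ge0 // subr_ge0 ler1n.
have PE m : P`_m = lam R k m.
  by rewrite /P /lam coefD !coefCM !coefXn fpsDE !fpsZE !fps_XnE.
have P0 : P`_0 = 0 by rewrite PE lam_vge.
have Pp i : 0 <= P`_i.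
  rewrite PE /lam fpsDE !fpsZE !fps_XnE /GRing.scale /= addr_ge0 // mulr_ge0 ?divr_ge0 ?exprn_ge0 //.
have := exp_poly_tends P0 Pp w.
have -> : P.[w] = (k%:R ^+ 2 - 1) / 4.
  by rewrite /P hornerD (hornerM _ 'X^2) (hornerM _ 'X^4) !hornerC !hornerXn w2 w4 /kk; field.
have -> // : (fun m : nat => P`_m) = lam R k :> S.
by apply/fpsP=> m; exact: PE.
Qed.

(** The polynomial has finitely many coefficients, and each of them only shifts the index at which
    the series [Elam] is truncated. *)
Lemma conv_tends (p : {poly R}) (w : R) : w ^+ 2 * k%:R = 1 ->
  tends (fun N => \sum_(m < N) (\sum_(i < m.+1) p`_i * Elam (m - i)%N) * w ^+ m)
    (expR (- ((k%:R ^+ 2 - 1) / 4)) * p.[w]).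
Proof.
move=> wk; have T := Elam_tends wk.
rewrite horner_coef mulr_sumr.
have E (i : 'I_(size p)) : expR (- ((k%:R ^+ 2 - 1) / 4)) * (p`_i * w ^+ i) =
   (p`_i * w ^+ i) * expR (- ((k%:R ^+ 2 - 1) / 4)) by rewrite mulrC.
rewrite (eq_bigr _ (fun i _ => E i)).
apply: (tends_eq (x := fun N => \sum_(l < size p) (p`_l * w ^+ l) * \sum_(l' < (N - l)%N) Elam l' * w ^+ l') (N := size p)).
  apply: (@tends_sum _ (size p) (fun l N => (p`_l * w ^+ l) * \sum_(l' < (N - l)%N) Elam l' * w ^+ l')
    (fun i => (p`_i * w ^+ i) * expR (- ((k%:R ^+ 2 - 1) / 4)))) => l _.
  apply: tendsZ; apply: (tends_comp (x := fun N => \sum_(l' < N) Elam l' * w ^+ l') T) => N.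
  by exists (N + l)%N => n H; rewrite -(leq_add2r l) subnK // (leq_trans _ H) // leq_addl.
move=> N pN; rewrite (psumM (fun i => p`_i) Elam).
rewrite (big_ord_widen N (fun l => p`_l * w ^+ l * \sum_(l' < (N - l)%N) Elam l' * w ^+ l') pN).
rewrite big_mkcond /=; apply: eq_bigr => l _; case: ltnP => // pl.
by rewrite nth_default // !mul0r.
Qed.

Notation SGm r := ((-1) ^+ r * mfun (fun i => hw (@cH R M' k i)) (C2 R k M' r.*2)).

(** Averaging the values at [u] and [- u] keeps the even powers of [v], and [u^(2q) = 1/k^q]. This
    is the origin of the two summands of [C2]. *)
Lemma pcoef_tends r : tends (fun Q => \sum_(q < Q) pcoef R M' k r q.*2 / k%:R ^+ q)
  (expR (- ((k%:R ^+ 2 - 1) / 4)) * (mfun (fun i => hw (@cH R M' k i)) (C2 R k M' r.*2) / 2)).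
Proof.
have kR0 : 0 < k%:R :> R by rewrite ltr0n.
have [p [pu pE]] := pcoef_conv r; pose u : R := (Num.sqrt k%:R)^-1.
have uk : u ^+ 2 * k%:R = 1 by rewrite exprVn sqr_sqrtr ?ltW // mulVf // gt_eqF.
have nuk : (- u) ^+ 2 * k%:R = 1 by rewrite sqrrN.
have H := tendsZ (1/2) (tendsD (conv_tends p nuk) (conv_tends p uk)).
have Hd (N : nat) : exists M, forall n, (M <= n)%N -> (N <= n.*2)%N.
  by exists N => n /leq_trans; apply; rewrite -addnn leq_addr.
have -> : mfun (fun i => hw (@cH R M' k i)) (C2 R k M' r.*2) = p.[- u] + p.[u].
  rewrite !pu // -hfunD -mulrDl //.
have := tends_comp H Hd.
have -> : 1 / 2 * (expR (- ((k%:R ^+ 2 - 1) / 4)) * p.[- u] + expR (- ((k%:R ^+ 2 - 1) / 4)) * p.[u]) =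
  expR (- ((k%:R ^+ 2 - 1) / 4)) * ((p.[- u] + p.[u]) / 2) by field.
move/(tends_eq (N := 0)); apply => Q _; rewrite -big_split mulr_sumr.
rewrite (eq_bigr (fun m : 'I_Q.*2 => 1 / 2 * (pcoef R M' k r m * (- u) ^+ m + pcoef R M' k r m * u ^+ m))); last first.
  by move=> m _; rewrite /= pE.
elim: Q => [|Q IHQ]; first by rewrite !big_ord0.
rewrite doubleS !big_ord_recr /= IHQ -addrA; congr (_ + _).
have n1 : (- u) ^+ Q.*2 = u ^+ Q.*2 by rewrite exprNn -signr_odd odd_double mul1r.
have n2 : (- u) ^+ Q.*2.+1 = - u ^+ Q.*2.+1 by rewrite !exprS n1 mulNr.
rewrite n1 n2.
have uQ : u ^+ Q.*2 = (k%:R ^+ Q)^-1.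
  by rewrite -mul2n exprM -exprVn; congr (_ ^+ _); apply: (mulIf (lt0r_neq0 kR0)); rewrite uk mulVf // gt_eqF.
rewrite uQ; move: (u ^+ Q.*2.+1) (pcoef _ _ _ _ Q.*2) (pcoef _ _ _ _ Q.*2.+1) => a b c.
by field; rewrite expf_neq0 // gt_eqF.
Qed.

Notation kG := (scl (k%:R^-1 : R^o) (Gam R)).
(** The limits of the terms are computed only after multiplication by the Stirling series [kG],
    which is therefore inverted formally; it cancels against the expansion of the double factorial
    in the final product. *)
Definition Alim : S := fps_binom (- 1) (kG - 1) *
  (fun r => expR (- ((k%:R ^+ 2 - 1) / 4)) / 2 * SGm r : R^o).

Lemma kG_vge : vge 1 (kG - 1).
Proof. by apply: vge1P; rewrite fpsBE /scl Gam0 expr0 fpsE1 scale1r subrr. Qed.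
Lemma kGV : fps_binom (- 1) (kG - 1) * kG = 1.
Proof.
have E : 1 + (kG - 1) = kG by rewrite addrC subrK.
by have := fps_binomN 1 kG_vge; rewrite (fps_binom_nat 1 kG_vge) expr1 E.
Qed.
Lemma Alim_conv : kG * Alim = (fun r => expR (- ((k%:R ^+ 2 - 1) / 4)) / 2 * SGm r : R^o).
Proof. by rewrite /Alim mulrA [kG * _]mulrC kGV mul1r. Qed.

Lemma aser_tends r : tends (fun Q => \sum_(q < Q) aser R M' k q r) (Alim r).
Proof.
have S1 l : tends (fun Q => (kG * \sum_(q < Q) aser R M' k q) l) (expR (- ((k%:R ^+ 2 - 1) / 4)) / 2 * SGm l).
  have := tendsZ ((-1) ^+ l) (pcoef_tends l).
  have -> : (-1) ^+ l * (expR (- ((k%:R ^+ 2 - 1) / 4)) * (mfun (fun i => hw (@cH R M' k i)) (C2 R k M' l.*2) / 2)) =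
    expR (- ((k%:R ^+ 2 - 1) / 4)) / 2 * SGm l by ring.
  move/(tends_eq (N := 0)); apply => Q _; rewrite mulr_sumr [RHS](_ : _ = \sum_(q < Q) (kG * aser R M' k q) l).
    apply: eq_bigr => q _; rewrite pcoef_aser //.
    have kq : k%:R ^+ q != 0 :> R by rewrite expf_neq0 // pnatr_eq0 -lt0n.
    have s2 : (-1) ^+ l * (-1) ^+ l = 1 :> R by rewrite -expr2 sqrr_sign.
    transitivity ((-1) ^+ l * (-1) ^+ l * (kG * aser R M' k q) l); last by rewrite s2 mul1r.
    move: ((-1) ^+ l) (k%:R ^+ q) kq ((kG * aser R M' k q) l) => a b b0 c.
    by field.
  by rewrite mulr_sumr fps_sumE.
have := @tends_sum _ r.+1 (fun i Q => fps_binom (- 1) (kG - 1) i * (kG * \sum_(q < Q) aser R M' k q) (r - i)%N)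
  (fun i => fps_binom (- 1) (kG - 1) i * (expR (- ((k%:R ^+ 2 - 1) / 4)) / 2 * SGm (r - i))) .
rewrite /Alim fpsME => H; apply: (tends_eq (N := 0) (H _)) => [i _|Q _].
  by apply: tendsZ.
by rewrite -(fpsME (fps_binom (- 1) (kG - 1)) (kG * _)) mulrA kGV mul1r fps_sumE.
Qed.

Hypotheses (kM : (k <= M'.+1)%N) (k2 : (2 <= k)%N).
Theorem SG_expansion r : exists K : R, exists n1 : nat, forall n, (n1 <= n)%N -> ~~ odd (n * k) ->
  `|k`!%:R ^+ n * (SG k n)%:R / oddf R (n * k)./2 - \sum_(l < r) Alim l * n%:R^-1 ^+ l| <= K * n%:R^-1 ^+ r.
Proof.
have [K [n1 H]] := @SG_tannery R M' k kM k2 r; exists K, n1 => n n1n ev.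
apply: (tends_bound (x := fun Q => \sum_(l < r) (\sum_(q < Q) aser R M' k q l) * n%:R^-1 ^+ l) (N := (n * k)./2.+1)).
  apply: (@tends_sum _ r (fun l Q => (\sum_(q < Q) aser R M' k q l) * n%:R^-1 ^+ l)
    (fun l => Alim l * n%:R^-1 ^+ l)) => l _.
  rewrite mulrC; apply: (tends_eq (N := 0) (tendsZ (n%:R^-1 ^+ l) (aser_tends l))) => Q _.
  by rewrite mulrC.
move=> Q hQ; have := H n Q n1n ev hQ; congr (`|_ - _| <= _); apply: eq_bigr => l _.
Qed.
End SumQ.

(** * Independence of the number of variables *)
Section Widen.
Variables (R : realType) (n N : nat).
Hypotheses (nN : (n <= N)%N) (n1 : (0 < n)%N).
Notation A := {mpoly R[n.+1]}.
Notation A' := {mpoly R[N.+1]}.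
Definition wid (i : 'I_n.+1) : 'I_N.+1 := widen_ord (nN : (n < N.+1)%N) i.
Definition embw (p : A) : A' := p \mPo [tuple 'X_(wid i) | i < n.+1].

Lemma embwZ (x : R) p : embw (x *: p) = x *: embw p.
Proof. exact: comp_mpolyZ. Qed.
Lemma embwD p q : embw (p + q) = embw p + embw q.
Proof. exact: comp_mpolyD. Qed.
Lemma embwM p q : embw (p * q) = embw p * embw q.
Proof. exact: rmorphM. Qed.
Lemma embw0 : embw 0 = 0. Proof. exact: comp_mpoly0. Qed.
Lemma embw1 : embw 1 = 1. Proof. exact: comp_mpoly1. Qed.

Lemma mfun_embw (om : 'I_N.+1 -> nat -> R) p : (forall i, om i 0%N = 1) ->
  mfun om (embw p) = mfun (fun i => om (wid i)) p.
Proof.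
move=> om0; elim/mpoly_lin_ind: p.
- by move=> p q Hp Hq; rewrite embwD !mfunD Hp Hq.
- by rewrite embw0 !mfun0.
- by move=> x p Hp; rewrite embwZ !mfunZ Hp.
move=> m; pose e (j : nat) := if (j < n.+1)%N then m (inord j) else 0%N.
have -> : embw 'X_[m] = \prod_(j < N.+1) 'X_j ^+ e j.
  rewrite /embw comp_mpolyX.
  rewrite (eq_bigr (fun i : 'I_n.+1 => 'X_(inord i : 'I_N.+1) ^+ m (inord i))) => [|i _].
    rewrite (big_ord_widen N.+1 (fun i => 'X_(inord i : 'I_N.+1) ^+ m (inord i))) //.
    rewrite big_mkcond; apply: eq_bigr => j _; rewrite /e; case: ifP => jn; last by rewrite expr0.
    by rewrite inord_val.
  rewrite tnth_mktuple inord_val; congr ('X_ _ ^+ _); apply/val_inj.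
  by rewrite /= inordK // (leq_trans (ltn_ord i)).
rewrite mfunXn mfunX; rewrite [RHS](eq_bigr (fun i : 'I_n.+1 => om (inord i) (m (inord i)))) => [|i _].
  rewrite (big_ord_widen N.+1 (fun i => om (inord i) (m (inord i)))) //.
  rewrite [RHS]big_mkcond; apply: eq_bigr => j _; rewrite /e; case: ifP => jn; last exact: om0.
  by rewrite inord_val.
rewrite inord_val; congr (om _ _); apply/val_inj.
by rewrite /= inordK // (leq_trans (ltn_ord i)).
Qed.

Let rho (j : nat) (a : A) (a' : A') := a' = embw a.
Let r0 : forall j, rho j 0 0. Proof. by move=> j; rewrite /rho embw0. Qed.
Let r1 : rho 0%N 1 1. Proof. by rewrite /rho embw1. Qed.
Let rD : forall j a b a' b', rho j a a' -> rho j b b' -> rho j (a + b) (a' + b').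
Proof. by move=> j a b _ _ -> ->; rewrite /rho embwD. Qed.
Let rZ : forall j (x : R) a a', rho j a a' -> rho j (x *: a) (x *: a').
Proof. by move=> j x a _ ->; rewrite /rho embwZ. Qed.
Let rM : forall i j a b a' b', rho i a a' -> rho j b b' -> rho (i + j)%N (a * b) (a' * b').
Proof. by move=> i j a b _ _ -> ->; rewrite /rho embwM. Qed.

Lemma embw_tv j : (j <= n.+1)%N -> tv R N j = embw (tv R n j).
Proof.
move=> jn; rewrite /tv jn (leq_trans jn) ?ltnS // !andbT; case: j jn => [|j] jn /=; first by rewrite embw0.
rewrite /embw comp_mpolyXU -tnth_nth tnth_mktuple; congr ('X_ _); apply/val_inj.
by rewrite /= !inordK // (leq_trans jn).
Qed.
Lemma frel_W : frel rho n.+1 (Wser R n) (Wser R N).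
Proof. by move=> [|j] jn; rewrite /rho /Wser /= ?embw0 // -embw_tv. Qed.
Lemma frel_isqrt K : frel rho K (isqrt1mz2 R n) (isqrt1mz2 R N).
Proof.
apply: (frel_subst r0 r1 rD rZ rM) => j _; rewrite /rho; case: ifP => _; last by rewrite embw0.
by rewrite -!scaleN1r embwZ embw1.
Qed.
Lemma embw_vcoef p q : (p <= n)%N || (q == 0%N) -> vcoef R N p q = embw (vcoef R n p q).
Proof.
rewrite !vcoefE; case/orP => [pn|/eqP ->].
  have H := frelM r0 rD rM (frelX r0 r1 rD rM q frel_W) (@frel_isqrt n.+1).
  exact: (H p pn).
by rewrite !expr0 !mul1r; apply: (@frel_isqrt p.+1).
Qed.
(** For [j <= n + 1], variables other than [t_1] enter through [Wser ^ b] with [b >= 1], whose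
    coefficient then has degree at most [n]; so none beyond [t_{n+1}] occurs. *)
Lemma frel_B0 k (u : R) : frel rho n.+2 (B0 k n u) (B0 k N u).
Proof.
move=> j jn; rewrite /rho /B0; case: eqP => _; first by rewrite embw0.
rewrite /B0j; apply: (rho_sum (rho := rho) r0 rD (j := 0)) => l _; apply: (rho_sum (rho := rho) r0 rD (j := 0)) => a _.
apply: (rho_sum (rho := rho) r0 rD (j := 0)) => b abl; rewrite /rho embwZ embwM; congr (_ *: (_ * _)).
  rewrite (@embw_tv 1) //; elim: (_ - _)%N => [|m IHm]; first by rewrite !expr0 embw1.
  by rewrite !exprS embwM IHm.
apply: embw_vcoef; case: eqP => [_|b0]; rewrite ?orbT // orbF.
by move: abl b0 jn; clear; lia.
Qed.
Lemma frel_T K (c : nat -> R) : frel rho K (fun m => c m *: tv R n 1 ^+ m) (fun m => c m *: tv R N 1 ^+ m).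
Proof.
move=> j _; rewrite /rho embwZ; congr (_ *: _); rewrite (@embw_tv 1) //.
elim: j => [|j IHj]; first by rewrite !expr0 embw1.
by rewrite !exprS embwM IHj.
Qed.
Lemma C1exponentE N' k (u : R) : C1exponent k N' u =
  fps_divX2 (kR R k * (kR R k - 1) * u ^+ 2 *: (s2t2 R N' * fps_binom (- 2) (Tst1 R N')) + - fps_log1p (B0 k N' u)) +
  ((kR R k - 1) ^+ 2 / 4) *: fps_binom (- 4) (Tst1 R N') +
  fps_const (((2 * kR R k ^+ 2 * u ^+ 2 - kR R k + 1) * (kR R k - 1) / 4 : R)%:MP).
Proof. by []. Qed.
(** Division by [s^2] loses two orders: [n + 1] variables determine the orders below [n], so that
    order [2r] needs [2r + 2] of them. *)
Lemma frel_C1exp k (u : R) : frel rho n (C1exponent k n u) (C1exponent k N u).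
Proof.
have bT q K : frel rho K (fps_binom q (Tst1 R n)) (fps_binom q (Tst1 R N)).
  by apply: (frel_subst r0 r1 rD rZ rM); exact: frel_T.
rewrite !C1exponentE; apply: (frelD rD); first apply: (frelD rD).
- move=> j jn; have jn2 : (j.+2 < n.+2)%N by [].
  suff H : frel rho n.+2 (kR R k * (kR R k - 1) * u ^+ 2 *: (s2t2 R n * fps_binom (- 2) (Tst1 R n)) + - fps_log1p (B0 k n u))
    (kR R k * (kR R k - 1) * u ^+ 2 *: (s2t2 R N * fps_binom (- 2) (Tst1 R N)) + - fps_log1p (B0 k N u)).
    exact: (H _ jn2).
  apply: (frelD rD); last first.
    by apply: (frelN rZ); apply: (frel_subst r0 r1 rD rZ rM); exact: frel_B0.
  apply: (frelZ rZ); apply: (frelM r0 rD rM) => // m _.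
  by rewrite /s2t2; case: ifP => _; [apply: embw_tv|exact: r0].
- by apply: (frelZ rZ); exact: bT.
move=> j _; rewrite /rho /fps_const; case: ifP => _; last by rewrite embw0.
by rewrite /embw comp_mpolyC.
Qed.
Lemma frel_C2 k : frel rho n (C2 R k n) (C2 R k N).
Proof.
have H (u : R) : frel rho n (C1 k n u) (C1 k N u).
  by apply: (frel_subst r0 r1 rD rZ rM); exact: frel_C1exp.
apply: (frelM r0 rD rM); last exact: frel_T.
by apply: (frelD rD).
Qed.
End Widen.

Lemma SGt_widen (R : realType) k r N : (r.*2.+1 <= N)%N ->
  SGt R k r = (-1) ^+ r * mfun (fun i => hw (@cH R N k i)) (C2 R k N r.*2).
Proof.
move=> rN; rewrite /SGt; congr (_ * _).
have -> : C2 R k N r.*2 = embw rN (C2 R k r.*2.+1 r.*2).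
  exact: (@frel_C2 R _ _ rN isT k r.*2 (ltnSn _)).
by rewrite mfun_embw // => i; exact: hw0.
Qed.

(** * The asymptotic expansion *)
Section Assembly.
Variables (R : realType) (k : nat).
Hypothesis k2 : (2 <= k)%N.
Notation S := (fps R^o).
Notation kG := (scl (k%:R^-1 : R^o) (Gam R)).

Let k0 : (0 < k)%N. Proof. exact: ltnW. Qed.

(** For odd [n k] the truncated series itself is taken, so that the calculus of expansions along all
    integers applies. *)
Definition zk r n : R := if odd (n * k) then (pol r (kG : S)).[eps R n] else zst R (n * k)./2.
Lemma zk_asy r : asy r (zk r) kG.
Proof.
have [C C0 [N0 H]] := bigO_ge0 (@zst_asy R r).
exists (C * (2 / k%:R) ^+ r), (N0.*2.+2)%N => n nN; rewrite /zk; case: ifP => ev.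
  by rewrite subrr normr0 !mulr_ge0 ?exprn_ge0 ?eps_ge0 // mulr_ge0 // invr_ge0.
have hE : (n * k)./2.*2 = (n * k)%N by rewrite even_halfK // ev.
have n0 : (0 < n)%N by apply: leq_trans nN.
have nk : (n <= n * k)%N by rewrite leq_pmulr.
have hN : (N0 < (n * k)./2)%N by move: nN hE nk; clear; lia.
have := H _ hN; rewrite hE.
have -> : (pol r (Gam R)).[eps R (n * k)] = (pol r (kG : S)).[eps R n].
  rewrite !pol_sum; apply: eq_bigr => j _; rewrite /scl /eps natrM invfM exprMn /GRing.scale /=.
  by ring.
move/le_trans; apply; rewrite -mulrA ler_wpM2l // -exprMn.
have -> // : eps R (n * k)./2 = 2 / k%:R * eps R n.
have h0 : ((n * k)./2)%:R != 0 :> R by rewrite pnatr_eq0 -lt0n (leq_ltn_trans _ hN).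
have E : ((n * k)./2)%:R * 2 = n%:R * k%:R :> R by rewrite -!natrM muln2 hE.
have nz : n%:R != 0 :> R by rewrite pnatr_eq0 -lt0n.
have kz : k%:R != 0 :> R by rewrite pnatr_eq0 -lt0n.
rewrite /eps; apply: (mulfI h0); rewrite divff //.
have -> : ((n * k)./2)%:R * (2 / k%:R * n%:R^-1) = (((n * k)./2)%:R * 2) / (n%:R * k%:R) :> R by field; rewrite nz kz.
by rewrite E divff // mulf_neq0.
Qed.

Lemma an_gt0 n : (0 < n)%N -> 0 < an R k n.
Proof.
move=> n0; rewrite /an; apply: divr_gt0; last by rewrite sqrtr_gt0.
apply: mulr_gt0; last exact: expR_gt0.
rewrite divr_gt0 ?exprn_gt0 ?ltr0n ?fact_gt0 //.
by rewrite divr_gt0 ?expR_gt0 // ltr0n muln_gt0 n0.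
Qed.

(** The factor 2 compensates the two factors [1 / sqrt 2], one in [an] and one in [zst]. *)
Lemma SG_an n : (0 < n)%N -> ~~ odd (n * k) ->
  (SG k n)%:R = an R k n * (2 * expR ((k%:R ^+ 2 - 1) / 4) *
    (k`!%:R ^+ n * (SG k n)%:R / oddf R (n * k)./2 * zst R (n * k)./2)).
Proof.
move=> n0 ev; set M := (n * k)./2; have hE : M.*2 = (n * k)%N by rewrite even_halfK.
have o0 := lt0r_neq0 (oddf_gt0 R M).
rewrite /an /zst -/M hE /eps expRN expr_div_n -(@expRM_natl R) mulr1 exprVn.
have e0 : expR M%:R != 0 :> R by rewrite gt_eqF // expR_gt0.
have l0 : expR ((k%:R ^+ 2 - 1) / 4) != 0 :> R by rewrite gt_eqF // expR_gt0.
have f0 : k`!%:R ^+ n != 0 :> R by rewrite expf_neq0 // pnatr_eq0 -lt0n fact_gt0.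
have N0 : (n * k)%:R ^+ M != 0 :> R by rewrite expf_neq0 // pnatr_eq0 -lt0n muln_gt0 n0.
have s0 : Num.sqrt 2 != 0 :> R by rewrite gt_eqF // sqrtr_gt0.
have s2 : Num.sqrt 2 * Num.sqrt 2 = 2 :> R by rewrite -expr2 sqr_sqrtr.
move: (oddf R M) (expR M%:R) (expR ((k%:R ^+ 2 - 1) / 4)) (k`!%:R ^+ n) ((n * k)%:R ^+ M) (Num.sqrt 2) (SG k n)%:R
  o0 e0 l0 f0 N0 s0 s2 => o e l f N s g o0 e0 l0 f0 N0 s0 s2.
rewrite -[in RHS]s2; field.
by rewrite o0 e0 l0 f0 N0 s0.
Qed.

Theorem SG_asymptotic r : exists C : R, exists N0 : nat, forall n : nat,
  (N0 <= n)%N -> ~~ odd (n * k) ->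
  `|(SG k n)%:R - an R k n * \sum_(l < r) SGt R k l * (n%:R)^-1 ^+ l| <= C * an R k n * (n%:R)^-1 ^+ r.
Proof.
(* The exact formula asks for at least [k] variables, and the coefficients up to order [r] for at
   most [2r + 2]. *)
pose M' := (k + r.*2.+1)%N.
have M1 : (0 < M')%N by rewrite /M' addnS.
have kM : (k <= M'.+1)%N by rewrite leqW // leq_addr.
set a := Alim R M' k.
have aE := Alim_conv R M' k; rewrite -/a in aE.
pose X n : R := if odd (n * k) then (pol r (a : S)).[eps R n] else k`!%:R ^+ n * (SG k n)%:R / oddf R (n * k)./2.
have Xa : asy r X a.
  have [K [n1 H]] := @SG_expansion R M' k M1 k0 kM k2 r.
  exists `|K|, n1 => n nn; rewrite /X; case: ifP => ev.
    by rewrite subrr normr0 mulr_ge0 ?exprn_ge0 ?eps_ge0.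
  rewrite pol_sum; apply: le_trans (H n (ltnW nn) (negbT ev)) _.
  by rewrite ler_wpM2r ?exprn_ge0 ?invr_ge0 // ler_norm.
have [C [N0 H]] := asyZ (2 * expR ((k%:R ^+ 2 - 1) / 4)) (asyM (zk_asy r) Xa).
exists C, N0.+1 => n nN ev; have n0 : (0 < n)%N by apply: leq_trans nN.
have := H n nN; rewrite /zk /X (negbTE ev) pol_sum.
have -> : \sum_(j < r) ((2 * expR ((k%:R ^+ 2 - 1) / 4)) *: (kG * a) : S) j * eps R n ^+ j =
    \sum_(l < r) SGt R k l * n%:R^-1 ^+ l.
  apply: eq_bigr => l _; congr (_ * _); rewrite fpsZE aE expRN (@SGt_widen _ _ _ M'); last first.
    by have := ltn_ord l; rewrite /M'; clear; lia.
  rewrite /GRing.scale /=.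
  have l0 : expR ((k%:R ^+ 2 - 1) / 4) != 0 :> R by rewrite gt_eqF // expR_gt0.
  by field.
move=> B; rewrite {1}(SG_an n0 ev) -mulrBr normrM (gtr0_norm (an_gt0 n0)).
have -> : C * an R k n * n%:R^-1 ^+ r = an R k n * (C * n%:R^-1 ^+ r) by rewrite [RHS]mulrCA mulrA.
apply: ler_wpM2l; first exact: ltW (an_gt0 n0).
by rewrite [_ / _ * zst _ _]mulrC.
Qed.
End Assembly.

(** * Dependence of the coefficients on k *)
Section RationalSeries.
Variable R : realType.
Notation S := (fps R^o).

Definition israt (x : R) := exists c : rat, x = ratr c.
Lemma israt_nat n : israt n%:R. Proof. by exists n%:R; rewrite rmorph_nat. Qed.
Lemma isratD x y : israt x -> israt y -> israt (x + y).
Proof. by move=> [a ->] [b ->]; exists (a + b); rewrite rmorphD. Qed.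
Lemma isratN x : israt x -> israt (- x).
Proof. by move=> [a ->]; exists (- a); rewrite rmorphN. Qed.
Lemma isratM x y : israt x -> israt y -> israt (x * y).
Proof. by move=> [a ->] [b ->]; exists (a * b); rewrite rmorphM. Qed.
Lemma isratV x : israt x -> israt x^-1.
Proof. by move=> [a ->]; exists a^-1; rewrite fmorphV. Qed.
Lemma isratX x n : israt x -> israt (x ^+ n).
Proof. by move=> [a ->]; exists (a ^+ n); rewrite rmorphXn. Qed.
Lemma israt_sum (I : Type) (r : seq I) (P : pred I) (F : I -> R) :
  (forall i, P i -> israt (F i)) -> israt (\sum_(i <- r | P i) F i).
Proof. by move=> H; elim/big_ind: _ => //; [exact: (israt_nat 0)|exact: isratD]. Qed.
Lemma israt_gbinom al m : israt al -> israt (gbinom al m).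
Proof.
move=> Ha; apply: isratM; last by apply: isratV; exact: israt_nat.
elim/big_ind: _ => [|x y|i _]; [exact: (israt_nat 1)|exact: isratM|].
by apply: isratD Ha _; apply: isratN; exact: israt_nat.
Qed.
Lemma israt_log m : israt (if m == 0%N then 0 else (-1) ^+ m.+1 / m%:R).
Proof.
case: ifP => _; first exact: (israt_nat 0).
apply: isratM; last by apply: isratV; exact: israt_nat.
by apply/isratX/isratN/(israt_nat 1).
Qed.
Lemma israt_half : israt (- (1/2)).
Proof. by apply: isratN; apply: isratM; [exact: (israt_nat 1)|apply: isratV; exact: (israt_nat 2)]. Qed.

Definition ratS (f : S) := forall n, israt (f n).
Lemma ratSM f g : ratS f -> ratS g -> ratS (f * g).
Proof. by move=> Hf Hg n; rewrite fpsME; apply: israt_sum => i _; apply: isratM. Qed.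
Lemma ratS1 : ratS 1. Proof. by move=> n; rewrite fpsE1; exact: israt_nat. Qed.
Lemma ratSX f n : ratS f -> ratS (f ^+ n).
Proof. by move=> Hf; elim: n => [|n IHn]; [exact: ratS1|rewrite exprS; apply: ratSM]. Qed.
Lemma ratS_subst c f : (forall m, israt (c m)) -> ratS f -> ratS (fps_subst c f).
Proof.
move=> Hc Hf n; apply: israt_sum => i _; rewrite fps_powE; apply: isratM => //.
exact: ratSX.
Qed.
Lemma ratS_T : ratS (Tser R).
Proof.
have rX : ratS (fX : S) by move=> n; rewrite fps_XE; exact: israt_nat.
have rpsi : ratS (psi R).
  apply: ratS_subst => [m|n]; first exact: israt_gbinom israt_half.
  have r3 : ratS (- fps_log1p (fX : S) + fX + (- (1/2)) *: (fps_pow fX 2 : S)).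
    move=> m; rewrite !fpsDE fpsNE fpsZE fps_powE; apply: isratD; first apply: isratD.
    - by apply: isratN; apply: ratS_subst => [i|]; [exact: israt_log|exact: rX].
    - exact: rX.
    - by apply: isratM; [exact: israt_half|exact: ratSX].
  exact: r3 n.+2.
have rs f : ratS f -> ratS (Tstep f).
  by move=> Hf [|n]; [exact: (israt_nat 0)|apply: ratS_subst].
move=> n; rewrite /Tser; have : ratS (iter n.+1 (@Tstep R) (fun _ => 0)); last by apply.
by elim: n.+1 => [|m IHm]; [move=> m; exact: (israt_nat 0)|apply: rs].
Qed.
Lemma rat_ucoef p q : israt (ucoef R p q).
Proof.
apply: ratS_subst => [m|]; last exact: ratS_T.
by apply: israt_gbinom; apply: isratN; exact: israt_nat.
Qed.
End RationalSeries.

(** * Grading by powers of the square root of k *)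

Section PolyK.
Variables (R : realType) (n : nat).
Notation A := {mpoly R[n.+1]}.
Notation C := {poly rat}.
Notation S := (fps R^o).

Definition theta (k : nat) (c : C) : R := (map_poly (ratr : rat -> R) c).[k%:R].
Lemma thetaD k : {morph theta k : c d / c + d}.
Proof. by move=> c d; rewrite /theta rmorphD hornerD. Qed.
Lemma thetaM k : {morph theta k : c d / c * d}.
Proof. by move=> c d; rewrite /theta rmorphM hornerM. Qed.
Lemma thetaC k (x : rat) : theta k x%:P = ratr x.
Proof. by rewrite /theta map_polyC hornerC. Qed.
Lemma theta1 k : theta k 1 = 1.
Proof. by rewrite -polyC1 thetaC rmorph1. Qed.
Lemma thetaX k : theta k 'X = k%:R.
Proof. by rewrite /theta map_polyX hornerX. Qed.

Definition root k : R := Num.sqrt k%:R.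
Definition rscale k (i : 'I_n.+1) : R := if i == ord0 then root k else 1.

(* [phi k] evaluates the coefficients at [k] and rescales [t_1] by [sqrt k]. *)
Definition phi k (q : {mpoly C[n.+1]}) : A :=
  \sum_(m <- msupp q) (theta k q@_m * \prod_i rscale k i ^+ m i) *: 'X_[m].

Lemma phi_sup k q (s : seq 'X_{1..n.+1}) : uniq s -> {subset msupp q <= s} ->
  phi k q = \sum_(m <- s) (theta k q@_m * \prod_i rscale k i ^+ m i) *: 'X_[m].
Proof.
move=> us ps; rewrite /phi [RHS](bigID (mem (msupp q))) /= [X in _ + X]big1 ?addr0.
  rewrite -[RHS]big_filter; apply: perm_big; apply: uniq_perm; rewrite ?filter_uniq ?msupp_uniq //.
  by move=> m; rewrite mem_filter; case: (boolP (m \in _)) => //= /ps ->.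
by move=> m /memN_msupp_eq0 ->; rewrite /theta rmorph0 horner0 mul0r scale0r.
Qed.
Lemma phiD k p q : phi k (p + q) = phi k p + phi k q.
Proof.
pose s := undup (msupp p ++ msupp q).
have us : uniq s by apply: undup_uniq.
rewrite (@phi_sup k p s) // ?(@phi_sup k q s) // ?(@phi_sup k (p + q) s) //.
- by rewrite -big_split; apply: eq_bigr => m _; rewrite mcoeffD thetaD mulrDl scalerDl.
- by move=> m /msuppD_le; rewrite mem_undup.
- by move=> m mq; rewrite mem_undup mem_cat mq orbT.
- by move=> m mq; rewrite mem_undup mem_cat mq.
Qed.
Lemma phi0 k : phi k 0 = 0. Proof. by rewrite /phi msupp0 big_nil. Qed.
Lemma phi_sum k (I : Type) (r : seq I) (P : pred I) (F : I -> {mpoly C[n.+1]}) :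
  phi k (\sum_(i <- r | P i) F i) = \sum_(i <- r | P i) phi k (F i).
Proof. exact: (big_morph _ (phiD k) (phi0 k)). Qed.
Lemma phiZX k (c : C) m : phi k (c *: 'X_[m]) = (theta k c * \prod_i rscale k i ^+ m i) *: 'X_[m].
Proof.
rewrite (@phi_sup k _ [:: m]) //; last first.
  by move=> m' /msuppZ_le; rewrite msuppX.
by rewrite big_seq1 mcoeffZ mcoeffX eqxx mulr1.
Qed.
Lemma phiM k p q : phi k (p * q) = phi k p * phi k q.
Proof.
rewrite {1}(mpolyE p) {1}(mpolyE q) mulr_suml phi_sum [phi k p in RHS]/phi mulr_suml.
apply: eq_bigr => m _; rewrite mulr_sumr phi_sum [phi k q in RHS]/phi mulr_sumr.
apply: eq_bigr => m' _; rewrite -scalerAl -scalerAr scalerA -mpolyXD phiZX -scalerAl -scalerAr scalerA -mpolyXD.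
congr (_ *: _); rewrite thetaM.
have -> : \prod_i rscale k i ^+ (m + m')%MM i = (\prod_i rscale k i ^+ m i) * \prod_i rscale k i ^+ m' i.
  by rewrite -big_split; apply: eq_bigr => i _; rewrite mnmDE exprD.
ring.
Qed.

Lemma root_gt0 k : (2 <= k)%N -> 0 < root k.
Proof. by move=> k2; rewrite sqrtr_gt0 ltr0n ltnW. Qed.
Lemma root2 k : root k ^+ 2 = k%:R.
Proof. by rewrite sqr_sqrtr. Qed.

(** Weight [j]: up to [sqrt k ^ -j], the elements [a k] are images under [phi k] of one polynomial
    independent of [k]. The variable [t_1] and the number [u] have weight 1, the other variables
    weight 0. *)
Definition Gd (j : nat) (a : nat -> A) :=
  exists q, forall k, (2 <= k)%N -> a k = root k ^- j *: phi k q.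

Lemma Gd_ext j a b : (forall k, (2 <= k)%N -> a k = b k) -> Gd j b -> Gd j a.
Proof. by move=> E [q H]; exists q => k k2; rewrite E // H. Qed.
Lemma Gd0 j : Gd j (fun=> 0).
Proof. by exists 0 => k _; rewrite phi0 scaler0. Qed.
Lemma GdD j a b : Gd j a -> Gd j b -> Gd j (fun k => a k + b k).
Proof. by move=> [p Hp] [q Hq]; exists (p + q) => k k2; rewrite Hp // Hq // phiD scalerDr. Qed.
Lemma GdM i j a b : Gd i a -> Gd j b -> Gd (i + j) (fun k => a k * b k).
Proof.
move=> [p Hp] [q Hq]; exists (p * q) => k k2.
by rewrite Hp // Hq // phiM -scalerAl -scalerAr scalerA exprD invfM.
Qed.
Lemma Gd_sum j (I : Type) (r : seq I) (P : pred I) (F : I -> nat -> A) :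
  (forall i, P i -> Gd j (F i)) -> Gd j (fun k => \sum_(i <- r | P i) F i k).
Proof.
move=> H; elim: r => [|x r IHr].
  by apply: (@Gd_ext _ _ (fun=> 0)) => [k _|]; [rewrite big_nil|exact: Gd0].
case Px : (P x).
  apply: (@Gd_ext _ _ (fun k => F x k + \sum_(i <- r | P i) F i k)) => [k _|].
    by rewrite big_cons Px.
  by apply: GdD IHr; apply: H.
by apply: Gd_ext IHr => k _; rewrite big_cons Px.
Qed.
Lemma GdP (c : C) : Gd 0 (fun k => (theta k c)%:A).
Proof.
exists (c *: 'X_[0%MM]) => k _; rewrite phiZX expr0 invr1 scale1r mpolyX0.
by rewrite big1 ?mulr1 // => i _; rewrite mnm0E expr0.
Qed.
Lemma GdZ (c : C) j a : Gd j a -> Gd j (fun k => theta k c *: a k).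
Proof.
by move=> /(GdM (GdP c)); apply: Gd_ext => k _; rewrite mulr_algl.
Qed.
Lemma GdR (x : R) j a : israt x -> Gd j a -> Gd j (fun k => x *: a k).
Proof.
by move=> [c ->] /(GdZ c%:P); apply: Gd_ext => k _; rewrite thetaC.
Qed.
Lemma Gd_up j a : Gd j a -> Gd j.+2 a.
Proof.
move=> /(GdZ 'X)[q H]; exists q => k k2; have r0 := lt0r_neq0 (root_gt0 k2).
have kz : k%:R != 0 :> R by rewrite pnatr_eq0 -lt0n ltnW.
apply: (@scalerI _ _ (k%:R : R)) => //; have := H k k2; rewrite thetaX => ->.
rewrite scalerA; congr (_ *: _); rewrite -[in RHS]root2 -[j.+2]addn2 exprD invfM mulrCA.
by rewrite divff ?mulr1 // expf_neq0.
Qed.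
Lemma GdX j a m : Gd j a -> Gd (m * j) (fun k => a k ^+ m).
Proof.
move=> Ha; elim: m => [|m IHm].
  by apply: Gd_ext (GdP 1) => k _; rewrite expr0 theta1 scale1r.
by apply: Gd_ext (GdM Ha IHm) => k _; rewrite exprS.
Qed.
Lemma Gd_var0 : Gd 1 (fun=> 'X_ord0).
Proof.
exists (1 *: 'X_[U_(ord0)]) => k k2; rewrite phiZX.
rewrite (bigD1 ord0) //= mnm1E eqxx expr1 big1 ?mulr1 => [|i i0].
  rewrite /rscale ?eqxx theta1 mul1r scalerA mulVf ?scale1r //.
  exact: lt0r_neq0 (root_gt0 k2).
by rewrite mnm1E eq_sym (negbTE i0) expr0.
Qed.
Lemma Gd_var i : i != ord0 -> Gd 0 (fun=> 'X_i).
Proof.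
move=> i0; exists (1 *: 'X_[U_(i)]) => k k2; rewrite phiZX expr0 invr1 scale1r.
rewrite (bigD1 i) //= mnm1E eqxx expr1 big1 ?mulr1 => [|l li].
  by rewrite /rscale (negbTE i0) theta1 mul1r scale1r.
by rewrite mnm1E eq_sym (negbTE li) expr0.
Qed.

(* The Gaussian weight of [t_1] is that of [t_1 / sqrt k] for a weight independent of [k]. *)
Definition hwr (c : rat) (e : nat) : rat := if odd e then 0 else c ^+ e./2 * e`!%:R / (e./2)`!%:R.
Definition hcr (i : 'I_n.+1) : rat := if i == ord0 then - (4 : rat)^-1 else - (2 * i.+1%:R)^-1.
Lemma hw_scale k (i : 'I_n.+1) e : (2 <= k)%N ->
  rscale k i ^+ e * hw (hcoef R k i) e = ratr (hwr (hcr i) e).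
Proof.
move=> k2; rewrite /hw /hwr; case: ifP => oe; first by rewrite mulr0 rmorph0.
have eE : e = e./2.*2 by rewrite even_halfK // oe.
rewrite fmorph_div rmorphM rmorphXn !rmorph_nat !mulrA; congr (_ * _ / _).
rewrite {1}eE -mul2n exprM -exprMn; congr (_ ^+ _).
rewrite /rscale /hcoef /hcr -[(i == 0%N :> nat)]/(i == ord0); case: ifP => _.
  rewrite root2 rmorphN fmorphV rmorph_nat /kR mulrN invfM mulrCA divff ?mulr1 //.
  by rewrite pnatr_eq0 -lt0n ltnW.
by rewrite expr1n mul1r rmorphN fmorphV rmorphM !rmorph_nat.
Qed.
(** After rescaling [t_1] the Gaussian weights are rational and independent of [k], and for weight
    [2r] the prefactor is [1/k^r]. *)
Lemma Gd_hadamard r a : Gd r.*2 a -> exists p : {poly rat}, forall k, (2 <= k)%N ->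
  mfun (fun i => hw (hcoef R k i)) (a k) = theta k p / k%:R ^+ r.
Proof.
move=> [q H]; exists (\sum_(m <- msupp q) (\prod_i hwr (hcr i) (m i))%:P * q@_m) => k k2.
rewrite H // mfunZ -mul2n exprM root2 mulrC; congr (_ / _).
have -> : theta k (\sum_(m <- msupp q) (\prod_i hwr (hcr i) (m i))%:P * q@_m) =
    \sum_(m <- msupp q) theta k ((\prod_i hwr (hcr i) (m i))%:P * q@_m).
  by apply: (big_morph _ (thetaD k)); rewrite /theta rmorph0 horner0.
rewrite /phi mfun_sum; apply: eq_bigr => m _; rewrite mfunZ mfunX thetaM thetaC rmorph_prod.
rewrite [RHS]mulrC -[LHS]mulrA; congr (_ * _).
by rewrite -big_split; apply: eq_bigr => i _; exact: hw_scale.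
Qed.

Definition FG (w : nat) (f : nat -> fps A) := forall j, Gd (w * j) (fun k => f k j).

Lemma FGD w f g : FG w f -> FG w g -> FG w (fun k => f k + g k).
Proof. by move=> Hf Hg j; apply: Gd_ext (GdD (Hf j) (Hg j)). Qed.
Lemma FGZ w c f : FG w f -> FG w (fun k => theta k c *: f k).
Proof. by move=> Hf j; apply: Gd_ext (GdZ c (Hf j)). Qed.
Lemma FGM w f g : FG w f -> FG w g -> FG w (fun k => f k * g k).
Proof.
move=> Hf Hg j; apply: (@Gd_ext _ _ (fun k => \sum_(i < j.+1) f k i * g k (j - i)%N)) => [k _|].
  exact: fpsME.
apply: Gd_sum => i _; have ij : (i <= j)%N by rewrite -ltnS.
by rewrite -{1}(subnKC ij) mulnDr; apply: GdM.
Qed.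
Lemma FG1 w : FG w (fun=> 1).
Proof.
move=> [|j]; last by apply: Gd_ext (Gd0 _) => k _; rewrite fpsE1.
rewrite muln0; apply: Gd_ext (GdP 1) => k _.
by rewrite fpsE1 theta1 scale1r.
Qed.
Lemma FGX w f m : FG w f -> FG w (fun k => f k ^+ m).
Proof.
move=> Hf; elim: m => [|m IHm]; first exact: (FG1 w).
by move=> j; apply: Gd_ext (FGM Hf IHm j) => k _; rewrite exprS.
Qed.
Lemma FG_subst w c f : (forall m, israt (c m)) -> FG w f -> FG w (fun k => fps_subst c (f k)).
Proof.
move=> Hc Hf j; rewrite /fps_subst; apply: Gd_sum => m _; apply: GdR => //.
by apply: Gd_ext (FGX m Hf j) => k _; rewrite fps_powE.
Qed.
(** The coefficient of [s^(j+2)] has weight [j] only, so that after division by [s^2] the weight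
    still equals the power of [s]. *)
Definition FI (f : nat -> fps A) :=
  (forall k j, (2 <= k)%N -> (j < 2)%N -> f k j = 0) /\ forall j, Gd j (fun k => f k j.+2).
Lemma FI_FG f : FI f -> FG 1 f.
Proof.
move=> [H0 H] j; rewrite mul1n; case: (ltnP j 2) => j2.
  by apply: Gd_ext (Gd0 _) => k k2; apply: H0.
by case: j j2 => [|[|j]] // _; apply: Gd_up.
Qed.
Lemma FI_M f g : FI f -> FG 1 g -> FI (fun k => f k * g k).
Proof.
move=> [H0 H] Hg; split.
  move=> k j k2 j2; rewrite fpsME big1 // => i _.
  by rewrite H0 ?mul0r // (leq_ltn_trans _ j2) // -ltnS.
move=> j; apply: (@Gd_ext _ _ (fun k => \sum_(i < j.+1) f k i.+2 * g k (j - i)%N)) => [k k2|].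
  rewrite fpsME 2![in LHS]big_ord_recl (H0 k ord0) // (H0 k (lift ord0 ord0)) // !mul0r !add0r; apply: eq_bigr => i _.
  by rewrite !lift0 !subSS.
apply: Gd_sum => i _; have ij : (i <= j)%N by rewrite -ltnS.
by rewrite -{1}(subnKC ij); apply: GdM => //; have := Hg (j - i)%N; rewrite mul1n.
Qed.
Lemma FI_log f : FI f -> FI (fun k => fps_log1p (f k)).
Proof.
move=> Hf; have HX m : FI (fun k => f k ^+ m.+1).
  have [h1 h2] := FI_M Hf (FGX m (FI_FG Hf)).
  split=> [k j k2 j2|j]; first by rewrite exprS h1.
  by apply: Gd_ext (h2 j) => k _; rewrite exprS.
split=> [k j k2 j2|j].
  rewrite /fps_log1p /fps_subst big1 // => -[[|m] mj] _; first by rewrite scale0r.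
  by rewrite fps_powE (proj1 (HX m)) // scaler0.
rewrite /fps_log1p /fps_subst; apply: Gd_sum => -[[|m] mj] _.
  by apply: Gd_ext (Gd0 _) => k _; rewrite scale0r.
apply: GdR; first exact: (@israt_log R m.+1).
by apply: Gd_ext (proj2 (HX m) j) => k _; rewrite fps_powE.
Qed.

Variable sg : bool.
Definition us k : R := (-1) ^+ sg * (root k)^-1.
Lemma us2 k : (2 <= k)%N -> us k ^+ 2 * k%:R = 1.
Proof.
move=> k2; rewrite /us exprMn sqrr_sign mul1r exprVn root2 mulVf //.
by rewrite pnatr_eq0 -lt0n ltnW.
Qed.
Lemma Gd_us m : Gd m (fun k => (us k ^+ m)%:A).
Proof.
exists (((-1) ^+ sg)%:P ^+ m *: 'X_[0%MM]) => k _; rewrite phiZX big1 => [|i _]; last by rewrite mnm0E expr0.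
rewrite mulr1 mpolyX0 scalerA /us exprMn exprVn mulrC; congr (_ *: _); congr (_ * _).
elim: m => [|m IHm]; first by rewrite !expr0 theta1.
by rewrite !exprS thetaM -IHm thetaC rmorphXn rmorphN1.
Qed.

Lemma FG_T (c : S) : ratS c -> FG 1 (fun=> fun m => c m *: tv R n 1 ^+ m).
Proof.
move=> Hc j; apply: GdR => //; rewrite mul1n.
by have := GdX j Gd_var0; rewrite muln1; apply: Gd_ext => k _; rewrite tv1.
Qed.
Lemma Gd_tv j : Gd 0 (fun=> tv R n j.+2).
Proof.
rewrite /tv; case: ifP => [jn|_]; last exact: Gd0.
by apply: Gd_var; apply/eqP => /(congr1 val); rewrite /= inordK.
Qed.
Lemma Gd_gser e : Gd 0 (fun=> gser R n e).
Proof.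
have W : FG 0 (fun=> fX * Wser R n).
  move=> j; apply: (@Gd_ext _ _ (fun=> (fX * Wser R n) j)) => //.
  rewrite fps_XM; case: j => [|[|j]]; [exact: Gd0|exact: Gd0|exact: Gd_tv].
have I : FG 0 (fun=> isqrt1mz2 R n).
  apply: FG_subst => [m|j]; first exact: israt_gbinom (israt_half R).
  case: ifP => _; last exact: Gd0.
  by apply: Gd_ext (GdP (-1)) => k _; rewrite /theta rmorphN1 hornerN hornerC scaleN1r.
have E : FG 0 (fun=> fps_exp (fX * Wser R n)).
  by apply: FG_subst W => m; apply: isratV; exact: israt_nat.
exact: (FGM E I e).
Qed.

(** A falling factorial of length [d >= 2] contains the factor [k], which cancels [u^2] and gains
    two units of weight; the terms with [d = 1] vanish by [gser1]. *)
Lemma FI_B0 : FI (fun k => B0 k n (us k)).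
Proof.
split=> [k j k2 j2|j].
  case: j j2 => [|[|//]] _; first by [].
  by rewrite /B0 /= B0E !big_ord_recl !big_ord0 /= /hterm subn0 gser1 mulr0 scaler0 !addr0.
suff H : Gd j (fun k => \sum_(a < j.+3) \sum_(d < j.+3)
  (if (0 < d)%N && (a.*2 <= d)%N then hterm n k (us k) j.+2 a d else 0)).
  by apply: Gd_ext H => k _; rewrite /B0 B0E.
apply: Gd_sum => a _; apply: Gd_sum => -[d dj] _ /=.
case E : ((0 < d)%N && (a.*2 <= d)%N); last exact: Gd0.
move/andP: E => [d0 ad].
case: d dj d0 ad => [|[|d]] // dj _ ad.
  apply: Gd_ext (Gd0 _) => k _; have a0 : nat_of_ord a = 0%N by move: ad; clear; lia.
  by rewrite /hterm a0 subn0 gser1 mulr0 scaler0.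
pose c : C := \prod_(m < d.+1) ('X - (m.+1%:R)%:P).
have cE k : theta k c * k%:R = (k ^_ d.+2)%:R.
  have -> : theta k c = \prod_(m < d.+1) (k%:R - m.+1%:R).
    rewrite /c (big_morph _ (thetaM k) (_ : _ = 1)); last by rewrite theta1.
    apply: eq_bigr => m _.
    by rewrite /theta rmorphB /= map_polyX map_polyC hornerD hornerN hornerX hornerC /= rmorph_nat.
  by rewrite -kR_ffact [RHS]big_ord_recl /kR subr0 mulrC; congr (_ * _); apply: eq_bigr => m _; rewrite lift0.
have H0 := GdM (Gd_us d) (GdX (j - d) Gd_var0); rewrite muln1 subnKC in H0; last by move: dj; clear; lia.
have H1 := GdM H0 (Gd_gser (d.+2 - a.*2)); rewrite addn0 in H1.
have r1 : israt (ucoef R (j.+2 - d.+2) (d.+2 + a.*2) / a`!%:R).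
  by apply: isratM; [exact: rat_ucoef|apply: isratV; exact: israt_nat].
pose c2 : C := ((2^-1 : rat)%:P * ('X - 1)) ^+ a.
have c2E k : theta k c2 = ((k%:R - 1) / 2) ^+ a.
  rewrite /theta /c2 rmorphXn rmorphM rmorphB /= map_polyX map_polyC rmorph1 horner_exp hornerM hornerC.
  by rewrite hornerD hornerN hornerX hornerC /= fmorphV rmorph_nat mulrC.
apply: Gd_ext (GdZ c (GdZ c2 (GdR r1 H1))) => k k2.
have uE : us k ^+ d.+2 = us k ^+ 2 * us k ^+ d by rewrite -exprD.
rewrite /hterm uE c2E -cE subSS subSS -(mulrA ((us k ^+ d)%:A)) mulr_algl !scalerA; congr (_ *: _).
have := us2 k2; move: (us k ^+ 2) (us k ^+ d) (ucoef _ _ _) (_ ^+ a) => x y z w xk.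
transitivity (x * k%:R * (theta k c * w * (z / a`!%:R) * y)); last by rewrite xk mul1r.
ring.
Qed.

Lemma FG_C1 : FG 1 (fun k => C1 k n (us k)).
Proof.
apply: FG_subst => [m|]; first by apply: isratV; exact: israt_nat.
have bT (q : R) : israt q -> FG 1 (fun=> fps_binom q (Tst1 R n)).
  by move=> Hq; apply: FG_subst => [m|]; [exact: israt_gbinom|apply: FG_T; exact: ratS_T].
have i2 : israt (- 2 : R) by apply: isratN; exact: israt_nat.
have i4 : israt (- 4 : R) by apply: isratN; exact: israt_nat.
have G1 : FG 1 (fun k => fps_divX2 (kR R k * (kR R k - 1) * us k ^+ 2 *: (s2t2 R n * fps_binom (- 2) (Tst1 R n)) + - fps_log1p (B0 k n (us k)))).
  move=> j; rewrite mul1n.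
  have L := proj2 (FI_log FI_B0) j.
  have H := GdM (Gd_tv 0) (bT _ i2 j); rewrite mul1n add0n in H.
  apply: Gd_ext (GdD (GdZ ('X - 1) H) (GdR (isratN (israt_nat R 1)) L)) => k k2.
  rewrite /fps_divX2 fpsDE fpsNE fpsZE scaleN1r; congr (_ + _).
  have -> : s2t2 R n = fX ^+ 2 * fps_const (tv R n 2).
    apply/fpsP=> m; rewrite /s2t2 mulrC fps_constM fps_XnE.
    by case: (m == 2%N); rewrite ?mulr1 ?mulr0.
  rewrite -(mulrA (fX ^+ 2)) fps_XnM !subSS subn0 fps_constM; congr (_ *: _).
  rewrite /theta rmorphB /= map_polyX rmorph1 hornerD hornerN hornerX hornerC /kR.
  have -> : k%:R * (k%:R - 1) * us k ^+ 2 = (us k ^+ 2 * k%:R) * (k%:R - 1) by ring.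
  by rewrite (us2 k2) mul1r.
have G2 : FG 1 (fun k => ((kR R k - 1) ^+ 2 / 4) *: fps_binom (- 4) (Tst1 R n)).
  move=> j; apply: Gd_ext (FGZ ((('X - 1) ^+ 2) * (4^-1 : rat)%:P) (bT _ i4) j) => k _.
  rewrite !fpsZE; congr (_ *: _); rewrite /theta rmorphM rmorphXn rmorphB /= map_polyX rmorph1 map_polyC.
  by rewrite hornerM horner_exp hornerD hornerN hornerX !hornerC /= fmorphV rmorph_nat.
have G3 : FG 1 (fun k => fps_const (((2 * kR R k ^+ 2 * us k ^+ 2 - kR R k + 1) * (kR R k - 1) / 4 : R)%:MP) : fps A).
  move=> j; rewrite /fps_const; case: eqP => [->|_]; last exact: Gd0.
  rewrite muln0; apply: Gd_ext (GdP (('X ^+ 2 - 1) * (4^-1 : rat)%:P)) => k k2.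
  rewrite -mul_mpolyC mulr1; congr (_%:MP).
  rewrite /theta rmorphM rmorphB rmorphXn /= map_polyX rmorph1 map_polyC.
  rewrite hornerM hornerD hornerN horner_exp hornerX !hornerC /= fmorphV rmorph_nat /kR.
  have -> : 2 * k%:R ^+ 2 * us k ^+ 2 = 2 * k%:R * (us k ^+ 2 * k%:R) by ring.
  by rewrite us2 //; ring.
move=> j; apply: Gd_ext (FGD (FGD G1 G2) G3 j) => k _.
by rewrite C1exponentE.
Qed.
End PolyK.

Theorem SGt_poly (R : realType) r : exists p : {poly rat}, forall k : nat, (2 <= k)%N ->
  SGt R k r = (map_poly (ratr : rat -> R) p).[k%:R] / k%:R ^+ r.
Proof.
pose n := r.*2.+1.
have dT : FG 1 (fun=> dTst1 R n).
  apply: FG_T => m; apply: isratM; first exact: israt_nat.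
  exact: ratS_T.
have H := FGM (FGD (@FG_C1 R n true) (@FG_C1 R n false)) dT r.*2.
rewrite mul1n in H; have [p Hp] := Gd_hadamard H.
exists ((-1) ^+ r * p) => k k2; have := Hp k k2.
rewrite -/(theta R k ((-1) ^+ r * p)) thetaM -mulrA => <-; rewrite /SGt -/n.
have -> : theta R k ((-1) ^+ r) = (-1) ^+ r by rewrite /theta rmorphXn rmorphN1 horner_exp hornerN hornerC.
have -> : C2 R k n r.*2 = ((C1 k n (us R true k) + C1 k n (us R false k)) * dTst1 R n) r.*2.
  by rewrite /us expr0 expr1 mulN1r mul1r.
by [].
Qed.

Theorem theorem8 (R : realType) :
  (forall k : nat, (2 <= k)%N -> forall r : nat,
     exists C : R, exists N0 : nat, forall n : nat,
       (N0 <= n)%N -> ~~ odd (n * k) ->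
       `| (SG k n)%:R - an R k n * \sum_(l < r) SGt R k l * (n%:R)^-1 ^+ l |
         <= C * an R k n * (n%:R)^-1 ^+ r)
  /\
  (forall r : nat, exists p : {poly rat}, forall k : nat, (2 <= k)%N ->
     SGt R k r = (map_poly (ratr : rat -> R) p).[k%:R] / k%:R ^+ r).
Proof.
split; first by move=> k k2 r; exact: SG_asymptotic.
exact: SGt_poly.
Qed.
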